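(* Let $n\in\mathbb N$. There is a constant $C$ depending only on the dimension $n$ (and on the fixed function $\varphi_0$ used to define the space $B(\mathbb R^{2n})$) such that the following holds. Let $m$ be a function on $\mathbb R^{2n}$ belonging to the Besov space $B(\mathbb R^{2n})$. Then the associated bilinear multiplier operator $T_m$ admits a bounded extension from $L^2(\mathbb R^n)\times L^2(\mathbb R^n)$ to $L^1(\mathbb R^n)$ and $$\|T_m(f,g)\|_{L^1(\mathbb R^n)}\le C\|m\|_{B(\mathbb R^{2n})}\|f\|_{L^2(\mathbb R^n)}\|g\|_{L^2(\mathbb R^n)}$$ for all $f,g\in L^2(\mathbb R^n)$.
   Context: The Fourier transform on $\mathbb R^d$ is $\widehat f(\xi)=\int_{\mathbb R^d} f(x)e^{-2\pi i x\cdot\xi}\,dx$, extended to tempered distributions. The Lorentz space $L^{4,\infty}(\mathbb R^{2n})$ consists of measurable $f$ with $\|f\|_{L^{4,\infty}(\mathbb R^{2n})}=\sup_{\lambda>0}\lambda\,|\{x\in\mathbb R^{2n}:|f(x)|>\lambda\}|^{1/4}<\infty$. Fix a smooth function $\varphi_0$ on $\mathbb R^{2n}$ with $\varphi_0(\xi)=1$ if $|\xi|\le1$ and $\varphi_0(\xi)=0$ if $|\xi|\ge\frac32$; for $k\in\mathbb N$ (positive integers) set $\varphi_k(\xi)=\varphi_0(2^{-k}\xi)-\varphi_0(2^{1-k}\xi)$. Define $\Lambda_k$ by $\widehat{\Lambda_kf}=\varphi_k\widehat f$ for integers $k\ge0$. The space $B(\mathbb R^{2n})$ consists of all functions $f$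 on $\mathbb R^{2n}$ with $$\|f\|_{B(\mathbb R^{2n})}=\sum_{k=0}^\infty 2^{\frac{nk}2}\|\Lambda_kf\|_{L^{4,\infty}(\mathbb R^{2n})}<\infty .$$ For a bounded function $m$ on $\mathbb R^{2n}=\mathbb R^n\times\mathbb R^n$, the bilinear multiplier operator $T_m$ is defined for Schwartz functions $f,g$ on $\mathbb R^n$ by $$T_m(f,g)(x)=\int_{\mathbb R^n}\int_{\mathbb R^n}m(\xi,\eta)\widehat f(\xi)\widehat g(\eta)e^{2\pi i x\cdot(\xi+\eta)}\,d\xi\,d\eta,\quad x\in\mathbb R^n.$$ Functions in $B(\mathbb R^{2n})$ are essentially bounded, so $T_m$ is well defined. *)

(* Defs.v *)
From HB Require Import structures.
From mathcomp Require Import all_boot all_order all_algebra.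
From mathcomp Require Import all_classical all_reals all_analysis.
From mathcomp Require Import complex.
Set Implicit Arguments.
Unset Strict Implicit.
Unset Printing Implicit Defensive.
Import Order.TTheory GRing.Theory Num.Theory.
Import numFieldNormedType.Exports.
Import ComplexField.Normc.
Local Open Scope classical_set_scope.
Local Open Scope ring_scope.
Local Open Scope complex_scope.

(* 'rV[R]_d carries the sigma-algebra generated by the coordinates, i.e. the
   Borel sets.  "Measurable" means Borel measurable below: elements of L^1, L^2
   and B are classes modulo a.e. equality, and each class has a Borel
   representative. *)
Definition measure_rV_display : measure_display. Proof. exact. Qed.

Section measurable_rV.
Context {R : realType} (d : nat).

Let coord_rV (i : 'I_d) (x : 'rV[R]_d) : measurableTypeR R := x ord0 i.

Let rV_set0 : g_sigma_preimage coord_rV set0.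
Proof. exact: sigma_algebra0. Qed.

Let rV_setC A : g_sigma_preimage coord_rV A -> g_sigma_preimage coord_rV (~` A).
Proof. exact: sigma_algebraC. Qed.

Let rV_bigcup (F : (set 'rV[R]_d)^nat) :
  (forall i, g_sigma_preimage coord_rV (F i)) ->
  g_sigma_preimage coord_rV (\bigcup_i (F i)).
Proof. exact: sigma_algebra_bigcup. Qed.

HB.instance Definition _ := @isMeasurable.Build measure_rV_display
  'rV[R]_d (g_sigma_preimage coord_rV) rV_set0 rV_setC rV_bigcup.

End measurable_rV.


(* The library's sigma-finite structure on product measures is not inferred. *)
Lemma sigma_finite_product d1 d2 (T1 : measurableType d1)
    (T2 : measurableType d2) (R : realType)
    (m1 : {sigma_finite_measure set T1 -> \bar R})
    (m2 : {sigma_finite_measure set T2 -> \bar R}) :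
  sigma_finite setT (m1 \x m2)%E.
Proof.
have /sigma_finiteP[F [TF ndF Foo]] := sigma_finiteT m1.
have /sigma_finiteP[G [TG ndG Goo]] := sigma_finiteT m2.
exists (fun n => F n `*` G n).
 rewrite -setXTT TF TG predeqE => -[x y]; split.
    move=> [/= [n _ Fnx] [k _ Gky]]; exists (maxn n k) => //; split.
    - by move: x Fnx; exact/subsetPset/ndF/leq_maxl.
    - by move: y Gky; exact/subsetPset/ndG/leq_maxr.
  by move=> [n _ []/= ? ?]; split; exists n.
move=> k; have [? ?] := Foo k; have [? ?] := Goo k.
split; first exact: measurableX.
by rewrite product_measure1E// lte_mul_pinfty// ge0_fin_numE.
Qed.

Section lebesgue_rV.
Context {R : realType}.

Lemma measurable_coord_rV d (i : 'I_d) :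
  measurable_fun [set: 'rV[R]_d] (fun x => x ord0 i : measurableTypeR R).
Proof.
move=> _ Y mY; rewrite setTI; apply: sub_sigma_algebra => /=.
rewrite -bigcup_seq/=; exists i => /=; first by rewrite mem_index_enum.
by exists Y => //; rewrite setTI.
Qed.

Lemma measurable_fun_rV d' (T : measurableType d') d (f : T -> 'rV[R]_d) :
  (forall i, measurable_fun [set: T] (fun t => f t ord0 i : measurableTypeR R)) ->
  measurable_fun [set: T] f.
Proof.
move=> mf; pose S := [set A | measurable (f @^-1` A)].
suff sub : measurable `<=` S by move=> _ Y /sub; rewrite setTI.
apply: smallest_sub.
  split => [|A mA|F mF]; rewrite /S /=.
  - by rewrite preimage_set0.
  - by rewrite setTD preimage_setC; exact: measurableC.
  - by rewrite preimage_bigcup; apply: bigcup_measurable => k _; exact: mF.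
rewrite -bigcup_seq => A [i _ [B mB <-]].
by rewrite /S /= setTI -[X in measurable X]setTI; exact: mf.
Qed.

Definition cons_rV d (p : measurableTypeR R * 'rV[R]_d) : 'rV[R]_d.+1 :=
  row_mx (p.1)%:M p.2 : 'rV[R]_(1 + d).

Definition uncons_rV d (x : 'rV[R]_d.+1) : measurableTypeR R * 'rV[R]_d :=
  (x ord0 ord0, rsubmx (x : 'rV[R]_(1 + d))).

Lemma cons_rVK d : cancel (@cons_rV d) (@uncons_rV d).
Proof.
move=> [a v]; rewrite /uncons_rV /cons_rV /=; congr pair; last exact: row_mxKr.
rewrite (_ : ord0 = lshift d (@ord0 0)); last exact/val_inj.
by rewrite (row_mxEl a%:M v) mxE.
Qed.

Lemma measurable_cons_rV d : measurable_fun setT (@cons_rV d).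
Proof.
apply: measurable_fun_rV => i; case: (split_ordP (i : 'I_(1 + d))) => j ->.
  rewrite (_ : (fun _ => _) = fst) //; apply/funext => -[a v].
  by rewrite /cons_rV (row_mxEl a%:M v) mxE (ord1 j).
rewrite (_ : (fun _ => _) =
    (fun v : 'rV[R]_d => v ord0 j : measurableTypeR R) \o snd).
  by apply: measurableT_comp => //; exact: measurable_coord_rV.
by apply/funext => -[a v]; rewrite /cons_rV (row_mxEr a%:M v).
Qed.

Lemma measurable_uncons_rV d : measurable_fun setT (@uncons_rV d).
Proof.
apply/measurable_fun_pairP; split => /=; first exact: measurable_coord_rV.
apply: measurable_fun_rV => i.
rewrite (_ : (fun _ => _) =
    fun x : 'rV[R]_d.+1 => x ord0 (lift ord0 i) : measurableTypeR R).
  exact: measurable_coord_rV.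
by apply/funext => x; rewrite /= mxE; congr (x _ _); apply/val_inj.
Qed.

Section step.
Context d (mu : {sigma_finite_measure set 'rV[R]_d -> \bar R}).

Definition lebesgue_rV_step : set 'rV[R]_d.+1 -> \bar R :=
  pushforward ((@lebesgue_measure R) \x mu)%E (@cons_rV d).

Let lebesgue_rV_step0 : lebesgue_rV_step set0 = 0%E.
Proof. by rewrite /lebesgue_rV_step /pushforward preimage_set0 measure0. Qed.

Let lebesgue_rV_step_ge0 A : (0 <= lebesgue_rV_step A)%E.
Proof. by rewrite /lebesgue_rV_step /pushforward measure_ge0. Qed.

Let lebesgue_rV_step_sigma_additive : semi_sigma_additive lebesgue_rV_step.
Proof.
pose m := measure_function_pushforward__canonical__measure_function_Measure
  ((@lebesgue_measure R) \x mu)%E (@measurable_cons_rV d).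
exact: (@measure_semi_sigma_additive _ _ _ m).
Qed.

HB.instance Definition _ := isMeasure.Build _ _ _ lebesgue_rV_step
  lebesgue_rV_step0 lebesgue_rV_step_ge0 lebesgue_rV_step_sigma_additive.

Let lebesgue_rV_step_sigma_finite : sigma_finite setT lebesgue_rV_step.
Proof.
have [F FT mF] := sigma_finite_product (@lebesgue_measure R) mu.
exists (fun k => @uncons_rV d @^-1` F k).
  by rewrite -preimage_bigcup -FT preimage_setT.
move=> k; have [mFk Fkoo] := mF k; split.
  by rewrite -[X in measurable X]setTI; exact: measurable_uncons_rV.
rewrite /lebesgue_rV_step /pushforward -comp_preimage.
rewrite (_ : _ @^-1` _ = F k) //.
by apply/seteqP; split => p /=; rewrite cons_rVK.
Qed.

HB.instance Definition _ := Measure_isSigmaFinite.Build _ _ _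
  lebesgue_rV_step lebesgue_rV_step_sigma_finite.

End step.

Fixpoint lebesgue_rV d : {sigma_finite_measure set 'rV[R]_d -> \bar R} :=
  match d with
  | 0%N => \d_(0 : 'rV[R]_0)
  | d'.+1 => lebesgue_rV_step (lebesgue_rV d')
  end.

End lebesgue_rV.

Section analysis_rV.
Context {R : realType} (d : nat).
Implicit Types (x xi : 'rV[R]_d) (f g h psi phi : 'rV[R]_d -> R[i]).

Definition dot_rV x xi : R := \sum_(i < d) x ord0 i * xi ord0 i.

(* The Euclidean norm; the library norm on 'rV[R]_d is the sup norm. *)
Definition norm2_rV x : R := Num.sqrt (dot_rV x x).

Definition cmeasurable f :=
  measurable_fun setT (fun x => complex.Re (f x) : measurableTypeR R) /\
  measurable_fun setT (fun x => complex.Im (f x) : measurableTypeR R).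

Definition cintegral f : R[i] :=
  (\int[lebesgue_rV d]_x complex.Re (f x)) +i* (\int[lebesgue_rV d]_x complex.Im (f x)).

Definition cLnorm (p : \bar R) f : \bar R :=
  Lnorm (lebesgue_rV d) p (fun x => (normc (f x))%:E).

Definition Lp (p : \bar R) f := cmeasurable f /\ (cLnorm p f < +oo)%E.

Definition ae_eq_rV f g := {ae lebesgue_rV d, forall x, f x = g x}.

Definition lorentz4_norm f : \bar R :=
  ereal_sup [set (l%:E * (lebesgue_rV d [set x | (l < normc (f x))%R]) `^ 4^-1)%E
            | l in [set l : R | 0 < l]].

Definition locally_integrable_rV f :=
  cmeasurable f /\
  forall K : set 'rV[R]_d, compact K ->
    (\int[lebesgue_rV d]_(x in K) (normc (f x))%:E < +oo)%E.

(* The iterated partial derivative along the coordinates listed in s. *)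
Fixpoint partial (s : seq 'I_d) (u : 'rV[R]_d -> R) : 'rV[R]_d -> R :=
  if s is i :: s' then fun x => 'D_(delta_mx ord0 i) (partial s' u) x else u.

Definition smooth_real (u : 'rV[R]_d -> R) := forall s : seq 'I_d,
  continuous (partial s u) /\
  forall i x, derivable (partial s u) x (delta_mx ord0 i).

Definition smooth f :=
  smooth_real (fun x => complex.Re (f x)) /\ smooth_real (fun x => complex.Im (f x)).

Definition cpartial (s : seq 'I_d) f x : R[i] :=
  partial s (fun y => complex.Re (f y)) x +i* partial s (fun y => complex.Im (f y)) x.

Definition schwartz_seminorm (N : nat) f : \bar R :=
  ereal_sup [set z | exists (s : seq 'I_d) x, (size s <= N)%N /\
    z = ((1 + norm2_rV x) ^+ N * normc (cpartial s f x))%:E].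

Definition schwartz f :=
  smooth f /\ forall N, (schwartz_seminorm N f < +oo)%E.

Definition test_function f :=
  smooth f /\ exists r : R, forall x, r < norm2_rV x -> f x = 0.

Definition cexp (t : R) : R[i] := cos t +i* sin t.

Definition fourier f xi : R[i] :=
  cintegral (fun x => f x * cexp (- (2 * pi * dot_rV x xi))).

(* A distribution is represented by its pairing psi |-> u psi; only its values
   on Schwartz functions are meaningful. *)
Definition distribution := ('rV[R]_d -> R[i]) -> R[i].
Implicit Types u v : distribution.

Definition tempered u :=
  (forall (a : R[i]) psi phi, schwartz psi -> schwartz phi ->
     u (fun x => a * psi x + phi x) = a * u psi + u phi) /\
  exists (C : R) (N : nat), forall psi, schwartz psi ->
    ((normc (u psi))%:E <= C%:E * schwartz_seminorm N psi)%E.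

Definition eq_distribution u v := forall psi, schwartz psi -> u psi = v psi.

Definition distr_fourier u : distribution := fun psi => u (fourier psi).

Definition distr_mul phi u : distribution :=
  fun psi => u (fun x => phi x * psi x).

(* u is the tempered distribution given by the function f; as test functions
   are dense in the Schwartz space, f determines u, and u determines f a.e. *)
Definition distr_of_fun u f :=
  [/\ tempered u, locally_integrable_rV f &
      forall psi, test_function psi -> u psi = cintegral (fun x => f x * psi x)].

(* h = Lambda f, where Lambda is the Fourier multiplier operator of symbol phi,
   both f and h being identified with tempered distributions. *)
Definition fourier_multiplier phi f h := exists u v : distribution,
  [/\ distr_of_fun u f, distr_of_fun v h &
      eq_distribution (distr_fourier v) (distr_mul phi (distr_fourier u))].

(* The L^{4,oo} norm of Lambda f.  All functions h representing Lambda f are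
   a.e. equal, so the infimum is over a single value; it is +oo if f is not a
   tempered distribution or Lambda f is not a function. *)
Definition lorentz4_norm_multiplier phi f : \bar R :=
  ereal_inf [set lorentz4_norm h | h in fourier_multiplier phi f].

(* dyadic phi k is phi_k when phi_0 is phi. *)
Definition dyadic phi (k : nat) xi : R[i] :=
  if k is 0%N then phi xi
  else phi ((2 ^- k) *: xi) - phi ((2 * 2 ^- k) *: xi).

End analysis_rV.

Section bilinear.
Context {R : realType} (n : nat).
Implicit Types (f g : 'rV[R]_n -> R[i]) (m phi : 'rV[R]_(n + n) -> R[i]).

Definition besov_norm phi m : \bar R :=
  (\sum_(0 <= k <oo) (2 `^ (n%:R * k%:R / 2))%:E *
     lorentz4_norm_multiplier (dyadic phi k) m)%E.

Definition besov phi m := cmeasurable m /\ (besov_norm phi m < +oo)%E.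

Definition bilinear_multiplier m f g (x : 'rV[R]_n) : R[i] :=
  cintegral (fun xi => cintegral (fun eta =>
    m (row_mx xi eta) * fourier f xi * fourier g eta *
    cexp (2 * pi * dot_rV x (xi + eta)))).

(* T is a bilinear operator from L^2 x L^2 to L^1, both made of functions up to
   a.e. equality. *)
Definition bilinear_L2_L1
    (T : ('rV[R]_n -> R[i]) -> ('rV[R]_n -> R[i]) -> 'rV[R]_n -> R[i]) :=
  [/\ forall f g, Lp 2%:E f -> Lp 2%:E g -> Lp 1%:E (T f g),
      forall f f' g g', Lp 2%:E f -> Lp 2%:E f' -> Lp 2%:E g -> Lp 2%:E g' ->
        ae_eq_rV f f' -> ae_eq_rV g g' -> ae_eq_rV (T f g) (T f' g'),
      forall (a : R[i]) f f' g, Lp 2%:E f -> Lp 2%:E f' -> Lp 2%:E g ->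
        ae_eq_rV (T (fun x => a * f x + f' x) g)
                 (fun x => a * T f g x + T f' g x) &
      forall (a : R[i]) f g g', Lp 2%:E f -> Lp 2%:E g -> Lp 2%:E g' ->
        ae_eq_rV (T f (fun x => a * g x + g' x))
                 (fun x => a * T f g x + T f g' x)].

End bilinear.

(* Main.v *)
(** Pairing T_h(f,g) with a bounded function w turns the bilinear operator into
    the trilinear form  int h(xi,eta) f^(xi) g^(eta) w^(xi+eta),  and for h in
    L^{4,oo} this form is bounded on L^2 x L^2 x L^2: cut h at its level sets and
    use |{|h| > l}| <= l^-4.  So T_h maps L^2 x L^2 into L^1 locally: testing on
    a ball of radius rho costs the factor rho^{n/2}, the L^2 norm of w.

    A dyadic piece h_k = Lambda_k m has a Fourier transform supported in a ball
    of radius rho = (3/2) 2^k, hence T_{h_k}(f,g)(x) depends only on the values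
    of f and g at distance at most rho from x.  One may therefore replace f and g
    by their restrictions to a window around x, apply the local bound with cost
    rho^{n/2} ~ 2^{nk/2}, and average over the window; since f and g are both
    localized, Cauchy-Schwarz sums the local estimates.  This gives
    |T_{h_k}|_{L^2 x L^2 -> L^1} <= C 2^{nk/2} |h_k|_{4,oo}.

    The partial sums of the h_k are, on the Fourier side, dilated cutoffs times
    the transform of m, which tend to the transform of m as distributions; as
    the series also converges absolutely in a weighted L^1 space, its sum is m
    almost everywhere, and Fatou's lemma yields the bound for T_m on Schwartz
    functions.  The operator is then extended by density.

    Products of norms |f| |g| are handled as (t |f|^2 + |g|^2 / t) for all t > 0,
    which are additive under localization. *)

(* The hypotheses supply one auxiliary function, [phi0]; every bump, cutoff, smooth step and
   inversion kernel below is made from it by restriction, dilation and squaring, so the constant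
   depends only on [n] and [phi0]. The Fourier inversion constant [inv_mass] is kept as an unknown
   positive number, and Plancherel enters as an inequality with constant [osc_mass]; both are
   computed from such a kernel. Complex exponentials are replaced by cosines with a phase, which
   reduces measurability, convergence and Fubini arguments to real functions.

   The norm of B is a sum of infima over the functions representing the pieces, and each
   representative comes with its own pair of distributions. Representatives are therefore chosen
   with a summable error, the distributions attached to [m] are identified afterwards, and the error
   tends to 0 at the end. A priori [m] is only locally integrable; that the integral defining T_m
   converges absolutely on Schwartz functions is a consequence of the summation of the pieces. *)
Require Import Defs.
From mathcomp Require Import all_boot all_order all_algebra.
From mathcomp Require Import all_classical all_reals all_analysis.
From mathcomp Require Import measurable_realfun complex ring lra zify.
From mathcomp Require finmap.
Set Implicit Arguments.
Unset Strict Implicit.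
Unset Printing Implicit Defensive.
Import Order.TTheory GRing.Theory Num.Theory.
Import numFieldNormedType.Exports.
Import ComplexField.Normc.
Local Open Scope classical_set_scope.
Local Open Scope ring_scope.

(** * Lebesgue measure on row vectors *)

Section lebesgue_affine.
Context {R : realType}.
Local Notation leb := (@lebesgue_measure R).
Local Open Scope ereal_scope.

Lemma ge0_integral_oppR (G : R -> \bar R) :
  measurable_fun setT G -> (forall x, 0 <= G x) ->
  \int[leb]_x G x = \int[leb]_x G (- x)%R.
Proof.
move=> mG G0; rewrite -[RHS]/(\int[leb]_(x in (-%R : _ -> measurableTypeR R) @^-1` setT) (G \o (-%R : _ -> measurableTypeR R)) x).
rewrite -ge0_integral_pushforward//=.
by apply: eq_measure_integral => A mA _; rewrite [RHS]lebesgue_measureN.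
Qed.

Let affineR (a r : R) : measurableTypeR R -> measurableTypeR R :=
  fun x => (a + r * x)%R.

Let measurable_affineR a r : measurable_fun setT (affineR a r).
Proof. by apply: measurable_funD => //; exact: measurable_funM. Qed.

(** By uniqueness of Lebesgue measure the two measures need only be compared on half-open intervals,
    and an increasing affine map pulls these back to half-open intervals. *)
Lemma ge0_integral_affineR_gt0 (a r : R) (G : R -> \bar R) : (0 < r)%R ->
  measurable_fun setT G -> (forall x, 0 <= G x) ->
  \int[leb]_x G x = r%:E * \int[leb]_x G (a + r * x)%R.
Proof.
move=> r0 mG G0.
pose m0 := measure_function_pushforward__canonical__measure_function_Measure
  leb (measurable_affineR a r).
have -> : r%:E = (NngNum (ltW r0))%:num%:E by [].
rewrite -[X in _ * X]/(\int[leb]_(x in affineR a r @^-1` setT) (G \o affineR a r) x).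
rewrite -(@ge0_integral_pushforward _ _ _ _ _ _ (measurable_affineR a r) leb)//=.
rewrite -(@ge0_integral_mscale _ _ _ m0 setT measurableT (NngNum (ltW r0)) G mG)//.
apply: eq_measure_integral => A mA _.
apply: lebesgue_measure_unique => //= _ [[x y]] _ <-.
rewrite /mscale /= /pushforward.
rewrite (_ : affineR a r @^-1` _ = `]((x - a) / r)%R, ((y - a) / r)%R]%classic); last first.
  apply/seteqP; split => t; rewrite /= !in_itv/= /affineR.
    by rewrite ltr_pdivrMr// ler_pdivlMr//; lra.
  by rewrite ltr_pdivrMr// ler_pdivlMr//; lra.
rewrite !lebesgue_measure_itv/= !lte_fin.
rewrite ltr_pM2r ?invr_gt0// ltrD2r; case: ifPn => // _; last by rewrite mule0.
by rewrite -!EFinB -EFinM; congr EFin; field; exact: lt0r_neq0.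
Qed.

Lemma ge0_integral_affineR (a r : R) (G : R -> \bar R) : r != 0%R ->
  measurable_fun setT G -> (forall x, 0 <= G x) ->
  \int[leb]_x G x = `|r|%:E * \int[leb]_x G (a + r * x)%R.
Proof.
move=> r0 mG G0; have [rp|rn|/eqP] := ltgtP r 0%R; last by rewrite (negbTE r0).
- rewrite (@ge0_integral_affineR_gt0 a (- r)) ?oppr_gt0// ltr0_norm//.
  rewrite [X in _ * X]ge0_integral_oppR//; last first.
    by apply: measurableT_comp => //; exact: measurable_affineR.
  by congr (_ * _); apply: eq_integral => x _; rewrite mulrNN.
- by rewrite gtr0_norm//; exact: ge0_integral_affineR_gt0.
Qed.

End lebesgue_affine.

Section rV_measure.
Context {R : realType}.
Local Notation leb := (@lebesgue_measure R).

(** The library norm is the sup norm, so a ball is a finite intersection of coordinate strips. *)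
Lemma measurable_ball_rV d (x : 'rV[R]_d) (e : R) : measurable (ball x e).
Proof.
have [e0|e0] := leP e 0.
  rewrite (_ : ball x e = set0); first exact: measurable0.
  by apply/seteqP; split => // y [] /lt_geF; rewrite e0.
rewrite (_ : ball x e = \bigcap_(i in [set: 'I_d])
   ((fun y : 'rV[R]_d => y ord0 i : measurableTypeR R) @^-1` ball (x ord0 i) e)).
  apply: fin_bigcap_measurable => [|i _]; first exact: finite_finset.
  rewrite -[X in measurable X]setTI; apply: measurable_coord_rV => //.
  exact: measurable_ball.
apply/seteqP; split => y /=.
  by move=> [_ h] i _; exact: h.
by move=> h; split=> // i j; rewrite (ord1 i); exact: h.
Qed.

(** An open set is a countable union of balls with rational centres and radii [k.+1%:R^-1]. This
    links the coordinate sigma-algebra with the topology. *)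
Lemma open_measurable_rV d (U : set 'rV[R]_d) : open U -> measurable U.
Proof.
move=> oU.
pose q (z : 'rV[rat]_d) : 'rV[R]_d := map_mx ratr z.
pose B (p : 'rV[rat]_d * nat) := ball (q p.1) (p.2.+1%:R^-1).
rewrite (_ : U = \bigcup_k (if unpickle k is Some p then
    (if `[< B p `<=` U >] then B p else set0) else set0)).
  apply: bigcupT_measurable => k; case: unpickle => [p|]; last exact: measurable0.
  by case: ifP => _; [exact: measurable_ball_rV|exact: measurable0].
apply/seteqP; split => [x Ux|x [k _]]; last first.
  by case: unpickle => [p|]//; case: asboolP => // + h; apply.
have /nbhs_ballP[e /= e0 eU] : nbhs x U by exact: open_nbhs_nbhs.
have [k ke] : exists k : nat, (k.+1%:R^-1 < e / 2)%R.
  have [k _ hk] := near_infty_natSinv_lt (PosNum (divr_gt0 e0 (@ltr0Sn R 1))).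
  by exists k; exact: hk (leqnn k).
have k0 : (0 < (k.+1%:R^-1 : R))%R by rewrite invr_gt0.
have /choice[z hz] : forall i : 'I_d, exists z : rat,
    (`|x ord0 i - ratr z| < k.+1%:R^-1)%R.
  move=> i; have [z] := @rat_in_itvoo R (x ord0 i - k.+1%:R^-1) (x ord0 i + k.+1%:R^-1) ltac:(by rewrite ltrBlDr -addrA ltrDl addr_gt0).
  by rewrite in_itv/= => /andP[h1 h2]; exists z; rewrite ltr_distl ltrBlDr h2 -ltrBlDr h1.
exists (pickle (\row_i z i, k)) => //; rewrite pickleK.
have qx : ball (q (\row_i z i)) k.+1%:R^-1 x.
  by split=> // i j; rewrite (ord1 i) !mxE /ball /= distrC.
case: asboolP => //; case=> y hy; apply: eU; apply: (@ball_splitr _ _ (q (\row_i z i))).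
  by apply: (@le_ball _ _ _ (k.+1%:R^-1)); [exact: ltW|exact: qx].
by apply: (@le_ball _ _ _ (k.+1%:R^-1)); [exact: ltW|exact: hy].
Qed.

Lemma continuous_measurable_rV d (f : 'rV[R]_d -> R) : continuous f ->
  measurable_fun setT (f : _ -> measurableTypeR R).
Proof.
move=> /continuousP cf; apply: (measurability _ (RGenOpens.measurableE R)).
move=> _ [_ [a [b ->] <-]]; rewrite setTI; apply: open_measurable_rV.
exact/cf/interval_open.
Qed.

Lemma measurable_row_mx m p : measurable_fun setT
  (fun z : 'rV[R]_m * 'rV[R]_p => row_mx z.1 z.2).
Proof.
apply: measurable_fun_rV => i; case: (split_ordP i) => j ->.
  rewrite (_ : (fun _ => _) =
      (fun v : 'rV[R]_m => v ord0 j : measurableTypeR R) \o fst).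
    by apply: measurableT_comp => //; exact: measurable_coord_rV.
  by apply/funext => z /=; rewrite row_mxEl.
rewrite (_ : (fun _ => _) =
    (fun v : 'rV[R]_p => v ord0 j : measurableTypeR R) \o snd).
  by apply: measurableT_comp => //; exact: measurable_coord_rV.
by apply/funext => z /=; rewrite row_mxEr.
Qed.

Lemma measurable_affine_rV d (a : 'rV[R]_d) (r : R) :
  measurable_fun setT (fun x : 'rV[R]_d => a + r *: x).
Proof.
apply: measurable_fun_rV => i.
rewrite (_ : (fun _ => _) = (fun x : 'rV[R]_d => a ord0 i + r * x ord0 i)).
  by apply: measurable_funD => //; apply: measurable_funM => //; exact: measurable_coord_rV.
by apply/funext => x; rewrite !mxE.
Qed.

Local Open Scope ereal_scope.

Lemma ge0_integral_rVS d (F : 'rV[R]_d.+1 -> \bar R) :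
  measurable_fun setT F -> (forall x, 0 <= F x) ->
  \int[lebesgue_rV d.+1]_x F x =
  \int[leb]_a \int[lebesgue_rV d]_v F (cons_rV (a, v)).
Proof.
move=> mF F0.
rewrite -(@fubini_tonelli1 _ _ _ _ _ leb (lebesgue_rV d) (F \o @cons_rV R d)); last 2 first.
- by apply: measurableT_comp => //; exact: measurable_cons_rV.
- by move=> x; exact: F0.
rewrite -[RHS]/(\int[leb \x lebesgue_rV d]_(x in @cons_rV R d @^-1` setT) (F \o @cons_rV R d) x).
rewrite -(@ge0_integral_pushforward _ _ _ _ _ _ (@measurable_cons_rV R d))//.
Qed.

Lemma integral_rV0 (F : 'rV[R]_0 -> \bar R) :
  measurable_fun setT F -> \int[lebesgue_rV 0]_x F x = F 0%R.
Proof. by move=> mF; rewrite integral_dirac// diracT mul1e. Qed.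

(** Associativity of concatenation up to the identification of index types. It lets the recursively
    defined [lebesgue_rV] be split after any number of coordinates. *)
Lemma cons_rV_row_mx m p (a : R) (x : 'rV[R]_m) (y : 'rV[R]_p) :
  @cons_rV R (m + p) (a, row_mx x y) = row_mx (cons_rV (a, x) : 'rV_m.+1) y.
Proof.
apply/rowP => i; rewrite /cons_rV /=.
case: (split_ordP (i : 'I_(1 + (m + p)))) => j ->.
  rewrite (row_mxEl a%:M).
  transitivity (row_mx (row_mx a%:M x : 'rV_(1 + m)) y ord0 (lshift p (lshift m j))).
    by rewrite !row_mxEl.
  by congr (row_mx _ _ _ _); exact/val_inj.
rewrite (row_mxEr a%:M); case: (split_ordP j) => k ->.
  rewrite row_mxEl.
  transitivity (row_mx (row_mx a%:M x : 'rV_(1 + m)) y ord0 (lshift p (rshift 1 k))).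
    by rewrite row_mxEl row_mxEr.
  by congr (row_mx _ _ _ _); exact/val_inj.
rewrite row_mxEr.
transitivity (row_mx (row_mx a%:M x : 'rV_(1 + m)) y ord0 (rshift m.+1 k)).
  by rewrite row_mxEr.
by congr (row_mx _ _ _ _); exact/val_inj.
Qed.

Lemma ge0_integral_row_mx m p (F : 'rV[R]_(m + p) -> \bar R) :
  measurable_fun setT F -> (forall x, 0 <= F x) ->
  \int[lebesgue_rV (m + p)]_x F x =
  \int[lebesgue_rV m]_x \int[lebesgue_rV p]_y F (row_mx x y).
Proof.
elim: m F => [|m IH] F mF F0.
  have mG : measurable_fun setT
      (fun z : 'rV[R]_0 * 'rV[R]_p => F (row_mx z.1 z.2)).
    by apply: measurableT_comp => //; exact: measurable_row_mx.
  rewrite [RHS]integral_rV0//; last first.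
    exact: (@measurable_fun_fubini_tonelli_F _ _ _ _ _ _ _ mG).
  apply: eq_integral => y _; congr F; apply/rowP => i.
  by rewrite -[i in RHS](_ : rshift 0 i = i) ?row_mxEr//; exact/val_inj.
have mG : measurable_fun setT
    (fun z : 'rV[R]_m.+1 * 'rV[R]_p => F (row_mx z.1 z.2)).
  by apply: measurableT_comp => //; exact: measurable_row_mx.
rewrite [LHS](@ge0_integral_rVS (m + p) F)// ge0_integral_rVS//; last 2 first.
  exact: (@measurable_fun_fubini_tonelli_F _ _ _ _ _ _ _ mG).
  by move=> x; apply: integral_ge0.
apply: eq_integral => a _; rewrite IH//; last first.
  apply: measurableT_comp => //.
  apply: (measurableT_comp (@measurable_cons_rV R (m + p))).
  exact: measurable_pair1.
apply: eq_integral => x _; apply: eq_integral => y _.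
by rewrite cons_rV_row_mx.
Qed.

Lemma ge0_integral_affine_rV d (a : 'rV[R]_d) (r : R) (F : 'rV[R]_d -> \bar R) :
  r != 0%R -> measurable_fun setT F -> (forall x, 0 <= F x) ->
  \int[lebesgue_rV d]_x F x =
  (`|r| ^+ d)%:E * \int[lebesgue_rV d]_x F (a + r *: x)%R.
Proof.
move=> r0; elim: d a F => [|d IH] a F mF F0.
  rewrite !integral_rV0 ?expr0 ?mul1e//.
    by congr F; apply/rowP => -[].
  by apply: measurableT_comp => //; exact: measurable_affine_rV.
have mG : measurable_fun setT (fun x : 'rV[R]_d.+1 => F (a + r *: x)%R).
  by apply: measurableT_comp => //; exact: measurable_affine_rV.
have mc b (H : 'rV[R]_d.+1 -> \bar R) : measurable_fun setT H ->
    measurable_fun setT (fun v => H (cons_rV (b, v))).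
  move=> mH; apply: measurableT_comp => //.
  apply: (measurableT_comp (@measurable_cons_rV R d)).
  exact: measurable_pair1.
have mi (H : 'rV[R]_d.+1 -> \bar R) : measurable_fun setT H -> (forall x, 0 <= H x) ->
    measurable_fun setT (fun b : R => \int[lebesgue_rV d]_v (H (cons_rV (b, v)))).
  move=> mH H0.
  have mG' : measurable_fun setT (H \o @cons_rV R d).
    by apply: measurableT_comp => //; exact: measurable_cons_rV.
  exact: (@measurable_fun_fubini_tonelli_F _ _ _ _ _ _ _ mG' (fun z => H0 _)).
pose a' : 'rV[R]_d := rsubmx (a : 'rV_(1 + d)).
have aE b v : (a + r *: cons_rV (b, v) = cons_rV ((a ord0 ord0 + r * b), a' + r *: v))%R.
  apply/rowP => i; rewrite /cons_rV /= !mxE.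
  case: (split_ordP (i : 'I_(1 + d))) => j ->.
    by rewrite (ord1 j) !mxE/= !mulr1n; congr (a _ _ + _)%R; exact/val_inj.
  by rewrite /a' !mxE.
rewrite ge0_integral_rVS// (@ge0_integral_affineR _ (a ord0 ord0) r)//; last 2 first.
- exact: mi.
- by move=> x; apply: integral_ge0.
rewrite ge0_integral_rVS// exprS EFinM -muleA; congr (_ * _).
rewrite -ge0_integralZl//; try by [move=> *; apply: integral_ge0|rewrite lee_fin exprn_ge0]; try exact: (mi (fun x => F (a + r *: x)%R) mG).
apply: eq_integral => b _.
rewrite (IH a')//; last exact: mc.
by congr (_ * _); apply: eq_integral => v _; rewrite aE.
Qed.

(** Positive and negative parts are shifted separately, so the equality also covers integrals that
    are infinite or a difference of infinities. *)
Lemma integral_shift_rV d (a : 'rV[R]_d) (F : 'rV[R]_d -> \bar R) :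
  measurable_fun setT F ->
  \int[lebesgue_rV d]_x F (a + x)%R = \int[lebesgue_rV d]_x F x.
Proof.
move=> mF; rewrite [LHS]integralE [RHS]integralE; congr (_ - _).
  rewrite [RHS](@ge0_integral_affine_rV _ a 1)//; last exact: measurable_funepos.
  rewrite normr1 expr1n mul1e; apply: eq_integral => x _.
  by rewrite !funeposE scale1r.
rewrite [RHS](@ge0_integral_affine_rV _ a 1)//; last exact: measurable_funeneg.
rewrite normr1 expr1n mul1e; apply: eq_integral => x _.
by rewrite !funenegE scale1r.
Qed.

Lemma integral_opp_rV d (F : 'rV[R]_d -> \bar R) :
  measurable_fun setT F ->
  \int[lebesgue_rV d]_x F (- x)%R = \int[lebesgue_rV d]_x F x.
Proof.
move=> mF; rewrite [LHS]integralE [RHS]integralE; congr (_ - _).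
  rewrite [RHS](@ge0_integral_affine_rV _ 0%R (-1)) ?oppr_eq0//; last exact: measurable_funepos.
  rewrite normrN1 expr1n mul1e; apply: eq_integral => x _.
  by rewrite !funeposE scaleN1r add0r.
rewrite [RHS](@ge0_integral_affine_rV _ 0%R (-1)) ?oppr_eq0//; last exact: measurable_funeneg.
rewrite normrN1 expr1n mul1e; apply: eq_integral => x _.
by rewrite !funenegE scaleN1r add0r.
Qed.

Lemma integral_row_mx m p (F : 'rV[R]_(m + p) -> \bar R) :
  measurable_fun setT F ->
  \int[lebesgue_rV (m + p)]_x F x =
  \int[lebesgue_rV m \x lebesgue_rV p]_z F (row_mx z.1 z.2).
Proof.
move=> mF.
have mG (G : 'rV[R]_(m + p) -> \bar R) : measurable_fun setT G ->
    measurable_fun setT (fun z : 'rV[R]_m * 'rV[R]_p => G (row_mx z.1 z.2)).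
  by move=> ?; apply: measurableT_comp => //; exact: measurable_row_mx.
rewrite [LHS]integralE [RHS]integralE; congr (_ - _).
  rewrite ge0_integral_row_mx//; last exact: measurable_funepos.
  rewrite fubini_tonelli1; [|by apply: measurable_funepos; exact: mG|by []].
  by apply: eq_integral => x _; apply: eq_integral => y _; rewrite !funeposE.
rewrite ge0_integral_row_mx//; last exact: measurable_funeneg.
rewrite fubini_tonelli1; [|by apply: measurable_funeneg; exact: mG|by []].
by apply: eq_integral => x _; apply: eq_integral => y _; rewrite !funenegE.
Qed.

End rV_measure.

(** * The trilinear form *)

Ltac mfun :=
  lazymatch goal with
  | |- measurable_fun _ (fun x => EFin _) => apply/measurable_EFinP; mfun
  | |- measurable_fun _ (EFin \o _) => apply/measurable_EFinP; mfun
  | |- measurable_fun _ (fun x => if _ then _ else _) =>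
      apply: measurable_fun_ifT; mfun
  | |- measurable_fun _ (fun x => andb _ _) => apply: measurable_and; mfun
  | |- measurable_fun _ (fun x => Order.le _ _) => apply: measurable_fun_ler; mfun
  | |- measurable_fun _ (fun x => Order.lt _ _) => apply: measurable_fun_ltr; mfun
  | |- measurable_fun _ (fun x => GRing.add _ (GRing.opp _)) =>
      apply: measurable_funB; mfun
  | |- measurable_fun _ (fun x => GRing.add _ _) => apply: measurable_funD; mfun
  | |- measurable_fun _ (fun x => GRing.opp _) => apply: measurable_funN; mfun
  | |- measurable_fun _ (fun x => GRing.mul _ _) => apply: measurable_funM; mfun
  | |- measurable_fun _ (fun x => GRing.exp _ _) => apply: measurable_funX; mfun
  | |- measurable_fun _ (fun x => Num.norm _) =>
      apply: (measurableT_comp (@normr_measurable _ _)); mfun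
  | |- measurable_fun _ (fun x => powR _ _) =>
      apply: (measurableT_comp (@measurable_powR _ _)); mfun
  | |- _ => first
      [ assumption | exact: measurable_cst | exact: measurable_fst
      | exact: measurable_snd | exact: measurable_id | exact: measurable_coord_rV
      | (apply: measurableT_comp; [assumption|]); mfun
      | idtac ]
  end.

Section real_integrals.
Context d (T : measurableType d) {R : realType} (mu : {measure set T -> \bar R}).
Local Open Scope ereal_scope.

Lemma ge0_le_integral_EFin (f g : T -> R) :
  measurable_fun setT f -> measurable_fun setT g ->
  (forall x, 0 <= f x <= g x)%R ->
  \int[mu]_x (f x)%:E <= \int[mu]_x (g x)%:E.
Proof.
move=> mf mg fg; apply: ge0_le_integral => //.
- by move=> x _; rewrite lee_fin; case/andP: (fg x).
- exact/measurable_EFinP.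
- exact/measurable_EFinP.
- by move=> x _; rewrite lee_fin; case/andP: (fg x).
Qed.

Lemma ge0_integralD_EFin (f g : T -> R) :
  measurable_fun setT f -> measurable_fun setT g ->
  (forall x, 0 <= f x)%R -> (forall x, 0 <= g x)%R ->
  \int[mu]_x (f x + g x)%:E = \int[mu]_x (f x)%:E + \int[mu]_x (g x)%:E.
Proof.
move=> mf mg f0 g0; under eq_integral do rewrite EFinD.
rewrite ge0_integralD//.
- by move=> x _; rewrite lee_fin.
- exact/measurable_EFinP.
- by move=> x _; rewrite lee_fin.
- exact/measurable_EFinP.
Qed.

Lemma ge0_integralZl_real (f : T -> R) (k : R) :
  measurable_fun setT f -> (forall x, 0 <= f x)%R -> (0 <= k)%R ->
  \int[mu]_x (k * f x)%:E = k%:E * \int[mu]_x (f x)%:E.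
Proof.
move=> mf f0 k0; under eq_integral do rewrite EFinM.
rewrite ge0_integralZl//; first exact/measurable_EFinP.
by move=> x _; rewrite lee_fin.
Qed.

End real_integrals.

(** * Integrals over the level [l] *)

Section layer_cake.
Context {R : realType}.
Local Notation leb := (@lebesgue_measure R).
Local Open Scope ereal_scope.

(** Writes [v] as the length of the set of levels below it; [v] will be the kernel and [c] the
    product of the three functions. *)
Lemma integral_layer_lt (v c : R) : (0 <= v)%R -> (0 <= c)%R ->
  \int[leb]_l (if (0 < l)%R && (l < v)%R then c else 0%R)%:E = (v * c)%:E.
Proof.
move=> v0 c0; transitivity (\int[leb]_(l in `]0%R, v[) (cst c%:E l)).
  rewrite [RHS]integral_mkcond; apply: eq_integral => l _.
  by rewrite patchE mem_setE in_itv/=; case: ifP.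
rewrite integral_cst//= lebesgue_measure_itv/= lte_fin.
case: ltgtP v0 => // [v0|<-] _; last by rewrite mule0 mul0r.
by rewrite -EFinD subr0 mulrC EFinM.
Qed.

Lemma integral_layer_le (a : R) : (0 <= a)%R ->
  \int[leb]_l (if (0 < l)%R && (l <= a)%R then a else 0%R)%:E = (a ^+ 2)%:E.
Proof.
move=> a0; transitivity (\int[leb]_(l in `]0%R, a]) (cst a%:E l)).
  rewrite [RHS]integral_mkcond; apply: eq_integral => l _.
  by rewrite patchE mem_setE in_itv/=; case: ifP.
rewrite integral_cst//= lebesgue_measure_itv/= lte_fin.
case: ltgtP a0 => // [a0|<-] _; last by rewrite mule0 expr0n.
by rewrite -EFinD subr0 expr2 EFinM.
Qed.

(** Counterpart of the previous identity for values below the level: the exponent -2 is the one for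
    which the cube, integrated over [l], returns the square. *)
Lemma integral_layer_gt (a : R) : (0 <= a)%R ->
  \int[leb]_l (if (0 < l)%R && (a < l)%R then (l `^ (-2) * a ^+ 3)%R else 0%R)%:E
  = (a ^+ 2)%:E.
Proof.
rewrite le_eqVlt => /predU1P[<-|a0].
  rewrite expr0n/=; under eq_integral do rewrite mulr0 if_same.
  by rewrite expr0n integral0_eq.
transitivity (\int[leb]_(l in `]a, +oo[) ((l ^+ 2)^-1 * a ^+ 3)%R%:E).
  rewrite [RHS]integral_mkcond; apply: eq_integral => l _.
  rewrite patchE mem_setE in_itv/= andbT.
  case: ifPn => [/andP[l0 ->]|]; first by rewrite powRN powR_mulrn ?ltW.
  by rewrite negb_and => /orP[|/negbTE->//]; rewrite -leNgt => l0; rewrite lt_gtF// (le_lt_trans l0).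
have mf : measurable_fun (`]a, +oo[ : set R) (fun l => ((l ^+ 2)^-1 * a ^+ 3)%R).
  apply: open_continuous_measurable_fun => //.
  move=> x; rewrite inE/= in_itv/= andbT => ax.
  apply: cvgM; last exact: cvg_cst.
  apply: (@cvgV _ _ _ _ (fun l : R => (l ^+ 2)%R)); last exact: exprn_continuous.
  by rewrite sqrf_eq0 gt_eqF// (lt_trans a0).
rewrite integral_itv_obnd_cbnd; last exact/measurable_EFinP.
pose F (l : R) := (- (a ^+ 3 * l^-1))%R.
rewrite (@ge0_continuous_FTC2y _ _ F _ 0%R).
- by rewrite /F -EFinN -EFinD; congr EFin; field; exact: lt0r_neq0.
- by move=> x ax; rewrite mulr_ge0// ?invr_ge0 ?exprn_ge0// ltW// (lt_le_trans a0).
- apply: continuous_in_subspaceT => x; rewrite inE/= in_itv/= andbT => ax.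
  apply: cvgM; last exact: cvg_cst.
  apply: (@cvgV _ _ _ _ (fun l : R => (l ^+ 2)%R)); last exact: exprn_continuous.
  by rewrite sqrf_eq0 gt_eqF// (lt_le_trans a0).
- rewrite -oppr0 -(mulr0 (a ^+ 3)%R); apply: cvgN; apply: cvgM; first exact: cvg_cst.
  apply/(@gtr0_cvgV0 R _ _ _ (fun x : R => x)); last exact: cvg_id.
  by near=> x.
- move=> x ax; apply: derivableN; apply: derivableM => //.
  by apply: derivableV => //; rewrite gt_eqF// (lt_trans a0).
- apply: cvg_at_right_filter; apply: cvgN; apply: cvgM; first exact: cvg_cst.
  by apply: inv_continuous; rewrite gt_eqF.
- move=> x; rewrite in_itv/= andbT => ax; rewrite /F.
  have x0 : x != 0%R by rewrite gt_eqF// (lt_trans a0).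
  rewrite derive1E deriveN; last first.
    by apply: derivableM => //; exact: derivableV.
  rewrite deriveM//; last exact: derivableV.
  rewrite derive_cst scaler0 addr0 deriveV// derive_id scaler1 -exprVn.
  by rewrite /GRing.scale/= mulrN opprK exprVn mulrC.
Unshelve. all: by end_near. Qed.

End layer_cake.

(** * The weak L4 trilinear estimate in abstract form *)

Section trilinear.
Context {R : realType} dT dX (T : measurableType dT) (X : measurableType dX).
Variables (mu : {sigma_finite_measure set T -> \bar R})
          (nu : {sigma_finite_measure set X -> \bar R}).
Local Notation leb := (@lebesgue_measure R).
Local Open Scope ereal_scope.

Let lo (l a : R) : R := if (l <= a)%R then 0%R else a.
Let hi (l a : R) : R := if (l <= a)%R then a else 0%R.

(** [P] and [Q] are the costs at level [l] of the parts of [A] above and below [l]. The weights are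
    such that either one, integrated over all levels, gives the squared L2 norm. *)
Let P (A : X -> R) (l : R) : \bar R :=
  \int[nu]_x (if (0 < l)%R && (l <= A x)%R then A x else 0%R)%:E.
Let Q (A : X -> R) (l : R) : \bar R :=
  \int[nu]_x (if (0 < l)%R && (A x < l)%R then (l `^ (-2) * A x ^+ 3)%R else 0%R)%:E.

Let mP (A : X -> R) : measurable_fun setT A ->
  measurable_fun setT (fun z : X * R =>
    (if (0 < z.2)%R && (z.2 <= A z.1)%R then A z.1 else 0%R)%:E).
Proof. by move=> mA; mfun. Qed.

Let mQ (A : X -> R) : measurable_fun setT A ->
  measurable_fun setT (fun z : X * R => (if (0 < z.2)%R && (A z.1 < z.2)%R
    then (z.2 `^ (-2) * A z.1 ^+ 3)%R else 0%R)%:E).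
Proof.
by move=> mA; mfun.
Qed.

Let integralP (A : X -> R) : measurable_fun setT A -> (forall x, 0 <= A x)%R ->
  \int[leb]_l P A l = \int[nu]_x (A x ^+ 2)%:E.
Proof.
move=> mA A0; transitivity (\int[nu]_x \int[leb]_l (if (0 < l)%R && (l <= A x)%R then A x else 0%R)%:E); first apply/esym/(@fubini_tonelli _ _ _ _ _ nu leb _ (mP mA)).
  by move=> [x l] /=; rewrite lee_fin; case: ifP.
by apply: eq_integral => x _; rewrite integral_layer_le.
Qed.

Let integralQ (A : X -> R) : measurable_fun setT A -> (forall x, 0 <= A x)%R ->
  \int[leb]_l Q A l = \int[nu]_x (A x ^+ 2)%:E.
Proof.
move=> mA A0; transitivity (\int[nu]_x \int[leb]_l (if (0 < l)%R && (A x < l)%R then (l `^ (-2) * A x ^+ 3)%R else 0%R)%:E); first apply/esym/(@fubini_tonelli _ _ _ _ _ nu leb _ (mQ mA)).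
  move=> [x l] /=; rewrite lee_fin; case: ifP => // /andP[l0 _].
  by rewrite mulr_ge0 ?exprn_ge0 ?powR_ge0.
by apply: eq_integral => x _; rewrite integral_layer_gt.
Qed.


Let mhi dY (Z : measurableType dY) (f : Z -> R) l :
  measurable_fun setT f -> measurable_fun setT (fun x => hi l (f x)).
Proof. by move=> mf; rewrite /hi; mfun. Qed.
Let mlo dY (Z : measurableType dY) (f : Z -> R) l :
  measurable_fun setT f -> measurable_fun setT (fun x => lo l (f x)).
Proof. by move=> mf; rewrite /lo; mfun. Qed.
Let hi0 l x : (0 <= x -> 0 <= hi l x)%R. Proof. by rewrite /hi; case: ifP. Qed.
Let lo0 l x : (0 <= x -> 0 <= lo l x)%R. Proof. by rewrite /lo; case: ifP. Qed.

(** [P] occurs twice because the high part of each function is paired once with the square of each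
    of the other two. *)
Let DD (A : X -> R) (l : R) := P A l + P A l + Q A l.

Let P_ge0 A l : (forall x, 0 <= A x)%R -> 0 <= P A l.
Proof. by move=> h; apply: integral_ge0 => x _; rewrite lee_fin; case: ifP. Qed.

Let Q_ge0 A l : (forall x, 0 <= A x)%R -> 0 <= Q A l.
Proof.
move=> h; apply: integral_ge0 => x _; rewrite lee_fin; case: ifP => // _.
by rewrite mulr_ge0 ?powR_ge0 ?exprn_ge0.
Qed.

Let measurable_P (A : X -> R) : measurable_fun setT A -> (forall x, 0 <= A x)%R ->
  measurable_fun setT (P A).
Proof.
move=> mA' h; apply: (@measurable_fun_fubini_tonelli_G _ _ _ _ _ nu _ (mP mA')).
by move=> [x l] /=; rewrite lee_fin; case: ifP.
Qed.

Let measurable_Q (A : X -> R) : measurable_fun setT A -> (forall x, 0 <= A x)%R ->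
  measurable_fun setT (Q A).
Proof.
move=> mA' h; apply: (@measurable_fun_fubini_tonelli_G _ _ _ _ _ nu _ (mQ mA')).
move=> [x l] /=; rewrite lee_fin; case: ifP => // _.
by rewrite mulr_ge0 ?powR_ge0 ?exprn_ge0.
Qed.

Let measurable_DD (A : X -> R) : measurable_fun setT A -> (forall x, 0 <= A x)%R ->
  measurable_fun setT (DD A).
Proof.
move=> mA' h; apply: emeasurable_funD; last exact: measurable_Q.
by apply: emeasurable_funD; exact: measurable_P.
Qed.

Let DD_ge0 A l : (forall x, 0 <= A x)%R -> 0 <= DD A l.
Proof. by move=> h; apply: adde_ge0; [apply: adde_ge0|]; [exact: P_ge0|exact: P_ge0|exact: Q_ge0]. Qed.

Let integral_DD (A : X -> R) : measurable_fun setT A -> (forall x, 0 <= A x)%R ->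
  \int[nu]_x (A x ^+ 2)%:E <= 1 -> \int[leb]_l DD A l <= 3%:E.
Proof.
move=> mA' h hA'; have mP' := measurable_P mA' h; have mQ' := measurable_Q mA' h.
rewrite ge0_integralD//=.
- rewrite ge0_integralD//=.
  + rewrite integralP// integralQ//.
    by rewrite (_ : 3%:E = 1 + 1 + 1) ?leeD// -!EFinD; congr EFin; lra.
  + by move=> *; exact: P_ge0.
  + by move=> *; exact: P_ge0.
- by move=> *; rewrite adde_ge0 ?P_ge0.
- exact: emeasurable_funD.
- by move=> *; exact: Q_ge0.
Qed.

Let PE (A : X -> R) l : (0 < l)%R -> P A l = \int[nu]_x (hi l (A x))%:E.
Proof. by move=> l0; apply: eq_integral => x _; rewrite l0. Qed.

Let QE (A : X -> R) l : measurable_fun setT A -> (forall x, 0 <= A x)%R ->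
  (0 < l)%R -> Q A l = (l ^- 2)%:E * \int[nu]_x (lo l (A x) ^+ 3)%:E.
Proof.
move=> mA' h l0; rewrite -ge0_integralZl_real//.
- apply: eq_integral => x _; rewrite l0/= powRN powR_mulrn ?ltW//.
  by rewrite /lo; case: leP => _; rewrite ?expr0n/= ?mulr0.
- by apply: measurable_funX; exact: mlo.
- by move=> x; rewrite exprn_ge0// lo0.
- by rewrite invr_ge0 exprn_ge0// ltW.
Qed.

Variables (u1 u2 u3 : T -> X).
Hypotheses (mu1 : measurable_fun setT u1) (mu2 : measurable_fun setT u2)
  (mu3 : measurable_fun setT u3).
(** Models the fact that any two of xi + eta, xi and eta are independent coordinates on the product
    space, with Jacobian one. *)
Let tensor (u v : T -> X) := forall G H : X -> R,
  measurable_fun setT G -> measurable_fun setT H ->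
  (forall x, 0 <= G x)%R -> (forall x, 0 <= H x)%R ->
  \int[mu]_t (G (u t) * H (v t))%:E = \int[nu]_x (G x)%:E * \int[nu]_x (H x)%:E.
Hypotheses (t12 : tensor u1 u2) (t13 : tensor u1 u3) (t23 : tensor u2 u3).
Variables (V : T -> R) (A B C : X -> R).
Hypotheses (mV : measurable_fun setT V) (mA : measurable_fun setT A)
  (mB : measurable_fun setT B) (mC : measurable_fun setT C).
Hypotheses (V0 : forall t, (0 <= V t)%R) (A0 : forall x, (0 <= A x)%R)
  (B0 : forall x, (0 <= B x)%R) (C0 : forall x, (0 <= C x)%R).
Hypothesis hV : forall l : R, (0 < l)%R ->
  (l ^+ 4)%:E * mu [set t | (l < V t)%R] <= 1.
Hypotheses (hA : \int[nu]_x (A x ^+ 2)%:E <= 1)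
  (hB : \int[nu]_x (B x ^+ 2)%:E <= 1) (hC : \int[nu]_x (C x ^+ 2)%:E <= 1).

Let a t := A (u1 t). Let b t := B (u2 t). Let c t := C (u3 t).
Let ma : measurable_fun setT a. Proof. exact: measurableT_comp. Qed.
Let mb : measurable_fun setT b. Proof. exact: measurableT_comp. Qed.
Let mc : measurable_fun setT c. Proof. exact: measurableT_comp. Qed.
Let a0 t : (0 <= a t)%R. Proof. exact: A0. Qed.
Let b0 t : (0 <= b t)%R. Proof. exact: B0. Qed.
Let c0 t : (0 <= c t)%R. Proof. exact: C0. Qed.

(* The high part: one factor exceeds the level, the two others are paired by
   [2 y z <= y^2 + z^2]; the low part is compared with the geometric mean of
   the three pairwise products. *)
Let pointwise l t : (0 < l)%R ->
  (a t * b t * c t <=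
   (hi l (a t) * (b t ^+ 2) + hi l (a t) * (c t ^+ 2)) +
   ((b t ^+ 2) * hi l (c t) + hi l (b t) * (c t ^+ 2)) +
   ((a t ^+ 2) * hi l (b t) + (a t ^+ 2) * hi l (c t)) +
   lo l (a t) * lo l (b t) * lo l (c t))%R.
Proof.
move=> l0; have := a0 t; have := b0 t; have := c0 t.
rewrite /hi /lo; move: (a t) (b t) (c t) => x y z z0 y0 x0.
have h (p q r : R) : (0 <= p -> 0 <= q -> 0 <= r -> p * q * r <= p * q ^+ 2 + p * r ^+ 2)%R.
  move=> p0 q0 r0; rewrite -mulrA -mulrDr ler_wpM2l//.
  by have := sqr_ge0 (q - r)%R; have := sqr_ge0 q; have := sqr_ge0 r; rewrite sqrrB; nra.
have s2 (p q : R) : (0 <= p -> 0 <= p * q ^+ 2)%R by move=> p0; rewrite mulr_ge0 ?sqr_ge0.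
have s2' (p q : R) : (0 <= p -> 0 <= q ^+ 2 * p)%R by move=> p0; rewrite mulr_ge0 ?sqr_ge0.
have h1 := h x y z x0 y0 z0; have h2 := h y x z y0 x0 z0; have h3 := h z x y z0 x0 y0.
have k1 := s2 x y x0; have k2 := s2 x z x0; have k3 := s2 y x y0.
have k4 := s2 y z y0; have k5 := s2 z x z0; have k6 := s2 z y z0.
case: ifP => _; case: ifP => _; case: ifP => _; rewrite ?mul0r ?mulr0 ?addr0 ?add0r; lra.
Qed.


(** AM-GM with a free parameter [s], a substitute for Cauchy-Schwarz: the constant term is to be
    integrated over a level set, the cubes factor by [tensor]. The square of the product is the
    product of the three pairwise products, hence at most the sum of their cubes. *)
Let ptwise_low s (p q r : R) : (0 <= p -> 0 <= q -> 0 <= r -> 0 < s ->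
  p * q * r <= s / 2 + (2 * s)^-1 *
    (p ^+ 3 * q ^+ 3 + p ^+ 3 * r ^+ 3 + q ^+ 3 * r ^+ 3))%R.
Proof.
move=> p0 q0 r0 s0; set M := (X in (_ <= _ + _ * X)%R).
have hM : ((p * q * r) ^+ 2 <= M)%R.
  have h (x y z : R) : (0 <= x -> 0 <= y -> 0 <= z ->
      x * y * z <= x ^+ 3 + y ^+ 3 + z ^+ 3)%R.
    move=> x0 y0 z0.
    have e : (x ^+ 3 + y ^+ 3 + z ^+ 3 - 3 * (x * y * z) =
       (x + y + z) * ((x - y) ^+ 2 + (y - z) ^+ 2 + (x - z) ^+ 2) / 2)%R by field.
    have : (0 <= (x + y + z) * ((x - y) ^+ 2 + (y - z) ^+ 2 + (x - z) ^+ 2) / 2)%R.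
      by rewrite divr_ge0// mulr_ge0// ?addr_ge0// sqr_ge0.
    have : (0 <= x * y * z)%R by rewrite !mulr_ge0.
    by rewrite -e; lra.
  rewrite (_ : _ ^+ 2 = (p * q) * (p * r) * (q * r))%R; last by ring.
  apply: le_trans (h _ _ _ (mulr_ge0 p0 q0) (mulr_ge0 p0 r0) (mulr_ge0 q0 r0)) _.
  by rewrite /M !exprMn.
have e : (s / 2 + (2 * s)^-1 * M - p * q * r =
   (2 * s)^-1 * ((s - p * q * r) ^+ 2 + (M - (p * q * r) ^+ 2)))%R.
  by field; rewrite gt_eqF.
rewrite -subr_ge0 e; apply: mulr_ge0; first by rewrite invr_ge0 mulr_ge0// ltW.
by rewrite addr_ge0 ?sqr_ge0// subr_ge0.
Qed.

(** The level set has measure at most l^-4. With x, y, z the integrals of the cubes, Cauchy-Schwarz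
    suggests the bound l^-2 times the root of xy + xz + yz, which is at most l^-2 (x + y + z). *)
Let low_level l : (0 < l)%R ->
  \int[mu]_t (if (l < V t)%R then lo l (a t) * lo l (b t) * lo l (c t) else 0)%:E
  <= Q A l + Q B l + Q C l.
Proof.
move=> l0; rewrite !QE//.
pose al A := \int[nu]_x (lo l (A x) ^+ 3)%:E; rewrite -!/(al _).
have m3 F : measurable_fun setT F -> measurable_fun setT (fun x : X => (lo l (F x) ^+ 3)%R).
  by move=> mF; apply: measurable_funX; exact: mlo.
have p3 F : (forall x : X, 0 <= F x)%R -> forall x, (0 <= lo l (F x) ^+ 3)%R.
  by move=> F0 x; rewrite exprn_ge0// lo0.
have al0 F : (forall x, 0 <= F x)%R -> 0 <= al F.
  by move=> F0; apply: integral_ge0 => x _; rewrite lee_fin p3.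
have k0 : (0 < l ^- 2)%R by rewrite invr_gt0 exprn_gt0.
have nN F : (forall x, 0 <= F x)%R -> (l ^- 2)%:E * al F != -oo.
  move=> F0; rewrite gt_eqF//; apply: (@lt_le_trans _ _ 0); first exact: ltNy0.
  by apply: mule_ge0; [rewrite lee_fin ltW|exact: al0].
(* An infinite right-hand side is trivial; otherwise the three integrals are finite and can be
   replaced by reals. *)
have [|hR] := eqVneq ((l ^- 2)%:E * al A + (l ^- 2)%:E * al B + (l ^- 2)%:E * al C) +oo.
  by move=> ->; exact: leey.
have [x ex] : exists x, al A = x%:E.
  move: hR; case e : (al A) => [x| |]; [by exists x| |by have := al0 _ A0; rewrite e].
  by rewrite gt0_muley ?lte_fin// addye ?nN// addye ?nN// eqxx.
have [y ey] : exists y, al B = y%:E.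
  move: hR; case e : (al B) => [y| |]; [by exists y| |by have := al0 _ B0; rewrite e].
  by rewrite gt0_muley ?lte_fin// addey ?nN// addye ?nN// eqxx.
have [z ez] : exists z, al C = z%:E.
  move: hR; case e : (al C) => [z| |]; [by exists z| |by have := al0 _ C0; rewrite e].
  rewrite gt0_muley ?lte_fin// addey ?eqxx//.
  by rewrite ex ey -!EFinM -EFinD.
have x0 : (0 <= x)%R by rewrite -lee_fin -ex al0.
have y0 : (0 <= y)%R by rewrite -lee_fin -ey al0.
have z0 : (0 <= z)%R by rewrite -lee_fin -ez al0.
rewrite ex ey ez -!EFinM -!EFinD; apply/lee_addgt0Pr => e e0.
set k := (l ^- 2)%R in k0 *.
(* [w] is the target bound, made positive by [e]. With the choice of [s] below, the measure term and
   the cubic term contribute at most w / 2 each. *)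
pose w := (k * x + k * y + k * z + e)%R.
have w0 : (0 < w)%R by rewrite ltr_wpDl// !addr_ge0// mulr_ge0// ltW.
pose s := (w / k ^+ 2)%R.
have s0 : (0 < s)%R by rewrite divr_gt0// exprn_gt0.
have mla := @mlo _ _ _ l ma. have mlb := @mlo _ _ _ l mb. have mlc := @mlo _ _ _ l mc.
have mi : measurable_fun setT (fun t => if (l < V t)%R then 1%R else 0%R : R) by mfun.
pose G t := (lo l (a t) ^+ 3 * lo l (b t) ^+ 3 + lo l (a t) ^+ 3 * lo l (c t) ^+ 3
  + lo l (b t) ^+ 3 * lo l (c t) ^+ 3)%R.
have mG1 : measurable_fun setT (fun t => lo l (a t) ^+ 3 * lo l (b t) ^+ 3)%R by mfun.
have mG2 : measurable_fun setT (fun t => lo l (a t) ^+ 3 * lo l (c t) ^+ 3)%R by mfun.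
have mG3 : measurable_fun setT (fun t => lo l (b t) ^+ 3 * lo l (c t) ^+ 3)%R by mfun.
have mG : measurable_fun setT G by rewrite /G; mfun.
have G0 t : (0 <= G t)%R by rewrite /G !addr_ge0// mulr_ge0// exprn_ge0// lo0.
apply: (@le_trans _ _ (\int[mu]_t ((s / 2) * (if (l < V t)%R then 1 else 0) + (2 * s)^-1 * G t)%:E)).
  apply: ge0_le_integral_EFin; [by mfun|by mfun|] => t.
  case: ifP => _; last first.
    by rewrite lexx/= mulr0 add0r mulr_ge0 ?G0// invr_ge0 mulr_ge0 ?ltW.
  by rewrite !mulr_ge0 ?lo0//= mulr1 /G ptwise_low ?lo0.
rewrite ge0_integralD_EFin; [|by mfun|by mfun| |]; last 2 first.
- by move=> t; apply: mulr_ge0; [rewrite divr_ge0// ltW|case: ifP].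
- by move=> t; apply: mulr_ge0; [rewrite invr_ge0 mulr_ge0// ltW|exact: G0].
rewrite !ge0_integralZl_real//; last 3 first.
- by rewrite invr_ge0 mulr_ge0// ltW.
- by move=> t; case: ifP.
- by rewrite divr_ge0// ltW.
have EG : \int[mu]_t (G t)%:E = (x * y + x * z + y * z)%:E.
  rewrite /G ge0_integralD_EFin//; last 3 first.
  - by mfun.
  - by move=> t; rewrite addr_ge0// mulr_ge0// exprn_ge0// lo0.
  - by move=> t; rewrite mulr_ge0// exprn_ge0// lo0.
  rewrite ge0_integralD_EFin//; last 2 first.
  - by move=> t; rewrite mulr_ge0// exprn_ge0// lo0.
  - by move=> t; rewrite mulr_ge0// exprn_ge0// lo0.
  rewrite (t12 (m3 _ mA) (m3 _ mB) (p3 _ A0) (p3 _ B0)).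
  rewrite (t13 (m3 _ mA) (m3 _ mC) (p3 _ A0) (p3 _ C0)).
  rewrite (t23 (m3 _ mB) (m3 _ mC) (p3 _ B0) (p3 _ C0)).
  by rewrite -!/(al _) ex ey ez -!EFinM -!EFinD.
rewrite EG.
have mE : measurable [set t | (l < V t)%R].
  rewrite -[X in measurable X]setTI; exact: (measurable_fun_ltr (measurable_cst l) mV measurableT (I : measurable [set true])).
have -> : \int[mu]_t (if (l < V t)%R then 1%R else 0%R)%:E = mu [set t | (l < V t)%R].
  rewrite -[X in _ = mu X]setIT -integral_indic//; apply: eq_integral => t _.
  rewrite indicE; case: ifPn => h; first by rewrite mem_set.
  by rewrite memNset//= => h'; rewrite h' in h.
have hE : (s / 2)%:E * mu [set t | (l < V t)%R] <= (s / 2 * k ^+ 2)%:E.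
  have l4 : (k ^+ 2 * l ^+ 4 = 1)%R by rewrite /k -exprVn; field; rewrite gt_eqF.
  rewrite [leRHS]EFinM; apply: lee_wpmul2l; first by rewrite lee_fin divr_ge0// ltW.
  have := @lee_wpmul2l _ (k ^+ 2)%:E _ _ _ (hV l0).
  by rewrite muleA -EFinM l4 mul1e mule1; apply; rewrite lee_fin exprn_ge0// ltW.
apply: (le_trans (leeD hE (lexx _))).
rewrite -EFinM -!EFinD lee_fin.
have -> : (s / 2 * k ^+ 2 = w / 2)%R by rewrite /s; field; rewrite gt_eqF.
have -> : (k * x + k * y + k * z + e = w)%R by [].
suff : ((2 * s)^-1 * (x * y + x * z + y * z) <= w / 2)%R by lra.
have s20 : (0 < 2 * s)%R by exact: mulr_gt0.
rewrite ler_pdivrMl//.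
have -> : (2 * s * (w / 2) = (w / k) ^+ 2)%R by rewrite /s; field; rewrite gt_eqF.
have hw : (x + y + z <= w / k)%R by rewrite ler_pdivlMr// /w; lra.
have : ((x + y + z) ^+ 2 <= (w / k) ^+ 2)%R by rewrite ler_sqr ?nnegrE ?addr_ge0// (le_trans _ hw)// !addr_ge0.
apply: le_trans; rewrite -subr_ge0.
have -> : ((x + y + z) ^+ 2 - (x * y + x * z + y * z) = x ^+ 2 + y ^+ 2 + z ^+ 2 + (x * y + x * z + y * z))%R by ring.
by rewrite !addr_ge0// ?sqr_ge0// mulr_ge0.
Qed.

Let level l : (0 < l)%R ->
  \int[mu]_t (if (l < V t)%R then a t * b t * c t else 0)%:E
  <= DD A l + DD B l + DD C l.
Proof.
move=> l0.
have mla := @mlo _ _ _ l ma. have mlb := @mlo _ _ _ l mb. have mlc := @mlo _ _ _ l mc.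
have mha := @mhi _ _ _ l ma. have mhb := @mhi _ _ _ l mb. have mhc := @mhi _ _ _ l mc.
pose H1 t := (hi l (a t) * (b t ^+ 2) + hi l (a t) * (c t ^+ 2))%R.
pose H2 t := ((b t ^+ 2) * hi l (c t) + hi l (b t) * (c t ^+ 2))%R.
pose H3 t := ((a t ^+ 2) * hi l (b t) + (a t ^+ 2) * hi l (c t))%R.
pose L t := (if (l < V t)%R then lo l (a t) * lo l (b t) * lo l (c t) else 0)%R.
have hh (F : X -> R) u t : (forall x, 0 <= F x)%R -> (0 <= hi l (F (u t)))%R by move=> ?; exact: hi0.
have H10 t : (0 <= H1 t)%R by rewrite addr_ge0// mulr_ge0 ?hi0 ?sqr_ge0.
have H20 t : (0 <= H2 t)%R by rewrite addr_ge0// mulr_ge0 ?hi0 ?sqr_ge0.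
have H30 t : (0 <= H3 t)%R by rewrite addr_ge0// mulr_ge0 ?hi0 ?sqr_ge0.
have L0 t : (0 <= L t)%R by rewrite /L; case: ifP => // _; rewrite !mulr_ge0 ?lo0.
have mH1 : measurable_fun setT H1 by rewrite /H1; mfun.
have mH2 : measurable_fun setT H2 by rewrite /H2; mfun.
have mH3 : measurable_fun setT H3 by rewrite /H3; mfun.
have mL : measurable_fun setT L by rewrite /L; mfun.
have H120 t : (0 <= H1 t + H2 t)%R := addr_ge0 (H10 t) (H20 t).
have H1230 t : (0 <= H1 t + H2 t + H3 t)%R := addr_ge0 (H120 t) (H30 t).
apply: (@le_trans _ _ (\int[mu]_t (H1 t + H2 t + H3 t + L t)%:E)).
  apply: ge0_le_integral_EFin; [by mfun|by mfun|] => t.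
  case: ifP => h; last by rewrite lexx /= (addr_ge0 (H1230 t) (L0 t)).
  rewrite !mulr_ge0//= (le_trans (pointwise t l0))// /L h.
  by rewrite /H1 /H2 /H3.
have mH12 : measurable_fun setT (fun t => H1 t + H2 t)%R by apply: measurable_funD.
have mH123 : measurable_fun setT (fun t => H1 t + H2 t + H3 t)%R by apply: measurable_funD.
rewrite (@ge0_integralD_EFin _ _ _ _ _ _ mH123 mL H1230 L0).
rewrite (@ge0_integralD_EFin _ _ _ _ _ _ mH12 mH3 H120 H30).
rewrite (@ge0_integralD_EFin _ _ _ _ _ _ mH1 mH2 H10 H20).
have s2 (F : X -> R) : measurable_fun setT F -> measurable_fun setT (fun x => F x ^+ 2)%R.
  by move=> mF; mfun.
have s20 (F : X -> R) x : (0 <= F x ^+ 2)%R by exact: sqr_ge0.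
have hh0 (F : X -> R) : (forall x, 0 <= F x)%R -> forall x, (0 <= hi l (F x))%R.
  by move=> F0 x; exact: hi0.
have i1 : \int[mu]_t (H1 t)%:E <= P A l + P A l.
  rewrite /H1 ge0_integralD_EFin; try by [mfun | move=> t; rewrite mulr_ge0 ?hi0 ?sqr_ge0].
  rewrite (t12 (mhi _ mA) (s2 _ mB) (hh0 _ A0) (s20 _)) (t13 (mhi _ mA) (s2 _ mC) (hh0 _ A0) (s20 _)).
  by rewrite PE// leeD//; rewrite -[leRHS]mule1 lee_wpmul2l//; apply: integral_ge0 => x _; rewrite lee_fin hi0.
have i2 : \int[mu]_t (H2 t)%:E <= P C l + P B l.
  rewrite /H2 ge0_integralD_EFin; try by [mfun | move=> t; rewrite mulr_ge0 ?hi0 ?sqr_ge0].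
  rewrite (t23 (s2 _ mB) (mhi _ mC) (s20 _) (hh0 _ C0)) (t23 (mhi _ mB) (s2 _ mC) (hh0 _ B0) (s20 _)).
  rewrite !PE// leeD//.
    by rewrite -[leRHS]mul1e lee_wpmul2r//; apply: integral_ge0 => x _; rewrite lee_fin hi0.
  by rewrite -[leRHS]mule1 lee_wpmul2l//; apply: integral_ge0 => x _; rewrite lee_fin hi0.
have i3 : \int[mu]_t (H3 t)%:E <= P B l + P C l.
  rewrite /H3 ge0_integralD_EFin; try by [mfun | move=> t; rewrite mulr_ge0 ?hi0 ?sqr_ge0].
  rewrite (t12 (s2 _ mA) (mhi _ mB) (s20 _) (hh0 _ B0)) (t13 (s2 _ mA) (mhi _ mC) (s20 _) (hh0 _ C0)).
  by rewrite !PE// leeD//; rewrite -[leRHS]mul1e lee_wpmul2r//; apply: integral_ge0 => x _; rewrite lee_fin hi0.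
apply: (le_trans (leeD (leeD (leeD i1 i2) i3) (low_level l0))).
suff gen (p q r p' q' r' : \bar R) : p + p + (r + q) + (q + r) + (p' + q' + r') =
    p + p + p' + (q + q + q') + (r + r + r') by rewrite gen.
by rewrite !addeA (ACl (1*2*7*4*5*8*3*6*9))%AC.
Qed.

(** Nine is three functions times the bound 3 of [integral_DD]. *)
Lemma trilinear_le9 :
  \int[mu]_t (V t * (A (u1 t) * B (u2 t) * C (u3 t)))%:E <= 9%:E.
Proof.
have mJ : measurable_fun setT (fun z : T * R =>
    (if (0 < z.2)%R && (z.2 < V z.1)%R then a z.1 * b z.1 * c z.1 else 0)%R%:E).
  by mfun.
have J0 z : 0 <= (fun z : T * R =>
    (if (0 < z.2)%R && (z.2 < V z.1)%R then a z.1 * b z.1 * c z.1 else 0)%R%:E) z.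
  by rewrite lee_fin; case: ifP => // _; rewrite !mulr_ge0.
have e9 : 9%:E = 3%:E + 3%:E + 3%:E :> \bar R by rewrite -!EFinD; congr EFin; lra.
have -> : \int[mu]_t (V t * (A (u1 t) * B (u2 t) * C (u3 t)))%:E =
    \int[mu]_t \int[leb]_l (if (0 < l)%R && (l < V t)%R then a t * b t * c t else 0)%R%:E.
  by apply: eq_integral => t _; rewrite integral_layer_lt// !mulr_ge0.
rewrite (@fubini_tonelli _ _ _ _ _ mu leb _ mJ J0).
apply: (@le_trans _ _ (\int[leb]_l (DD A l + DD B l + DD C l))).
  apply: ge0_le_integral => //.
  - by move=> l _; apply: integral_ge0 => t _; exact: (J0 (t, l)).
  - exact: (@measurable_fun_fubini_tonelli_G _ _ _ _ _ mu _ mJ J0).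
  - by apply: emeasurable_funD; [apply: emeasurable_funD|]; exact: measurable_DD.
  - move=> l _; have [l0|l0] := ltP 0%R l; first exact: level.
    rewrite integral0_eq//; apply: adde_ge0; last exact: DD_ge0.
    by apply: adde_ge0; exact: DD_ge0.
rewrite ge0_integralD//=; last 4 first.
- by move=> l _; rewrite adde_ge0 ?DD_ge0.
- by apply: emeasurable_funD; exact: measurable_DD.
- by move=> l _; rewrite DD_ge0.
- exact: measurable_DD.
rewrite ge0_integralD//=; [|by move=> l _; rewrite DD_ge0|exact: measurable_DD|by move=> l _; rewrite DD_ge0|exact: measurable_DD].
by rewrite e9 !leeD// integral_DD.
Qed.

End trilinear.

(** * The trilinear form on pairs of frequencies *)

Section trilinear_rV.
Context {R : realType} (n : nat).
Local Open Scope ereal_scope.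
Local Notation lam := (@lebesgue_rV R).

Lemma measurable_lsubmx : measurable_fun setT (fun p : 'rV[R]_(n + n) => lsubmx p).
Proof.
apply: measurable_fun_rV => i; under eq_fun do rewrite mxE.
exact: measurable_coord_rV.
Qed.

Lemma measurable_rsubmx : measurable_fun setT (fun p : 'rV[R]_(n + n) => rsubmx p).
Proof.
apply: measurable_fun_rV => i; under eq_fun do rewrite mxE.
exact: measurable_coord_rV.
Qed.

Lemma measurable_addmx d (T : measurableType d) m (f g : T -> 'rV[R]_m) :
  measurable_fun setT f -> measurable_fun setT g ->
  measurable_fun setT (fun p => f p + g p)%R.
Proof.
move=> mf mg; apply: measurable_fun_rV => i; under eq_fun do rewrite mxE.
by apply: measurable_funD; apply: (measurableT_comp (measurable_coord_rV i)).
Qed.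

Let tensor_lr (G H : 'rV[R]_n -> R) :
  measurable_fun setT G -> measurable_fun setT H ->
  (forall x, 0 <= G x)%R -> (forall x, 0 <= H x)%R ->
  \int[lam (n + n)]_t (G (lsubmx t) * H (rsubmx t))%:E =
  \int[lam n]_x (G x)%:E * \int[lam n]_x (H x)%:E.
Proof.
move=> mG mH G0 H0; rewrite ge0_integral_row_mx; last 2 first.
- apply/measurable_EFinP; apply: measurable_funM; apply: measurableT_comp => //.
    exact: measurable_lsubmx.
  exact: measurable_rsubmx.
- by move=> x; rewrite lee_fin mulr_ge0.
transitivity (\int[lam n]_x ((G x)%:E * \int[lam n]_y (H y)%:E)).
  apply: eq_integral => x _; rewrite -ge0_integralZl_real//.
  by apply: eq_integral => y _; rewrite row_mxKl row_mxKr.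
rewrite ge0_integralZr//; first exact/measurable_EFinP.
- by move=> x _; rewrite lee_fin.
- by apply: integral_ge0 => x _; rewrite lee_fin.
Qed.

(** For fixed xi, passing from eta to xi + eta is a translation, which reduces this to
    [tensor_lr]. *)
Let tensor_sl (G H : 'rV[R]_n -> R) :
  measurable_fun setT G -> measurable_fun setT H ->
  (forall x, 0 <= G x)%R -> (forall x, 0 <= H x)%R ->
  \int[lam (n + n)]_t (G (lsubmx t + rsubmx t)%R * H (lsubmx t))%:E =
  \int[lam n]_x (G x)%:E * \int[lam n]_x (H x)%:E.
Proof.
move=> mG mH G0 H0; rewrite muleC -tensor_lr// !ge0_integral_row_mx; try by
  [move=> x; rewrite lee_fin mulr_ge0|
  apply/measurable_EFinP; apply: measurable_funM; apply: measurableT_comp => //;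
  try apply: measurable_addmx; first [exact: measurable_lsubmx|exact: measurable_rsubmx]].
apply: eq_integral => x _.
rewrite -[RHS](@integral_shift_rV _ _ x); last first.
  apply/measurable_EFinP; under eq_fun do rewrite row_mxKl row_mxKr.
  exact: measurable_funM.
by apply: eq_integral => y _; rewrite !row_mxKl !row_mxKr mulrC.
Qed.

(** Now the translation acts on xi for fixed eta, so the two integrals are exchanged first. *)
Let tensor_sr (G H : 'rV[R]_n -> R) :
  measurable_fun setT G -> measurable_fun setT H ->
  (forall x, 0 <= G x)%R -> (forall x, 0 <= H x)%R ->
  \int[lam (n + n)]_t (G (lsubmx t + rsubmx t)%R * H (rsubmx t))%:E =
  \int[lam n]_x (G x)%:E * \int[lam n]_x (H x)%:E.
Proof.
move=> mG mH G0 H0.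
rewrite ge0_integral_row_mx; try by
  [move=> x; rewrite lee_fin mulr_ge0|
  apply/measurable_EFinP; apply: measurable_funM; apply: measurableT_comp => //;
  try apply: measurable_addmx; first [exact: measurable_lsubmx|exact: measurable_rsubmx]].
have mF : measurable_fun setT (fun z : 'rV[R]_n * 'rV[R]_n => (G (z.1 + z.2)%R * H z.2)%:E).
  apply/measurable_EFinP; apply: measurable_funM; apply: measurableT_comp => //.
  exact: measurable_addmx.
transitivity (\int[lam n]_x \int[lam n]_y (G (x + y)%R * H y)%:E).
  by apply: eq_integral => x _; apply: eq_integral => y _; rewrite row_mxKl row_mxKr.
rewrite (@fubini_tonelli _ _ _ _ _ (lam n) (lam n) _ mF); last first.
  by move=> z; rewrite lee_fin mulr_ge0.
transitivity (\int[lam n]_y (\int[lam n]_x (G x)%:E * (H y)%:E)).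
  apply: eq_integral => y _.
  have <- : \int[lam n]_x (G (y + x)%R)%:E = \int[lam n]_x (G x)%:E.
    by apply: (@integral_shift_rV R n y (fun x => (G x)%:E)); exact/measurable_EFinP.
  rewrite muleC -ge0_integralZl_real//; last first.
    by apply: measurableT_comp => //; apply: measurable_addmx.
  by apply: eq_integral => x _; rewrite mulrC addrC.
rewrite ge0_integralZl//; first exact/measurable_EFinP.
- by move=> x _; rewrite lee_fin.
- by apply: integral_ge0 => x _; rewrite lee_fin.
Qed.

(** Homogeneity reduces the claim to the normalised estimate; the bounds are strictly positive
    because the functions are divided by them. *)
Lemma lorentz_trilinear (V : 'rV[R]_(n + n) -> R) (A B C : 'rV[R]_n -> R)
    (k a b c : R) :
  (0 < k)%R -> (0 < a)%R -> (0 < b)%R -> (0 < c)%R ->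
  measurable_fun setT V -> measurable_fun setT A -> measurable_fun setT B ->
  measurable_fun setT C ->
  (forall t, 0 <= V t)%R -> (forall x, 0 <= A x)%R -> (forall x, 0 <= B x)%R ->
  (forall x, 0 <= C x)%R ->
  (forall l : R, (0 < l)%R ->
    (l ^+ 4)%:E * lam (n + n) [set t | (l < V t)%R] <= (k ^+ 4)%:E) ->
  \int[lam n]_x (A x ^+ 2)%:E <= (a ^+ 2)%:E ->
  \int[lam n]_x (B x ^+ 2)%:E <= (b ^+ 2)%:E ->
  \int[lam n]_x (C x ^+ 2)%:E <= (c ^+ 2)%:E ->
  \int[lam (n + n)]_p
     (V p * (A (lsubmx p + rsubmx p)%R * B (lsubmx p) * C (rsubmx p)))%:E
  <= (9 * (k * (a * b * c)))%:E.
Proof.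
move=> k0 a0 b0 c0 mV mA mB mC V0 A0 B0 C0 hV hA hB hC.
have sc (F : 'rV[R]_n -> R) (r : R) : measurable_fun setT F -> (0 < r)%R ->
    \int[lam n]_x (F x ^+ 2)%:E <= (r ^+ 2)%:E ->
    \int[lam n]_x ((r^-1 * F x) ^+ 2)%:E <= 1.
  move=> mF r0 h; under eq_integral do rewrite exprMn.
  rewrite ge0_integralZl_real//; last 3 first.
  - exact: measurable_funX.
  - by move=> x; exact: sqr_ge0.
  - exact: sqr_ge0.
  apply: le_trans (lee_wpmul2l _ h) _; first by rewrite lee_fin sqr_ge0.
  by rewrite -EFinM lee_fin -exprMn mulVf ?expr1n// gt_eqF.
have ms (F : 'rV[R]_n -> R) (r : R) : measurable_fun setT F ->
  measurable_fun setT (fun x => r^-1 * F x)%R by move=> mF; mfun.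
have ps (F : 'rV[R]_n -> R) (r : R) : (forall x, 0 <= F x)%R -> (0 < r)%R ->
  forall x, (0 <= r^-1 * F x)%R.
  by move=> F0 r0 x; apply: mulr_ge0 => //; rewrite invr_ge0 ltW.
have mu1 : measurable_fun setT (fun p : 'rV[R]_(n + n) => lsubmx p + rsubmx p)%R.
  by apply: measurable_addmx; [exact: measurable_lsubmx|exact: measurable_rsubmx].
have mVk : measurable_fun setT (fun t => k^-1 * V t)%R by mfun.
have hVk : forall l : R, (0 < l)%R ->
    (l ^+ 4)%:E * lam (n + n) [set t | (l < k^-1 * V t)%R] <= 1.
  move=> l l0; have := hV (k * l)%R (mulr_gt0 k0 l0).
  have -> : [set t | (l < k^-1 * V t)%R] = [set t | (k * l < V t)%R].
    by apply/seteqP; split => t /=; rewrite ltr_pdivlMl.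
  have k4 : 0 <= (k ^- 4)%:E by rewrite lee_fin invr_ge0 exprn_ge0// ltW.
  move=> /(lee_wpmul2l k4).
  rewrite muleA -!EFinM exprMn mulrA mulVf ?mul1r// ?expf_eq0 ?gt_eqF//.
have := @trilinear_le9 _ _ _ _ _ (lam (n + n)) (lam n) _ _ _
  mu1 measurable_lsubmx measurable_rsubmx tensor_sl tensor_sr tensor_lr
  _ _ _ _ mVk (ms _ a mA) (ms _ b mB) (ms _ c mC) _ (ps _ _ A0 a0) (ps _ _ B0 b0) (ps _ _ C0 c0)
  hVk (sc _ _ mA a0 hA) (sc _ _ mB b0 hB) (sc _ _ mC c0 hC).
have kp := ltW k0; have ap := ltW a0; have bp := ltW b0; have cp := ltW c0.
move=> /(_ (fun t => mulr_ge0 (eqbRL (invr_ge0 k) kp) (V0 t))).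
have r0 : (0 < k * (a * b * c))%R by rewrite !mulr_gt0.
move=> /(@lee_wpmul2l _ (k * (a * b * c))%:E); rewrite lee_fin => /(_ (ltW r0)).
rewrite -EFinM (mulrC _ 9%R); apply: le_trans; rewrite -ge0_integralZl_real.
- rewrite le_eqVlt; apply/orP; left; apply/eqP.
  apply: eq_integral => t _; congr EFin; field.
  by rewrite !gt_eqF.
- apply: measurable_funM => //; apply: measurable_funM; first apply: measurable_funM.
  + by apply: (measurableT_comp (ms _ a mA)).
  + by apply: (measurableT_comp (ms _ b mB)); exact: measurable_lsubmx.
  + by apply: (measurableT_comp (ms _ c mC)); exact: measurable_rsubmx.
- by move=> t; rewrite !mulr_ge0// invr_ge0.
- exact: ltW.
Qed.

(** Taking fourth powers replaces the real exponent of the norm by polynomial arithmetic; a finite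
    norm excludes level sets of infinite measure. *)
Lemma lorentz4_norm_level d (h : 'rV[R]_d -> R[i]) (k : R) :
  (0 <= k)%R -> lorentz4_norm h <= k%:E -> forall l : R, (0 < l)%R ->
  (l ^+ 4)%:E * lam d [set t | (l < normc (h t))%R] <= (k ^+ 4)%:E.
Proof.
move=> k0 hk l l0.
have : l%:E * (lam d [set x | (l < normc (h x))%R]) `^ 4^-1 <= k%:E.
  by apply: le_trans hk; apply: ereal_sup_ubound; exists l.
have : 0 <= lam d [set x | (l < normc (h x))%R] by exact: measure_ge0.
case: (lam d _) => [r r0|_|/(lt_le_trans ltNy0)]//; last first.
  by rewrite poweRyr// gt0_muley ?lte_fin.
rewrite lee_fin in r0; rewrite poweR_EFin -!EFinM !lee_fin => h1.
have -> : (l ^+ 4 * r = (l * r `^ 4^-1) ^+ 4)%R.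
  by rewrite exprMn -(@powR_mulrn _ (r `^ _)) ?powR_ge0// -powRrM mulVf ?powRr1.
by rewrite ler_pXn2r ?nnegrE// mulr_ge0 ?powR_ge0// ltW.
Qed.

End trilinear_rV.

(** * Smooth functions, Schwartz bounds and cutoffs *)

Notation "''e_' i" := (delta_mx ord0 i) (at level 8, i at level 2, format "''e_' i").

Section continuity.
Context {R : realType} {T : topologicalType}.
Implicit Types f g : T -> R.

Lemma continuous_add f g : continuous f -> continuous g ->
  continuous (fun x => f x + g x).
Proof. by move=> cf cg x; exact: (@cvgD _ _ _ _ _ f g _ _ (cf x) (cg x)). Qed.

Lemma continuous_mul f g : continuous f -> continuous g ->
  continuous (fun x => f x * g x).
Proof. by move=> cf cg x; exact: (@cvgM _ _ _ _ f g _ _ (cf x) (cg x)). Qed.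

Lemma continuous_opp f : continuous f -> continuous (fun x => - f x).
Proof. by move=> cf x; exact: (@cvgN _ _ _ _ _ f _ (cf x)). Qed.

Lemma continuous_bigsum (I : Type) (l : seq I) (f : I -> T -> R) :
  (forall i, continuous (f i)) -> continuous (fun x => \sum_(i <- l) f i x).
Proof.
move=> cf; elim: l => [|i l IH].
  by under eq_fun do rewrite big_nil; exact: cst_continuous.
by under eq_fun do rewrite big_cons; exact: continuous_add.
Qed.

Lemma continuous_circ (U : topologicalType) (L : U -> T) f :
  continuous L -> continuous f -> continuous (fun x => f (L x)).
Proof. by move=> cL cf x; apply: (@continuous_comp _ _ _ L f); [exact: cL|exact: cf]. Qed.

End continuity.

Lemma continuous_rV {R : realType} {T : topologicalType} d (f : T -> 'rV[R]_d) :
  (forall i, continuous (fun t => f t ord0 i)) -> continuous f.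
Proof.
move=> cf t; apply/cvg_ballP => e e0.
have : \forall y \near t, forall i, ball (f t ord0 i) e (f y ord0 i).
  by apply: filter_forall => i; move/cvg_ballP: (cf i t) => h; exact: h.
by apply: filterS => y h; split=> // i j; rewrite (ord1 i).
Qed.

Section directional.
Context {R : realType}.

Lemma is_derive_lineP (V : normedModType R) (f : V -> R) (x v : V) (df : R) :
  is_derive x v f df <-> is_derive (0 : R) 1 (fun h : R => f (h *: v + x)) df.
Proof.
have E : (fun h => h^-1 *: ((f \o shift x) (h *: v) - f x)) =
    (fun h => h^-1 *: (((fun h : R => f (h *: v + x)) \o shift 0) (h *: 1) -
       (fun h : R => f (h *: v + x)) 0)).
  apply/funext => h /=; rewrite /shift/= scale0r add0r addr0.
  by rewrite (_ : h%:A = h :> R)//; exact: mulr1.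
split=> -[d1 d2]; split.
- by move: d1; rewrite /derivable E.
- by rewrite -d2 /derive E.
- by move: d1; rewrite /derivable E.
- by rewrite -d2 /derive E.
Qed.

Lemma is_derive_shift_line (V : normedModType R) (f : V -> R) (x v : V) (t df : R) :
  is_derive (t *: v + x) v f df <-> is_derive t 1 (fun h : R => f (h *: v + x)) df.
Proof.
rewrite is_derive_lineP; rewrite [X in _ <-> X](is_derive_lineP _ t).
rewrite (_ : (fun h : R => f (h *: v + (t *: v + x))) =
  (fun h : R => f ((h *: 1 + t) *: v + x)))//.
by apply/funext => h; rewrite addrA -scalerDl (_ : h%:A = h :> R)//; exact: mulr1.
Qed.

End directional.

(** * Calculus of iterated partial derivatives *)

Section smooth_calculus.
Context {R : realType}.
Variable d : nat.
Implicit Types (u v w : 'rV[R]_d -> R) (s : seq 'I_d) (x : 'rV[R]_d).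

Lemma partial_cat s1 s2 u : partial (s1 ++ s2) u = partial s1 (partial s2 u).
Proof. by elim: s1 => //= i s1 ->. Qed.

Lemma smooth_partial s u : smooth_real u -> smooth_real (partial s u).
Proof. by move=> su s'; rewrite -partial_cat; exact: su. Qed.

Lemma smooth_continuous u : smooth_real u -> continuous u.
Proof. by move=> su; exact: (su [::]).1. Qed.

Lemma smooth_is_derive u s i x : smooth_real u ->
  is_derive x ('e_i) (partial s u) (partial (i :: s) u x).
Proof. by move=> su; split=> //; exact: (su s).2. Qed.

(** Smoothness and the formula for all iterated derivatives are certified together: a family [P] is
    guessed, and only single derivatives of its members are checked. *)
Lemma smooth_realP u (P : seq 'I_d -> 'rV[R]_d -> R) :
  P [::] = u -> (forall s, continuous (P s)) ->
  (forall s i x, is_derive x ('e_i) (P s) (P (i :: s) x)) ->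
  smooth_real u /\ forall s, partial s u = P s.
Proof.
move=> P0 cP dP.
have E s : partial s u = P s.
  elim: s => [|i s IH] //=; rewrite IH; apply/funext => x.
  by have [_] := dP s i x.
by split=> // s; rewrite E; split=> // i x; have [] := dP s i x.
Qed.

Lemma smooth_cst (c : R) : smooth_real (fun _ : 'rV[R]_d => c) /\
  forall s, partial s (fun _ => c) = fun _ => if s is [::] then c else 0.
Proof.
pose P (s : seq 'I_d) (_ : 'rV[R]_d) := if s is [::] then c else 0.
by apply: (@smooth_realP (fun=> c) P erefl) => s; exact: cst_continuous.
Qed.

Lemma smoothD u v : smooth_real u -> smooth_real v ->
  smooth_real (fun x => u x + v x) /\
  forall s, partial s (fun x => u x + v x) = fun x => partial s u x + partial s v x.
Proof.
move=> su sv; apply: smooth_realP => // [s|s i x].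
  by apply: continuous_add; [exact: (su s).1|exact: (sv s).1].
by apply: is_deriveD; exact: smooth_is_derive.
Qed.

Lemma smoothZ (c : R) u : smooth_real u ->
  smooth_real (fun x => c * u x) /\
  forall s, partial s (fun x => c * u x) = fun x => c * partial s u x.
Proof.
move=> su; apply: smooth_realP => // [s|s i x].
  by apply: continuous_mul; [exact: cst_continuous|exact: (su s).1].
by apply: (@is_deriveZ _ _ _ (partial s u)); exact: smooth_is_derive.
Qed.

Lemma smoothN u : smooth_real u ->
  smooth_real (fun x => - u x) /\
  forall s, partial s (fun x => - u x) = fun x => - partial s u x.
Proof.
move=> su; apply: smooth_realP => // [s|s i x].
  by apply: continuous_opp; exact: (su s).1.
by apply: is_deriveN; exact: smooth_is_derive.
Qed.

(** All distributions of the derivatives in [s] over two factors, listed with multiplicity; the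
    repetitions stand for the binomial coefficients. *)
Fixpoint leibniz s : seq (seq 'I_d * seq 'I_d) :=
  if s is i :: s' then
    [seq (i :: p.1, p.2) | p <- leibniz s'] ++ [seq (p.1, i :: p.2) | p <- leibniz s']
  else [:: ([::], [::])].

Lemma leibniz_cons i s : leibniz (i :: s) =
  [seq (i :: p.1, p.2) | p <- leibniz s] ++ [seq (p.1, i :: p.2) | p <- leibniz s].
Proof. by []. Qed.

Lemma size_leibniz s : size (leibniz s) = (2 ^ size s)%N.
Proof. by elim: s => //= i s IH; rewrite size_cat !size_map IH addnn expnS mul2n. Qed.

Lemma leibniz_size s p : p \in leibniz s -> (size p.1 + size p.2)%N = size s.
Proof.
elim: s p => [|i s IH] p /=; first by rewrite inE => /eqP->.
rewrite mem_cat => /orP[] /mapP[q /IH h ->] /=; rewrite ?addnS ?addSn h //.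
Qed.

Lemma smoothM u v : smooth_real u -> smooth_real v ->
  smooth_real (fun x => u x * v x) /\
  forall s, partial s (fun x => u x * v x) =
    fun x => \sum_(p <- leibniz s) partial p.1 u x * partial p.2 v x.
Proof.
move=> su sv; apply: smooth_realP => [|s|s i x].
- by apply/funext => x; rewrite big_seq1.
- apply: (@continuous_bigsum _ _ _ _ (fun p x => partial p.1 u x * partial p.2 v x)) => p.
  by apply: continuous_mul; [exact: (su p.1).1|exact: (sv p.2).1].
- rewrite leibniz_cons big_cat/= !big_map.
  elim: (leibniz s) => [|p l IH].
    by under eq_fun do rewrite big_nil; rewrite !big_nil addr0; exact: is_derive_cst.
  under eq_fun do rewrite big_cons.
  apply: is_derive_eq; rewrite ?big_cons.
  apply: is_deriveD; first by apply: is_deriveM; exact: smooth_is_derive.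
  by rewrite /GRing.scale/=; ring.
Qed.

Lemma smooth_coord (i : 'I_d) : smooth_real (fun x => x ord0 i) /\
  forall s, partial s (fun x => x ord0 i) = fun x =>
    if s is [::] then x ord0 i else if s == [:: i] then 1 else 0.
Proof.
apply: smooth_realP => // [[|j s]|[|j s] k x].
- exact: coord_continuous.
- exact: cst_continuous.
- apply/is_derive_lineP; apply: is_derive_eq.
    under eq_fun do rewrite !mxE; apply: is_deriveD.
  by rewrite /GRing.scale/= addr0 mul0r mulr1 add0r eqseq_cons andbT eq_sym; case: eqP.
- have -> : ([:: k, j & s] == [:: i]) = false by rewrite eqseq_cons andbF.
  exact: is_derive_cst.
Qed.

End smooth_calculus.

Section smooth_comp.
Context {R : realType}.
Variables (d D : nat) (L : 'rV[R]_d -> 'rV[R]_D) (c : 'I_d -> R) (sg : 'I_d -> 'I_D).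
Hypothesis hL : forall x h i, L (h *: 'e_i + x) = (h * c i) *: 'e_(sg i) + L x.
Hypothesis cL : continuous L.

(** The hypothesis on [L] covers translations, dilations, coordinate projections (some [c i] vanish)
    and embeddings, so a single chain rule serves them all. *)
Lemma smooth_comp_monomial (u : 'rV[R]_D -> R) : smooth_real u ->
  smooth_real (fun x => u (L x)) /\
  forall s, partial s (fun x => u (L x)) =
    fun x => (\prod_(i <- s) c i) * partial (map sg s) u (L x).
Proof.
move=> su; apply: smooth_realP => [|s|s i x].
- by apply/funext => x /=; rewrite big_nil mul1r.
- apply: continuous_mul; first exact: cst_continuous.
  by apply: continuous_circ; [exact: cL|exact: (su _).1].
- rewrite (_ : _ * _ = (\prod_(i0 <- s) c i0) *
      (partial (map sg (i :: s)) u (L x) * c i)); last by rewrite big_cons; ring.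
  apply: (@is_deriveZ _ _ _ (fun x => partial (map sg s) u (L x))).
  apply/is_derive_lineP.
  under eq_fun do rewrite hL.
  have /is_derive_lineP h1 := @smooth_is_derive _ _ u (map sg s) (sg i) (L x) su.
  rewrite (_ : (fun h : R => _) = (fun k => partial (map sg s) u (k *: 'e_(sg i) + L x)) \o
    (fun h => h * c i)); last by [].
  have h1' : is_derive (0 * c i) 1 (fun k : R => partial (map sg s) u
      (k *: 'e_(sg i) + L x)) (partial (sg i :: map sg s) u (L x)).
    by rewrite mul0r.
  have h2 : is_derive (0 : R) 1 (fun h => h * c i) (c i).
    by apply: is_derive_eq; rewrite /GRing.scale/= mulr0 add0r mulr1.
  exact: (@is_derive1_comp _ _ (fun h => h * c i) _ _ _ h1' h2).
Qed.

End smooth_comp.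

Section local.
Context {R : realType}.
Variable d : nat.
Implicit Types (u v : 'rV[R]_d -> R) (s : seq 'I_d).

Lemma partial_local (U : set 'rV[R]_d) u v : open U ->
  (forall x, U x -> u x = v x) -> forall s x, U x -> partial s u x = partial s v x.
Proof.
move=> oU uv; elim=> [|i s IH] x Ux //=; first exact: uv.
apply: near_eq_derive.
have : nbhs x U by exact: open_nbhs_nbhs.
by apply: filterS => y Uy; exact: IH.
Qed.

(** For functions defined by cases: near each point the candidate family is compared with the
    derivatives of some smooth function that may depend on the point. *)
Lemma smooth_realP_local u (P : seq 'I_d -> 'rV[R]_d -> R) :
  P [::] = u ->
  (forall x : 'rV[R]_d, exists v, smooth_real v /\
     nbhs x [set y | forall s, P s y = partial s v y]) ->
  smooth_real u /\ forall s, partial s u = P s.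
Proof.
move=> P0 h; apply: smooth_realP => // [s x|s i x].
  have [v [sv hv]] := h x.
  have e := nbhs_singleton hv.
  rewrite /continuous_at (e s); apply: cvg_trans ((sv s).1 x).
  have E : \forall y \near x, partial s v y = P s y by apply: filterS hv => y /= ->.
  exact: (near_eq_cvg E).
have [v [sv hv]] := h x.
have e := nbhs_singleton hv.
rewrite (e (i :: s)).
apply: (@near_eq_is_derive _ _ _ (partial s v)).
  by apply: filterS hv => y /= ->.
exact: smooth_is_derive.
Qed.

End local.

Section norm2.
Context {R : realType}.
Variable d : nat.
Implicit Types x y : 'rV[R]_d.

Lemma dot_ge0 x : 0 <= dot_rV x x.
Proof. by apply: sumr_ge0 => i _; rewrite -expr2 sqr_ge0. Qed.

Lemma norm2_ge0 x : 0 <= norm2_rV x.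
Proof. exact: sqrtr_ge0. Qed.

Lemma norm2_coord x i : `|x ord0 i| <= norm2_rV x.
Proof.
rewrite -(@ler_pXn2r _ 2) ?nnegrE ?norm2_ge0// sqr_sqrtr ?dot_ge0//.
rewrite /dot_rV (bigD1 i)//= real_normK ?num_real// expr2 lerDl.
by apply: sumr_ge0 => j _; rewrite -expr2 sqr_ge0.
Qed.

Lemma norm2_le_sum x : norm2_rV x <= \sum_i `|x ord0 i|.
Proof.
have S0 : 0 <= \sum_i `|x ord0 i| by exact: sumr_ge0.
rewrite -(@ler_pXn2r _ 2) ?nnegrE ?norm2_ge0// sqr_sqrtr ?dot_ge0// expr2 mulr_suml.
apply: ler_sum => i _; rewrite -expr2 -real_normK ?num_real// expr2.
by rewrite ler_wpM2l// (bigD1 i)//= lerDl sumr_ge0.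
Qed.

Lemma norm2Z (c : R) x : norm2_rV (c *: x) = `|c| * norm2_rV x.
Proof.
rewrite /norm2_rV (_ : dot_rV _ _ = c ^+ 2 * dot_rV x x).
  by rewrite sqrtrM ?sqr_ge0// sqrtr_sqr.
by rewrite /dot_rV mulr_sumr; apply: eq_bigr => i _; rewrite !mxE; ring.
Qed.

Lemma norm2_le_coord (r : R) x : (forall i, `|x ord0 i| <= r) -> norm2_rV x <= d%:R * r.
Proof.
move=> h; apply: le_trans (norm2_le_sum x) _.
by apply: le_trans (ler_sum _ (fun i _ => h i)) _; rewrite sumr_const card_ord mulr_natl.
Qed.

Lemma continuous_dot : continuous (fun x => dot_rV x x).
Proof.
apply: (@continuous_bigsum _ _ _ _ (fun i x => x ord0 i * x ord0 i)) => i.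
by apply: continuous_mul; exact: coord_continuous.
Qed.

Lemma continuous_norm2 : continuous (@norm2_rV R d).
Proof. exact: (continuous_circ continuous_dot (@sqrt_continuous R)). Qed.

(** A Peetre-type inequality; the factor involving [d] arises because the Euclidean norm is
    estimated through its coordinates. *)
Lemma norm2_shift x y : 1 + norm2_rV x <= (1 + d%:R) * (1 + norm2_rV y) * (1 + norm2_rV (x + y)).
Proof.
have h : norm2_rV x <= d%:R * norm2_rV (x + y) + d%:R * norm2_rV y.
  rewrite -mulrDr; apply: norm2_le_coord => i.
  have -> : x ord0 i = (x + y) ord0 i - y ord0 i by rewrite mxE addrK.
  by apply: le_trans (ler_normB _ _) _; rewrite lerD// norm2_coord.
have := norm2_ge0 (x + y); have := norm2_ge0 y; move: h.
have := ler0n R d; move: (norm2_rV x) (norm2_rV y) (norm2_rV _) d%:R => X Y Z D.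
by move=> D0 h Y0 Z0; have := mulr_ge0 Y0 Z0; have := mulr_ge0 D0 (mulr_ge0 Y0 Z0); nra.
Qed.

Lemma compact_norm2_le (r : R) : compact [set x : 'rV[R]_d | norm2_rV x <= r].
Proof.
apply: bounded_closed_compact.
  exists r; split=> [|t rt x /= xr]; first exact: num_real.
  apply: (le_trans _ (ltW rt)).
  have r0 : 0 <= r by apply: le_trans xr; exact: norm2_ge0.
  rewrite [leLHS]/Num.norm/= mx_normrE; apply/bigmax_leP; split=> // -[i j] _ /=.
  by rewrite (ord1 i); apply: le_trans (norm2_coord x j) xr.
rewrite -[X in closed X]/(@norm2_rV R d @^-1` [set t | t <= r]).
by apply: closed_comp; [move=> y _; exact: continuous_norm2|exact: closed_le].
Qed.

End norm2.

Section norm2_row_mx.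
Context {R : realType}.

Lemma dot_row_mx m p (a c : 'rV[R]_m) (b e : 'rV[R]_p) :
  dot_rV (row_mx a b) (row_mx c e) = dot_rV a c + dot_rV b e.
Proof.
rewrite /dot_rV big_split_ord/=; congr (_ + _); apply: eq_bigr => i _.
  by rewrite !row_mxEl.
by rewrite !row_mxEr.
Qed.

Lemma norm2_row_mx m p (a : 'rV[R]_m) (b : 'rV[R]_p) :
  norm2_rV (row_mx a b) <= norm2_rV a + norm2_rV b.
Proof.
rewrite -(@ler_pXn2r _ 2) ?nnegrE ?addr_ge0 ?norm2_ge0//.
rewrite sqrrD !sqr_sqrtr ?dot_ge0// dot_row_mx.
by rewrite -addrA lerD2l lerDr mulrn_wge0// mulr_ge0 ?norm2_ge0.
Qed.

Lemma norm2_row_mxl m p (a : 'rV[R]_m) (b : 'rV[R]_p) :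
  norm2_rV a <= norm2_rV (row_mx a b).
Proof. by rewrite ler_wsqrtr// dot_row_mx lerDl dot_ge0. Qed.

Lemma norm2_row_mxr m p (a : 'rV[R]_m) (b : 'rV[R]_p) :
  norm2_rV b <= norm2_rV (row_mx a b).
Proof. by rewrite ler_wsqrtr// dot_row_mx lerDr dot_ge0. Qed.

End norm2_row_mx.

(** * Quantitative Schwartz bounds *)

Section schwartz_bounds.
Context {R : realType}.
Variable d : nat.
Implicit Types (u v w : 'rV[R]_d -> R) (s : seq 'I_d) (x : 'rV[R]_d) (M N : nat) (K : R).

(** As in [schwartz_seminorm], one index governs both the number of derivatives and the power of the
    weight, so the loss in each operation is the change of a single number. *)
Definition sbound M K u := forall s x, (size s <= M)%N ->
  (1 + norm2_rV x) ^+ M * `|partial s u x| <= K.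

Definition rschwartz u := smooth_real u /\ forall M, exists K, sbound M K u.

Lemma weight_ge1 x M : 1 <= (1 + norm2_rV x) ^+ M.
Proof. by rewrite exprn_ege1// lerDl norm2_ge0. Qed.

Lemma weight_ge0 x M : 0 <= (1 + norm2_rV x) ^+ M.
Proof. exact: le_trans ler01 (weight_ge1 x M). Qed.

Lemma sbound_ge0 M K u : sbound M K u -> 0 <= K.
Proof. by move=> /(_ [::] 0 (leq0n _)); apply: le_trans; rewrite mulr_ge0// weight_ge0. Qed.

Lemma sbound_le M N K K' u : (N <= M)%N -> K <= K' -> sbound M K u -> sbound N K' u.
Proof.
move=> NM KK' h s x sN; apply: le_trans KK'; apply: le_trans (h s x (leq_trans sN NM)).
by rewrite ler_wpM2r// ler_weXn2l// lerDl norm2_ge0.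
Qed.

Lemma sboundD M K K' u v : smooth_real u -> smooth_real v ->
  sbound M K u -> sbound M K' v -> sbound M (K + K') (fun x => u x + v x).
Proof.
move=> su sv hu hv s x sM; rewrite (smoothD su sv).2.
apply: (@le_trans _ _ ((1 + norm2_rV x) ^+ M * (`|partial s u x| + `|partial s v x|))).
  by rewrite ler_wpM2l ?weight_ge0// ler_normD.
by rewrite mulrDr lerD ?hu ?hv.
Qed.

Lemma sboundZ M K c u : smooth_real u -> sbound M K u ->
  sbound M (`|c| * K) (fun x => c * u x).
Proof.
move=> su hu s x sM; rewrite (smoothZ c su).2 normrM mulrCA.
by rewrite ler_wpM2l// hu.
Qed.

Lemma sboundN M K u : smooth_real u -> sbound M K u -> sbound M K (fun x => - u x).
Proof. by move=> su hu s x sM; rewrite (smoothN su).2 normrN hu. Qed.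

Lemma sbound_partial M K t u : sbound (M + size t) K u -> sbound M K (partial t u).
Proof.
move=> hu s x sM; rewrite -partial_cat.
apply: le_trans (hu (s ++ t) x _); last by rewrite size_cat leq_add2r.
by rewrite ler_wpM2r// ler_weXn2l ?leq_addr// lerDl norm2_ge0.
Qed.

Lemma ler_sum_size (I : eqType) (l : seq I) (F : I -> R) (c : R) :
  (forall i, i \in l -> F i <= c) -> \sum_(i <- l) F i <= (size l)%:R * c.
Proof.
move=> h; apply: (@le_trans _ _ (\sum_(i <- l) c)); first by rewrite !big_seq ler_sum.
by rewrite big_const_seq count_predT iter_addr addr0 mulr_natl.
Qed.

(** A factor of linear growth costs one power of the weight, hence the index [M.+1] for [u]. The
    constant [2 ^+ M] bounds the number of Leibniz terms. *)
Lemma sboundM M K Kw w u : smooth_real w -> smooth_real u ->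
  (forall a x, (size a <= M)%N -> `|partial a w x| <= Kw * (1 + norm2_rV x)) ->
  sbound M.+1 K u -> sbound M (2 ^+ M * (Kw * K)) (fun x => w x * u x).
Proof.
move=> sw su hw hu s x sM; rewrite (smoothM sw su).2.
have K0 := sbound_ge0 hu.
have n1 : 1 <= 1 + norm2_rV x by rewrite lerDl norm2_ge0.
have Kw0 : 0 <= Kw.
  have := hw [::] x (leq0n _); have := normr_ge0 (w x); move=> /le_trans h /h.
  by rewrite pmulr_lge0// (lt_le_trans _ n1).
apply: (@le_trans _ _ ((1 + norm2_rV x) ^+ M *
    (\sum_(p <- leibniz s) `|partial p.1 w x * partial p.2 u x|))).
  by rewrite ler_wpM2l ?weight_ge0// ler_norm_sum.
rewrite mulr_sumr; apply: le_trans (ler_sum_size (c := Kw * K) _) _; last first.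
  rewrite size_leibniz natrX ler_wpM2r ?mulr_ge0// ler_weXn2l//.
  by rewrite ler1n.
move=> p /leibniz_size hp.
have h1 : (size p.1 <= M)%N by apply: leq_trans sM; rewrite -hp leq_addr.
have h2 : (size p.2 <= M.+1)%N by apply: leqW; apply: leq_trans sM; rewrite -hp leq_addl.
rewrite normrM mulrCA; apply: le_trans (ler_wpM2r _ (hw _ x h1)) _.
  by rewrite mulr_ge0// weight_ge0.
by rewrite -mulrA ler_wpM2l// mulrA -exprS hu.
Qed.

(** Linear growth of every derivative accommodates coordinates, cutoffs and oscillating factors
    while the loss stays at one index. *)
Definition tame w := smooth_real w /\ forall M, exists K, forall a x, (size a <= M)%N ->
  `|partial a w x| <= K * (1 + norm2_rV x).

Lemma rschwartzD u v : rschwartz u -> rschwartz v -> rschwartz (fun x => u x + v x).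
Proof.
move=> [su hu] [sv hv]; split; first exact: (smoothD su sv).1.
move=> M; have [K hK] := hu M; have [K' hK'] := hv M.
by exists (K + K'); exact: sboundD.
Qed.

Lemma rschwartzZ c u : rschwartz u -> rschwartz (fun x => c * u x).
Proof.
move=> [su hu]; split; first exact: (smoothZ c su).1.
by move=> M; have [K hK] := hu M; exists (`|c| * K); exact: sboundZ.
Qed.

Lemma rschwartzN u : rschwartz u -> rschwartz (fun x => - u x).
Proof.
move=> [su hu]; split; first exact: (smoothN su).1.
by move=> M; have [K hK] := hu M; exists K; exact: sboundN.
Qed.

Lemma rschwartz_partial t u : rschwartz u -> rschwartz (partial t u).
Proof.
move=> [su hu]; split; first exact: smooth_partial.
by move=> M; have [K hK] := hu (M + size t)%N; exists K; exact: sbound_partial.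
Qed.

Lemma rschwartzM w u : tame w -> rschwartz u -> rschwartz (fun x => w x * u x).
Proof.
move=> [sw hw] [su hu]; split; first exact: (smoothM sw su).1.
move=> M; have [K hK] := hu M.+1; have [Kw hKw] := hw M.
by exists (2 ^+ M * (Kw * K)); exact: sboundM.
Qed.

Lemma bounded_tame w : smooth_real w ->
  (forall M, exists K, forall a x, (size a <= M)%N -> `|partial a w x| <= K) -> tame w.
Proof.
move=> sw hw; split=> // M; have [K hK] := hw M; exists `|K| => a x aM.
apply: le_trans (hK a x aM) _; apply: le_trans (ler_norm K) _.
by rewrite ler_peMr// lerDl norm2_ge0.
Qed.

Lemma rschwartz_tame u : rschwartz u -> tame u.
Proof.
move=> [su hu]; apply: bounded_tame => // M; have [K hK] := hu M; exists K => a x aM.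
by apply: le_trans (hK a x aM); rewrite ler_peMl// weight_ge1.
Qed.

Lemma tame_coord i : tame (fun x => x ord0 i).
Proof.
split; first exact: (smooth_coord i).1.
move=> M; exists 1 => a x _; rewrite (smooth_coord i).2 mul1r.
have n1 : 1 <= 1 + norm2_rV x by rewrite lerDl norm2_ge0.
case: a => [|b a]; first by apply: le_trans (norm2_coord x i) _; rewrite lerDr.
by case: ifP => _; rewrite ?normr1 ?normr0// (le_trans _ n1).
Qed.

Lemma rschwartz_shift (y : 'rV[R]_d) u : rschwartz u -> rschwartz (fun x => u (x + y)).
Proof.
move=> [su hu].
have hL (x : 'rV[R]_d) h i : (h *: 'e_i + x) + y = (h * 1) *: 'e_i + (x + y).
  by rewrite mulr1 addrA.
have cL : continuous (fun x : 'rV[R]_d => x + y).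
  apply: continuous_rV => i; under eq_fun do rewrite mxE.
  by apply: continuous_add; [exact: coord_continuous|exact: cst_continuous].
have [s1 s2] := smooth_comp_monomial (sg := id) hL cL su; split=> // M.
have [K hK] := hu M; exists (((1 + d%:R) * (1 + norm2_rV y)) ^+ M * K) => s x sM.
rewrite s2 big1// mul1r map_id.
pose A := (1 + d%:R) * (1 + norm2_rV y).
have hA : 1 + norm2_rV x <= A * (1 + norm2_rV (x + y)) := norm2_shift x y.
have A0 : 0 <= A by rewrite mulr_ge0// addr_ge0// norm2_ge0.
have w0 z : 0 <= 1 + norm2_rV z :> R by rewrite addr_ge0 ?norm2_ge0.
apply: (@le_trans _ _ ((A * (1 + norm2_rV (x + y))) ^+ M * `|partial s u (x + y)|)).
  by rewrite ler_wpM2r// lerXn2r// nnegrE// mulr_ge0.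
by rewrite exprMn -mulrA ler_wpM2l ?exprn_ge0// hK.
Qed.

End schwartz_bounds.

Section tensor.
Context {R : realType}.
Variable n : nat.
Implicit Types u v : 'rV[R]_n -> R.

Let sg (i : 'I_(n + n)) : 'I_n := match fintype.split i with inl j => j | inr j => j end.
(** The two projections of the product space fit [smooth_comp_monomial], with coefficient 0 on the
    directions that they annihilate. *)
Let cl (i : 'I_(n + n)) : R := if fintype.split i is inl _ then 1 else 0.
Let cr (i : 'I_(n + n)) : R := if fintype.split i is inl _ then 0 else 1.

Let hl (x : 'rV[R]_(n + n)) h i :
  lsubmx (h *: 'e_i + x) = (h * cl i) *: 'e_(sg i) + lsubmx x.
Proof.
apply/rowP => j; rewrite !mxE /= /sg /cl.
case: fintype.splitP => k hk /=; rewrite -!val_eqE/= hk; first by rewrite mulr1.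
by rewrite mulr0 mul0r ltn_eqF ?mulr0// (leq_trans (ltn_ord j))// leq_addr.
Qed.

Let hr (x : 'rV[R]_(n + n)) h i :
  rsubmx (h *: 'e_i + x) = (h * cr i) *: 'e_(sg i) + rsubmx x.
Proof.
apply/rowP => j; rewrite !mxE /= /sg /cr.
case: fintype.splitP => k hk /=; rewrite -!val_eqE/= hk.
  by rewrite mulr0 mul0r gtn_eqF ?mulr0// (leq_trans (ltn_ord k))// leq_addr.
by rewrite eqn_add2l mulr1.
Qed.

Let prod_le1 (c : 'I_(n + n) -> R) s : (forall i, 0 <= c i <= 1) ->
  `|\prod_(i <- s) c i| <= 1.
Proof.
move=> h; elim: s => [|i s IH]; first by rewrite big_nil normr1.
rewrite big_cons normrM mulr_ile1//.
by have /andP[? ?] := h i; rewrite ger0_norm.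
Qed.

Lemma rschwartz_tensor u v : rschwartz u -> rschwartz v ->
  rschwartz (fun x : 'rV[R]_(n + n) => u (lsubmx x) * v (rsubmx x)).
Proof.
move=> [su hu] [sv hv].
have [sul pul] := smooth_comp_monomial hl (@continuous_lsubmx R 1 n n) su.
have [svr pvr] := smooth_comp_monomial hr (@continuous_rsubmx R 1 n n) sv.
have [suv puv] := smoothM sul svr.
split=> // M; have [K hK] := hu M; have [K' hK'] := hv M.
have K0 := sbound_ge0 hK; have K0' := sbound_ge0 hK'.
exists (2 ^+ M * (K * K')) => s x sM; rewrite puv.
set W := (1 + norm2_rV x) ^+ M.
have W0 : 0 <= W by exact: weight_ge0.
have hW : W <= (1 + norm2_rV (lsubmx x)) ^+ M * (1 + norm2_rV (rsubmx x)) ^+ M.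
  rewrite -exprMn lerXn2r// ?nnegrE ?mulr_ge0 ?addr_ge0 ?norm2_ge0//.
  have := @norm2_row_mx R n n (lsubmx x) (rsubmx x); rewrite hsubmxK.
  have := norm2_ge0 (lsubmx x); have := norm2_ge0 (rsubmx x).
  move: (norm2_rV _) (norm2_rV (lsubmx x)) (norm2_rV (rsubmx x)) => X Y Z Z0 Y0 h.
  by have := mulr_ge0 Y0 Z0; nra.
apply: (@le_trans _ _ (W * (\sum_(p <- leibniz s)
    `|partial p.1 (fun x => u (lsubmx x)) x * partial p.2 (fun x => v (rsubmx x)) x|))).
  by rewrite ler_wpM2l// ler_norm_sum.
rewrite mulr_sumr; apply: le_trans (ler_sum_size (c := K * K') _) _; last first.
  by rewrite size_leibniz natrX ler_wpM2r ?mulr_ge0// ler_weXn2l// ler1n.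
move=> p /leibniz_size hp.
have h1 : (size p.1 <= M)%N by apply: leq_trans sM; rewrite -hp leq_addr.
have h2 : (size p.2 <= M)%N by apply: leq_trans sM; rewrite -hp leq_addl.
rewrite pul pvr; apply: le_trans (ler_wpM2r _ hW) _ => //.
rewrite !normrM mulrACA.
have := hK (map sg p.1) (lsubmx x); rewrite size_map => /(_ h1) k1.
have := hK' (map sg p.2) (rsubmx x); rewrite size_map => /(_ h2) k2.
apply: ler_pM; rewrite ?mulr_ge0 ?weight_ge0//.
  apply: le_trans k1; rewrite ler_wpM2l ?weight_ge0// ler_piMl// prod_le1// => i.
  by rewrite /cl; case: fintype.split => _; rewrite ?lexx ?ler01.
apply: le_trans k2; rewrite ler_wpM2l ?weight_ge0// ler_piMl// prod_le1// => i.
by rewrite /cr; case: fintype.split => _; rewrite ?lexx ?ler01.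
Qed.

End tensor.

(** * Cutoffs, their dilates and smooth steps *)

Section cutoff.
Context {R : realType}.
Variables (d : nat) (chi : 'rV[R]_d -> R).
Hypotheses (chi_smooth : smooth_real chi)
  (chi1 : forall x, norm2_rV x <= 1 -> chi x = 1)
  (chi0 : forall x, 3 / 2 <= norm2_rV x -> chi x = 0).

Lemma partial_cutoff_far s x : 3 / 2 < norm2_rV x -> partial s chi x = 0.
Proof.
move=> h; rewrite (@partial_local _ _ [set x | 3 / 2 < norm2_rV x] chi (fun=> 0))//.
- by rewrite (smooth_cst d 0).2; case: s.
- rewrite -[X in open X]/(@norm2_rV R d @^-1` [set t | 3 / 2 < t]).
  by apply: open_comp; [move=> y _; exact: continuous_norm2|exact: open_gt].
- by move=> y /ltW; exact: chi0.
Qed.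

(** A derivative of [chi] is continuous and vanishes beyond radius 3/2, so its absolute value
    attains a maximum on the ball of radius 2; for each order there are finitely many
    derivatives. *)
Lemma partial_cutoff_bounded M : exists K, forall s x, (size s <= M)%N ->
  `|partial s chi x| <= K.
Proof.
have one s : exists K, forall x, `|partial s chi x| <= K.
  have /(_ _) := @EVT_max_rV R d (fun x => `|partial s chi x|) [set x | norm2_rV x <= 2].
  have ne : [set x : 'rV[R]_d | norm2_rV x <= 2] !=set0.
    by exists 0; rewrite /= -(scale0r 0) norm2Z normr0 mul0r.
  have cpt := @compact_norm2_le R d 2.
  have ct : {within [set x : 'rV[R]_d | norm2_rV x <= 2], continuous (fun x => `|partial s chi x|)}.
    apply: continuous_subspaceT.
    apply: (continuous_circ (chi_smooth s).1) => t; exact: norm_continuous.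
  move=> /(_ ne cpt ct) [c _ hc].
  exists `|partial s chi c| => x; have [x2|x2] := leP (norm2_rV x) 2.
    by apply: hc; rewrite inE.
  by rewrite partial_cutoff_far ?normr0// (le_lt_trans _ x2)//; lra.
have sub N : exists K, forall s : seq 'I_d, (size s <= N)%N -> forall x, `|partial s chi x| <= K.
  elim: N => [|N [K hK]].
    by have [K hK] := one [::]; exists K => -[|//] _ x; exact: hK.
  have /choice[B hB] : forall s, exists K, forall x, `|partial s chi x| <= K by [].
  exists (K + \sum_(t : N.+1.-tuple 'I_d) `|B t|) => s.
  have K0 : 0 <= K by apply: le_trans (hK [::] _ 0).
  rewrite leq_eqVlt ltnS => /predU1P[sN x|sN x]; last first.
    by apply: le_trans (hK s sN x) _; rewrite lerDl sumr_ge0.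
  have sN' : size s == N.+1 by rewrite sN.
  rewrite (bigD1 (Tuple sN'))//= addrA.
  apply: le_trans (hB s x) _; apply: le_trans (ler_norm _) _.
  by rewrite addrAC lerDr addr_ge0// sumr_ge0.
by have [K hK] := sub M; exists K => s x sM; exact: hK.
Qed.

Let dil (r : R) (x : 'rV[R]_d) : 'rV[R]_d := r *: x.

Let hdil r (x : 'rV[R]_d) h i : dil r (h *: 'e_i + x) = (h * r) *: 'e_i + dil r x.
Proof. by rewrite /dil scalerDr scalerA mulrC. Qed.

Let cdil r : continuous (dil r).
Proof.
apply: continuous_rV => i; under eq_fun do rewrite mxE.
by apply: continuous_mul; [exact: cst_continuous|exact: coord_continuous].
Qed.

Lemma smooth_dilate r : smooth_real (fun x => chi (r *: x)) /\
  forall s, partial s (fun x => chi (r *: x)) =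
    fun x => r ^+ size s * partial s chi (r *: x).
Proof.
have [s1 s2] := smooth_comp_monomial (c := fun=> r) (sg := id) (@hdil r) (@cdil r) chi_smooth.
split=> // s; rewrite s2; apply/funext => x; rewrite map_id; congr (_ * _).
by rewrite big_const_seq count_predT; elim: (size s) => //= k ->; rewrite exprS.
Qed.

Lemma tame_cutoff r : 0 <= r <= 1 -> tame (fun x => chi (r *: x)).
Proof.
move=> /andP[r0 r1]; apply: bounded_tame; first exact: (smooth_dilate r).1.
move=> M; have [K hK] := partial_cutoff_bounded M; exists K => s x sM.
rewrite (smooth_dilate r).2 normrM; apply: le_trans (hK s (r *: x) sM).
by rewrite ler_piMl// ger0_norm ?exprn_ge0// exprn_ile1.
Qed.

(** The function vanishes where r |x| < 1, and elsewhere r (1 + |x|) exceeds 1. Smallness in [r] is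
    thus bought with one power of the weight; this is the source of the convergence rates of cutoffs
    on tempered distributions. *)
Lemma partial_oneB_cutoff M : exists K, 0 <= K /\ forall (r : R) s x, 0 < r <= 1 ->
  (size s <= M)%N -> `|partial s (fun x => 1 - chi (r *: x)) x| <= K * r * (1 + norm2_rV x).
Proof.
have [K hK] := partial_cutoff_bounded M.
have K0 : 0 <= K by apply: le_trans (hK [::] 0 _).
exists (1 + K); split=> [|r s x /andP[r0 r1] sM]; first by rewrite addr_ge0.
have [s1 s2] := smooth_dilate r.
have sE : partial s (fun x => 1 - chi (r *: x)) x =
    (if s is [::] then 1 else 0) - r ^+ size s * partial s chi (r *: x).
  have [n1 n2] := smoothN s1.
  by rewrite (smoothD (smooth_cst d 1).1 n1).2 n2 s2 (smooth_cst d 1).2.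
have [xr|xr] := ltP (r * norm2_rV x) 1.
  rewrite (@partial_local _ _ [set x | r * norm2_rV x < 1] _ (fun=> 0))//.
  - rewrite (smooth_cst d 0).2; case: (s) => [|? ?]; rewrite normr0.
      by rewrite !mulr_ge0// ?addr_ge0 ?norm2_ge0// ltW.
    by rewrite !mulr_ge0// ?addr_ge0 ?norm2_ge0// ltW.
  - rewrite -[X in open X]/((fun x => r * @norm2_rV R d x) @^-1` [set t | t < 1]).
    apply: open_comp; last exact: open_lt.
    move=> y _; apply: continuous_mul; [exact: cst_continuous|exact: continuous_norm2].
  - by move=> y /ltW yr; rewrite chi1 ?subrr// norm2Z gtr0_norm.
rewrite sE; apply: (@le_trans _ _ (1 + K)).
  apply: le_trans (ler_normB _ _) _; apply: lerD.
    by case: (s) => [|? ?]; rewrite ?normr1 ?normr0.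
  rewrite normrM; apply: le_trans (hK s (r *: x) sM).
  by rewrite ler_piMl// ger0_norm ?exprn_ge0 ?exprn_ile1// ltW.
rewrite -mulrA ler_peMr ?addr_ge0// mulrDr mulr1.
by apply: le_trans xr _; rewrite lerDr ltW.
Qed.

Lemma sbound_oneB_cutoff M : exists C, forall r K u, 0 < r <= 1 -> smooth_real u ->
  sbound M.+1 K u -> sbound M (C * r * K) (fun x => (1 - chi (r *: x)) * u x).
Proof.
have [K0 [K00 hK0]] := partial_oneB_cutoff M.
exists (2 ^+ M * K0) => r K u r01 su hu.
have sw : smooth_real (fun x => 1 - chi (r *: x)).
  exact: (smoothD (smooth_cst d 1).1 (smoothN (smooth_dilate r).1).1).1.
rewrite -mulrA -(mulrA (2 ^+ M)) (mulrA K0); apply: sboundM => // a x aM.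
exact: hK0.
Qed.

(** A smooth Heaviside function of one coordinate: [chi] along an axis, continued by 1 on the
    positive side. The two branches agree for coordinates between 0 and 1, which makes the gluing
    smooth. *)
Definition step (i : 'I_d) (x : 'rV[R]_d) : R :=
  if x ord0 i <= 0 then chi (x ord0 i *: 'e_i) else 1.

Lemma smooth_step i : smooth_real (step i).
Proof.
pose L (x : 'rV[R]_d) := x ord0 i *: ('e_i : 'rV[R]_d).
have hL (x : 'rV[R]_d) h k : L (h *: 'e_k + x) = (h * (i == k)%:R) *: 'e_i + L x.
  by rewrite /L !mxE eqxx/= -scalerDl.
have cL : continuous L.
  apply: continuous_rV => k; under eq_fun do rewrite mxE.
  by apply: continuous_mul; [exact: coord_continuous|exact: cst_continuous].
have [s1 s2] := smooth_comp_monomial (sg := fun=> i) hL cL chi_smooth.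
pose P s (x : 'rV[R]_d) := if x ord0 i <= 0 then partial s (fun x => chi (L x)) x
  else if s is [::] then 1 else 0.
have oi t : open [set x : 'rV[R]_d | x ord0 i < t].
  rewrite -[X in open X]/((fun x : 'rV[R]_d => x ord0 i) @^-1` [set s | s < t]).
  by apply: open_comp; [move=> y _; exact: coord_continuous|exact: open_lt].
have oi' t : open [set x : 'rV[R]_d | t < x ord0 i].
  rewrite -[X in open X]/((fun x : 'rV[R]_d => x ord0 i) @^-1` [set s | t < s]).
  by apply: open_comp; [move=> y _; exact: coord_continuous|exact: open_gt].
have nL x : norm2_rV (L x) = `|x ord0 i|.
  rewrite norm2Z (_ : norm2_rV _ = 1) ?mulr1//.
  rewrite /norm2_rV /dot_rV (bigD1 i)//= big1 ?mxE ?eqxx/= ?mulr1 ?addr0 ?sqrtr1// => k ki.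
  by rewrite !mxE (negbTE ki) andbF mul0r.
apply: (@smooth_realP_local _ _ _ P _ _).1 => // x.
have [x1|x1] := ltP (x ord0 i) 1.
  exists (fun x => chi (L x)); split=> //.
  have : nbhs x [set x : 'rV[R]_d | x ord0 i < 1] by exact: open_nbhs_nbhs.
  apply: filterS => y /= y1 s; rewrite /P; case: ltP => // y0.
  rewrite (@partial_local _ _ ([set x | x ord0 i < 1] `&` [set x | 0 < x ord0 i]) _ (fun=> 1))//.
  - by rewrite (smooth_cst d 1).2.
  - exact: (openI (oi 1) (oi' 0)).
  - by move=> z [/= z1 z0]; rewrite chi1// nL gtr0_norm// ltW.
exists (fun=> 1); split; first exact: (smooth_cst d 1).1.
have : nbhs x [set x : 'rV[R]_d | 0 < x ord0 i].
  by apply: open_nbhs_nbhs; split=> //=; exact: lt_le_trans x1.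
by apply: filterS => y /= y1 s; rewrite /P leNgt y1 (smooth_cst d 1).2.
Qed.

Lemma step0 i (x : 'rV[R]_d) : x ord0 i <= - (3 / 2) -> step i x = 0.
Proof.
move=> h; rewrite /step ifT; last by apply: le_trans h _; lra.
rewrite chi0// norm2Z (_ : norm2_rV _ = 1) ?mulr1; first by rewrite ler0_norm; lra.
rewrite /norm2_rV /dot_rV (bigD1 i)//= big1 ?mxE ?eqxx/= ?mulr1 ?addr0 ?sqrtr1// => k ki.
by rewrite !mxE (negbTE ki) andbF mul0r.
Qed.

Lemma step1 i (x : 'rV[R]_d) : 0 < x ord0 i -> step i x = 1.
Proof. by move=> h; rewrite /step leNgt h. Qed.

Lemma step_bounded : exists K, forall i x, `|step i x| <= K.
Proof.
have [K hK] := partial_cutoff_bounded 0.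
exists (`|K| + 1) => i x; rewrite /step; case: ifP => _; last first.
  by rewrite normr1 lerDr.
by apply: le_trans (hK [::] _ _) _ => //; apply: le_trans (ler_norm K) _; rewrite lerDl.
Qed.

End cutoff.

(** * Integrable functions and the polynomial weight *)

Section integrable_real.
Context dT (T : measurableType dT) {R : realType} (mu : {measure set T -> \bar R}).
Implicit Types f g : T -> R.

Definition rintegrable f := mu.-integrable setT (EFin \o f).

Lemma rintegrable_measurable f : rintegrable f -> measurable_fun setT f.
Proof. by move=> /measurable_int/measurable_EFinP. Qed.

Lemma rintegrable_le f g : measurable_fun setT f -> rintegrable g ->
  (forall x, `|f x| <= g x) -> rintegrable f.
Proof.
move=> mf ig fg; apply: le_integrable ig => //; first exact/measurable_EFinP.
move=> x _ /=; rewrite lee_fin; apply: le_trans (fg x) _; exact: ler_norm.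
Qed.

Lemma rintegrableD f g : rintegrable f -> rintegrable g ->
  rintegrable (fun x => f x + g x).
Proof. by move=> hf hg; apply: eq_integrable (integrableD _ hf hg). Qed.

Lemma rintegrableB f g : rintegrable f -> rintegrable g ->
  rintegrable (fun x => f x - g x).
Proof. by move=> hf hg; apply: eq_integrable (integrableB _ hf hg). Qed.

Lemma rintegrableZ c f : rintegrable f -> rintegrable (fun x => c * f x).
Proof. by move=> hf; apply: eq_integrable (integrableZl measurableT c hf). Qed.

Lemma rintegrableN f : rintegrable f -> rintegrable (fun x => - f x).
Proof.
move=> /(rintegrableZ (-1)); rewrite /rintegrable.
by under eq_fun do rewrite /= mulN1r.
Qed.

Lemma rintegrable_abs f : rintegrable f -> rintegrable (fun x => `|f x|).
Proof. by move=> hf; apply: eq_integrable (integrable_abse hf). Qed.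

Lemma rintegrableM f (b : T -> R) (C : R) : rintegrable f -> measurable_fun setT b ->
  (forall x, `|b x| <= C) -> rintegrable (fun x => b x * f x).
Proof.
move=> hf mb hb.
apply: (rintegrable_le (g := fun x => C * `|f x|)).
- by apply: measurable_funM => //; exact: rintegrable_measurable.
- exact/rintegrableZ/rintegrable_abs.
- by move=> x; rewrite normrM ler_wpM2r.
Qed.

Lemma rintegral_lty f : measurable_fun setT f -> (forall x, 0 <= f x) ->
  (\int[mu]_x (f x)%:E < +oo)%E -> rintegrable f.
Proof.
move=> mf f0 h; apply/integrableP; split; first exact/measurable_EFinP.
by under eq_integral do rewrite /= ger0_norm//.
Qed.

Lemma rintegrable_EFin f : rintegrable f ->
  (\int[mu]_x (f x)%:E = (\int[mu]_x f x)%:E)%E.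
Proof. by move=> hf; rewrite /Rintegral fineK//; exact: integrable_fin_num. Qed.

Lemma Rintegral_add f g : rintegrable f -> rintegrable g ->
  \int[mu]_x (f x + g x) = \int[mu]_x f x + \int[mu]_x g x.
Proof. exact: RintegralD. Qed.

Lemma le_Rintegral_abs f g : measurable_fun setT f -> rintegrable g ->
  (forall x, `|f x| <= g x) -> `|\int[mu]_x f x| <= \int[mu]_x g x.
Proof.
move=> mf hg fg; have hf := rintegrable_le mf hg fg.
apply: le_trans (le_normr_Rintegral measurableT hf) _.
by apply: le_Rintegral => //; exact: rintegrable_abs.
Qed.

Lemma Rintegral_dominated (f_ : nat -> T -> R) f g :
  (forall n, measurable_fun setT (f_ n)) ->
  (forall x, f_ n x @[n --> \oo] --> f x) ->
  rintegrable g -> (forall n x, `|f_ n x| <= g x) ->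
  \int[mu]_x f_ n x @[n --> \oo] --> \int[mu]_x f x.
Proof.
move=> mf_ hf hg fg.
have mf : measurable_fun setT f.
  by apply: (measurable_fun_cvg mf_) => x _; exact: hf.
have fgx x : `|f x| <= g x.
  have h : `|f_ n x| @[n --> \oo] --> `|f x| by apply: cvg_norm; exact: hf.
  rewrite -(cvg_lim _ h)//; apply: limr_le; last by apply: nearW => n; exact: fg.
  by apply/cvg_ex; eexists; exact: h.
have if_ n : rintegrable (f_ n) by exact: rintegrable_le (mf_ n) hg (fg n).
have hif : rintegrable f by exact: rintegrable_le mf hg fgx.
have hE x : setT x -> (f_ n x)%:E @[n --> \oo] --> (f x)%:E.
  by move=> _; apply/fine_cvgP; split; [exact: nearW|exact: hf].
have [_ _ h] := @dominated_convergence _ T R mu setT measurableT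
  (fun n => EFin \o f_ n) (EFin \o f) (EFin \o g)
  (fun n => iffRL (measurable_EFinP _ _) (mf_ n)) (iffRL (measurable_EFinP _ _) mf)
  (aeW _ hE) hg (aeW _ (fun x n _ => fg n x)).
move: h; rewrite /= (rintegrable_EFin hif) => /fine_cvgP[_].
exact.
Qed.

Lemma is_derive_under_integral (f df : R -> T -> R) (G : T -> R) :
  (forall h, rintegrable (f h)) ->
  (forall (h : R) x, `|h| < 1 -> is_derive h 1 (f ^~ x) (df h x)) ->
  rintegrable G -> (forall x, 0 <= G x) ->
  (forall h x, `|h| < 1 -> `|df h x| <= G x) ->
  is_derive (0 : R) 1 (fun h => \int[mu]_x f h x) (\int[mu]_x df 0 x).
Proof.
move=> hf hd hG G0 dG.
have I0 : (0 : R) \in `](-1), 1[ by rewrite in_itv/=; lra.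
have inI h : h \in `](-1), (1:R)[ -> `|h| < 1 by rewrite in_itv/= ltr_norml.
have d1 h x : `|h| < 1 -> partial1of2 f h x = df h x.
  by move=> h1; rewrite partial1of2E; have [_] := hd h x h1.
have c := @cvg_differentiation_under_integral R _ T mu f setT measurableT 0 (-1) 1 I0
  (fun h _ => hf h) (fun h x hI _ => let: DeriveDef d _ := hd h x (inI h hI) in d) G G0 hG.
have /c {}c : forall h x, `](-1), 1[%classic h -> setT x -> `|partial1of2 f h x| <= G x.
  by move=> h x /inI h1 _; rewrite d1// dG.
have E : \int[mu]_x partial1of2 f 0 x = \int[mu]_x df 0 x.
  by congr fine; apply: eq_integral => x _; rewrite d1// normr0.
rewrite E in c.
have c' : h^-1 *: (((fun h => \int[mu]_x f h x) \o shift 0) (h *: 1) - \int[mu]_x f 0 x)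
    @[h --> 0^'] --> \int[mu]_x df 0 x.
  by apply: cvg_trans c; apply: near_eq_cvg; near=> h; rewrite /= (_ : h%:A = h :> R)//; exact: mulr1.
split; first by apply/cvg_ex; exists (\int[mu]_x df 0 x).
exact/cvg_lim.
Unshelve. all: by end_near. Qed.

End integrable_real.

(** * An integrable weight of polynomial decay *)

Section weight.
Context {R : realType}.
Local Notation lam := (@lebesgue_rV R).

(** An unnormalised Cauchy density; its product form gives the mass [pi ^+ d] by Tonelli. *)
Definition weight d (x : 'rV[R]_d) : R := \prod_i (1 + x ord0 i ^+ 2)^-1.

Lemma weight_factor_gt0 (t : R) : 0 < 1 + t ^+ 2.
Proof. by rewrite ltr_pwDl// sqr_ge0. Qed.

Lemma weightP_ge0 d (x : 'rV[R]_d) : 0 <= weight x.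
Proof. by apply: prodr_ge0 => i _; rewrite invr_ge0 ltW// weight_factor_gt0. Qed.

Lemma continuous_weight d : continuous (@weight d).
Proof.
have h (l : seq 'I_d) : continuous (fun x : 'rV[R]_d => \prod_(i <- l) (1 + x ord0 i ^+ 2)^-1).
  elim: l => [|i l IH].
    by under eq_fun do rewrite big_nil; exact: cst_continuous.
  under eq_fun do rewrite big_cons.
  apply: continuous_mul => //.
  apply: (continuous_circ (f := fun t : R => (1 + t ^+ 2)^-1) (L := fun x : 'rV[R]_d => x ord0 i)).
    exact: coord_continuous.
  exact: continuous_oneDsqrV.
exact: h.
Qed.

Lemma integral_weight d : (\int[lam d]_x (weight x)%:E = (pi ^+ d)%:E)%E.
Proof.
elim: d => [|d IH].
  rewrite integral_rV0 ?/weight ?big_ord0//; apply/measurable_EFinP.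
  exact: (continuous_measurable_rV (@continuous_weight _)).
rewrite ge0_integral_rVS; last 2 first.
- exact: (iffRL (measurable_EFinP _ _) (continuous_measurable_rV (@continuous_weight _))).
- by move=> x; rewrite lee_fin weightP_ge0.
have E a (v : 'rV[R]_d) : weight (cons_rV (a, v)) = (1 + a ^+ 2)^-1 * weight v.
  rewrite /weight big_ord_recl /cons_rV /=; congr (_ * _).
    by have -> : row_mx a%:M v ord0 ord0 = a := congr1 fst (cons_rVK (a, v)).
  apply: eq_bigr => i _; rewrite (_ : lift ord0 i = rshift 1 i); last exact/val_inj.
  by rewrite (row_mxEr a%:M v).
under eq_integral => a _.
  under eq_integral do rewrite E.
  rewrite ge0_integralZl_real//; last 3 first.
  - exact: (continuous_measurable_rV (@continuous_weight _)).
  - by move=> x; exact: weightP_ge0.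
  - by rewrite invr_ge0 ltW// weight_factor_gt0.
  over.
rewrite ge0_integralZr//; last 3 first.
- apply/measurable_EFinP; exact: (continuous_measurable_fun (@continuous_oneDsqrV R)).
- by move=> a _; rewrite lee_fin invr_ge0 ltW// weight_factor_gt0.
- by apply: integral_ge0 => x _; rewrite lee_fin weightP_ge0.
rewrite IH (ge0_symfun_integralT (f := fun a : R => (1 + a ^+ 2)^-1)).
- rewrite (_ : [set x | 0 <= x] = `[0, +oo[%classic); last first.
    by apply/seteqP; split => x /=; rewrite in_itv/= andbT.
  by rewrite integral0y_oneDsqr -!EFinM exprS; congr (_ * _)%:E; lra.
- by move=> x; rewrite invr_ge0 ltW// weight_factor_gt0.
- exact: continuous_oneDsqrV.
- by move=> x /=; rewrite sqrrN.
Qed.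

Lemma rintegrable_weight d : rintegrable (lam d) (@weight d).
Proof.
apply: rintegral_lty; [|exact: weightP_ge0|by rewrite integral_weight ltry].
exact: (continuous_measurable_rV (@continuous_weight _)).
Qed.

(** Turns a bound at index [2 * d] into domination by an integrable function. *)
Lemma weight_le d (x : 'rV[R]_d) : 1 <= (1 + norm2_rV x) ^+ (2 * d) * weight x.
Proof.
rewrite /weight prodfV -ler_pdivrMr ?mul1r ?invrK ?invr_gt0; last first.
  by apply: prodr_gt0 => i _; exact: weight_factor_gt0.
have -> : (1 + norm2_rV x) ^+ (2 * d) = \prod_(i < d) (1 + norm2_rV x) ^+ 2.
  by rewrite prodr_const card_ord exprM.
apply: ler_prod => i _; rewrite ltW ?weight_factor_gt0//=.
have := norm2_coord x i; have := norm2_ge0 x; have := normr_ge0 (x ord0 i).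
by rewrite -(real_normK (num_real (x ord0 i))); nra.
Qed.

Lemma sbound_weight d K (u : 'rV[R]_d -> R) x :
  sbound (2 * d) K u -> `|u x| <= K * weight x.
Proof.
move=> hu; have h := hu [::] x (leq0n _).
apply: (@le_trans _ _ ((1 + norm2_rV x) ^+ (2 * d) * `|u x| * weight x)).
  by rewrite mulrAC ler_peMl// weight_le.
by rewrite ler_wpM2r// weightP_ge0.
Qed.

Definition weight_mass d : R := \int[lam d]_x weight x.

Lemma weight_mass_ge0 d : 0 <= weight_mass d.
Proof. by apply: Rintegral_ge0 => x _; exact: weightP_ge0. Qed.

Lemma smooth_measurable d (u : 'rV[R]_d -> R) : smooth_real u -> measurable_fun setT u.
Proof. by move=> /smooth_continuous/continuous_measurable_rV. Qed.

Lemma rschwartz_integrable d (u : 'rV[R]_d -> R) : rschwartz u -> rintegrable (lam d) u.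
Proof.
move=> [su hu]; have [K hK] := hu (2 * d)%N.
apply: (rintegrable_le (g := fun x => K * weight x)); first exact: smooth_measurable.
  exact/rintegrableZ/rintegrable_weight.
by move=> x; exact: sbound_weight.
Qed.

End weight.

(** * Cosine and sine transforms *)

Section Rintegral_fubini.
Context d1 d2 (T1 : measurableType d1) (T2 : measurableType d2) {R : realType}.
Variable m1 : {sigma_finite_measure set T1 -> \bar R}.
Variable m2 : {sigma_finite_measure set T2 -> \bar R}.

Lemma measurable_Rintegral (f : T1 -> T2 -> R) :
  measurable_fun setT (fun z : T1 * T2 => f z.1 z.2) ->
  measurable_fun setT (fun x => \int[m2]_y f x y).
Proof.
move=> mf; apply: measurableT_comp => //.
rewrite (_ : (fun x => _) = (fun x => \int[m2]_y ((fun z => (f z.1 z.2)%:E)^\+ (x, y)) -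
  \int[m2]_y ((fun z => (f z.1 z.2)%:E)^\- (x, y)))%E); last first.
  apply/funext => x; rewrite integralE; congr (_ - _)%E; apply: eq_integral => y _.
    by rewrite !funeposE.
  by rewrite !funenegE.
apply: emeasurable_funB.
  apply: measurable_fun_fubini_tonelli_F => //.
  by apply: measurable_funepos; exact/measurable_EFinP.
apply: measurable_fun_fubini_tonelli_F => //.
by apply: measurable_funeneg; exact/measurable_EFinP.
Qed.

(** In Fubini's theorem the inner integral is finite almost everywhere, and [fine] changes it only
    on the exceptional null set. *)
Lemma Rintegral_ae (f : T1 -> \bar R) :
  {ae m1, forall x, f x \is a fin_num} -> measurable_fun setT f ->
  \int[m1]_x fine (f x) = fine (\int[m1]_x f x).
Proof.
move=> hf mf; congr fine; apply: ae_eq_integral => //.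
- by apply/measurable_EFinP; apply: measurableT_comp.
- by apply: filterS hf => x h _; rewrite fineK.
Qed.

End Rintegral_fubini.

Section Rintegral_fubini2.
Context d1 d2 (T1 : measurableType d1) (T2 : measurableType d2) {R : realType}.
Variable m1 : {sigma_finite_measure set T1 -> \bar R}.
Variable m2 : {sigma_finite_measure set T2 -> \bar R}.

Lemma Rintegral_fubini (f : T1 -> T2 -> R) :
  measurable_fun setT (fun z : T1 * T2 => f z.1 z.2) ->
  (\int[m1]_x \int[m2]_y (`|f x y|)%:E < +oo)%E ->
  \int[m1]_x \int[m2]_y f x y = \int[m2]_y \int[m1]_x f x y.
Proof.
move=> mf foo; pose F (z : T1 * T2) := (f z.1 z.2)%:E.
have mF : measurable_fun setT F by exact/measurable_EFinP.
have iF : (m1 \x m2)%E.-integrable setT F by apply/(integrable12ltyP _ _ mF).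
rewrite (Rintegral_ae (m1 := m1) (f := fun x => \int[m2]_y (f x y)%:E)%E); last 2 first.
- apply: filterS (ae_integrable1 iF) => x h; exact: integrable_fin_num h.
- exact: (measurable_fubini_F iF).
rewrite (Rintegral_ae (m1 := m2) (f := fun y => \int[m1]_x (f x y)%:E)%E); last 2 first.
- apply: filterS (ae_integrable2 iF) => x h; exact: integrable_fin_num h.
- exact: (measurable_fubini_G iF).
by congr fine; exact: (Fubini iF).
Qed.

Lemma Rintegral_fubini_prod (f : T1 -> T2 -> R) (g1 : T1 -> R) (g2 : T2 -> R) :
  measurable_fun setT (fun z : T1 * T2 => f z.1 z.2) ->
  rintegrable m1 g1 -> rintegrable m2 g2 ->
  (forall x, 0 <= g1 x) -> (forall y, 0 <= g2 y) ->
  (forall x y, `|f x y| <= g1 x * g2 y) ->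
  \int[m1]_x \int[m2]_y f x y = \int[m2]_y \int[m1]_x f x y.
Proof.
move=> mf h1 h2 p1 p2 hf; apply: Rintegral_fubini => //.
have mg1 := rintegrable_measurable h1.
have mg2 := rintegrable_measurable h2.
have E x : (\int[m2]_y (g1 x * g2 y)%:E = (g1 x * \int[m2]_y g2 y)%:E)%E.
  rewrite ge0_integralZl_real// (rintegrable_EFin h2) //.
apply: (@le_lt_trans _ _ (\int[m1]_x (g1 x * \int[m2]_y g2 y)%:E)%E).
  apply: ge0_le_integral => //.
  - by move=> x _; apply: integral_ge0.
  - apply: (measurable_fun_fubini_tonelli_F (fun z : T1 * T2 => (`|f z.1 z.2|)%:E)) => //.
    by apply/measurable_EFinP; exact: measurableT_comp.
  - by apply/measurable_EFinP; exact: measurable_funM.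
  - move=> x _; rewrite -E; apply: ge0_le_integral => //.
    + apply/measurable_EFinP; apply: measurableT_comp => //.
      exact: (measurableT_comp mf (measurable_pair1 x)).
    + by apply/measurable_EFinP; exact: measurable_funM.
    + by move=> y _; rewrite lee_fin.
have -> : (fun x => (g1 x * \int[m2]_y g2 y)%:E) = (fun x => ((\int[m2]_y g2 y) * g1 x)%:E).
  by apply/funext => x; rewrite mulrC.
rewrite ge0_integralZl_real//; last by apply: Rintegral_ge0.
by rewrite (rintegrable_EFin h1) -EFinM ltry.
Qed.

End Rintegral_fubini2.

Section Rintegral_sum.
Context dT (T : measurableType dT) {R : realType} (mu : {measure set T -> \bar R}).

Lemma rintegrable_sum (I : Type) (l : seq I) (f : I -> T -> R) :
  (forall i, rintegrable mu (f i)) -> rintegrable mu (fun x => \sum_(i <- l) f i x).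
Proof.
move=> hf; have := @integrable_sum _ T R mu setT measurableT I l xpredT
  (fun i x => (f i x)%:E) (fun i _ => hf i).
by apply: eq_integrable => // x _; rewrite /= sumEFin.
Qed.

Lemma Rintegral_sum (I : Type) (l : seq I) (f : I -> T -> R) :
  (forall i, rintegrable mu (f i)) ->
  \int[mu]_x (\sum_(i <- l) f i x) = \sum_(i <- l) \int[mu]_x f i x.
Proof.
move=> hf; elim: l => [|i l IH].
  by rewrite big_nil -[RHS](mul0r (fine (mu setT))) -Rintegral_cst//; under eq_fun do rewrite big_nil.
rewrite big_cons -IH -Rintegral_add//; last exact: rintegrable_sum.
by congr fine; apply: eq_integral => x _; rewrite big_cons.
Qed.

End Rintegral_sum.

(** * Transforms of real Schwartz functions *)

Section osc.
Context {R : realType}.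
Local Notation lam := (@lebesgue_rV R).
Variable d : nat.
Implicit Types (p q u : 'rV[R]_d -> R) (x xi : 'rV[R]_d) (c K : R).

Definition osc c x xi : R := cos (2 * pi * dot_rV x xi + c).

(* The phases [c = 0] and [c = - pi / 2] give the cosine and the sine transform. *)
Definition osc_transform c p xi : R := \int[lam d]_x (p x * osc c x xi).

Lemma dotDZl (x y xi : 'rV[R]_d) (h : R) :
  dot_rV (h *: y + x) xi = h * dot_rV y xi + dot_rV x xi.
Proof.
rewrite /dot_rV mulr_sumr -big_split/=; apply: eq_bigr => i _.
by rewrite !mxE mulrDl mulrA.
Qed.

Lemma dotC x xi : dot_rV x xi = dot_rV xi x.
Proof. by apply: eq_bigr => i _; rewrite mulrC. Qed.

Lemma dot_e i xi : dot_rV ('e_i) xi = xi ord0 i.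
Proof.
rewrite /dot_rV (bigD1 i)//= mxE !eqxx mul1r big1 ?addr0// => j ji.
by rewrite mxE (negbTE ji) andbF mul0r.
Qed.

Lemma oscC c x xi : osc c x xi = osc c xi x.
Proof. by rewrite /osc dotC. Qed.

Lemma osc_le1 c x xi : `|osc c x xi| <= 1.
Proof. by rewrite ler_norml cos_geN1 cos_le1. Qed.

Lemma measurable_osc2 c d' (T : measurableType d') (F G : T -> 'rV[R]_d) :
  measurable_fun setT F -> measurable_fun setT G ->
  measurable_fun setT (fun t => osc c (F t) (G t)).
Proof.
move=> mF mG; apply: measurableT_comp.
  by apply: continuous_measurable_fun; exact: continuous_cos.
apply: measurable_funD => //; apply: measurable_funM => //.
apply: measurable_sum => i.
apply: measurable_funM; apply: (measurableT_comp (measurable_coord_rV i)) => //.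
Qed.

Lemma measurable_osc c xi : measurable_fun setT (fun x => osc c x xi).
Proof. exact: measurable_osc2. Qed.

Lemma rintegrable_osc c p xi : rintegrable (lam d) p ->
  rintegrable (lam d) (fun x => p x * osc c x xi).
Proof.
move=> hp; under eq_fun do rewrite mulrC.
apply: (@rintegrableM _ _ _ _ p (osc c ^~ xi) 1 hp (measurable_osc c xi)) => x.
exact: osc_le1.
Qed.

Lemma osc_transform_le c p (G : 'rV[R]_d -> R) xi :
  measurable_fun setT p -> rintegrable (lam d) G -> (forall x, `|p x| <= G x) ->
  `|osc_transform c p xi| <= \int[lam d]_x G x.
Proof.
move=> mp hG pG; apply: le_Rintegral_abs => //.
  by apply: measurable_funM => //; exact: measurable_osc.
by move=> x; rewrite normrM; apply: le_trans (pG x); rewrite ler_piMr// osc_le1.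
Qed.

Lemma measurable_osc_transform c p : measurable_fun setT p ->
  measurable_fun setT (osc_transform c p).
Proof.
move=> mp; rewrite /osc_transform.
apply: (measurable_Rintegral (lam d) (f := fun xi x => p x * osc c x xi)).
apply: measurable_funM; first exact: (measurableT_comp mp).
exact: measurable_osc2.
Qed.

Lemma osc_transform_sbound c K p xi : smooth_real p -> sbound (2 * d) K p ->
  `|osc_transform c p xi| <= K * weight_mass d.
Proof.
move=> sp hp; rewrite -RintegralZl//; last exact: rintegrable_weight.
apply: osc_transform_le => [||x]; first exact: smooth_measurable.
  exact/rintegrableZ/rintegrable_weight.
exact: sbound_weight.
Qed.

(** Differentiation shifts the phase by [pi / 2], so the derivatives of a transform remain in the
    same family of transforms. *)
Lemma is_derive_osc_line c x xi y (t : R) :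
  is_derive t 1 (fun h : R => osc c x (h *: y + xi))
    (2 * pi * dot_rV x y * osc (c + pi / 2) x (t *: y + xi)).
Proof.
have E (h : R) : osc c x (h *: y + xi) = cos (h * (2 * pi * dot_rV x y) + (2 * pi * dot_rV x xi + c)).
  by rewrite /osc dotC dotDZl !(dotC _ x); congr cos; ring.
have E2 (h : R) : osc (c + pi / 2) x (h *: y + xi) = - sin (h * (2 * pi * dot_rV x y) + (2 * pi * dot_rV x xi + c)).
  by rewrite -cosDpihalf /osc dotC dotDZl !(dotC _ x); congr cos; ring.
under eq_fun do rewrite E.
rewrite E2.
apply: is_derive_eq; rewrite /GRing.scale/= !mulr0 !add0r !addr0 !mulr1; ring.
Qed.


Lemma cos_lipschitz (a b : R) : `|cos a - cos b| <= `|a - b|.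
Proof.
have h (s t : R) : s <= t -> `|cos s - cos t| <= `|s - t|.
  rewrite le_eqVlt => /orP[/eqP->|st]; first by rewrite !subrr.
  have hd (r : R) : r \in `]s, t[%R -> is_derive r 1 (@cos R) (- sin r).
    by move=> _; exact: is_derive_cos.
  have [z _ E] := MVT st hd (continuous_subspaceT (@continuous_cos R)).
  rewrite distrC E normrM normrN (distrC s t) ler_piMl// ler_norml.
  by rewrite sin_geN1 sin_le1.
by have [/h//|/ltW/h] := leP a b; rewrite distrC (distrC b).
Qed.

Lemma lipschitz_continuous_rV (f : 'rV[R]_d -> R) (L : 'I_d -> R) :
  (forall x y, `|f x - f y| <= \sum_i `|x ord0 i - y ord0 i| * L i) -> continuous f.
Proof.
move=> hf x; apply: (iffRL (@cvg_ballP _ _ _ _ (nbhs_filter x) f (f x))) => e e0.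
pose S (y : 'rV[R]_d) := \sum_i `|x ord0 i - y ord0 i| * L i.
have cS : continuous S.
  apply: (@continuous_bigsum _ _ _ _ (fun i (y : 'rV[R]_d) => `|x ord0 i - y ord0 i| * L i)) => i.
  apply: continuous_mul; last exact: cst_continuous.
  apply: (continuous_circ (f := Num.norm) (L := fun y : 'rV[R]_d => x ord0 i - y ord0 i)).
    apply: continuous_add; first exact: cst_continuous.
    by apply: continuous_opp; exact: coord_continuous.
  exact: norm_continuous.
have Sx : S x < e by rewrite /S big1// => i _; rewrite subrr normr0 mul0r.
by apply: filterS (cvgr_lt (S x) (cS x) e Sx) => y; exact: le_lt_trans.
Qed.

(** Integrated against [p], this makes the transform Lipschitz, with the first absolute moments of
    [p] as constants; continuity follows. *)
Lemma osc_lipschitz c x xi eta :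
  `|osc c x xi - osc c x eta| <= \sum_i `|xi ord0 i - eta ord0 i| * (2 * pi * `|x ord0 i|).
Proof.
apply: le_trans (cos_lipschitz _ _) _.
have -> : 2 * pi * dot_rV x xi + c - (2 * pi * dot_rV x eta + c) =
    \sum_i (xi ord0 i - eta ord0 i) * (2 * pi * x ord0 i).
  rewrite opprD addrACA subrr addr0 -mulrBr /dot_rV -sumrB mulr_sumr.
  by apply: eq_bigr => i _; ring.
apply: le_trans (ler_norm_sum _ _ _) _; apply: ler_sum => i _.
by rewrite !normrM (@ger0_norm _ 2)// (@ger0_norm _ pi)// pi_ge0.
Qed.

Lemma rschwartz_coordM i p : rschwartz p -> rschwartz (fun x => x ord0 i * p x).
Proof. by move=> hp; apply: rschwartzM hp; exact: tame_coord. Qed.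

Lemma continuous_osc_transform c p : rschwartz p -> continuous (osc_transform c p).
Proof.
move=> hp.
pose L i := \int[lam d]_x (2 * pi * `|x ord0 i * p x|).
have iL i : rintegrable (lam d) (fun x => 2 * pi * `|x ord0 i * p x|).
  by apply/rintegrableZ/rintegrable_abs/rschwartz_integrable/rschwartz_coordM.
apply: (@lipschitz_continuous_rV _ L) => xi eta.
have ip := rschwartz_integrable hp.
rewrite /osc_transform -RintegralB//; try exact: rintegrable_osc.
have -> : \sum_i `|xi ord0 i - eta ord0 i| * L i =
    \int[lam d]_x (\sum_i `|xi ord0 i - eta ord0 i| * (2 * pi * `|x ord0 i * p x|)).
  rewrite Rintegral_sum//; last by move=> i; exact: rintegrableZ.
  by apply: eq_bigr => i _; rewrite RintegralZl//; exact: iL.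
apply: le_Rintegral_abs.
- apply: measurable_funB; apply: rintegrable_measurable; exact: rintegrable_osc.
- apply: rintegrable_sum => i; exact: rintegrableZ.
- move=> x; rewrite -mulrBr normrM.
  apply: le_trans (ler_wpM2l (normr_ge0 _) (osc_lipschitz c x xi eta)) _.
  by rewrite mulr_sumr; apply: ler_sum => i _; rewrite normrM; nra.
Qed.

Lemma is_derive_osc_transform c i p xi : rschwartz p ->
  is_derive xi ('e_i) (osc_transform c p)
    (osc_transform (c + pi / 2) (fun x => 2 * pi * x ord0 i * p x) xi).
Proof.
move=> hp; apply/is_derive_lineP; rewrite /osc_transform.
have ip := rschwartz_integrable hp.
have ixp := rschwartz_integrable (rschwartz_coordM i hp).
pose df (h : R) (x : 'rV[R]_d) := p x * (2 * pi * x ord0 i * osc (c + pi / 2) x (h *: 'e_i + xi)).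
have -> : \int[lam d]_x (2 * pi * x ord0 i * p x * osc (c + pi / 2) x xi) = \int[lam d]_x df 0 x.
  by congr fine; apply: eq_integral => x _; rewrite /df scale0r add0r; congr EFin; ring.
apply: (@is_derive_under_integral _ _ _ (lam d) (fun h x => p x * osc c x (h *: 'e_i + xi)) df
  (fun x => 2 * pi * `|x ord0 i * p x|)).
- by move=> h; exact: rintegrable_osc.
- move=> h x _; have := is_derive_osc_line c x xi ('e_i) h.
  rewrite (dotC x) dot_e => h1.
  exact: (is_deriveZ (p x) h1).
- exact/rintegrableZ/rintegrable_abs.
- by move=> x; rewrite mulr_ge0// mulr_ge0// pi_ge0.
- move=> h x _; rewrite /df !normrM (@ger0_norm _ 2)// (@ger0_norm _ pi) ?pi_ge0//.
  have := osc_le1 (c + pi / 2) x (h *: 'e_i + xi); have := pi_ge0 R.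
  have := normr_ge0 (p x); have := normr_ge0 (x ord0 i) => h1 h2 h3 h4.
  have h5 : 0 <= 2 * pi * (`|x ord0 i| * `|p x|) by rewrite !mulr_ge0.
  by apply: le_trans (ler_piMr h5 h4); rewrite le_eqVlt; apply/orP; left; apply/eqP; ring.
Qed.

Fixpoint osc_weights (s : seq 'I_d) p : 'rV[R]_d -> R :=
  if s is i :: s' then fun x => 2 * pi * x ord0 i * osc_weights s' p x else p.

Lemma tame_osc_weight i : tame (fun x : 'rV[R]_d => 2 * pi * x ord0 i).
Proof.
have [s1 h1] := tame_coord i (R := R); split; first exact: (smoothZ (2 * pi) s1).1.
move=> M; have [K hK] := h1 M; exists (2 * pi * K) => a x aM.
rewrite (smoothZ (2 * pi) s1).2 normrM ger0_norm ?mulr_ge0 ?pi_ge0//.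
by rewrite -mulrA ler_wpM2l ?hK// mulr_ge0// pi_ge0.
Qed.

Lemma rschwartz_osc_weights s p : rschwartz p -> rschwartz (osc_weights s p).
Proof.
by move=> hp; elim: s => //= i s IH; apply: rschwartzM IH; exact: tame_osc_weight.
Qed.

Lemma osc_transform_smooth c p : rschwartz p ->
  smooth_real (osc_transform c p) /\ forall s, partial s (osc_transform c p) =
    osc_transform (c + (size s)%:R * (pi / 2)) (osc_weights s p).
Proof.
move=> hp; apply: smooth_realP => [|s|s i xi].
- by rewrite mul0r addr0.
- exact/continuous_osc_transform/rschwartz_osc_weights.
- have := is_derive_osc_transform (c + (size s)%:R * (pi / 2)) i xi (rschwartz_osc_weights s hp).
  have -> // : c + (size (i :: s))%:R * (pi / 2) = c + (size s)%:R * (pi / 2) + pi / 2.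
  by rewrite /= -natr1 mulrDl mul1r addrA.
Qed.


Lemma smooth_osc c xi : smooth_real (fun x => osc c x xi) /\
  forall s, partial s (fun x => osc c x xi) = fun x =>
    (\prod_(i <- s) (2 * pi * xi ord0 i)) * osc (c + (size s)%:R * (pi / 2)) x xi.
Proof.
apply: smooth_realP => [|s|s i x].
- by apply/funext => x; rewrite big_nil mul1r mul0r addr0.
- apply: (@lipschitz_continuous_rV _ (fun i => `|\prod_(i <- s) (2 * pi * xi ord0 i)| * (2 * pi * `|xi ord0 i|))) => x y.
  rewrite -mulrBr normrM !(oscC _ _ xi).
  apply: le_trans (ler_wpM2l (normr_ge0 _) (osc_lipschitz _ xi x y)) _.
  by rewrite mulr_sumr; apply: ler_sum => i _; rewrite mulrCA.
- apply/is_derive_lineP; rewrite big_cons.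
  have h := is_derive_osc_line (c + (size s)%:R * (pi / 2)) xi x ('e_i) 0.
  have h' := is_deriveZ (\prod_(j <- s) (2 * pi * xi ord0 j)) h.
  under eq_fun do rewrite oscC.
  apply: is_derive_eq h' _; rewrite (dotC xi) dot_e scale0r add0r (oscC _ xi).
  have -> : c + (size (i :: s))%:R * (pi / 2) = c + (size s)%:R * (pi / 2) + pi / 2.
    by rewrite /= -natr1 mulrDl mul1r addrA.
  by rewrite -[LHS]/(_ * (_ * _)) mulrA (mulrC (\prod_(_ <- _) _)).
Qed.

Lemma tame_osc c xi : tame (fun x => osc c x xi).
Proof.
have [s1 h1] := smooth_osc c xi; apply: bounded_tame => // M.
exists ((1 + \sum_i `|2 * pi * xi ord0 i|) ^+ M) => a x aM; rewrite h1 normrM.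
apply: (@le_trans _ _ `|\prod_(i <- a) (2 * pi * xi ord0 i)|).
  by rewrite ler_piMr// osc_le1.
have S0 : 0 <= \sum_i `|2 * pi * xi ord0 i| by exact: sumr_ge0.
apply: (@le_trans _ _ ((1 + \sum_i `|2 * pi * xi ord0 i|) ^+ size a)); last first.
  by rewrite ler_weXn2l// lerDl.
elim: a {aM} => [|i a IH]; first by rewrite big_nil normr1 expr0.
rewrite big_cons normrM exprS ler_pM// (bigD1 i)//= addrCA lerDl addr_ge0//.
exact: sumr_ge0.
Qed.

(** By translation invariance the integral of [p (h *: 'e_i + x)] is constant in [h]; its derivative
    at 0, taken under the integral, is the integral of the partial derivative. *)
Lemma Rintegral_partial0 i p : rschwartz p -> \int[lam d]_x partial [:: i] p x = 0.
Proof.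
move=> hp; have [sp bp] := hp.
have [K hK] := (rschwartz_partial [:: i] hp).2 (2 * d)%N.
(* The constant of [norm2_shift] for shifts of length at most 1: one majorant serves all translates
   with |h| < 1. *)
pose C : R := K * ((1 + d%:R) * (1 + 1)) ^+ (2 * d).
have K0 := sbound_ge0 hK.
have hd : is_derive (0 : R) 1 (fun h : R => \int[lam d]_x p (h *: 'e_i + x))
    (\int[lam d]_x partial [:: i] p (0 *: 'e_i + x)).
  apply: (@is_derive_under_integral _ _ _ (lam d) (fun h x => p (h *: 'e_i + x))
    (fun h x => partial [:: i] p (h *: 'e_i + x)) (fun x => C * weight x)).
  - move=> h; have := rschwartz_integrable (rschwartz_shift (h *: 'e_i) hp).
    by under eq_fun do rewrite addrC.
  - move=> h x _; apply: (iffLR (is_derive_shift_line p x ('e_i) h _)).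
    exact: (smooth_is_derive [::] i (h *: 'e_i + x) sp).
  - exact/rintegrableZ/rintegrable_weight.
  - by move=> x; rewrite mulr_ge0 ?weightP_ge0// mulr_ge0 ?exprn_ge0// mulr_ge0// addr_ge0.
  - move=> h x h1.
    have e1 : norm2_rV (h *: 'e_i : 'rV[R]_d) <= 1.
      rewrite norm2Z /norm2_rV dot_e mxE !eqxx sqrtr1 mulr1; exact: ltW.
    set y := h *: 'e_i + x.
    have hy : 1 + norm2_rV x <= (1 + d%:R) * (1 + 1) * (1 + norm2_rV y).
      apply: le_trans (norm2_shift x (h *: 'e_i)) _; rewrite (addrC x).
      by rewrite ler_wpM2r ?addr_ge0 ?norm2_ge0// ler_wpM2l ?lerD2l.
    have h2 : (1 + norm2_rV x) ^+ (2 * d) <= ((1 + d%:R) * (1 + 1)) ^+ (2 * d) * (1 + norm2_rV y) ^+ (2 * d).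
      by rewrite -exprMn lerXn2r// nnegrE ?mulr_ge0 ?addr_ge0 ?norm2_ge0.
    have := hK [::] y (leq0n _); rewrite /= -/(partial [:: i] p y) => h3.
    apply: (@le_trans _ _ ((1 + norm2_rV x) ^+ (2 * d) * weight x * `|partial [:: i] p y|)).
      by rewrite ler_peMl// weight_le.
    rewrite /C mulrAC ler_wpM2r ?weightP_ge0// mulrC.
    apply: le_trans (ler_wpM2l (normr_ge0 _) h2) _.
    rewrite mulrCA mulrC ler_wpM2r ?exprn_ge0 ?mulr_ge0 ?addr_ge0//.
    by rewrite mulrC.
have hd0 : is_derive (0 : R) 1 (fun h : R => \int[lam d]_x p (h *: 'e_i + x)) 0.
  rewrite (_ : (fun h : R => _) = cst (\int[lam d]_x p x)); first exact: is_derive_cst.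
  apply/funext => h; congr fine.
  apply: (integral_shift_rV (h *: 'e_i) (F := fun x => (p x)%:E)).
  by apply/measurable_EFinP; exact: smooth_measurable.
have E : \int[lam d]_x partial [:: i] p x = \int[lam d]_x partial [:: i] p (0 *: 'e_i + x).
    by rewrite scale0r; apply: eq_Rintegral => x _; rewrite add0r.
by rewrite E -(@derive_val _ _ _ _ _ _ _ hd) (@derive_val _ _ _ _ _ _ _ hd0).
Qed.

(** Integration by parts: [Rintegral_partial0] applied to [p] times the oscillation of phase
    [c - pi / 2], whose derivative is the oscillation of phase [c]. *)
Lemma osc_transform_coord c i p xi : rschwartz p ->
  2 * pi * xi ord0 i * osc_transform c p xi =
  - osc_transform (c - pi / 2) (partial [:: i] p) xi.
Proof.
move=> hp; have [so po] := smooth_osc (c - pi / 2) xi.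
have hF := rschwartzM (tame_osc (c - pi / 2) xi) hp.
have := Rintegral_partial0 i hF.
have := (smoothM so hp.1).2 [:: i] => ->; rewrite /=.
have E x : \sum_(q <- [:: ([:: i], [::]); ([::], [:: i])])
    partial q.1 (fun x => osc (c - pi / 2) x xi) x * partial q.2 p x =
    2 * pi * xi ord0 i * (p x * osc c x xi) + partial [:: i] p x * osc (c - pi / 2) x xi.
  rewrite !big_cons big_nil addr0 !po big_seq1 big_nil /= mul1r !mul0r !mul1r addr0 subrK; ring.
under eq_Rintegral do rewrite E.
have ip := rschwartz_integrable hp.
have idp := rschwartz_integrable (rschwartz_partial [:: i] hp).
rewrite Rintegral_add; last 2 first.
- exact/rintegrableZ/rintegrable_osc.
- exact: rintegrable_osc.
rewrite RintegralZl//; last exact: rintegrable_osc.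
by move/eqP; rewrite addr_eq0 => /eqP.
Qed.

(** Each further power of the weight is paid with one derivative of [p]: the Euclidean norm is below
    the sum of the coordinates, and each coordinate is absorbed by an integration by parts. *)
Lemma osc_transform_decay M : exists C, forall c p K xi, rschwartz p ->
  sbound (M + 2 * d) K p -> (1 + norm2_rV xi) ^+ M * `|osc_transform c p xi| <= C * K.
Proof.
elim: M => [|M [C IH]].
  exists (weight_mass d) => c p K xi hp hK; rewrite expr0 mul1r mulrC.
  exact: osc_transform_sbound hp.1 hK.
exists (C * (1 + d%:R)) => c p K xi hp hK.
have hK0 : sbound (M + 2 * d) K p by apply: sbound_le hK.
apply: (@le_trans _ _ ((1 + norm2_rV xi) ^+ M * `|osc_transform c p xi| +
   \sum_i (1 + norm2_rV xi) ^+ M * `|osc_transform (c - pi / 2) (partial [:: i] p) xi|)).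
  rewrite -mulr_sumr -mulrDr exprSr -mulrA ler_wpM2l ?weight_ge0// mulrDl mul1r lerD2l.
  apply: le_trans (ler_wpM2r (normr_ge0 _) (norm2_le_sum xi)) _.
  rewrite mulr_suml; apply: ler_sum => i _.
  rewrite -(normrN (osc_transform _ (partial _ _) _)) -osc_transform_coord// !normrM.
  rewrite ler_wpM2r// (@ger0_norm _ 2)// (@ger0_norm _ pi) ?pi_ge0// ler_peMl//.
  by have := pi_ge2 R; lra.
have -> : C * (1 + d%:R) * K = C * K + d%:R * (C * K) by ring.
rewrite lerD ?IH//.
apply: (@le_trans _ _ (\sum_(i < d) C * K)).
  apply: ler_sum => i _; apply: IH; first exact: rschwartz_partial.
  by apply: sbound_partial; rewrite addn1.
by rewrite sumr_const card_ord mulr_natl.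
Qed.

Lemma osc_weights_sbound k M : exists C, forall (s : seq 'I_d) p K, (size s <= k)%N ->
  rschwartz p -> sbound (M + k) K p -> sbound M (C * K) (osc_weights s p).
Proof.
elim: k M => [|k IH] M.
  by exists 1 => -[|//] p K _ _; rewrite addn0 mul1r.
have [C hC] := IH M.+1; exists (1 + `|2 ^+ M * (2 * pi * C)|) => -[|i s] p K hs hp hK.
  have K0 := sbound_ge0 hK.
  by apply: sbound_le hK; rewrite ?leq_addr// ler_peMl// lerDl.
have [sw _] := tame_osc_weight i.
have hw a x : (size a <= M)%N ->
    `|partial a (fun x : 'rV[R]_d => 2 * pi * x ord0 i) x| <= 2 * pi * (1 + norm2_rV x).
  move=> aM; rewrite (smoothZ _ (smooth_coord i).1).2 normrM ger0_norm ?mulr_ge0 ?pi_ge0//.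
  rewrite ler_wpM2l ?mulr_ge0 ?pi_ge0//.
  have n1 : 1 <= 1 + norm2_rV x by rewrite lerDl norm2_ge0.
  rewrite (smooth_coord i).2; case: a aM => [|b a] _.
    by apply: le_trans (norm2_coord x i) _; rewrite lerDr.
  by case: ifP => _; rewrite ?normr1// normr0 (le_trans _ n1).
have hK' : sbound (M.+1 + k) K p by rewrite addSnnS.
apply: sbound_le (leqnn M) _ (sboundM sw (rschwartz_osc_weights s hp).1 hw (hC s p K hs hp hK')).
have K0 := sbound_ge0 hK.
have -> : 2 ^+ M * (2 * pi * (C * K)) = 2 ^+ M * (2 * pi * C) * K by ring.
rewrite ler_wpM2r//.
by apply: le_trans (ler_norm _) _; rewrite lerDr.
Qed.

(** Index count: [M] derivatives of the transform multiply [p] by at most [M] coordinates, [M]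
    powers of the weight cost [M] derivatives of [p], and integrability costs [2 * d]. *)
Lemma osc_transform_bound M : exists N C, forall c p K, rschwartz p ->
  sbound N K p -> sbound M (C * K) (osc_transform c p).
Proof.
have [C1 h1] := osc_transform_decay M.
have [C2 h2] := osc_weights_sbound M (M + 2 * d).
exists (M + 2 * d + M)%N, (C1 * C2) => c p K hp hK s xi sM.
rewrite (osc_transform_smooth c hp).2 -mulrA; apply: h1; first exact: rschwartz_osc_weights.
exact: h2.
Qed.

Lemma rschwartz_osc_transform c p : rschwartz p -> rschwartz (osc_transform c p).
Proof.
move=> hp; split; first exact: (osc_transform_smooth c hp).1.
move=> M; have [N [C h]] := osc_transform_bound M; have [K hK] := hp.2 N.
by exists (C * K); exact: h.
Qed.

End osc.

(** * Inversion and Plancherel inequality *)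

Section fatou_le.
Context dT (T : measurableType dT) {R : realType} (mu : {measure set T -> \bar R}).

Lemma fatou_le (f_ : nat -> T -> \bar R) (f : T -> \bar R) (c : \bar R) :
  (forall n, measurable_fun setT (f_ n)) -> (forall n x, 0 <= f_ n x)%E ->
  (forall x, f_ n x @[n --> \oo] --> f x) ->
  (forall n, \int[mu]_x f_ n x <= c)%E -> (\int[mu]_x f x <= c)%E.
Proof.
move=> mf f0 cf h; have := fatou mu measurableT mf (fun n x _ => f0 n x).
under eq_integral => x _ do rewrite (is_cvg_limn_einfE (cvgP _ (cf x))) (cvg_lim _ (cf x))//.
move=> /le_trans; apply; rewrite limn_einf_lim; apply: lime_le; first exact: is_cvg_einfs.
by apply: nearW => n; apply: le_trans (h n); apply: ereal_inf_lbound; exists n => //=.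
Qed.

End fatou_le.

Section inversion.
Context {R : realType}.
Local Notation lam := (@lebesgue_rV R).
Variable d : nat.
Implicit Types (p q u F : 'rV[R]_d -> R) (x y z xi : 'rV[R]_d) (c K : R).

Lemma Rintegral_shift (a : 'rV[R]_d) F : measurable_fun setT F ->
  \int[lam d]_x F (a + x) = \int[lam d]_x F x.
Proof.
move=> mF; congr fine; apply: (integral_shift_rV a (F := fun x => (F x)%:E)).
exact/measurable_EFinP.
Qed.

Lemma Rintegral_dilate (r : R) F : 0 < r -> measurable_fun setT F ->
  \int[lam d]_x F x = r ^+ d * \int[lam d]_x F (r *: x).
Proof.
move=> r0 mF.
have E (G : 'rV[R]_d -> \bar R) : measurable_fun setT G -> (forall x, 0 <= G x)%E ->
    (\int[lam d]_x G x = (r ^+ d)%:E * \int[lam d]_x G (r *: x)%R)%E.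
  move=> mG G0; rewrite (ge0_integral_affine_rV 0 (r := r))// ?gt_eqF// gtr0_norm//.
  by congr (_ * _)%E; apply: eq_integral => x _; rewrite add0r.
rewrite /Rintegral integralE [in RHS]integralE.
have mF' : measurable_fun setT (fun x => (F x)%:E) by exact/measurable_EFinP.
have rd0 : (r ^+ d != 0) by rewrite expf_neq0// gt_eqF.
rewrite (E _ (measurable_funepos mF')) ?(E _ (measurable_funeneg mF'))//.
rewrite -[r ^+ d]/(fine (r ^+ d)%:E).
set a := (\int[_]_x _)%E; set b := (\int[_]_x _)%E.
have -> : (\int[lam d]_x (fun x => (F (r *: x))%:E)^\+ x = a)%E.
  by apply: eq_integral => x _; rewrite !funeposE.
have -> : (\int[lam d]_x (fun x => (F (r *: x))%:E)^\- x = b)%E.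
  by apply: eq_integral => x _; rewrite !funenegE.
have a0 : (0 <= a)%E by exact: integral_ge0.
have b0 : (0 <= b)%E by exact: integral_ge0.
have rp : (0 < (r ^+ d)%:E)%E by rewrite lte_fin exprn_gt0.
(* If a part is infinite, both sides are 0, since [fine] sends infinite values to 0. *)
case: a a0 => [a||]// a0; case: b b0 => [b||]// b0; rewrite ?gt0_muley//=.
  by rewrite mulrBr.
all: by rewrite mulr0.
Qed.

Lemma measurable_dilate (r : R) F : measurable_fun setT F ->
  measurable_fun setT (fun x => F (r *: x)).
Proof.
move=> mF; apply: measurableT_comp mF _.
by have := measurable_affine_rV 0 r (d := d); under eq_fun do rewrite add0r.
Qed.

Lemma measurable_shift (a : 'rV[R]_d) F : measurable_fun setT F ->
  measurable_fun setT (fun x => F (a + x)).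
Proof.
move=> mF; apply: measurableT_comp mF _.
by have := measurable_affine_rV a 1 (d := d); under eq_fun do rewrite scale1r.
Qed.

Lemma measurable_comp_dilate2 (r : R) F : measurable_fun setT F ->
  measurable_fun setT (fun z : 'rV[R]_d * 'rV[R]_d => F (z.1 + r *: z.2)).
Proof.
move=> mF; apply: (measurableT_comp mF); apply: measurable_fun_rV => i.
under eq_fun do rewrite !mxE.
apply: measurable_funD; last apply: measurable_funM => //.
  by apply: (measurableT_comp (measurable_coord_rV i)).
by apply: (measurableT_comp (measurable_coord_rV i)).
Qed.

Lemma osc_transform_dilate c (r : R) u z : 0 < r -> measurable_fun setT u ->
  osc_transform c u z = r ^+ d * osc_transform c (fun x => u (r *: x)) (r *: z).
Proof.
move=> r0 mu; rewrite /osc_transform.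
rewrite (Rintegral_dilate r0); last by apply: measurable_funM => //; exact: measurable_osc.
congr (_ * _); apply: eq_Rintegral => x _; congr (_ * _).
have E (y t : 'rV[R]_d) : dot_rV (r *: y) t = r * dot_rV y t.
  by rewrite /dot_rV mulr_sumr; apply: eq_bigr => i _; rewrite mxE mulrA.
by rewrite /osc E [in RHS]dotC E dotC.
Qed.

(** The multiplication formula: the kernel is symmetric, so Fubini moves the transform from one
    factor to the other. *)
Lemma osc_mult c p q : rintegrable (lam d) p -> rintegrable (lam d) q ->
  \int[lam d]_xi (q xi * osc_transform c p xi) = \int[lam d]_x (p x * osc_transform c q x).
Proof.
move=> hp hq; have mp := rintegrable_measurable hp; have mq := rintegrable_measurable hq.
transitivity (\int[lam d]_xi \int[lam d]_x (q xi * (p x * osc c x xi))).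
  by apply: eq_Rintegral => xi _; rewrite RintegralZl//; exact: rintegrable_osc.
rewrite (@Rintegral_fubini_prod _ _ _ _ _ (lam d) (lam d)
  (fun xi x => q xi * (p x * osc c x xi)) (fun x => `|q x|) (fun x => `|p x|)).
- apply: eq_Rintegral => x _; rewrite -RintegralZl//; last exact: rintegrable_osc.
  by apply: eq_Rintegral => xi _; rewrite oscC mulrCA.
- apply: measurable_funM; first exact: (measurableT_comp mq).
  apply: measurable_funM; first exact: (measurableT_comp mp).
  exact: measurable_osc2.
- exact: rintegrable_abs.
- exact: rintegrable_abs.
- by [].
- by [].
- by move=> xi x; rewrite !normrM ler_wpM2l// ler_piMr// osc_le1.
Qed.

Lemma rintegrable_dilate (r : R) F : 0 < r -> rintegrable (lam d) F ->
  rintegrable (lam d) (fun x => F (r *: x)).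
Proof.
move=> r0 hF; have mF := rintegrable_measurable hF.
suff h : rintegrable (lam d) (fun x => `|F (r *: x)|).
  by apply: rintegrable_le h _ => //; exact: measurable_dilate.
apply: rintegral_lty => //; first by apply: measurableT_comp => //; exact: measurable_dilate.
have /integrableP[_ h] := hF.
have mF' : measurable_fun setT (fun x => (`|F x|)%:E).
  by apply/measurable_EFinP; exact: measurableT_comp.
have := @ge0_integral_affine_rV R d 0 r (fun x => (`|F x|)%:E) _ mF' _.
rewrite gt_eqF// => /(_ erefl (fun x => normr_ge0 _)) E.
move: h; rewrite /= E ltNge leye_eq => h; rewrite ltNge leye_eq; apply: contra h => /eqP h.
under eq_integral do rewrite add0r.
by rewrite h gtr0_norm// gt0_muley// lte_fin exprn_gt0.
Qed.

Lemma rintegrable_shift (a : 'rV[R]_d) F : rintegrable (lam d) F ->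
  rintegrable (lam d) (fun x => F (a + x)).
Proof.
move=> hF; have mF := rintegrable_measurable hF.
suff h : rintegrable (lam d) (fun x => `|F (a + x)|).
  by apply: rintegrable_le h _ => //; exact: measurable_shift.
apply: rintegral_lty => //; first by apply: measurableT_comp => //; exact: measurable_shift.
have /integrableP[_ h] := hF.
rewrite (integral_shift_rV a (F := fun x => (`|F x|)%:E))//.
by apply/measurable_EFinP; exact: measurableT_comp.
Qed.

Lemma osc_mult_dilate c p w (r : R) : 0 < r -> rintegrable (lam d) p ->
  rintegrable (lam d) w ->
  \int[lam d]_xi (w (r *: xi) * osc_transform c p xi) =
  \int[lam d]_z (p (r *: z) * osc_transform c w z).
Proof.
move=> r0 hp hw; have hwr := rintegrable_dilate r0 hw; rewrite (osc_mult c hp hwr).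
have mw := rintegrable_measurable hw; have mp := rintegrable_measurable hp.
have mwr := rintegrable_measurable hwr.
have hi : rintegrable (lam d) (fun x => p x * osc_transform c (fun x => w (r *: x)) x).
  under eq_fun do rewrite mulrC.
  apply: (rintegrableM (C := \int[lam d]_x `|w (r *: x)|) hp (measurable_osc_transform c mwr)) => x.
  by apply: osc_transform_le mwr (rintegrable_abs hwr) _.
rewrite (Rintegral_dilate r0 (rintegrable_measurable hi)) -RintegralZl//; last first.
  exact: rintegrable_dilate hi.
by apply: eq_Rintegral => z _; rewrite mulrCA -osc_transform_dilate.
Qed.

(** The addition formula for the cosine. It is the reason why inversion and Plancherel involve the
    cosine and the sine transform jointly. *)
Lemma osc_transform_shift p x xi : rintegrable (lam d) p ->
  osc_transform 0 (fun y => p (x + y)) xi =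
  osc 0 x xi * osc_transform 0 p xi + osc (- (pi / 2)) x xi * osc_transform (- (pi / 2)) p xi.
Proof.
move=> hp; have mp := rintegrable_measurable hp.
have E y : p (x + y) * osc 0 y xi = (fun z => osc 0 x xi * (p z * osc 0 z xi) +
    osc (- (pi / 2)) x xi * (p z * osc (- (pi / 2)) z xi)) (x + y).
  have D : dot_rV (x + y) xi = dot_rV x xi + dot_rV y xi.
    by have := dotDZl y x xi 1; rewrite scale1r mul1r.
  rewrite /osc /= D !cosBpihalf !addr0.
  rewrite (_ : 2 * pi * dot_rV y xi = 2 * pi * (dot_rV x xi + dot_rV y xi) - 2 * pi * dot_rV x xi); last by ring.
  by rewrite cosB; ring.
rewrite /osc_transform; under eq_Rintegral do rewrite E.
rewrite (Rintegral_shift x (F := fun z => osc 0 x xi * (p z * osc 0 z xi) +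
    osc (- (pi / 2)) x xi * (p z * osc (- (pi / 2)) z xi))); last first.
  by apply: rintegrable_measurable; apply: rintegrableD; apply: rintegrableZ; exact: rintegrable_osc.
rewrite Rintegral_add; try by apply: rintegrableZ; exact: rintegrable_osc.
by rewrite !RintegralZl//; exact: rintegrable_osc.
Qed.

Lemma cvg_dilate_seq u z : continuous u ->
  u (harmonic n *: z) @[n --> \oo] --> u 0.
Proof.
move=> cu; have h : harmonic n *: z @[n --> \oo] --> (0 : 'rV[R]_d).
  by rewrite -[X in _ --> X](scale0r z); apply: cvgZr_tmp; exact: cvg_harmonic.
exact: (cvg_comp _ _ h (cu 0)).
Qed.

Lemma rschwartz_le u : rschwartz u -> exists2 K, 0 <= K & forall x, `|u x| <= K.
Proof.
move=> [_ h]; have [K hK] := h 0%N; exists K; first exact: sbound_ge0 hK.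
by move=> x; have := hK [::] x (leq0n _); rewrite expr0 mul1r.
Qed.

Lemma cvg_Rintegral_dilate p q : rschwartz p -> rintegrable (lam d) q ->
  \int[lam d]_x (p (harmonic n *: x) * q x) @[n --> \oo] --> p 0 * \int[lam d]_x q x.
Proof.
move=> hp iq; have [K K0 hK] := rschwartz_le hp; rewrite -RintegralZl//.
apply: (Rintegral_dominated (f_ := fun n x => p (harmonic n *: x) * q x) (g := fun x => K * `|q x|)).
- move=> n; apply: measurable_funM; last exact: (rintegrable_measurable iq).
  by apply: measurable_dilate; exact: smooth_measurable hp.1.
- by move=> x; apply: cvgMr_tmp; apply: cvg_dilate_seq; exact: smooth_continuous hp.1.
- exact/rintegrableZ/rintegrable_abs.
- by move=> n x; rewrite normrM ler_wpM2r.
Qed.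

Section mass.
Variable w : 'rV[R]_d -> R.
Hypotheses (hw : rschwartz w) (w0 : w 0 = 1).

Definition inv_mass : R := \int[lam d]_x osc_transform 0 w x.

(** Insert [w (r *: xi)], move the transform onto [w] by the multiplication formula, and let r tend
    to 0 on both sides. [w] takes the place of the Gaussian of the classical proof, and the constant
    is the integral of its transform. *)
Lemma Rintegral_osc_transform p : rschwartz p ->
  \int[lam d]_xi osc_transform 0 p xi = inv_mass * p 0.
Proof.
move=> hp; have hW := rschwartz_osc_transform 0 hp; have hWw := rschwartz_osc_transform 0 hw.
have h1 := cvg_Rintegral_dilate hw (rschwartz_integrable hW).
have h2 := cvg_Rintegral_dilate hp (rschwartz_integrable hWw).
move: h1; rewrite w0 mul1r => h1.
have E : (fun n => \int[lam d]_x (w (harmonic n *: x) * osc_transform 0 p x)) =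
    (fun n => \int[lam d]_x (p (harmonic n *: x) * osc_transform 0 w x)).
  apply/funext => n; apply: osc_mult_dilate; last 2 first.
  - exact: rschwartz_integrable.
  - exact: rschwartz_integrable.
  - exact: harmonic_gt0.
rewrite E in h1; rewrite mulrC -/inv_mass.
by apply: (cvg_unique _ h1 h2).
Qed.

Lemma osc_inversion p x : rschwartz p ->
  osc_transform 0 (osc_transform 0 p) x +
  osc_transform (- (pi / 2)) (osc_transform (- (pi / 2)) p) x = inv_mass * p x.
Proof.
move=> hp; have hpx : rschwartz (fun y => p (x + y)).
  by have := rschwartz_shift x hp; under eq_fun do rewrite addrC.
have := Rintegral_osc_transform hpx; rewrite addr0 => <-.
rewrite -Rintegral_add.
- apply: eq_Rintegral => xi _; rewrite osc_transform_shift; last exact: rschwartz_integrable.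
  by rewrite !(oscC _ xi); congr (_ + _); exact: mulrC.
- by apply: rintegrable_osc; apply: rschwartz_integrable; exact: rschwartz_osc_transform.
- by apply: rintegrable_osc; apply: rschwartz_integrable; exact: rschwartz_osc_transform.
Qed.

Lemma osc_plancherel_eq p : rschwartz p ->
  \int[lam d]_xi (osc_transform 0 p xi ^+ 2 + osc_transform (- (pi / 2)) p xi ^+ 2) =
  inv_mass * \int[lam d]_x p x ^+ 2.
Proof.
move=> hp; have ip := rschwartz_integrable hp.
have hA := rschwartz_osc_transform 0 hp; have iA := rschwartz_integrable hA.
have hB := rschwartz_osc_transform (- (pi / 2)) hp; have iB := rschwartz_integrable hB.
have sqi q : rschwartz q -> rintegrable (lam d) (fun x => q x ^+ 2).
  by move=> hq; apply: rschwartz_integrable; apply: rschwartzM => //; exact: rschwartz_tame.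
rewrite Rintegral_add; try exact: sqi.
rewrite -RintegralZl//; last exact: sqi.
rewrite (osc_mult 0 ip iA) (osc_mult (- (pi / 2)) ip iB) -Rintegral_add.
- by apply: eq_Rintegral => x _; rewrite -mulrDr osc_inversion//; ring.
- apply: rschwartz_integrable; apply: rschwartzM; first exact: rschwartz_tame.
  exact: rschwartz_osc_transform.
- apply: rschwartz_integrable; apply: rschwartzM; first exact: rschwartz_tame.
  exact: rschwartz_osc_transform.
Qed.

End mass.

(** Zoom in at [a]: if the integral vanished, so would the integrals of u (a + r x) times [weight]
    for every r > 0. By Fatou the integral of their limit, u a times the mass of [weight], would be
    at most 0. *)
Lemma Rintegral_gt0 u a : continuous u -> (forall x, 0 <= u x) -> 0 < u a ->
  rintegrable (lam d) u -> 0 < \int[lam d]_x u x.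
Proof.
move=> cu u0 ua iu; rewrite lt0r Rintegral_ge0// andbT; apply/eqP => I0.
have mu := rintegrable_measurable iu.
have cua : continuous (fun x => u (a + x)).
  apply: (continuous_circ (f := u) (L := fun x : 'rV[R]_d => a + x)) => //.
  apply: continuous_rV => i; under eq_fun do rewrite mxE.
  by apply: continuous_add; [exact: cst_continuous|exact: coord_continuous].
have iw := @rintegrable_weight R d.
have w1 x : `|weight x| <= 1 :> R.
  rewrite ger0_norm ?weightP_ge0// /weight; apply: prodr_ile1 => i _.
  by rewrite invr_ge0 ltW ?weight_factor_gt0// invf_le1 ?weight_factor_gt0// lerDl sqr_ge0.
have hc x : (fun n => (u (a + harmonic n *: x) * weight x)%:E) @ \oo --> (u a * weight x)%:E.
  apply/fine_cvgP; split; first exact: nearW.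
  by apply: cvgMr_tmp; have := cvg_dilate_seq x cua; rewrite addr0.
have mi n : measurable_fun setT (fun x => (u (a + harmonic n *: x) * weight x)%:E).
  apply/measurable_EFinP; apply: measurable_funM; last exact: (rintegrable_measurable iw).
  by apply: (@measurable_dilate _ (fun x => u (a + x))); exact: measurable_shift.
have i0 n x : (0 <= (u (a + harmonic n *: x) * weight x)%:E)%E.
  by rewrite lee_fin mulr_ge0 ?weightP_ge0.
have Z n : (\int[lam d]_x (u (a + harmonic n *: x) * weight x)%:E <= 0)%E.
  have hn : 0 < harmonic n :> R by exact: harmonic_gt0.
  apply: (@le_trans _ _ (\int[lam d]_x (u (a + harmonic n *: x))%:E)%E).
    apply: ge0_le_integral_EFin.
    - exact: (iffLR (measurable_EFinP _ _) (mi n)).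
    - by apply: (@measurable_dilate _ (fun x => u (a + x))); exact: measurable_shift.
    - move=> x; rewrite mulr_ge0 ?weightP_ge0//= ler_piMr//.
      by apply: le_trans (ler_norm _) _.
  have ia := rintegrable_dilate hn (rintegrable_shift a iu).
  rewrite (rintegrable_EFin ia) lee_fin.
  have := Rintegral_dilate hn (measurable_shift a mu).
  rewrite Rintegral_shift// I0 => /esym/eqP; rewrite mulf_eq0 => /orP[|/eqP-> //].
  by rewrite expf_eq0 gt_eqF ?andbF.
have := fatou_le mi i0 hc Z.
rewrite ge0_integralZl_real//; last 2 first.
- exact: (rintegrable_measurable iw).
- by move=> x; exact: weightP_ge0.
rewrite integral_weight -EFinM lee_fin leNgt => /negP; apply.
by rewrite mulr_gt0// exprn_gt0// pi_gt0.
Qed.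

Section plancherel.
Variable w : 'rV[R]_d -> R.
Hypotheses (hw : rschwartz w) (w0 : w 0 = 1) (w_ge0 : forall x, 0 <= w x).

(** Plancherel for [w] itself: the left side is positive, because the cosine transform of [w] at 0
    is the integral of [w], and on the right the constant multiplies a nonnegative number. *)
Lemma inv_mass_gt0 : 0 < inv_mass w.
Proof.
have iw := rschwartz_integrable hw.
have cw := smooth_continuous hw.1.
have Iw : 0 < \int[lam d]_x w x by apply: (@Rintegral_gt0 w 0) => //; rewrite w0.
have E0 : osc_transform 0 w 0 = \int[lam d]_x w x.
  apply: eq_Rintegral => x _; rewrite /osc (_ : dot_rV x 0 = 0) ?mulr0 ?addr0 ?cos0 ?mulr1//.
  by rewrite /dot_rV big1// => i _; rewrite mxE mulr0.
have hA := rschwartz_osc_transform 0 hw.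
have hB := rschwartz_osc_transform (- (pi / 2)) hw.
have sq q : rschwartz q -> rschwartz (fun x => q x ^+ 2).
  by move=> hq; apply: rschwartzM => //; exact: rschwartz_tame.
have hAB := rschwartzD (sq _ hA) (sq _ hB).
have pos : 0 < \int[lam d]_xi (osc_transform 0 w xi ^+ 2 + osc_transform (- (pi / 2)) w xi ^+ 2).
  apply: (@Rintegral_gt0 _ 0).
  - exact: smooth_continuous hAB.1.
  - by move=> x; rewrite addr_ge0// sqr_ge0.
  - by rewrite ltr_pwDl ?sqr_ge0// E0 exprn_gt0.
  - exact: rschwartz_integrable.
have := osc_plancherel_eq hw w0 hw => E; rewrite E in pos.
have sqw : 0 <= \int[lam d]_x w x ^+ 2 by apply: Rintegral_ge0 => x _; exact: sqr_ge0.
by rewrite ltNge; apply/negP => c0; move: pos; rewrite ltNge mulr_le0_ge0.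
Qed.

(** The constant of Young's inequality for averages against dilates of the transform of [w]. *)
Definition osc_mass : R := \int[lam d]_x `|osc_transform 0 w x|.

Lemma osc_mass_ge0 : 0 <= osc_mass.
Proof. exact: Rintegral_ge0. Qed.

(** Infinite integrals are included: the left side is then 0. *)
Lemma le_EFin_Rintegral F : measurable_fun setT F ->
  ((`|\int[lam d]_x F x|)%:E <= \int[lam d]_x (`|F x|)%:E)%E.
Proof.
move=> mF; apply: (@le_trans _ _ `|\int[lam d]_x (F x)%:E|%E).
  by rewrite /Rintegral; case: (\int[_]_x _)%E => //=; rewrite normr0 leey.
by apply: (le_abse_integral (lam d) measurableT); exact/measurable_EFinP.
Qed.

Lemma measurable_sqr F : measurable_fun setT F -> measurable_fun setT (fun x => F x ^+ 2).
Proof. by move=> mF; exact: measurable_funM. Qed.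

Lemma osc_plancherel_dilate F (r : R) : 0 < r -> rintegrable (lam d) F ->
  \int[lam d]_xi (w (r *: xi) * (osc_transform 0 F xi ^+ 2 + osc_transform (- (pi / 2)) F xi ^+ 2)) =
  \int[lam d]_x \int[lam d]_z (F x * (F (x + r *: z) * osc_transform 0 w z)).
Proof.
move=> r0 hF; have mF := rintegrable_measurable hF; have iw := rschwartz_integrable hw.
have iwr := rintegrable_dilate r0 iw.
have iA c : rintegrable (lam d) (fun xi => w (r *: xi) * osc_transform c F xi).
  under eq_fun do rewrite mulrC.
  apply: (rintegrableM (C := \int[lam d]_x `|F x|) iwr (measurable_osc_transform c mF)) => x.
  by apply: osc_transform_le mF (rintegrable_abs hF) _.
have iA2 c : rintegrable (lam d) (fun xi => w (r *: xi) * osc_transform c F xi * osc_transform c F xi).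
  under eq_fun do rewrite mulrC.
  apply: (rintegrableM (C := \int[lam d]_x `|F x|) (iA c) (measurable_osc_transform c mF)) => x.
  by apply: osc_transform_le mF (rintegrable_abs hF) _.
have iF c : rintegrable (lam d) (fun x => F x * osc_transform c (fun xi => w (r *: xi) * osc_transform c F xi) x).
  under eq_fun do rewrite mulrC.
  have mA := rintegrable_measurable (iA c).
  apply: (rintegrableM (C := \int[lam d]_x `|w (r *: x) * osc_transform c F x|) hF (measurable_osc_transform c mA)) => x.
  by apply: osc_transform_le mA (rintegrable_abs (iA c)) _.
transitivity (\int[lam d]_xi (w (r *: xi) * osc_transform 0 F xi * osc_transform 0 F xi) +
   \int[lam d]_xi (w (r *: xi) * osc_transform (- (pi / 2)) F xi * osc_transform (- (pi / 2)) F xi)).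
  by rewrite -Rintegral_add//; apply: eq_Rintegral => xi _; ring.
rewrite (osc_mult _ hF (iA 0)) (osc_mult _ hF (iA (- (pi / 2)))) -Rintegral_add//.
apply: eq_Rintegral => x _; rewrite -mulrDr.
have iFx := rintegrable_shift x hF.
have -> : osc_transform 0 (fun xi => w (r *: xi) * osc_transform 0 F xi) x +
    osc_transform (- (pi / 2)) (fun xi => w (r *: xi) * osc_transform (- (pi / 2)) F xi) x =
    \int[lam d]_xi (w (r *: xi) * osc_transform 0 (fun y => F (x + y)) xi).
  rewrite -Rintegral_add; try exact: rintegrable_osc.
  apply: eq_Rintegral => xi _; rewrite osc_transform_shift// !(oscC _ xi); ring.
rewrite (osc_mult_dilate 0 r0 iFx iw) -RintegralZl//.
have hW := rschwartz_osc_transform 0 hw.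
have [K K0 hK] := rschwartz_le hW.
under eq_fun do rewrite /= mulrC.
apply: (rintegrableM (C := K) _ (smooth_measurable hW.1) hK).
exact: (rintegrable_dilate r0 iFx).
Qed.

(** The factor [w (r *: xi)] turns the squared transforms into a pairing of [F] with its own
    translates by r z, averaged against the transform of [w]. Bounding a product by the sum of the
    two squares gives an estimate uniform in r, whence the factor 2, and Fatou removes the factor as
    r tends to 0. In this form the inequality holds for every function in both L1 and L2, such as
    the dual functions used later. *)
Lemma osc_plancherel_le F : rintegrable (lam d) F -> rintegrable (lam d) (fun x => F x ^+ 2) ->
  (\int[lam d]_xi (osc_transform 0 F xi ^+ 2 + osc_transform (- (pi / 2)) F xi ^+ 2)%:E <=
   (2 * osc_mass * \int[lam d]_x F x ^+ 2)%:E)%E.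
Proof.
move=> hF hF2; have mF := rintegrable_measurable hF; have mF2 := measurable_sqr mF.
pose S xi := osc_transform 0 F xi ^+ 2 + osc_transform (- (pi / 2)) F xi ^+ 2.
have mS : measurable_fun setT S.
  by apply: measurable_funD; apply: measurable_sqr; exact: measurable_osc_transform.
have S0 xi : 0 <= S xi by rewrite addr_ge0// sqr_ge0.
have hk := rschwartz_osc_transform 0 hw.
have mk := smooth_measurable hk.1.
have ik := rintegrable_abs (rschwartz_integrable hk).
have mak : measurable_fun setT (fun z => `|osc_transform 0 w z|) by exact: measurableT_comp.
apply: (@fatou_le _ _ _ (lam d) (fun n xi => (w (harmonic n *: xi) * S xi)%:E)).
- move=> n; apply/measurable_EFinP; apply: measurable_funM => //.
  by apply: measurable_dilate; exact: smooth_measurable hw.1.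
- by move=> n x; rewrite lee_fin mulr_ge0.
- move=> xi; apply/fine_cvgP; split; first exact: nearW.
  have h : w (harmonic n *: xi) * S xi @[n --> \oo] --> w 0 * S xi.
    by apply: cvgMr_tmp; apply: cvg_dilate_seq; exact: smooth_continuous hw.1.
  by move: h; rewrite w0 mul1r.
move=> n; have r0 : 0 < harmonic n :> R by exact: harmonic_gt0.
set r := harmonic n in r0 *.
have iwr := rintegrable_dilate r0 (rschwartz_integrable hw).
have iS : rintegrable (lam d) (fun xi => w (r *: xi) * S xi).
  under eq_fun do rewrite mulrC.
  apply: (rintegrableM (C := (\int[lam d]_x `|F x|) ^+ 2 + (\int[lam d]_x `|F x|) ^+ 2) iwr mS) => x.
  have hA c := osc_transform_le c x mF (rintegrable_abs hF) (fun x => lexx _).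
  have sq c : osc_transform c F x ^+ 2 <= (\int[lam d]_x `|F x|) ^+ 2.
    rewrite -(real_normK (num_real (osc_transform c F x))).
    by rewrite lerXn2r// nnegrE// Rintegral_ge0.
  by rewrite ger0_norm//; exact: lerD.
rewrite (rintegrable_EFin iS) osc_plancherel_dilate//.
have mjoint : measurable_fun setT (fun t : 'rV[R]_d * 'rV[R]_d =>
    F t.1 * (F (t.1 + r *: t.2) * osc_transform 0 w t.2)).
  apply: measurable_funM; first exact: (measurableT_comp mF).
  by apply: measurable_funM; [exact: measurable_comp_dilate2|exact: (measurableT_comp mk)].
have mjoint2 : measurable_fun setT (fun t : 'rV[R]_d * 'rV[R]_d =>
    F (t.1 + r *: t.2) ^+ 2 * `|osc_transform 0 w t.2|).
  by apply: measurable_funM; [exact: (measurable_funM (measurable_comp_dilate2 r mF) (measurable_comp_dilate2 r mF))|exact: (measurableT_comp mak)].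
have mjoint1 : measurable_fun setT (fun t : 'rV[R]_d * 'rV[R]_d =>
    F t.1 ^+ 2 * `|osc_transform 0 w t.2|).
  by apply: measurable_funM; [exact: (measurableT_comp mF2)|exact: (measurableT_comp mak)].
have J1 x : (\int[lam d]_z (F x ^+ 2 * `|osc_transform 0 w z|)%:E = (osc_mass * F x ^+ 2)%:E)%E.
  by rewrite ge0_integralZl_real ?sqr_ge0// (rintegrable_EFin ik) -EFinM mulrC.
have J2 z : (\int[lam d]_x (F (x + r *: z) ^+ 2 * `|osc_transform 0 w z|)%:E =
    ((\int[lam d]_x F x ^+ 2) * `|osc_transform 0 w z|)%:E)%E.
  under eq_integral do rewrite mulrC addrC.
  rewrite ge0_integralZl_real//; last 2 first.
  - by apply: measurable_sqr; exact: measurable_shift.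
  - by move=> x; exact: sqr_ge0.
  rewrite (integral_shift_rV (r *: z) (F := fun x => (F x ^+ 2)%:E)); last exact/measurable_EFinP.
  by rewrite (rintegrable_EFin hF2) -EFinM mulrC.
(* [H1] and [H2] below collect the two squares; translation invariance gives both the same
   integral. *)
apply: (@le_trans _ _ (`|\int[lam d]_x \int[lam d]_z (F x * (F (x + r *: z) * osc_transform 0 w z))|)%:E).
  by rewrite lee_fin ler_norm.
have mG := measurable_Rintegral (lam d)
  (f := fun x z => F x * (F (x + r *: z) * osc_transform 0 w z)) mjoint.
apply: le_trans (le_EFin_Rintegral mG) _.
pose H1 x := (\int[lam d]_z (F x ^+ 2 * `|osc_transform 0 w z|)%:E)%E.
pose H2 x := (\int[lam d]_z (F (x + r *: z) ^+ 2 * `|osc_transform 0 w z|)%:E)%E.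
have mH1 : measurable_fun setT H1.
  apply: (measurable_fun_fubini_tonelli_F (fun t : 'rV[R]_d * 'rV[R]_d =>
    (F t.1 ^+ 2 * `|osc_transform 0 w t.2|)%:E)); first exact/measurable_EFinP.
  by move=> t; rewrite lee_fin mulr_ge0 ?sqr_ge0.
have mH2 : measurable_fun setT H2.
  apply: (measurable_fun_fubini_tonelli_F (fun t : 'rV[R]_d * 'rV[R]_d =>
    (F (t.1 + r *: t.2) ^+ 2 * `|osc_transform 0 w t.2|)%:E)); first exact/measurable_EFinP.
  by move=> t; rewrite lee_fin mulr_ge0 ?sqr_ge0.
have H10 x : (0 <= H1 x)%E by apply: integral_ge0 => z _; rewrite lee_fin mulr_ge0 ?sqr_ge0.
have H20 x : (0 <= H2 x)%E by apply: integral_ge0 => z _; rewrite lee_fin mulr_ge0 ?sqr_ge0.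
apply: (@le_trans _ _ (\int[lam d]_x (H1 x + H2 x))%E).
  apply: ge0_le_integral => //.
  - by apply/measurable_EFinP; exact: measurableT_comp.
  - exact: emeasurable_funD.
  - move=> x _.
    have mz1 : measurable_fun setT (fun z => F x * (F (x + r *: z) * osc_transform 0 w z)).
      exact: (measurableT_comp mjoint (measurable_pair1 x)).
    have mz2 : measurable_fun setT (fun z => F x ^+ 2 * `|osc_transform 0 w z|).
      exact: (measurableT_comp mjoint1 (measurable_pair1 x)).
    have mz3 : measurable_fun setT (fun z => F (x + r *: z) ^+ 2 * `|osc_transform 0 w z|).
      exact: (measurableT_comp mjoint2 (measurable_pair1 x)).
    apply: le_trans (le_EFin_Rintegral mz1) _.
    rewrite -ge0_integralD//; last 4 first.
    - by move=> z _; rewrite lee_fin mulr_ge0 ?sqr_ge0.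
    - exact/measurable_EFinP.
    - by move=> z _; rewrite lee_fin mulr_ge0 ?sqr_ge0.
    - exact/measurable_EFinP.
    apply: ge0_le_integral_EFin; [exact: measurableT_comp|exact: measurable_funD|] => z.
    rewrite normr_ge0/= mulrA normrM -mulrDl ler_wpM2r//.
    rewrite ler_norml; apply/andP; split; nra.
rewrite ge0_integralD//.
have -> : (\int[lam d]_x H2 x = (osc_mass * \int[lam d]_x F x ^+ 2)%:E)%E.
  rewrite /H2 (fubini_tonelli (fun t : 'rV[R]_d * 'rV[R]_d =>
    (F (t.1 + r *: t.2) ^+ 2 * `|osc_transform 0 w t.2|)%:E))/=; last 2 first.
  - exact/measurable_EFinP.
  - by move=> t; rewrite lee_fin mulr_ge0 ?sqr_ge0.
  under eq_integral do rewrite J2.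
  rewrite ge0_integralZl_real ?Rintegral_ge0//; last by move=> x _; exact: sqr_ge0.
  by rewrite (rintegrable_EFin ik) -EFinM mulrC.
have -> : (\int[lam d]_x H1 x = (osc_mass * \int[lam d]_x F x ^+ 2)%:E)%E.
  under eq_integral do rewrite /H1 J1.
  rewrite ge0_integralZl_real ?osc_mass_ge0//; last by move=> x; exact: sqr_ge0.
  by rewrite (rintegrable_EFin hF2) -EFinM.
by rewrite -EFinD lee_fin le_eqVlt; apply/orP; left; apply/eqP; ring.
Qed.

End plancherel.

End inversion.

(** * Complex Schwartz functions and tempered distributions *)

Section complex_parts.
Context {R : realType}.
Implicit Types (x y z : R[i]) (a : R).
Local Notation Re := (@complex.Re R).
Local Notation Im := (@complex.Im R).

Lemma complex_eq x y : Re x = Re y -> Im x = Im y -> x = y.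
Proof. by case: x => a b; case: y => c d /= -> ->. Qed.

Lemma cReD x y : Re (x + y) = Re x + Re y.
Proof. by case: x => a b; case: y. Qed.

Lemma cImD x y : Im (x + y) = Im x + Im y.
Proof. by case: x => a b; case: y. Qed.

Lemma cReN x : Re (- x) = - Re x.
Proof. by case: x. Qed.

Lemma cImN x : Im (- x) = - Im x.
Proof. by case: x. Qed.

Lemma cReM x y : Re (x * y) = Re x * Re y - Im x * Im y.
Proof. by case: x => a b; case: y. Qed.

Lemma cImM x y : Im (x * y) = Re x * Im y + Im x * Re y.
Proof. by case: x => a b; case: y. Qed.

Lemma normc_sqr x : normc x ^+ 2 = Re x ^+ 2 + Im x ^+ 2.
Proof. by case: x => a b /=; rewrite sqr_sqrtr// addr_ge0// sqr_ge0. Qed.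

Lemma normc_ge0 x : 0 <= normc x.
Proof. by case: x => a b; exact: sqrtr_ge0. Qed.

Lemma normc_Re x : `|Re x| <= normc x.
Proof.
rewrite -(@ler_pXn2r _ 2) ?nnegrE ?normc_ge0// normc_sqr real_normK ?num_real//.
by rewrite lerDl sqr_ge0.
Qed.

Lemma normc_Im x : `|Im x| <= normc x.
Proof.
rewrite -(@ler_pXn2r _ 2) ?nnegrE ?normc_ge0// normc_sqr real_normK ?num_real//.
by rewrite lerDr sqr_ge0.
Qed.

Lemma normc_le x : normc x <= `|Re x| + `|Im x|.
Proof.
rewrite -(@ler_pXn2r _ 2) ?nnegrE ?normc_ge0 ?addr_ge0// normc_sqr sqrrD.
by rewrite !real_normK ?num_real// addrAC lerDl mulrn_wge0// mulr_ge0.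
Qed.

Lemma normc_real a : normc (a%:C)%C = `|a|.
Proof. by rewrite /= expr0n/= addr0 sqrtr_sqr. Qed.

Lemma normc_cexp a : normc (cexp a) = 1.
Proof. by rewrite /= cos2Dsin2 sqrtr1. Qed.

End complex_parts.

Section complex_functions.
Context {R : realType}.
Local Notation lam := (@lebesgue_rV R).
Local Notation Re := (@complex.Re R).
Local Notation Im := (@complex.Im R).
Variable d : nat.
Implicit Types (f g h psi : 'rV[R]_d -> R[i]) (x xi : 'rV[R]_d).

Lemma cmeasurableM f g : cmeasurable f -> cmeasurable g -> cmeasurable (fun x => f x * g x).
Proof.
move=> [f1 f2] [g1 g2]; split.
  under eq_fun do rewrite cReM.
  by apply: measurable_funB; exact: measurable_funM.
under eq_fun do rewrite cImM.
by apply: measurable_funD; exact: measurable_funM.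
Qed.

Lemma cmeasurableD f g : cmeasurable f -> cmeasurable g -> cmeasurable (fun x => f x + g x).
Proof.
move=> [f1 f2] [g1 g2]; split.
  by under eq_fun do rewrite cReD; exact: measurable_funD.
by under eq_fun do rewrite cImD; exact: measurable_funD.
Qed.

Lemma cmeasurableN f : cmeasurable f -> cmeasurable (fun x => - f x).
Proof.
move=> [f1 f2]; split.
  by under eq_fun do rewrite cReN; exact: measurable_funN.
by under eq_fun do rewrite cImN; exact: measurable_funN.
Qed.

Lemma cmeasurable_cst (a : R[i]) : cmeasurable (fun _ : 'rV[R]_d => a).
Proof. by split; exact: measurable_cst. Qed.

Lemma measurable_normc f : cmeasurable f -> measurable_fun setT (fun x => normc (f x)).
Proof.
move=> [f1 f2]; rewrite (_ : (fun x => _) = (fun x => Num.sqrt (Re (f x) ^+ 2 + Im (f x) ^+ 2))).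
  apply: measurableT_comp; first by apply: continuous_measurable_fun; exact: sqrt_continuous.
  by apply: measurable_funD; exact: measurable_funM.
by apply/funext => x; case: (f x).
Qed.

Lemma schwartz_seminormE N f : schwartz f ->
  [/\ schwartz_seminorm N f = (fine (schwartz_seminorm N f))%:E,
      sbound N (fine (schwartz_seminorm N f)) (fun x => Re (f x)) &
      sbound N (fine (schwartz_seminorm N f)) (fun x => Im (f x))].
Proof.
move=> [_ h].
have le1 s x : (size s <= N)%N ->
    (((1 + norm2_rV x) ^+ N * normc (cpartial s f x))%:E <= schwartz_seminorm N f)%E.
  by move=> sN; apply: ereal_sup_ubound; exists s, x.
have E : (fine (schwartz_seminorm N f))%:E = schwartz_seminorm N f.
  rewrite fineK// fin_numElt h andbT.
  by apply: lt_le_trans (le1 [::] 0 _); first exact: ltNyr.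
split=> // s x sN; have := le1 s x sN; rewrite -E lee_fin; apply: le_trans;
  rewrite ler_wpM2l ?weight_ge0//.
  exact: (normc_Re (cpartial s f x)).
exact: (normc_Im (cpartial s f x)).
Qed.

Lemma schwartz_parts f : schwartz f ->
  rschwartz (fun x => Re (f x)) /\ rschwartz (fun x => Im (f x)).
Proof.
move=> hf; have [[s1 s2] _] := hf.
by split; split=> // N; have [_ h1 h2] := schwartz_seminormE N hf; eexists; eassumption.
Qed.

Lemma seminorm_le N K1 K2 f : sbound N K1 (fun x => Re (f x)) ->
  sbound N K2 (fun x => Im (f x)) -> (schwartz_seminorm N f <= (K1 + K2)%:E)%E.
Proof.
move=> h1 h2; apply: ge_ereal_sup => _ [s [x [sN ->]]]; rewrite lee_fin.
apply: le_trans (ler_wpM2l (weight_ge0 x N) (normc_le _)) _.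
by rewrite mulrDr lerD//; [exact: h1|exact: h2].
Qed.

Lemma partsP_schwartz f : rschwartz (fun x => Re (f x)) -> rschwartz (fun x => Im (f x)) ->
  schwartz f.
Proof.
move=> [s1 h1] [s2 h2]; split=> // N; have [K1 b1] := h1 N; have [K2 b2] := h2 N.
exact: le_lt_trans (seminorm_le b1 b2) (ltry _).
Qed.

Lemma schwartz_cmeasurable f : schwartz f -> cmeasurable f.
Proof.
by move=> /schwartz_parts[h1 h2]; split; apply: smooth_measurable; [exact: h1.1|exact: h2.1].
Qed.

Lemma schwartzD f g : schwartz f -> schwartz g -> schwartz (fun x => f x + g x).
Proof.
move=> /schwartz_parts[f1 f2] /schwartz_parts[g1 g2]; apply: partsP_schwartz.
  by under eq_fun do rewrite cReD; exact: rschwartzD.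
by under eq_fun do rewrite cImD; exact: rschwartzD.
Qed.

Lemma schwartzZ (a : R[i]) f : schwartz f -> schwartz (fun x => a * f x).
Proof.
move=> /schwartz_parts[f1 f2]; apply: partsP_schwartz.
  by under eq_fun do rewrite cReM; apply: rschwartzD; [|apply: rschwartzN]; exact: rschwartzZ.
by under eq_fun do rewrite cImM; apply: rschwartzD; exact: rschwartzZ.
Qed.

Lemma schwartz_realM (w : 'rV[R]_d -> R) f : tame w -> schwartz f ->
  schwartz (fun x => (w x)%:C%C * f x).
Proof.
move=> tw /schwartz_parts[f1 f2]; apply: partsP_schwartz.
  by under eq_fun do rewrite cReM /= mul0r subr0; exact: rschwartzM.
by under eq_fun do rewrite cImM /= mul0r addr0; exact: rschwartzM.
Qed.

(** Continuity restated with real bounds on the two parts, the form that the calculus of [sbound]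
    produces. *)
Lemma tempered_bound (u : @Defs.distribution R d) : tempered u -> exists C (N : nat), 0 <= C /\
  forall psi (K1 K2 : R), schwartz psi -> sbound N K1 (fun x => Re (psi x)) ->
  sbound N K2 (fun x => Im (psi x)) -> normc (u psi) <= C * (K1 + K2).
Proof.
move=> [_ [C [N h]]]; exists `|C|, N; split=> // psi K1 K2 hp b1 b2.
rewrite -lee_fin; apply: le_trans (h psi hp) _; rewrite EFinM.
have p0 : (0 <= schwartz_seminorm N psi)%E.
  apply: le_trans (ereal_sup_ubound _); last by exists [::], 0.
  by rewrite lee_fin mulr_ge0 ?weight_ge0// normc_ge0.
apply: (@le_trans _ _ (`|C|%:E * schwartz_seminorm N psi)%E).
  by apply: lee_wpmul2r => //; rewrite lee_fin ler_norm.
by apply: lee_wpmul2l; [rewrite lee_fin|exact: seminorm_le].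
Qed.

Lemma temperedD (u : @Defs.distribution R d) psi phi : tempered u -> schwartz psi -> schwartz phi ->
  u (fun x => psi x + phi x) = u psi + u phi.
Proof.
move=> [hu _] h1 h2; have := hu 1 psi phi h1 h2; rewrite mul1r => <-.
by congr u; apply/funext => x; rewrite mul1r.
Qed.

Section cutoff.
Variable chi : 'rV[R]_d -> R.
Hypotheses (chi_smooth : smooth_real chi)
  (chi1 : forall x, norm2_rV x <= 1 -> chi x = 1)
  (chi0 : forall x, 3 / 2 <= norm2_rV x -> chi x = 0).

Lemma rschwartz_cutoff : rschwartz chi.
Proof.
split=> // M; have [K hK] := partial_cutoff_bounded chi_smooth chi0 M.
have K0 : 0 <= K by apply: le_trans (hK [::] 0 _).
exists ((1 + 3 / 2) ^+ M * K) => s x sM.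
have [x2|x2] := leP (norm2_rV x) (3 / 2); last first.
  by rewrite (partial_cutoff_far chi0)// normr0 mulr0 mulr_ge0// exprn_ge0.
apply: ler_pM; rewrite ?weight_ge0//; last exact: hK.
by apply: lerXn2r; rewrite ?nnegrE ?lerD2l// addr_ge0// norm2_ge0.
Qed.

Lemma chi_at0 : chi 0 = 1.
Proof. by apply: chi1; rewrite -(scale0r 0) norm2Z normr0 mul0r. Qed.

Lemma test_cutoff (r : R) psi : 0 < r <= 1 -> schwartz psi ->
  test_function (fun x => (chi (r *: x))%:C%C * psi x).
Proof.
move=> /andP[r0 r1] hp; split.
  by have [] := schwartz_realM (tame_cutoff chi_smooth chi0 (r := r) _) hp; rewrite ?(ltW r0).
exists (3 / 2 / r) => x hx; rewrite chi0 ?mul0r// norm2Z gtr0_norm//.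
by rewrite -ler_pdivrMl// mulrC ltW.
Qed.

(** The error is [u] applied to (1 - chi (r x)) psi, up to sign, and this function is of order r in
    each seminorm by [sbound_oneB_cutoff]. *)
Lemma tempered_cutoff (u : @Defs.distribution R d) psi : tempered u -> schwartz psi ->
  exists C, forall r : R, 0 < r <= 1 ->
    normc (u (fun x => (chi (r *: x))%:C%C * psi x) - u psi) <= C * r.
Proof.
move=> tu hp; have [C [N [C0 hC]]] := tempered_bound tu.
have [p1 p2] := schwartz_parts hp.
have [A hA] := sbound_oneB_cutoff chi_smooth chi1 chi0 N.
have [K1 b1] := p1.2 N.+1; have [K2 b2] := p2.2 N.+1.
exists (C * (A * K1 + A * K2)) => r r01.
have tw : tame (fun x => chi (r *: x)).
  by apply: (tame_cutoff chi_smooth chi0); case/andP: r01 => /ltW-> ->.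
have hc := schwartz_realM tw hp.
have E := tu.1 (-1) _ _ hp hc; rewrite mulN1r addrC in E; rewrite -E.
have e1 : (fun x => Re (-1 * psi x + (chi (r *: x))%:C%C * psi x)) =
    (fun x => - ((1 - chi (r *: x)) * Re (psi x))).
  by apply/funext => x; rewrite cReD mulN1r cReN cReM /=; ring.
have e2 : (fun x => Im (-1 * psi x + (chi (r *: x))%:C%C * psi x)) =
    (fun x => - ((1 - chi (r *: x)) * Im (psi x))).
  by apply/funext => x; rewrite cImD mulN1r cImN cImM /=; ring.
have sw : smooth_real (fun x => 1 - chi (r *: x)).
  exact: (smoothD (smooth_cst d 1).1 (smoothN (smooth_dilate chi_smooth r).1).1).1.
have -> : C * (A * K1 + A * K2) * r = C * (A * r * K1 + A * r * K2) by ring.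
apply: hC.
- by apply: schwartzD hc; exact: schwartzZ.
- by rewrite e1; apply: sboundN; [exact: (smoothM sw p1.1).1|exact: hA r01 p1.1 b1].
- by rewrite e2; apply: sboundN; [exact: (smoothM sw p2.1).1|exact: hA r01 p2.1 b2].
Qed.

(* The polynomial weight makes the pairings with Schwartz functions absolutely
   convergent. *)
Definition slow h := cmeasurable h /\ exists M : nat,
  rintegrable (lam d) (fun x => normc (h x) * ((1 + norm2_rV x) ^+ M)^-1).

Lemma slow_integrable h (b p : 'rV[R]_d -> R) : slow h -> measurable_fun setT b ->
  (forall x, `|b x| <= normc (h x)) -> rschwartz p -> rintegrable (lam d) (fun x => b x * p x).
Proof.
move=> [mh [M hM]] mb hb hp; have [K hK] := hp.2 M.
apply: (rintegrable_le (g := fun x => K * (normc (h x) * ((1 + norm2_rV x) ^+ M)^-1))).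
- by apply: measurable_funM => //; exact: smooth_measurable hp.1.
- exact: rintegrableZ.
- move=> x; rewrite normrM mulrCA; apply: ler_pM => //.
  rewrite ler_pdivlMr ?exprn_gt0 ?ltr_pwDl ?norm2_ge0// mulrC.
  exact: hK [::] x (leq0n _).
Qed.

Lemma slow_integrable_parts h psi : slow h -> schwartz psi ->
  rintegrable (lam d) (fun x => Re (h x * psi x)) /\
  rintegrable (lam d) (fun x => Im (h x * psi x)).
Proof.
move=> sh /schwartz_parts[p1 p2]; have [[m1 m2] _] := sh; split.
  under eq_fun do rewrite cReM.
  apply: rintegrableB; apply: (slow_integrable (h := h)) => // x; [exact: normc_Re|exact: normc_Im].
under eq_fun do rewrite cImM.
apply: rintegrableD; apply: (slow_integrable (h := h)) => // x; [exact: normc_Re|exact: normc_Im].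
Qed.

Lemma cvg_harmonic_bound (a : nat -> R) l (C : R) :
  (forall n, `|a n - l| <= C * harmonic n) -> a n @[n --> \oo] --> l.
Proof.
move=> h; apply/cvgrPdist_le => e e0.
have c0 : (fun n => C * harmonic n) @ \oo --> (0 : R).
  by rewrite -[X in _ --> X](mulr0 C); apply: cvgMl_tmp; exact: cvg_harmonic.
apply: filterS (cvgr_lt 0 c0 e e0) => n /ltW; rewrite distrC.
exact: le_trans (h n).
Qed.

Lemma harmonic01 (n : nat) : (0 < harmonic n :> R) && (harmonic n <= 1 :> R).
Proof. by rewrite harmonic_gt0 /= invf_le1// ler1n. Qed.

Lemma cvg_tempered_cutoff (u : @Defs.distribution R d) psi : tempered u -> schwartz psi ->
  (Re (u (fun x => (chi (harmonic n *: x))%:C%C * psi x)) @[n --> \oo] --> Re (u psi)) /\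
  (Im (u (fun x => (chi (harmonic n *: x))%:C%C * psi x)) @[n --> \oo] --> Im (u psi)).
Proof.
move=> tu hp; have [C hC] := tempered_cutoff tu hp; split.
  apply: (@cvg_harmonic_bound _ _ C) => n; rewrite -cReN -cReD.
  exact: le_trans (normc_Re _) (hC _ (harmonic01 n)).
apply: (@cvg_harmonic_bound _ _ C) => n; rewrite -cImN -cImD.
exact: le_trans (normc_Im _) (hC _ (harmonic01 n)).
Qed.

(** [distr_of_fun] prescribes the pairing on test functions only. Cutoffs carry it to Schwartz
    functions: continuity of [v] on one side, dominated convergence on the other. *)
Lemma distr_schwartz (v : @Defs.distribution R d) h psi : distr_of_fun v h -> slow h ->
  schwartz psi -> v psi = cintegral (fun x => h x * psi x).
Proof.
move=> [tv _ hv] sh hp; have [c1 c2] := cvg_tempered_cutoff tv hp.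
have [i1 i2] := slow_integrable_parts sh hp.
have E n := hv _ (test_cutoff (harmonic01 n) hp).
have h1 := cvg_Rintegral_dilate rschwartz_cutoff i1; rewrite chi_at0 mul1r in h1.
have h2 := cvg_Rintegral_dilate rschwartz_cutoff i2; rewrite chi_at0 mul1r in h2.
have F1 : (fun n => Re (v (fun x => (chi (harmonic n *: x))%:C%C * psi x))) =
    (fun n => \int[lam d]_x (chi (harmonic n *: x) * Re (h x * psi x))).
  by apply/funext => n; rewrite E /=; apply: eq_Rintegral => x _; rewrite !cReM !cImM /=; ring.
have F2 : (fun n => Im (v (fun x => (chi (harmonic n *: x))%:C%C * psi x))) =
    (fun n => \int[lam d]_x (chi (harmonic n *: x) * Im (h x * psi x))).
  by apply/funext => n; rewrite E /=; apply: eq_Rintegral => x _; rewrite !cImM !cReM /=; ring.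
rewrite F1 in c1; rewrite F2 in c2.
by apply: complex_eq => /=; [exact: (cvg_unique _ c1 h1)|exact: (cvg_unique _ c2 h2)].
Qed.

(** Every dyadic piece comes with its own distribution attached to the same function; this makes
    them interchangeable. *)
Lemma distr_of_fun_unique (u u' : @Defs.distribution R d) f psi : distr_of_fun u f ->
  distr_of_fun u' f -> schwartz psi -> u psi = u' psi.
Proof.
move=> [tu _ hu] [tu' _ hu'] hp; have [c1 c2] := cvg_tempered_cutoff tu hp.
have [c1' c2'] := cvg_tempered_cutoff tu' hp.
have E n : u (fun x => (chi (harmonic n *: x))%:C%C * psi x) =
    u' (fun x => (chi (harmonic n *: x))%:C%C * psi x).
  by rewrite (hu _ (test_cutoff (harmonic01 n) hp)) (hu' _ (test_cutoff (harmonic01 n) hp)).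
have F1 : (fun n => Re (u (fun x => (chi (harmonic n *: x))%:C%C * psi x))) =
    (fun n => Re (u' (fun x => (chi (harmonic n *: x))%:C%C * psi x))).
  by apply/funext => n; rewrite E.
have F2 : (fun n => Im (u (fun x => (chi (harmonic n *: x))%:C%C * psi x))) =
    (fun n => Im (u' (fun x => (chi (harmonic n *: x))%:C%C * psi x))).
  by apply/funext => n; rewrite E.
rewrite F1 in c1; rewrite F2 in c2.
by apply: complex_eq => /=; [exact: (cvg_unique _ c1 c1')|exact: (cvg_unique _ c2 c2')].
Qed.

End cutoff.

Local Notation W0 := (osc_transform 0).
Local Notation W1 := (osc_transform (- (pi / 2))).

Lemma fourierE f : rintegrable (lam d) (fun x => Re (f x)) ->
  rintegrable (lam d) (fun x => Im (f x)) -> fourier f = fun xi =>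
  ((W0 (fun x => Re (f x)) xi + W1 (fun x => Im (f x)) xi) +i*
   (W0 (fun x => Im (f x)) xi - W1 (fun x => Re (f x)) xi))%C.
Proof.
move=> i1 i2; apply/funext => xi; apply: complex_eq => /=.
  rewrite -Rintegral_add; try exact: rintegrable_osc.
  apply: eq_Rintegral => x _; rewrite cReM /= cosN sinN /osc cosBpihalf addr0; ring.
rewrite -RintegralB//; try exact: rintegrable_osc.
apply: eq_Rintegral => x _; rewrite cImM /= cosN sinN /osc cosBpihalf addr0; ring.
Qed.

Lemma schwartz_integrable f : schwartz f ->
  rintegrable (lam d) (fun x => Re (f x)) /\ rintegrable (lam d) (fun x => Im (f x)).
Proof. by move=> /schwartz_parts[? ?]; split; exact: rschwartz_integrable. Qed.

Lemma schwartz_fourier f : schwartz f -> schwartz (fourier f).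
Proof.
move=> hf; have [i1 i2] := schwartz_integrable hf; have [f1 f2] := schwartz_parts hf.
rewrite fourierE//; apply: partsP_schwartz => /=.
  by apply: rschwartzD; exact: rschwartz_osc_transform.
apply: rschwartzD; first exact: rschwartz_osc_transform.
by apply: rschwartzN; exact: rschwartz_osc_transform.
Qed.

Lemma fourier_sbound M : exists N (C : R), forall f K1 K2, schwartz f ->
  sbound N K1 (fun x => Re (f x)) -> sbound N K2 (fun x => Im (f x)) ->
  sbound M (C * (K1 + K2)) (fun x => Re (fourier f x)) /\
  sbound M (C * (K1 + K2)) (fun x => Im (fourier f x)).
Proof.
have [N [C hC]] := @osc_transform_bound R d M; exists N, C => f K1 K2 hf b1 b2.
have [i1 i2] := schwartz_integrable hf; have [f1 f2] := schwartz_parts hf.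
have s c p (hp : rschwartz p) := (rschwartz_osc_transform c hp).1.
rewrite fourierE//; split => /=.
  by rewrite mulrDr; apply: sboundD; [exact: s|exact: s|exact: hC|exact: hC].
rewrite mulrDr addrC; apply: sboundD; [exact: s| |exact: hC|].
  by apply: (smoothN _).1; exact: s.
by apply: sboundN; [exact: s|exact: hC].
Qed.

Lemma osc_transformN c p xi : osc_transform c p (- xi) = osc_transform (- c) p xi.
Proof.
apply: eq_Rintegral => x _; congr (_ * _); rewrite /osc -cosN; congr cos.
rewrite (_ : dot_rV x (- xi) = - dot_rV x xi); first by ring.
by rewrite /dot_rV -sumrN; apply: eq_bigr => i _; rewrite mxE mulrN.
Qed.

Lemma osc_half_opp x xi : osc (pi / 2) x xi = - osc (- (pi / 2)) x xi :> R.
Proof. by rewrite /osc cosDpihalf cosBpihalf. Qed.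

Lemma osc_transformD c p q xi : rintegrable (lam d) p -> rintegrable (lam d) q ->
  osc_transform c (fun x => p x + q x) xi = osc_transform c p xi + osc_transform c q xi.
Proof.
move=> hp hq; rewrite -Rintegral_add; try exact: rintegrable_osc.
by apply: eq_Rintegral => x _; rewrite mulrDl.
Qed.

Lemma osc_transformZ c (k : R) p xi : rintegrable (lam d) p ->
  osc_transform c (fun x => k * p x) xi = k * osc_transform c p xi.
Proof.
move=> hp; rewrite -RintegralZl//; last exact: rintegrable_osc.
by apply: eq_Rintegral => x _; rewrite mulrA.
Qed.

Lemma W1_opp p xi : rintegrable (lam d) p -> W1 p (- xi) = - W1 p xi.
Proof.
move=> hp; rewrite osc_transformN opprK -mulN1r -RintegralZl//; last exact: rintegrable_osc.
by apply: eq_Rintegral => x _; rewrite osc_half_opp mulrN mulN1r.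
Qed.

Lemma W0_opp p xi : W0 p (- xi) = W0 p xi.
Proof. by rewrite osc_transformN oppr0. Qed.

Lemma Rintegral_odd (G : 'rV[R]_d -> R) : rintegrable (lam d) G ->
  (forall x, G (- x) = - G x) -> \int[lam d]_x G x = 0.
Proof.
move=> iG hG; have h : \int[lam d]_x G (- x) = \int[lam d]_x G x.
  congr fine; apply: (integral_opp_rV (F := fun x => (G x)%:E)).
  by apply/measurable_EFinP; exact: rintegrable_measurable iG.
have : \int[lam d]_x G (- x) = - \int[lam d]_x G x.
  by rewrite -mulN1r -RintegralZl//; apply: eq_Rintegral => x _; rewrite hG mulN1r.
by rewrite h; lra.
Qed.

Lemma osc_N c x xi : osc c (- x) xi = osc (- c) x xi :> R.
Proof.
rewrite /osc -cosN; congr cos.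
rewrite (_ : dot_rV (- x) xi = - dot_rV x xi); first by ring.
by rewrite /dot_rV -sumrN; apply: eq_bigr => i _; rewrite mxE mulNr.
Qed.

(** Parity: a cosine transform is even and the sine kernel is odd. The mixed terms of the composed
    complex transforms disappear for this reason. *)
Lemma W1W0 p xi : rschwartz p -> W1 (W0 p) xi = 0.
Proof.
move=> hp; apply: Rintegral_odd.
  by apply/rintegrable_osc/rschwartz_integrable/rschwartz_osc_transform.
by move=> x; rewrite W0_opp osc_N opprK osc_half_opp mulrN.
Qed.

Lemma W0W1 p xi : rschwartz p -> W0 (W1 p) xi = 0.
Proof.
move=> hp; apply: Rintegral_odd.
  by apply/rintegrable_osc/rschwartz_integrable/rschwartz_osc_transform.
by move=> x; rewrite W1_opp ?osc_N ?oppr0 ?mulNr//; exact: rschwartz_integrable.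
Qed.

(** [A] and [B] are the parts of the inverse transform of [theta], normalised by the inversion
    constant. The kernel is the square of [chi] because positivity of that constant asks for a
    nonnegative kernel. The lemma realises any test function on the frequency side as a Fourier
    transform. *)
Lemma fourier_surj (chi : 'rV[R]_d -> R) (theta : 'rV[R]_d -> R[i]) : rschwartz chi -> chi 0 = 1 ->
  schwartz theta -> exists2 psi, schwartz psi & fourier psi = theta.
Proof.
move=> hchi chi01 ht; have [ha hb] := schwartz_parts ht.
pose w x := chi x * chi x.
have hw : rschwartz w by apply: rschwartzM => //; exact: rschwartz_tame.
have w0 : w 0 = 1 by rewrite /w chi01 mulr1.
have c0 := inv_mass_gt0 hw w0 (fun x => sqr_ge0 (chi x)).
set c := inv_mass w in c0.
have cne : c != 0 by rewrite gt_eqF.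
pose a x := Re (theta x); pose b x := Im (theta x).
pose A x := c^-1 * (W0 a x + (- 1) * W1 b x).
pose B x := c^-1 * (W0 b x + W1 a x).
have sW k p : rschwartz p -> rschwartz (osc_transform k p) by exact: rschwartz_osc_transform.
have hA : rschwartz A by apply: rschwartzZ; apply: rschwartzD; [|apply: rschwartzZ]; exact: sW.
have hB : rschwartz B by apply: rschwartzZ; apply: rschwartzD; exact: sW.
exists (fun x => (A x +i* B x)%C); first exact: partsP_schwartz.
have iA := rschwartz_integrable hA; have iB := rschwartz_integrable hB.
have lin k (p q : 'rV[R]_d -> R) (l : R) xi : rschwartz p -> rschwartz q ->
    osc_transform k (fun x => c^-1 * (p x + l * q x)) xi =
    c^-1 * (osc_transform k p xi + l * osc_transform k q xi).
  move=> hp hq; have ip := rschwartz_integrable hp; have iq := rschwartz_integrable hq.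
  rewrite osc_transformZ; last by apply: rintegrableD => //; exact: rintegrableZ.
  by rewrite osc_transformD ?osc_transformZ//; exact: rintegrableZ.
have BE : B = fun x => c^-1 * (W0 b x + 1 * W1 a x).
  by apply/funext => x; rewrite /B mul1r.
rewrite fourierE//; apply/funext => xi; rewrite BE /A /=.
have sa k : rschwartz (osc_transform k a) by exact: sW.
have sb k : rschwartz (osc_transform k b) by exact: sW.
rewrite !lin// !W0W1// !W1W0//.
have ia := osc_inversion hw w0 xi ha; have ib := osc_inversion hw w0 xi hb.
rewrite -/a -/c in ia; rewrite -/b -/c in ib.
apply: complex_eq => /=.
  transitivity (c^-1 * (W0 (W0 a) xi + W1 (W1 a) xi)); first by ring.
  by rewrite ia mulKf.
transitivity (c^-1 * (W0 (W0 b) xi + W1 (W1 b) xi)); first by ring.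
by rewrite ib mulKf.
Qed.

End complex_functions.

(** * Bilinear multipliers and tensor products *)

Section product_integrals.
Context {R : realType}.
Local Notation lam := (@lebesgue_rV R).
Local Notation Re := (@complex.Re R).
Local Notation Im := (@complex.Im R).

Definition cintegrable d (f : 'rV[R]_d -> R[i]) :=
  rintegrable (lam d) (fun x => Re (f x)) /\ rintegrable (lam d) (fun x => Im (f x)).

Lemma cintegrable_cmeasurable d (f : 'rV[R]_d -> R[i]) : cintegrable f -> cmeasurable f.
Proof. by move=> [h1 h2]; split; [exact: rintegrable_measurable h1|exact: rintegrable_measurable h2]. Qed.

Lemma cintegrable_normc d (f : 'rV[R]_d -> R[i]) : cintegrable f ->
  rintegrable (lam d) (fun x => normc (f x)).
Proof.
move=> hf; have [h1 h2] := hf.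
apply: (rintegrable_le (g := fun x => `|Re (f x)| + `|Im (f x)|)).
- by apply: measurable_normc; exact: cintegrable_cmeasurable.
- by apply: rintegrableD; exact: rintegrable_abs.
- by move=> x; rewrite ger0_norm ?normc_ge0// normc_le.
Qed.

Lemma cintegrable_le d (f : 'rV[R]_d -> R[i]) (G : 'rV[R]_d -> R) : cmeasurable f ->
  rintegrable (lam d) G -> (forall x, normc (f x) <= G x) -> cintegrable f.
Proof.
move=> [m1 m2] hG h; split; apply: (rintegrable_le (g := G)) => // x.
  exact: le_trans (normc_Re _) (h x).
exact: le_trans (normc_Im _) (h x).
Qed.

Lemma dotDl d (x y xi : 'rV[R]_d) : dot_rV (x + y) xi = dot_rV x xi + dot_rV y xi.
Proof. by rewrite /dot_rV -big_split/=; apply: eq_bigr => i _; rewrite mxE mulrDl. Qed.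

Lemma Rintegral_row_mx m p (F : 'rV[R]_(m + p) -> R) : rintegrable (lam (m + p)) F ->
  \int[lam (m + p)%N]_x F x = \int[lam m]_x \int[lam p]_y F (row_mx x y).
Proof.
move=> hF; have mF := rintegrable_measurable hF.
have mF' : measurable_fun setT (fun x => (F x)%:E) by exact/measurable_EFinP.
pose G (z : 'rV[R]_m * 'rV[R]_p) := (F (row_mx z.1 z.2))%:E.
have mG : measurable_fun setT G by exact: (measurableT_comp mF' (@measurable_row_mx R m p)).
have iG : (lam m \x lam p)%E.-integrable setT G.
  apply/(integrable12ltyP _ _ mG).
  have /integrableP[_] := hF; rewrite ge0_integral_row_mx//.
  by apply: measurableT_comp => //.
rewrite (Rintegral_ae (m1 := lam m) (f := fun x => \int[lam p]_y (F (row_mx x y))%:E)%E); last 2 first.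
- apply: filterS (ae_integrable1 iG) => x h; exact: integrable_fin_num h.
- exact: (measurable_fubini_F iG).
rewrite /Rintegral integral_row_mx//; congr fine.
exact/esym/(integral12_prod_meas1 iG).
Qed.

Lemma rintegrable_tensor m p (F : 'rV[R]_m -> R) (G : 'rV[R]_p -> R) :
  rintegrable (lam m) F -> rintegrable (lam p) G ->
  rintegrable (lam (m + p)) (fun x => F (lsubmx x) * G (rsubmx x)).
Proof.
move=> hF hG; have mF := rintegrable_measurable hF; have mG := rintegrable_measurable hG.
have mFG : measurable_fun setT (fun x : 'rV[R]_(m + p) => F (lsubmx x) * G (rsubmx x)).
  apply: measurable_funM.
    apply: (measurableT_comp mF); apply: measurable_fun_rV => i.
    by under eq_fun do rewrite mxE; exact: measurable_coord_rV.
  apply: (measurableT_comp mG); apply: measurable_fun_rV => i.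
  by under eq_fun do rewrite mxE; exact: measurable_coord_rV.
apply: (rintegrable_le (g := fun x => `|F (lsubmx x) * G (rsubmx x)|)) => //.
apply: rintegral_lty => //; first exact: measurableT_comp.
rewrite ge0_integral_row_mx//; last first.
  by apply/measurable_EFinP; exact: measurableT_comp.
under eq_integral => x _.
  under eq_integral do rewrite row_mxKl row_mxKr normrM.
  rewrite ge0_integralZl_real//; last exact: measurableT_comp.
  rewrite (rintegrable_EFin (rintegrable_abs hG)) -EFinM mulrC.
  over.
rewrite ge0_integralZl_real ?Rintegral_ge0//; last exact: measurableT_comp.
by rewrite (rintegrable_EFin (rintegrable_abs hF)) ltry.
Qed.

Lemma Rintegral_tensor m p (F : 'rV[R]_m -> R) (G : 'rV[R]_p -> R) :
  rintegrable (lam m) F -> rintegrable (lam p) G ->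
  \int[lam (m + p)%N]_x (F (lsubmx x) * G (rsubmx x)) =
  (\int[lam m]_x F x) * \int[lam p]_x G x.
Proof.
move=> hF hG; rewrite Rintegral_row_mx; last exact: rintegrable_tensor.
rewrite mulrC -RintegralZl//; apply: eq_Rintegral => x _.
rewrite mulrC -RintegralZl//; apply: eq_Rintegral => y _.
by rewrite row_mxKl row_mxKr.
Qed.

Lemma cintegral_tensor m p (F : 'rV[R]_m -> R[i]) (G : 'rV[R]_p -> R[i]) :
  cintegrable F -> cintegrable G ->
  cintegral (fun x : 'rV[R]_(m + p) => F (lsubmx x) * G (rsubmx x)) =
  cintegral F * cintegral G.
Proof.
move=> [F1 F2] [G1 G2].
have t11 := rintegrable_tensor F1 G1; have t12 := rintegrable_tensor F1 G2.
have t21 := rintegrable_tensor F2 G1; have t22 := rintegrable_tensor F2 G2.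
apply: complex_eq => /=.
  rewrite -(Rintegral_tensor F1 G1) -(Rintegral_tensor F2 G2) -RintegralB//.
  by apply: eq_Rintegral => x _; rewrite cReM.
rewrite -(Rintegral_tensor F1 G2) -(Rintegral_tensor F2 G1) -Rintegral_add//.
by apply: eq_Rintegral => x _; rewrite cImM.
Qed.

Lemma cexpD (a b : R) : cexp (a + b) = cexp a * cexp b.
Proof. by apply: complex_eq; rewrite /= ?cosD ?sinD; ring. Qed.

Lemma measurable_phase d' (T : measurableType d') d (F : T -> 'rV[R]_d) (G : T -> 'rV[R]_d) :
  measurable_fun setT F -> measurable_fun setT G ->
  measurable_fun setT (fun t => 2 * pi * dot_rV (F t) (G t)).
Proof.
move=> mF mG; apply: measurable_funM => //; apply: measurable_sum => i.
by apply: measurable_funM; apply: (measurableT_comp (measurable_coord_rV i)).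
Qed.

Lemma cmeasurable_cexp d (F : 'rV[R]_d -> R) : measurable_fun setT F ->
  cmeasurable (fun x => cexp (F x)).
Proof.
move=> mF; split; apply: measurableT_comp mF; apply: continuous_measurable_fun.
  exact: continuous_cos.
exact: continuous_sin.
Qed.

Lemma cintegrable_cexp d (f : 'rV[R]_d -> R[i]) (F : 'rV[R]_d -> R) : cintegrable f ->
  measurable_fun setT F -> cintegrable (fun x => f x * cexp (F x)).
Proof.
move=> hf mF; apply: (cintegrable_le (G := fun x => normc (f x))).
- by apply: cmeasurableM; [exact: cintegrable_cmeasurable|exact: cmeasurable_cexp].
- exact: cintegrable_normc.
- by move=> x; rewrite normcM normc_cexp mulr1.
Qed.

Lemma fourier_shift d (f : 'rV[R]_d -> R[i]) x xi : cintegrable f ->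
  fourier (fun y => f (y + x)) xi = cexp (2 * pi * dot_rV x xi) * fourier f xi.
Proof.
move=> hf; pose F y := f y * cexp (- (2 * pi * dot_rV y xi)).
have mph : measurable_fun setT (fun y : 'rV[R]_d => - (2 * pi * dot_rV y xi)).
  by apply: measurable_funN; exact: measurable_phase.
have iF : cintegrable F by exact: cintegrable_cexp.
pose e := cexp (2 * pi * dot_rV x xi).
have E y : f (y + x) * cexp (- (2 * pi * dot_rV y xi)) = e * F (x + y).
  rewrite /F addrC mulrCA /e -cexpD; congr (_ * cexp _).
  by rewrite dotDl; ring.
have [i1 i2] := iF.
have I1 : \int[lam d]_y Re (F (x + y)) = \int[lam d]_y Re (F y).
  exact: (Rintegral_shift x (rintegrable_measurable i1)).
have I2 : \int[lam d]_y Im (F (x + y)) = \int[lam d]_y Im (F y).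
  exact: (Rintegral_shift x (rintegrable_measurable i2)).
have j1 := rintegrable_shift x i1; have j2 := rintegrable_shift x i2.
apply: complex_eq.
  rewrite cReM /= -I1 -I2 -!RintegralZl//.
  rewrite -RintegralB//; try exact: rintegrableZ.
  by apply: eq_Rintegral => y _; rewrite E cReM.
rewrite cImM /= -I1 -I2 -!RintegralZl//.
rewrite -Rintegral_add; try exact: rintegrableZ.
by apply: eq_Rintegral => y _; rewrite E cImM.
Qed.

End product_integrals.

(** * Bilinear multipliers as pairings, and their locality *)

Section bilinear_pieces.
Context {R : realType}.
Local Notation lam := (@lebesgue_rV R).
Local Notation Re := (@complex.Re R).
Local Notation Im := (@complex.Im R).
Variable n : nat.
Implicit Types (f g : 'rV[R]_n -> R[i]) (h m : 'rV[R]_(n + n) -> R[i]) (x xi eta : 'rV[R]_n)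
  (p : 'rV[R]_(n + n)).

(** Translating both factors by [x] absorbs the exponential, so the value of the operator at [x]
    becomes the pairing of the symbol with the transform of one Schwartz function. *)
Definition tensor_at f g x p := f (lsubmx p + x) * g (rsubmx p + x).

Lemma schwartz_shift f x : schwartz f -> schwartz (fun y => f (y + x)).
Proof.
by move=> /schwartz_parts[h1 h2]; apply: partsP_schwartz;
  [exact: (rschwartz_shift x h1)|exact: (rschwartz_shift x h2)].
Qed.

Lemma schwartz_tensor f g : schwartz f -> schwartz g ->
  schwartz (fun p => f (lsubmx p) * g (rsubmx p)).
Proof.
move=> /schwartz_parts[f1 f2] /schwartz_parts[g1 g2]; apply: partsP_schwartz.
  under eq_fun do rewrite cReM.
  exact: (rschwartzD (rschwartz_tensor f1 g1) (rschwartzN (rschwartz_tensor f2 g2))).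
under eq_fun do rewrite cImM.
exact: (rschwartzD (rschwartz_tensor f1 g2) (rschwartz_tensor f2 g1)).
Qed.

Lemma schwartz_tensor_at f g x : schwartz f -> schwartz g -> schwartz (tensor_at f g x).
Proof. by move=> hf hg; exact: schwartz_tensor (schwartz_shift x hf) (schwartz_shift x hg). Qed.

Lemma schwartz_cintegrable d (f : 'rV[R]_d -> R[i]) : schwartz f -> cintegrable f.
Proof. by move=> /schwartz_integrable. Qed.

Lemma fourier_tensor_at f g x p : schwartz f -> schwartz g ->
  fourier (tensor_at f g x) p = fourier f (lsubmx p) * fourier g (rsubmx p) *
    cexp (2 * pi * dot_rV x (lsubmx p + rsubmx p)).
Proof.
move=> hf hg.
have mph xi : measurable_fun setT (fun y : 'rV[R]_n => - (2 * pi * dot_rV y xi)).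
  by apply: measurable_funN; exact: measurable_phase.
have hfx := schwartz_cintegrable (schwartz_shift x hf).
have hgx := schwartz_cintegrable (schwartz_shift x hg).
have E q : tensor_at f g x q * cexp (- (2 * pi * dot_rV q p)) =
   (f (lsubmx q + x) * cexp (- (2 * pi * dot_rV (lsubmx q) (lsubmx p)))) *
   (g (rsubmx q + x) * cexp (- (2 * pi * dot_rV (rsubmx q) (rsubmx p)))).
  have -> : dot_rV q p = dot_rV (lsubmx q) (lsubmx p) + dot_rV (rsubmx q) (rsubmx p).
    by rewrite -dot_row_mx !hsubmxK.
  rewrite /tensor_at mulrDr opprD cexpD.
  by rewrite !mulrA; congr (_ * _); rewrite -!mulrA; congr (_ * _); exact: mulrC.
rewrite /fourier; under [X in cintegral X]eq_fun do rewrite E.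
rewrite (cintegral_tensor (cintegrable_cexp hfx (mph _)) (cintegrable_cexp hgx (mph _))).
rewrite -!/(fourier _ _) (fourier_shift x _ (schwartz_cintegrable hf)).
rewrite (fourier_shift x _ (schwartz_cintegrable hg)).
have D : dot_rV x (lsubmx p + rsubmx p) = dot_rV x (lsubmx p) + dot_rV x (rsubmx p).
  by rewrite dotC dotDl !(dotC x).
have -> : cexp (2 * pi * dot_rV x (lsubmx p + rsubmx p)) =
    cexp (2 * pi * dot_rV x (lsubmx p)) * cexp (2 * pi * dot_rV x (rsubmx p)).
  by rewrite D mulrDr cexpD.
ring.
Qed.

Lemma slow_cintegrable d (h psi : 'rV[R]_d -> R[i]) : slow h -> schwartz psi ->
  cintegrable (fun y => h y * psi y).
Proof. exact: slow_integrable_parts. Qed.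

Lemma bilinear_multiplierE h f g x : slow h -> schwartz f -> schwartz g ->
  bilinear_multiplier h f g x = cintegral (fun p => h p * fourier (tensor_at f g x) p).
Proof.
move=> sh hf hg.
have hT := schwartz_fourier (schwartz_tensor_at x hf hg).
have [i1 i2] := slow_cintegrable sh hT.
have E xi eta : h (row_mx xi eta) * fourier f xi * fourier g eta *
    cexp (2 * pi * dot_rV x (xi + eta)) =
    h (row_mx xi eta) * fourier (tensor_at f g x) (row_mx xi eta).
  by rewrite fourier_tensor_at// row_mxKl row_mxKr !mulrA.
rewrite /bilinear_multiplier; apply: complex_eq => /=.
  rewrite (Rintegral_row_mx i1); apply: eq_Rintegral => xi _; apply: eq_Rintegral => eta _.
  by rewrite E.
rewrite (Rintegral_row_mx i2); apply: eq_Rintegral => xi _; apply: eq_Rintegral => eta _.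
by rewrite E.
Qed.

Lemma weight_le1 d (y : 'rV[R]_d) : weight y <= 1.
Proof.
rewrite /weight; apply: prodr_ile1 => i _.
by rewrite invr_ge0 ltW ?weight_factor_gt0// invf_le1 ?weight_factor_gt0// lerDl sqr_ge0.
Qed.

Lemma continuous_weightV d M : continuous (fun y : 'rV[R]_d => ((1 + norm2_rV y) ^+ M)^-1).
Proof.
have -> : (fun y : 'rV[R]_d => ((1 + norm2_rV y) ^+ M)^-1) =
    (fun y => ((1 + `|norm2_rV y|) ^+ M)^-1).
  by apply/funext => y; rewrite (ger0_norm (norm2_ge0 y)).
apply: (continuous_circ (f := fun t : R => ((1 + `|t|) ^+ M)^-1) (@continuous_norm2 R d)).
move=> t; apply: cvgV; first by rewrite expf_neq0// gt_eqF// ltr_pwDl.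
apply: (continuous_circ (L := fun t : R => 1 + `|t|) (f := fun s : R => s ^+ M)).
  by apply: continuous_add; [exact: cst_continuous|exact: norm_continuous].
exact: exprn_continuous.
Qed.

(** The trilinear estimate with all three functions equal to [weight]: weak L4 embeds into a
    weighted L1 space. The same [M] serves all pieces and the bound is linear in the norm, as
    summation over the pieces requires. *)
Lemma lorentz_weighted : exists (M : nat) (C : R), 0 <= C /\ forall h (k : R),
  cmeasurable h -> 0 < k -> (lorentz4_norm h <= k%:E)%E ->
  (\int[lam (n + n)]_p (normc (h p) * ((1 + norm2_rV p) ^+ M)^-1)%:E <= (C * k)%:E)%E.
Proof.
(* Exponents of the weights at the two halves and at their sum; the last is doubled because 1 + |xi
   + eta| is controlled by the square of 1 + |p|. *)
set M := (2 * n + (2 * n + 2 * (2 * n)))%N.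
pose c : R := (1 + n%:R) ^+ (2 * n).
have c0 : 0 <= c by rewrite exprn_ge0// addr_ge0.
have a1 : 0 < 1 + weight_mass n :> R by rewrite ltr_pwDl// weight_mass_ge0.
exists M, (c * (9 * (1 + weight_mass n) ^+ 3)); split.
  by rewrite mulr_ge0// mulr_ge0// exprn_ge0// ltW.
move=> h k mh k1 hk1.
have mw : measurable_fun setT (@weight R n) by exact: rintegrable_measurable (@rintegrable_weight R n).
have mnh := measurable_normc mh.
have mM : measurable_fun setT (fun p : 'rV[R]_(n + n) => ((1 + norm2_rV p) ^+ M)^-1).
  exact: (continuous_measurable_rV (@continuous_weightV _ M)).
have P p : ((1 + norm2_rV p) ^+ M)^-1 <=
    c * (weight (lsubmx p + rsubmx p) * weight (lsubmx p) * weight (rsubmx p)).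
  have X0 : 0 < 1 + norm2_rV p by rewrite ltr_pwDl// norm2_ge0.
  have hl : 1 + norm2_rV (lsubmx p) <= 1 + norm2_rV p.
    by rewrite lerD2l -{2}(hsubmxK p) norm2_row_mxl.
  have hr : 1 + norm2_rV (rsubmx p) <= 1 + norm2_rV p.
    by rewrite lerD2l -{2}(hsubmxK p) norm2_row_mxr.
  have l0 : 0 <= 1 + norm2_rV (lsubmx p) by rewrite addr_ge0 ?norm2_ge0.
  have r0 : 0 <= 1 + norm2_rV (rsubmx p) by rewrite addr_ge0 ?norm2_ge0.
  have hs : 1 + norm2_rV (lsubmx p + rsubmx p) <= (1 + n%:R) * (1 + norm2_rV p) ^+ 2.
    have := norm2_shift (lsubmx p + rsubmx p) (- rsubmx p); rewrite addrK.
    have -> : norm2_rV (- rsubmx p) = norm2_rV (rsubmx p).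
      by rewrite -scaleN1r norm2Z normrN1 mul1r.
    move=> /le_trans; apply; rewrite -mulrA ler_wpM2l ?addr_ge0// expr2.
    by apply: ler_pM.
  have w1 : 1 <= (1 + norm2_rV p) ^+ (2 * n) * weight (lsubmx p).
    apply: le_trans (weight_le (lsubmx p)) _; rewrite ler_wpM2r ?weightP_ge0//.
    by apply: lerXn2r; rewrite ?nnegrE ?(ltW X0).
  have w2 : 1 <= (1 + norm2_rV p) ^+ (2 * n) * weight (rsubmx p).
    apply: le_trans (weight_le (rsubmx p)) _; rewrite ler_wpM2r ?weightP_ge0//.
    by apply: lerXn2r; rewrite ?nnegrE ?(ltW X0).
  have w3 : 1 <= (c * (1 + norm2_rV p) ^+ (2 * (2 * n))) * weight (lsubmx p + rsubmx p).
    apply: le_trans (weight_le (lsubmx p + rsubmx p)) _; rewrite ler_wpM2r ?weightP_ge0//.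
    rewrite /c (exprM (1 + norm2_rV p) 2) -exprMn; apply: lerXn2r; rewrite ?nnegrE//.
      by rewrite addr_ge0 ?norm2_ge0.
    by rewrite mulr_ge0 ?exprn_ge0 ?addr_ge0 ?norm2_ge0.
  have w4 : 1 <= (1 + norm2_rV p) ^+ (2 * n) * weight (lsubmx p) *
      ((1 + norm2_rV p) ^+ (2 * n) * weight (rsubmx p)) *
      ((c * (1 + norm2_rV p) ^+ (2 * (2 * n))) * weight (lsubmx p + rsubmx p)).
    by rewrite -[X in X <= _]mul1r ler_pM// -[X in X <= _]mul1r ler_pM.
  rewrite -[leLHS]mul1r ler_pdivrMr ?exprn_gt0//; apply: le_trans w4 _.
  by rewrite le_eqVlt; apply/orP; left; apply/eqP; rewrite /M !exprD; ring.
have w0 d (y : 'rV[R]_d) : 0 <= weight y by exact: weightP_ge0.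
have msw : (\int[lam n]_x (weight x ^+ 2)%:E <= ((1 + weight_mass n) ^+ 2)%:E)%E.
  apply: (@le_trans _ _ (\int[lam n]_x (weight x)%:E)%E).
    apply: ge0_le_integral_EFin => //; first exact: measurable_funM.
    by move=> x; rewrite exprn_ge0//= expr2 ler_piMl// weight_le1.
  rewrite (rintegrable_EFin (@rintegrable_weight R n)) lee_fin -/(weight_mass n).
  by have := weight_mass_ge0 n (R := R); nra.
have := lorentz_trilinear k1 a1 a1 a1 mnh mw mw mw (fun p => normc_ge0 _) (w0 n) (w0 n) (w0 n)
  (lorentz4_norm_level (ltW k1) hk1) msw msw msw.
set T := (9 * _); move=> hT.
have mV : measurable_fun setT (fun p : 'rV[R]_(n + n) => normc (h p) *
    (weight (lsubmx p + rsubmx p) * weight (lsubmx p) * weight (rsubmx p))).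
  apply: measurable_funM => //; apply: measurable_funM; last exact: (measurableT_comp mw (@measurable_rsubmx _ _)).
  apply: measurable_funM; last exact: (measurableT_comp mw (@measurable_lsubmx _ _)).
  by apply: (measurableT_comp mw); apply: measurable_addmx; [exact: measurable_lsubmx|exact: measurable_rsubmx].
have V0 p : 0 <= normc (h p) * (weight (lsubmx p + rsubmx p) * weight (lsubmx p) * weight (rsubmx p)).
  by rewrite mulr_ge0 ?normc_ge0// !mulr_ge0.
apply: (@le_trans _ _ (\int[lam (n + n)]_p (c * (normc (h p) *
    (weight (lsubmx p + rsubmx p) * weight (lsubmx p) * weight (rsubmx p))))%:E)%E).
  apply: ge0_le_integral_EFin; [exact: measurable_funM|exact: measurable_funM|] => p.
  rewrite mulr_ge0 ?normc_ge0 ?invr_ge0 ?weight_ge0//= mulrCA.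
  by rewrite ler_wpM2l ?normc_ge0.
rewrite ge0_integralZl_real//.
apply: (@le_trans _ _ (c%:E * T%:E)%E); first by apply: lee_wpmul2l => //; rewrite lee_fin.
by rewrite -EFinM lee_fin /T -!mulrA ler_wpM2l// ler_wpM2l//; nra.
Qed.

Lemma lorentz_slow h (k : R) : cmeasurable h -> 0 < k ->
  (lorentz4_norm h <= k%:E)%E -> slow h.
Proof.
move=> mh k0 hk; have [M [C [_ hC]]] := lorentz_weighted.
split=> //; exists M; apply: rintegral_lty.
- apply: measurable_funM; first exact: measurable_normc.
  exact: (continuous_measurable_rV (@continuous_weightV _ M)).
- by move=> p; rewrite mulr_ge0 ?normc_ge0// invr_ge0 weight_ge0.
- exact: le_lt_trans (hC h k mh k0 hk) (ltry _).
Qed.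

(** The value at [x] is [v] on the transform of [tensor_at f g x], that is, [u] on the transform of
    [phi] times [tensor_at f g x]; only the product with [phi] matters. *)
Lemma multiplier_local (chi : 'rV[R]_(n + n) -> R) (phi : 'rV[R]_(n + n) -> R[i])
    (u v : @Defs.distribution R (n + n)) h f g f' g' x :
  smooth_real chi -> (forall p, norm2_rV p <= 1 -> chi p = 1) ->
  (forall p, 3 / 2 <= norm2_rV p -> chi p = 0) ->
  distr_of_fun v h -> slow h ->
  eq_distribution (distr_fourier v) (distr_mul phi (distr_fourier u)) ->
  schwartz f -> schwartz g -> schwartz f' -> schwartz g' ->
  (forall p, phi p * tensor_at f g x p = phi p * tensor_at f' g' x p) ->
  bilinear_multiplier h f g x = bilinear_multiplier h f' g' x.
Proof.
move=> chi_smooth chi1 chi0 hv sh uv hf hg hf' hg' E.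
have s1 := schwartz_tensor_at x hf hg; have s2 := schwartz_tensor_at x hf' hg'.
rewrite (bilinear_multiplierE x sh hf hg) (bilinear_multiplierE x sh hf' hg').
rewrite -(distr_schwartz chi_smooth chi1 chi0 hv sh (schwartz_fourier s1)).
rewrite -(distr_schwartz chi_smooth chi1 chi0 hv sh (schwartz_fourier s2)).
have := uv _ s1; have := uv _ s2; rewrite /distr_fourier /distr_mul => -> ->.
by congr (u (fourier _)); apply/funext => p; exact: E.
Qed.

End bilinear_pieces.

Section fourier_plancherel.
Context {R : realType}.
Local Notation lam := (@lebesgue_rV R).
Local Notation Re := (@complex.Re R).
Local Notation Im := (@complex.Im R).
Variable d : nat.
Variable w : 'rV[R]_d -> R.
Hypotheses (hw : rschwartz w) (w0 : w 0 = 1) (w_ge0 : forall x, 0 <= w x).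
Local Notation W0 := (osc_transform 0).
Local Notation W1 := (osc_transform (- (pi / 2))).

Lemma cmeasurable_fourier (f : 'rV[R]_d -> R[i]) : cintegrable f -> cmeasurable (fourier f).
Proof.
move=> hf; have [m1 m2] := cintegrable_cmeasurable hf; have [i1 i2] := hf.
rewrite fourierE//; split => /=.
  by apply: measurable_funD; exact: measurable_osc_transform.
by apply: measurable_funB; exact: measurable_osc_transform.
Qed.

(** The constant is twice that of the real inequality because each component of the transform mixes
    the real and imaginary parts of [f]. *)
Lemma fourier_plancherel_le (f : 'rV[R]_d -> R[i]) : cintegrable f ->
  rintegrable (lam d) (fun x => normc (f x) ^+ 2) ->
  (\int[lam d]_xi (normc (fourier f xi) ^+ 2)%:E <=
   (4 * osc_mass w * \int[lam d]_x normc (f x) ^+ 2)%:E)%E.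
Proof.
move=> hf hf2; have [i1 i2] := hf.
have [m1 m2] := cintegrable_cmeasurable hf.
pose a x := Re (f x); pose b x := Im (f x).
have ia2 : rintegrable (lam d) (fun x => a x ^+ 2).
  apply: (rintegrable_le (g := fun x => normc (f x) ^+ 2)) => //; first exact: measurable_funM.
  by move=> x; rewrite ger0_norm ?sqr_ge0// normc_sqr lerDl sqr_ge0.
have ib2 : rintegrable (lam d) (fun x => b x ^+ 2).
  apply: (rintegrable_le (g := fun x => normc (f x) ^+ 2)) => //; first exact: measurable_funM.
  by move=> x; rewrite ger0_norm ?sqr_ge0// normc_sqr lerDr sqr_ge0.
have pa := osc_plancherel_le hw w0 w_ge0 i1 ia2.
have pb := osc_plancherel_le hw w0 w_ge0 i2 ib2.
have mS (p : 'rV[R]_d -> R) : measurable_fun setT p ->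
    measurable_fun setT (fun xi => W0 p xi ^+ 2 + W1 p xi ^+ 2).
  by move=> mp; apply: measurable_funD; apply: measurable_sqr; exact: measurable_osc_transform.
apply: (@le_trans _ _ (\int[lam d]_xi (2 * ((W0 a xi ^+ 2 + W1 a xi ^+ 2) +
    (W0 b xi ^+ 2 + W1 b xi ^+ 2)))%:E)%E).
  apply: ge0_le_integral_EFin.
  - by apply: measurable_sqr; apply: measurable_normc; exact: cmeasurable_fourier.
  - by apply: measurable_funM => //; apply: measurable_funD; exact: mS.
  - move=> xi; rewrite sqr_ge0 (fourierE i1 i2) normc_sqr /= -/a -/b.
    by have := sqr_ge0 (W0 a xi - W1 b xi); have := sqr_ge0 (W0 b xi + W1 a xi); nra.
rewrite ge0_integralZl_real//; last 2 first.
- by apply: measurable_funD; exact: mS.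
- by move=> xi; rewrite !addr_ge0// sqr_ge0.
rewrite ge0_integralD_EFin//; last 4 first.
- exact: mS.
- exact: mS.
- by move=> xi; rewrite addr_ge0// sqr_ge0.
- by move=> xi; rewrite addr_ge0// sqr_ge0.
apply: (@le_trans _ _ (2%:E * ((2 * osc_mass w * \int[lam d]_x a x ^+ 2)%:E +
   (2 * osc_mass w * \int[lam d]_x b x ^+ 2)%:E))%E).
  by apply: lee_wpmul2l; [rewrite lee_fin|exact: leeD].
rewrite -EFinD -EFinM lee_fin.
have -> : \int[lam d]_x normc (f x) ^+ 2 = \int[lam d]_x a x ^+ 2 + \int[lam d]_x b x ^+ 2.
  by rewrite -Rintegral_add//; apply: eq_Rintegral => x _; rewrite normc_sqr.
by rewrite le_eqVlt; apply/orP; left; apply/eqP; ring.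
Qed.

End fourier_plancherel.

(** * The estimate for a single dyadic piece *)

Section integral_transfer.
Context dT (T : measurableType dT) {R : realType} (mu : {measure set T -> \bar R}).

(** Serves to replace the operator on [f] and [g] by its value on windowed functions, an equality
    that holds only where the bump [b] is nonzero. *)
Lemma integral_weighted_le (b N N' : T -> R) (c : \bar R) :
  (forall x, b x != 0 -> N x = N' x) ->
  (\int[mu]_x (b x * N' x)%:E <= c)%E -> (\int[mu]_x (b x * N x)%:E <= c)%E.
Proof.
move=> h; rewrite (eq_integral (fun x => (b x * N x)%:E))// => x _.
by have [->|/h->] := eqVneq (b x) 0; rewrite ?mul0r.
Qed.

End integral_transfer.

(** * Local L1 bound by duality *)

Section local_bound.
Context {R : realType}.
Local Opaque bilinear_multiplier.
Local Notation lam := (@lebesgue_rV R).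
Local Notation Re := (@complex.Re R).
Local Notation Im := (@complex.Im R).
Local Notation W0 := (osc_transform 0).
Local Notation W1 := (osc_transform (- (pi / 2))).
Variable n : nat.
Implicit Types (f g : 'rV[R]_n -> R[i]) (h : 'rV[R]_(n + n) -> R[i]) (x : 'rV[R]_n)
  (p : 'rV[R]_(n + n)).

Local Notation s p := (lsubmx p + rsubmx p).

Lemma measurable_sum_lr : measurable_fun setT (fun p => s p : 'rV[R]_n).
Proof. by apply: measurable_addmx; [exact: measurable_lsubmx|exact: measurable_rsubmx]. Qed.

(** Here [b] and [c] bound squared norms and may vanish. They are enlarged by [d], chosen so that
    the total error is exactly [e]. *)
Lemma trilinear_sum (V : 'rV[R]_(n + n) -> R) (A B C : 'rV[R]_n -> R) (k a b c t : R) :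
  0 < k -> 0 < a -> 0 <= b -> 0 <= c -> 0 < t ->
  measurable_fun setT V -> measurable_fun setT A -> measurable_fun setT B ->
  measurable_fun setT C ->
  (forall p, 0 <= V p) -> (forall x, 0 <= A x) -> (forall x, 0 <= B x) ->
  (forall x, 0 <= C x) ->
  (forall l : R, 0 < l ->
    ((l ^+ 4)%:E * lam (n + n) [set p | (l < V p)%R] <= (k ^+ 4)%:E)%E) ->
  (\int[lam n]_x (A x ^+ 2)%:E <= (a ^+ 2)%:E)%E ->
  (\int[lam n]_x (B x ^+ 2)%:E <= b%:E)%E ->
  (\int[lam n]_x (C x ^+ 2)%:E <= c%:E)%E ->
  (\int[lam (n + n)]_p (V p * (A (s p) * B (lsubmx p) * C (rsubmx p)))%:E
    <= (9 * (k * (a * (t * b + c / t))))%:E)%E.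
Proof.
move=> k0 a0 b0 c0 t0 mV mA mB mC V0 A0 B0 C0 hV hA hB hC.
apply/lee_addgt0Pr => e e0; rewrite -EFinD.
have T0 : 0 < t + t^-1 by rewrite addr_gt0 ?invr_gt0.
have D0 : 0 < 9 * (k * (a * (t + t^-1))) by rewrite !mulr_gt0.
pose d := e / (9 * (k * (a * (t + t^-1)))).
have d0 : 0 < d by rewrite divr_gt0.
have bd : 0 < b + d by rewrite ltr_wpDl.
have cd : 0 < c + d by rewrite ltr_wpDl.
have hB' : (\int[lam n]_x (B x ^+ 2)%:E <= (Num.sqrt (b + d) ^+ 2)%:E)%E.
  by apply: le_trans hB _; rewrite sqr_sqrtr ?(ltW bd)// lee_fin lerDl ltW.
have hC' : (\int[lam n]_x (C x ^+ 2)%:E <= (Num.sqrt (c + d) ^+ 2)%:E)%E.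
  by apply: le_trans hC _; rewrite sqr_sqrtr ?(ltW cd)// lee_fin lerDl ltW.
have sb : 0 < Num.sqrt (b + d) by rewrite sqrtr_gt0.
have sc : 0 < Num.sqrt (c + d) by rewrite sqrtr_gt0.
apply: le_trans (lorentz_trilinear k0 a0 sb sc mV mA mB mC V0 A0 B0 C0 hV hA hB' hC') _.
rewrite lee_fin.
have -> : 9 * (k * (a * (t * b + c / t))) + e =
    9 * (k * (a * (t * (b + d) + (c + d) / t))).
  have -> : e = 9 * (k * (a * (t + t^-1))) * d by rewrite mulrC divfK// gt_eqF.
  by rewrite (mulrDl c d); ring.
rewrite ler_wpM2l// ler_wpM2l ?(ltW k0)// -mulrA ler_wpM2l ?(ltW a0)//.
have := sqr_sqrtr (ltW bd); have := sqr_sqrtr (ltW cd).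
set X := Num.sqrt (b + d); set Y := Num.sqrt (c + d) => <- <-.
have q0 : 0 <= (t * X - Y) ^+ 2 / t by rewrite divr_ge0 ?sqr_ge0 ?ltW.
have XY : 0 <= X * Y by rewrite mulr_ge0 ?sqrtr_ge0.
have E : (t * X - Y) ^+ 2 / t = t * X ^+ 2 + Y ^+ 2 / t - 2 * (X * Y).
  by field; rewrite gt_eqF.
rewrite E in q0; lra.
Qed.

(** The dual function is [b] times the sign of the inner integral. Fubini moves the oscillation onto
    it, and the symbol is then tested against transforms of [w] at xi + eta, the third factor of the
    trilinear form. *)
Lemma dual_abs (P Q G : 'rV[R]_(n + n) -> R) (b : 'rV[R]_n -> R) :
  rintegrable (lam (n + n)) P -> rintegrable (lam (n + n)) Q -> measurable_fun setT G ->
  (forall p, `|P p| <= G p) -> (forall p, `|Q p| <= G p) ->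
  rintegrable (lam n) b -> (forall x, 0 <= b x) ->
  exists w : 'rV[R]_n -> R, [/\ measurable_fun setT w, forall x, `|w x| <= b x &
    (\int[lam n]_x (b x * `|\int[lam (n + n)%N]_p (P p * osc 0 x (s p) +
        Q p * osc (- (pi / 2)) x (s p))|)%:E <=
     \int[lam (n + n)]_p (G p * (`|W0 w (s p)| + `|W1 w (s p)|))%:E)%E].
Proof.
move=> iP iQ mG PG QG ib b0.
have mP := rintegrable_measurable iP; have mQ := rintegrable_measurable iQ.
have mb := rintegrable_measurable ib; have ms := measurable_sum_lr.
have ms1 : measurable_fun setT (fun z : 'rV[R]_n * 'rV[R]_(n + n) => s z.2).
  by apply: (measurableT_comp ms); exact: measurable_snd.
pose J x p := P p * osc 0 x (s p) + Q p * osc (- (pi / 2)) x (s p).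
have mJ : measurable_fun setT (fun z : 'rV[R]_n * 'rV[R]_(n + n) => J z.1 z.2).
  apply: measurable_funD; apply: measurable_funM.
  - exact: (measurableT_comp mP).
  - exact: measurable_osc2.
  - exact: (measurableT_comp mQ).
  - exact: measurable_osc2.
pose F x := \int[lam (n + n)%N]_p J x p.
have mF : measurable_fun setT F by exact: (measurable_Rintegral (lam (n + n)) mJ).
pose w x := b x * Num.sg (F x).
have msg : measurable_fun setT (fun x => Num.sg (F x)).
  rewrite (_ : (fun x => _) = (fun x => if F x < 0 then -1 else if 0 < F x then 1 else 0)).
    by mfun.
  by apply/funext => x; case: (ltgtP (F x) 0) => [/ltr0_sg|/gtr0_sg|->]; rewrite ?sgr0.
have mw : measurable_fun setT w by exact: measurable_funM.
have wb x : `|w x| <= b x.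
  rewrite normrM (ger0_norm (b0 x)) ler_piMr//.
  by case: sgrP; rewrite ?normrN ?normr1 ?normr0.
have iw := rintegrable_le mw ib wb.
have iJ x : rintegrable (lam (n + n)) (J x).
  have mo c : measurable_fun setT (fun p => osc c x (s p)) by exact: measurable_osc2.
  apply: rintegrableD; under eq_fun do rewrite mulrC.
    by apply: (rintegrableM (C := 1) iP (mo _)) => p; exact: osc_le1.
  by apply: (rintegrableM (C := 1) iQ (mo _)) => p; exact: osc_le1.
exists w; split=> //; rewrite -/(J _ _).
pose H := fun p => `|P p| + `|Q p|.
have iH : rintegrable (lam (n + n)) H by apply: rintegrableD; exact: rintegrable_abs.
have JH x p : `|J x p| <= H p.
  apply: le_trans (ler_normD _ _) _; rewrite !normrM.
  by apply: lerD; rewrite ler_piMr// osc_le1.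
have FH x : `|F x| <= \int[lam (n + n)%N]_p H p.
  by apply: le_Rintegral_abs => //; exact: rintegrable_measurable.
have ibF : rintegrable (lam n) (fun x => b x * `|F x|).
  under eq_fun do rewrite mulrC.
  apply: (rintegrableM (C := \int[lam (n + n)%N]_p H p) ib); first exact: measurableT_comp.
  by move=> x; rewrite normr_id.
rewrite (rintegrable_EFin ibF).
have -> : \int[lam n]_x (b x * `|F x|) = \int[lam n]_x \int[lam (n + n)%N]_p (w x * J x p).
  apply: eq_Rintegral => x _; rewrite RintegralZl//; last exact: iJ.
  by rewrite -/(F x) /w -mulrA [in LHS]normrEsg.
rewrite (@Rintegral_fubini_prod _ _ _ _ _ (lam n) (lam (n + n)) (fun x p => w x * J x p)
  (fun x => `|w x|) H).
- have E p : \int[lam n]_x (w x * J x p) = P p * W0 w (s p) + Q p * W1 w (s p).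
    rewrite -RintegralZl//; last exact: rintegrable_osc.
    rewrite -RintegralZl//; last exact: rintegrable_osc.
    rewrite -Rintegral_add; try by apply: rintegrableZ; exact: rintegrable_osc.
    by apply: eq_Rintegral => x _; rewrite /J; ring.
  under eq_Rintegral do rewrite E.
  have mW c : measurable_fun setT (fun p => osc_transform c w (s p)).
    exact: (measurableT_comp (measurable_osc_transform c mw) ms).
  have mPQ : measurable_fun setT (fun p => P p * W0 w (s p) + Q p * W1 w (s p)).
    by apply: measurable_funD; exact: measurable_funM.
  apply: (@le_trans _ _ (`|\int[lam (n + n)%N]_p (P p * W0 w (s p) + Q p * W1 w (s p))|)%:E).
    by rewrite lee_fin ler_norm.
  apply: le_trans (le_EFin_Rintegral mPQ) _.
  apply: ge0_le_integral_EFin.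
  - exact: measurableT_comp.
  - apply: measurable_funM => //; apply: measurable_funD; apply: measurableT_comp => //.
  - move=> p; rewrite normr_ge0/= mulrDr; apply: le_trans (ler_normD _ _) _.
    by rewrite !normrM lerD// ler_wpM2r.
- by apply: measurable_funM => //; exact: (measurableT_comp mw).
- exact: rintegrable_abs.
- exact: iH.
- by [].
- by move=> p; rewrite addr_ge0.
- by move=> x p; rewrite normrM ler_wpM2l.
Qed.

Lemma multiplier_osc h f g x : slow h -> schwartz f -> schwartz g ->
  let H p := h p * (fourier f (lsubmx p) * fourier g (rsubmx p)) in
  Re (bilinear_multiplier h f g x) = \int[lam (n + n)%N]_p
    (Re (H p) * osc 0 x (s p) + (- Im (H p)) * osc (- (pi / 2)) x (s p)) /\
  Im (bilinear_multiplier h f g x) = \int[lam (n + n)%N]_p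
    (Im (H p) * osc 0 x (s p) + Re (H p) * osc (- (pi / 2)) x (s p)).
Proof.
move=> sh hf hg H.
have E p : h p * fourier (tensor_at f g x) p = H p * cexp (2 * pi * dot_rV x (s p)).
  by rewrite fourier_tensor_at// /H !mulrA.
rewrite (bilinear_multiplierE x sh hf hg); split=> /=; apply: eq_Rintegral => p _.
  by rewrite E cReM /= /osc addr0 cosBpihalf mulNr.
by rewrite E cImM /= /osc addr0 cosBpihalf addrC.
Qed.

Lemma multiplier_symbol_integrable h f g : slow h -> schwartz f -> schwartz g ->
  cintegrable (fun p => h p * (fourier f (lsubmx p) * fourier g (rsubmx p))).
Proof.
move=> sh hf hg.
exact: slow_cintegrable sh (schwartz_tensor (schwartz_fourier hf) (schwartz_fourier hg)).
Qed.

Lemma cmeasurable_multiplier h f g : slow h -> schwartz f -> schwartz g ->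
  cmeasurable (bilinear_multiplier h f g).
Proof.
move=> sh hf hg; have [i1 i2] := multiplier_symbol_integrable sh hf hg.
have m1 := rintegrable_measurable i1; have m2 := rintegrable_measurable i2.
have ms1 : measurable_fun setT (fun z : 'rV[R]_n * 'rV[R]_(n + n) => s z.2).
  by apply: (measurableT_comp measurable_sum_lr); exact: measurable_snd.
have mo c : measurable_fun setT (fun z : 'rV[R]_n * 'rV[R]_(n + n) => osc c z.1 (s z.2)).
  exact: measurable_osc2.
pose H p := h p * (fourier f (lsubmx p) * fourier g (rsubmx p)).
split.
  under eq_fun do rewrite (multiplier_osc _ sh hf hg).1.
  apply: (measurable_Rintegral (lam (n + n)) (f := fun x p => Re (H p) * osc 0 x (s p) +
    (- Im (H p)) * osc (- (pi / 2)) x (s p))).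
  apply: measurable_funD; apply: measurable_funM => //.
    exact: (measurableT_comp m1).
  by apply: measurable_funN; exact: (measurableT_comp m2).
under eq_fun do rewrite (multiplier_osc _ sh hf hg).2.
apply: (measurable_Rintegral (lam (n + n)) (f := fun x p => Im (H p) * osc 0 x (s p) +
  Re (H p) * osc (- (pi / 2)) x (s p))).
by apply: measurable_funD; apply: measurable_funM => //; [exact: (measurableT_comp m2)|exact: (measurableT_comp m1)].
Qed.

Lemma schwartz_sqr d (f : 'rV[R]_d -> R[i]) : schwartz f ->
  rintegrable (lam d) (fun y => normc (f y) ^+ 2).
Proof.
move=> /schwartz_parts[f1 f2]; under eq_fun do rewrite normc_sqr.
by apply: rschwartz_integrable; apply: rschwartzD; apply: rschwartzM => //; exact: rschwartz_tame.
Qed.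

Variable w : 'rV[R]_n -> R.
Hypotheses (hw : rschwartz w) (w0 : w 0 = 1) (w_ge0 : forall x, 0 <= w x).
Local Notation m := (osc_mass w).

(** The constant 72 is 9 from the trilinear estimate, 4 from Plancherel for [f] and [g], and 2 for
    the real and imaginary parts. The number [a] controls the L2 norm of the transforms of the dual
    function, which is dominated by [b]. *)
Lemma multiplier_dual h k f g (b : 'rV[R]_n -> R) (a t : R) : slow h -> 0 < k ->
  (lorentz4_norm h <= k%:E)%E -> schwartz f -> schwartz g ->
  rintegrable (lam n) b -> (forall x, 0 <= b x) -> rintegrable (lam n) (fun x => b x ^+ 2) ->
  0 < a -> 4 * m * \int[lam n]_x (b x ^+ 2) <= a ^+ 2 -> 0 < t ->
  (\int[lam n]_x (b x * (`|Re (bilinear_multiplier h f g x)| +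
      `|Im (bilinear_multiplier h f g x)|))%:E <=
   (72 * m * (k * a * (t * \int[lam n]_x (normc (f x) ^+ 2) +
      (\int[lam n]_x (normc (g x) ^+ 2)) / t)))%:E)%E.
Proof.
move=> sh k0 hk hf hg ib b0 ib2 a0 ab t0.
pose H p := h p * (fourier f (lsubmx p) * fourier g (rsubmx p)).
have [i1 i2] := multiplier_symbol_integrable sh hf hg.
have mH := cintegrable_cmeasurable (conj i1 i2); have mnH := measurable_normc mH.
have m0 : 0 <= m by exact: osc_mass_ge0.
have F0 (q : 'rV[R]_n -> R[i]) : 0 <= \int[lam n]_x (normc (q x) ^+ 2).
  by apply: Rintegral_ge0 => x _; exact: sqr_ge0.
have pl (q : 'rV[R]_n -> R[i]) : schwartz q ->
    (\int[lam n]_xi (normc (fourier q xi) ^+ 2)%:E <=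
     (4 * m * \int[lam n]_x (normc (q x) ^+ 2))%:E)%E.
  by move=> hq; apply: (fourier_plancherel_le hw w0 w_ge0); [exact: schwartz_cintegrable|exact: schwartz_sqr].
have mq (q : 'rV[R]_n -> R[i]) : schwartz q -> measurable_fun setT (fun xi => normc (fourier q xi)).
  by move=> hq; apply: measurable_normc; apply: cmeasurable_fourier; exact: schwartz_cintegrable.
have key (P Q : 'rV[R]_(n + n) -> R) : rintegrable (lam (n + n)) P ->
    rintegrable (lam (n + n)) Q -> (forall p, `|P p| <= normc (H p)) ->
    (forall p, `|Q p| <= normc (H p)) ->
    (\int[lam n]_x (b x * `|\int[lam (n + n)%N]_p (P p * osc 0 x (s p) +
        Q p * osc (- (pi / 2)) x (s p))|)%:E <=
     (9 * (k * (a * (t * (4 * m * \int[lam n]_x (normc (f x) ^+ 2)) +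
      (4 * m * \int[lam n]_x (normc (g x) ^+ 2)) / t))))%:E)%E.
  move=> iP iQ PH QH; have [v [mv vb hv]] := dual_abs iP iQ mnH PH QH ib b0.
  apply: le_trans hv _.
  have iv := rintegrable_le mv ib vb.
  have v2b x : `|v x ^+ 2| <= b x ^+ 2.
    rewrite ger0_norm ?sqr_ge0// -(real_normK (num_real (v x))).
    by apply: lerXn2r; rewrite ?nnegrE.
  have iv2 := rintegrable_le (measurable_sqr mv) ib2 v2b.
  have mA : measurable_fun setT (fun x => `|W0 v x| + `|W1 v x|).
    by apply: measurable_funD; apply: measurableT_comp => //; exact: measurable_osc_transform.
  have hA : (\int[lam n]_x ((`|W0 v x| + `|W1 v x|) ^+ 2)%:E <= (a ^+ 2)%:E)%E.
    have mS : measurable_fun setT (fun x => W0 v x ^+ 2 + W1 v x ^+ 2).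
      by apply: measurable_funD; apply: measurable_sqr; exact: measurable_osc_transform.
    apply: (@le_trans _ _ (\int[lam n]_x (2 * (W0 v x ^+ 2 + W1 v x ^+ 2))%:E)%E).
      apply: ge0_le_integral_EFin; [exact: measurable_sqr|exact: measurable_funM|] => x.
      rewrite sqr_ge0/= -(real_normK (num_real (W0 v x))) -(real_normK (num_real (W1 v x))).
      by have := sqr_ge0 (`|W0 v x| - `|W1 v x|); nra.
    rewrite ge0_integralZl_real//; last by move=> x; rewrite addr_ge0// sqr_ge0.
    apply: (@le_trans _ _ (2%:E * (2 * m * \int[lam n]_x v x ^+ 2)%:E)%E).
      by apply: lee_wpmul2l; [rewrite lee_fin|exact: (osc_plancherel_le hw w0 w_ge0 iv iv2)].
    rewrite -EFinM lee_fin; apply: le_trans ab.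
    have -> : 2 * (2 * m * \int[lam n]_x v x ^+ 2) = 4 * m * \int[lam n]_x v x ^+ 2 by ring.
    apply: ler_wpM2l; first by rewrite mulr_ge0.
    apply: le_Rintegral => // x _; exact: le_trans (ler_norm _) (v2b x).
  have b40 (q : 'rV[R]_n -> R[i]) : 0 <= 4 * m * \int[lam n]_x (normc (q x) ^+ 2).
    by rewrite !mulr_ge0.
  have tri := trilinear_sum k0 a0 (b40 f) (b40 g) t0 (measurable_normc sh.1) mA (mq f hf) (mq g hg)
    (fun p => normc_ge0 _) (fun x => addr_ge0 (normr_ge0 _) (normr_ge0 _)) (fun x => normc_ge0 _)
    (fun x => normc_ge0 _) (lorentz4_norm_level (ltW k0) hk) hA (pl f hf) (pl g hg).
  apply: le_trans tri; rewrite le_eqVlt; apply/orP; left; apply/eqP; apply: eq_integral => p _.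
  by congr EFin; rewrite /H !normcM; ring.
have [mT1 mT2] := cmeasurable_multiplier sh hf hg.
have mb := rintegrable_measurable ib.
have mabs (F : 'rV[R]_n -> R) : measurable_fun setT F ->
    measurable_fun setT (fun x => b x * `|F x|).
  by move=> mF; apply: measurable_funM => //; exact: measurableT_comp.
under eq_integral do rewrite mulrDr.
rewrite ge0_integralD_EFin; last 4 first.
- exact: mabs mT1.
- exact: mabs mT2.
- by move=> x; exact: mulr_ge0.
- by move=> x; exact: mulr_ge0.
have hN p : `|- Im (H p)| <= normc (H p) by rewrite normrN normc_Im.
have h1 := key (fun p => Re (H p)) (fun p => - Im (H p)) i1 (rintegrableN i2)
  (fun p => normc_Re _) hN.
have h2 := key (fun p => Im (H p)) (fun p => Re (H p)) i2 i1
  (fun p => normc_Im _) (fun p => normc_Re _).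
have h1' := integral_weighted_le (N := fun x => `|Re (bilinear_multiplier h f g x)|)
  (fun x _ => congr1 Num.norm (multiplier_osc x sh hf hg).1) h1.
have h2' := integral_weighted_le (N := fun x => `|Im (bilinear_multiplier h f g x)|)
  (fun x _ => congr1 Num.norm (multiplier_osc x sh hf hg).2) h2.
apply: (le_trans (leeD h1' h2')); rewrite -EFinD lee_fin.
by rewrite le_eqVlt; apply/orP; left; apply/eqP; ring.
Qed.

End local_bound.

(** * Windows and averaging over their centres *)

Section averaging.
Context {R : realType}.
Local Opaque bilinear_multiplier.
Local Notation lam := (@lebesgue_rV R).
Local Notation Re := (@complex.Re R).
Local Notation Im := (@complex.Im R).

Lemma integral_average d (u : 'rV[R]_d -> R) (r : R) (x : 'rV[R]_d) : 0 < r ->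
  (forall y, 0 <= u y) -> rintegrable (lam d) u ->
  (\int[lam d]_q (u (r^-1 *: (x - q)))%:E = (r ^+ d * \int[lam d]_y u y)%:E)%E.
Proof.
move=> r0 u0 iu; have mu := rintegrable_measurable iu.
have ri0 : 0 < r^-1 by rewrite invr_gt0.
have mG : measurable_fun setT (fun q : 'rV[R]_d => (u (r^-1 *: q))%:E).
  by apply/measurable_EFinP; exact: measurable_dilate.
have mGx : measurable_fun setT (fun q : 'rV[R]_d => (u (r^-1 *: (x + q)))%:E).
  by apply/measurable_EFinP; exact: (measurable_shift x (measurable_dilate r^-1 mu)).
have -> : (\int[lam d]_q (u (r^-1 *: (x - q)))%:E = \int[lam d]_q (u (r^-1 *: (x + q)))%:E)%E.
  exact: (integral_opp_rV mGx).
have -> : (\int[lam d]_q (u (r^-1 *: (x + q)))%:E = \int[lam d]_q (u (r^-1 *: q))%:E)%E.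
  exact: (integral_shift_rV x mG).
have iur := rintegrable_dilate ri0 iu.
rewrite (rintegrable_EFin iur) (Rintegral_dilate ri0 mu) mulrA exprVn divff ?mul1r//.
by rewrite expf_neq0// gt_eqF.
Qed.

Variable n : nat.
Hypothesis n_gt0 : (0 < n)%N.
Implicit Types (f g : 'rV[R]_n -> R[i]) (h : 'rV[R]_(n + n) -> R[i]) (x q : 'rV[R]_n)
  (p : 'rV[R]_(n + n)).
Variable chi : 'rV[R]_n -> R.
Hypotheses (chi_smooth : smooth_real chi)
  (chi1 : forall x, norm2_rV x <= 1 -> chi x = 1)
  (chi0 : forall x, 3 / 2 <= norm2_rV x -> chi x = 0).

(** Squaring makes the bump nonnegative whatever the sign of [chi], and it is the factor by which a
    window changes the squared modulus. *)
Definition sqr_cutoff x : R := chi x * chi x.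

Lemma rschwartz_sqr_cutoff : rschwartz sqr_cutoff.
Proof.
have h := rschwartz_cutoff chi_smooth chi0.
by apply: rschwartzM => //; exact: rschwartz_tame.
Qed.

Lemma sqr_cutoff_ge0 x : 0 <= sqr_cutoff x.
Proof. by rewrite /sqr_cutoff -expr2 sqr_ge0. Qed.

Lemma sqr_cutoff0 : sqr_cutoff 0 = 1.
Proof. by rewrite /sqr_cutoff (chi_at0 chi1) mulr1. Qed.

Definition window (L : R) q f x : R[i] := (chi (L^-1 *: (x - q)))%:C%C * f x.

Lemma schwartz_window L q f : 1 <= L -> schwartz f -> schwartz (window L q f).
Proof.
move=> L1 hf; have L0 : 0 < L by exact: lt_le_trans L1.
have hF := schwartz_shift q hf.
have tL : tame (fun x => chi (L^-1 *: x)).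
  by apply: (tame_cutoff chi_smooth chi0); rewrite invr_ge0 ltW//= invf_le1.
have := schwartz_shift (- q) (schwartz_realM tL hF).
by under eq_fun do rewrite -addrA addNr addr0.
Qed.

Lemma normc_window L q f x :
  normc (window L q f x) ^+ 2 = sqr_cutoff (L^-1 *: (x - q)) * normc (f x) ^+ 2.
Proof. by rewrite /window normcM normc_real exprMn real_normK ?num_real// expr2. Qed.

(* On the support of the averaging function, the window is invisible to kernels
   supported in the ball of radius [rho]. *)
Lemma window_eq (rho : R) q x (y : 'rV[R]_n) f : 0 < rho -> sqr_cutoff (rho^-1 *: (x - q)) != 0 ->
  norm2_rV y < rho -> window (n%:R * (5 / 2 * rho)) q f (y + x) = f (y + x).
Proof.
move=> rho0 bq yr; rewrite /window chi1 ?mul1r//.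
have xq : norm2_rV (x - q) < 3 / 2 * rho.
  have : norm2_rV (rho^-1 *: (x - q)) < 3 / 2.
    by rewrite ltNge; apply: contra bq => /chi0; rewrite /sqr_cutoff => ->; rewrite mul0r.
  by rewrite norm2Z gtr0_norm ?invr_gt0// mulrC ltr_pdivrMr.
have L0 : 0 < n%:R * (5 / 2 * rho) by rewrite !mulr_gt0// ltr0n.
rewrite norm2Z gtr0_norm ?invr_gt0// mulrC ler_pdivrMr// mul1r.
(* The coordinates of [y] and of [x - q] are below rho and 3/2 rho; this explains 5/2, and [n] comes
   from passing back to the Euclidean norm. *)
apply: norm2_le_coord => i; rewrite -addrA mxE.
apply: le_trans (ler_normD _ _) _.
have := norm2_coord y i; have := norm2_coord (x - q) i; lra.
Qed.

Let mass := osc_mass sqr_cutoff.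
Let Ib := \int[lam n]_x sqr_cutoff x.
(** The added 1 keeps the L2 bound for the bump strictly positive, as the trilinear estimate
    requires. *)
Let a0 : R := Num.sqrt (4 * mass * \int[lam n]_x (sqr_cutoff x ^+ 2)) + 1.

(** The last factor is the volume ratio between the window and the averaging bump. *)
Definition piece_const : R := 72 * mass * a0 * (n%:R * (5 / 2)) ^+ n.

Lemma piece_const_ge0 : 0 <= piece_const.
Proof.
rewrite /piece_const !mulr_ge0 ?exprn_ge0 ?mulr_ge0//; first exact: osc_mass_ge0.
by rewrite addr_ge0 ?sqrtr_ge0.
Qed.

(** A bump of width rho has L2 norm proportional to the square root of [rho ^+ n]; the exponent n/2
    of the Besov norm originates here. *)
Lemma piece_window_bound h k f g (rho t : R) q : 1 <= rho -> slow h -> 0 < k ->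
  (lorentz4_norm h <= k%:E)%E -> schwartz f -> schwartz g -> 0 < t ->
  (\int[lam n]_x (sqr_cutoff (rho^-1 *: (x - q)) * (`|Re (bilinear_multiplier h f g x)| +
      `|Im (bilinear_multiplier h f g x)|))%:E <=
   (72 * mass * (k * (Num.sqrt (rho ^+ n) * a0) * (t * \int[lam n]_x (normc (f x) ^+ 2) +
      (\int[lam n]_x (normc (g x) ^+ 2)) / t)))%:E)%E.
Proof.
move=> rho1 sh k0 hk hf hg t0; have r0 : 0 < rho by exact: lt_le_trans rho1.
have ri0 : 0 < rho^-1 by rewrite invr_gt0.
have rn0 : 0 < rho ^+ n by rewrite exprn_gt0.
have hb := rschwartz_sqr_cutoff; have ib := rschwartz_integrable hb.
have m0 : 0 <= mass by exact: osc_mass_ge0.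
have hb2 : rschwartz (fun x => sqr_cutoff x ^+ 2) by apply: rschwartzM => //; exact: rschwartz_tame.
have ib2 := rschwartz_integrable hb2.
have shiftdil (u : 'rV[R]_n -> R) : rintegrable (lam n) u ->
    rintegrable (lam n) (fun x => u (rho^-1 *: (x - q))).
  move=> iu; have := rintegrable_shift (- q) (rintegrable_dilate ri0 iu).
  by under eq_fun do rewrite addrC.
have E2 : \int[lam n]_x (sqr_cutoff (rho^-1 *: (x - q)) ^+ 2) = rho ^+ n * \int[lam n]_x (sqr_cutoff x ^+ 2).
  have := Rintegral_shift (- q) (rintegrable_measurable (rintegrable_dilate ri0 ib2)).
  under eq_Rintegral do rewrite addrC; move=> ->.
  rewrite [in RHS](Rintegral_dilate ri0 (rintegrable_measurable ib2)) mulrA exprVn divff ?mul1r//.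
  by rewrite gt_eqF.
apply: (multiplier_dual rschwartz_sqr_cutoff sqr_cutoff0 sqr_cutoff_ge0) => //.
- exact: shiftdil.
- by move=> x; exact: sqr_cutoff_ge0.
- exact: (shiftdil _ ib2).
- by rewrite mulr_gt0 ?sqrtr_gt0// ltr_wpDl ?sqrtr_ge0.
- rewrite E2 exprMn sqr_sqrtr ?(ltW rn0)// mulrCA ler_pM2l//.
  have s0 : 0 <= 4 * mass * \int[lam n]_x (sqr_cutoff x ^+ 2).
    by rewrite !mulr_ge0// Rintegral_ge0// => x _; exact: sqr_ge0.
  have := sqr_sqrtr s0; have := sqrtr_ge0 (4 * mass * \int[lam n]_x (sqr_cutoff x ^+ 2)).
  by rewrite /a0; set X := Num.sqrt _ => X0 <-; nra.
Qed.

Lemma measurable_l1 d (F : 'rV[R]_d -> R[i]) : cmeasurable F ->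
  measurable_fun setT (fun y => `|Re (F y)| + `|Im (F y)|).
Proof. by move=> [m1 m2]; apply: measurable_funD; exact: measurableT_comp. Qed.

Lemma measurable_sqr_cutoff2 (r : R) : measurable_fun setT
  (fun z : 'rV[R]_n * 'rV[R]_n => sqr_cutoff (r *: (z.2 - z.1))).
Proof.
apply: (measurableT_comp (smooth_measurable rschwartz_sqr_cutoff.1)).
apply: measurable_fun_rV => i; under eq_fun do rewrite !mxE.
apply: measurable_funM => //; apply: measurable_funB.
  exact: (measurableT_comp (measurable_coord_rV i) measurable_snd).
exact: (measurableT_comp (measurable_coord_rV i) measurable_fst).
Qed.

Lemma integral_window (L : R) (N : 'rV[R]_n -> R) : 0 < L -> measurable_fun setT N ->
  (forall x, 0 <= N x) ->
  (\int[lam n]_q \int[lam n]_x (sqr_cutoff (L^-1 *: (x - q)) * N x)%:E =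
   (L ^+ n * Ib)%:E * \int[lam n]_x (N x)%:E)%E.
Proof.
move=> L0 mN N0; have ib := rschwartz_integrable rschwartz_sqr_cutoff.
have Ib0 : 0 <= Ib by apply: Rintegral_ge0 => x _; exact: sqr_cutoff_ge0.
have mB : measurable_fun setT (fun z : 'rV[R]_n * 'rV[R]_n =>
    (sqr_cutoff (L^-1 *: (z.2 - z.1)) * N z.2)%:E).
  apply/measurable_EFinP; apply: measurable_funM; first exact: measurable_sqr_cutoff2.
  exact: (measurableT_comp mN measurable_snd).
rewrite (fubini_tonelli (fun z : 'rV[R]_n * 'rV[R]_n =>
    (sqr_cutoff (L^-1 *: (z.2 - z.1)) * N z.2)%:E))//=; last first.
  by move=> z; rewrite lee_fin mulr_ge0 ?sqr_cutoff_ge0.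
rewrite -ge0_integralZl_real//; last by rewrite mulr_ge0// exprn_ge0// ltW.
apply: eq_integral => x _; under eq_integral do rewrite mulrC.
rewrite ge0_integralZl_real//.
- by rewrite integral_average// ?sqr_cutoff_ge0 -?EFinM ?(mulrC (N x))//; exact: sqr_cutoff_ge0.
- exact: (measurableT_comp (measurable_sqr_cutoff2 L^-1) (measurable_pair2 x)).
- by move=> q; exact: sqr_cutoff_ge0.
Qed.

Lemma piece_bound (chiD : 'rV[R]_(n + n) -> R) phi (u v : @Defs.distribution R (n + n))
    h k f g (rho t : R) :
  smooth_real chiD -> (forall p, norm2_rV p <= 1 -> chiD p = 1) ->
  (forall p, 3 / 2 <= norm2_rV p -> chiD p = 0) ->
  1 <= rho -> (forall p, rho <= norm2_rV p -> phi p = 0) ->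
  distr_of_fun v h -> eq_distribution (distr_fourier v) (distr_mul phi (distr_fourier u)) ->
  0 < k -> (lorentz4_norm h <= k%:E)%E -> schwartz f -> schwartz g -> 0 < t ->
  (\int[lam n]_x (normc (bilinear_multiplier h f g x))%:E <=
   (piece_const * (k * Num.sqrt (rho ^+ n)) * (t * \int[lam n]_x (normc (f x) ^+ 2) +
      (\int[lam n]_x (normc (g x) ^+ 2)) / t))%:E)%E.
Proof.
move=> chiD_smooth chiD1 chiD0 rho1 phi0 hv uv k0 hk hf hg t0.
have [_ [mh _] _] := hv; have sh := lorentz_slow mh k0 hk.
have r0 : 0 < rho by exact: lt_le_trans rho1.
have n1 : 1 <= n%:R :> R by rewrite ler1n.
pose L := n%:R * (5 / 2 * rho).
have L1 : 1 <= L by rewrite /L; nra.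
have L0 : 0 < L by exact: lt_le_trans L1.
pose T := bilinear_multiplier h f g.
pose N x := `|Re (T x)| + `|Im (T x)|.
have mN : measurable_fun setT N := measurable_l1 (cmeasurable_multiplier sh hf hg).
have N0 x : 0 <= N x by exact: addr_ge0.
have local q x : sqr_cutoff (rho^-1 *: (x - q)) != 0 ->
    T x = bilinear_multiplier h (window L q f) (window L q g) x.
  move=> bq; apply: (multiplier_local chiD_smooth chiD1 chiD0 hv sh uv hf hg
    (schwartz_window q L1 hf) (schwartz_window q L1 hg)).
  move=> p; have [pr|pr] := leP rho (norm2_rV p); first by rewrite phi0// !mul0r.
  have pl : norm2_rV (lsubmx p) < rho.
    by apply: le_lt_trans pr; rewrite -{2}(hsubmxK p) norm2_row_mxl.
  have pr' : norm2_rV (rsubmx p) < rho.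
    by apply: le_lt_trans pr; rewrite -{2}(hsubmxK p) norm2_row_mxr.
  by rewrite /tensor_at (window_eq f r0 bq pl) (window_eq g r0 bq pr').
pose F2 (e : 'rV[R]_n -> R[i]) := \int[lam n]_x (normc (e x) ^+ 2).
pose K := 72 * mass * (k * (Num.sqrt (rho ^+ n) * a0)).
have hq q : (\int[lam n]_x (sqr_cutoff (rho^-1 *: (x - q)) * N x)%:E <=
    (K * (t * F2 (window L q f) + F2 (window L q g) / t))%:E)%E.
  pose Nq x := `|Re (bilinear_multiplier h (window L q f) (window L q g) x)| +
    `|Im (bilinear_multiplier h (window L q f) (window L q g) x)|.
  have E x : sqr_cutoff (rho^-1 *: (x - q)) != 0 -> N x = Nq x.
    by move=> /local E; rewrite /N /Nq E.
  apply: (integral_weighted_le E).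
  have := piece_window_bound q rho1 sh k0 hk (schwartz_window q L1 hf) (schwartz_window q L1 hg) t0.
  by rewrite mulrA.
have K0 : 0 <= K.
  rewrite /K !mulr_ge0 ?(ltW k0) ?sqrtr_ge0//; first exact: osc_mass_ge0.
  by rewrite addr_ge0 ?sqrtr_ge0.
have Ib0 : 0 < Ib.
  apply: (@Rintegral_gt0 _ _ sqr_cutoff 0).
  - exact: smooth_continuous rschwartz_sqr_cutoff.1.
  - exact: sqr_cutoff_ge0.
  - by rewrite sqr_cutoff0.
  - exact: rschwartz_integrable rschwartz_sqr_cutoff.
have F20 e : 0 <= F2 e by apply: Rintegral_ge0 => x _; exact: sqr_ge0.
have me (e : 'rV[R]_n -> R[i]) : schwartz e -> measurable_fun setT (fun x => normc (e x) ^+ 2).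
  by move=> he; exact: rintegrable_measurable (schwartz_sqr he).
have FE (e : 'rV[R]_n -> R[i]) q : schwartz e -> (F2 (window L q e))%:E =
    (\int[lam n]_x (sqr_cutoff (L^-1 *: (x - q)) * normc (e x) ^+ 2)%:E)%E.
  move=> he; rewrite -(rintegrable_EFin (schwartz_sqr (schwartz_window q L1 he))).
  by apply: eq_integral => x _; rewrite normc_window.
have mF (e : 'rV[R]_n -> R[i]) : schwartz e -> measurable_fun setT (fun q => F2 (window L q e)).
  move=> he; apply: (measurable_Rintegral (lam n) (f := fun q x => normc (window L q e x) ^+ 2)).
  under eq_fun do rewrite normc_window.
  by apply: measurable_funM; [exact: measurable_sqr_cutoff2|exact: (measurableT_comp (me e he))].
have IF (e : 'rV[R]_n -> R[i]) : schwartz e ->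
    (\int[lam n]_q (F2 (window L q e))%:E = (L ^+ n * Ib * F2 e)%:E)%E.
  move=> he; under eq_integral do rewrite (FE e _ he).
  rewrite (integral_window L0 (me e he)); last by move=> x; exact: sqr_ge0.
  by rewrite (rintegrable_EFin (schwartz_sqr he)) -EFinM.
have c0 : 0 < rho ^+ n * Ib by rewrite mulr_gt0// exprn_gt0.
(* Integration over the centre [q]: the left side acquires the mass of the bump of width rho, the
   right side that of the squared window of width [L], and the common factor [Ib] cancels
   afterwards. *)
have main : ((rho ^+ n * Ib)%:E * \int[lam n]_x (N x)%:E <=
    (K * (t * (L ^+ n * Ib * F2 f) + (L ^+ n * Ib * F2 g) / t))%:E)%E.
  rewrite -(integral_window r0 mN N0).
  apply: (@le_trans _ _ (\int[lam n]_q (K * (t * F2 (window L q f) + t^-1 * F2 (window L q g)))%:E)%E).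
    apply: ge0_le_integral => //.
    - by move=> q _; apply: integral_ge0 => x _; rewrite lee_fin mulr_ge0 ?sqr_cutoff_ge0.
    - apply: (measurable_fun_fubini_tonelli_F (fun z : 'rV[R]_n * 'rV[R]_n =>
        (sqr_cutoff (rho^-1 *: (z.2 - z.1)) * N z.2)%:E)).
        apply/measurable_EFinP; apply: measurable_funM; first exact: measurable_sqr_cutoff2.
        exact: (measurableT_comp mN measurable_snd).
      by move=> z; rewrite lee_fin mulr_ge0 ?sqr_cutoff_ge0.
    - apply/measurable_EFinP; apply: measurable_funM => //.
      by apply: measurable_funD; apply: measurable_funM => //; exact: mF.
    - by move=> q _; apply: le_trans (hq q) _; rewrite (mulrC t^-1).
  rewrite ge0_integralZl_real//; last 2 first.
  - by apply: measurable_funD; apply: measurable_funM => //; exact: mF.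
  - by move=> q; rewrite addr_ge0 ?mulr_ge0 ?invr_ge0 ?(ltW t0).
  rewrite ge0_integralD_EFin; last 4 first.
  - by apply: measurable_funM => //; exact: mF.
  - by apply: measurable_funM => //; exact: mF.
  - by move=> q; rewrite mulr_ge0// ltW.
  - by move=> q; rewrite mulr_ge0 ?invr_ge0// ltW.
  rewrite !ge0_integralZl_real ?invr_ge0 ?(ltW t0)//; last 2 first.
  - exact: mF.
  - exact: mF.
  by rewrite (IF f hf) (IF g hg) -(EFinM t) -(EFinM t^-1) -EFinD -EFinM (mulrC t^-1).
apply: (@le_trans _ _ (\int[lam n]_x (N x)%:E)%E).
  apply: ge0_le_integral_EFin => //.
    exact: measurable_normc (cmeasurable_multiplier sh hf hg).
  by move=> x; rewrite normc_ge0 normc_le.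
rewrite muleC -lee_pdivlMr// in main; apply: le_trans main _.
rewrite -EFinM lee_fin le_eqVlt; apply/orP; left; apply/eqP.
have EL : L ^+ n = (n%:R * (5 / 2)) ^+ n * rho ^+ n by rewrite -exprMn /L mulrA.
rewrite EL /piece_const /K -/(F2 f) -/(F2 g).
have rn0 : rho ^+ n != 0 by rewrite expf_neq0// gt_eqF.
set r2 := Num.sqrt (rho ^+ n); set r3 := (n%:R * (5 / 2)) ^+ n.
set r1 := rho ^+ n in rn0 *.
by field; rewrite rn0 !gt_eqF.
Qed.

End averaging.

(** * Test functions *)

Section orthants.
Context {R : realType}.
Variable d : nat.

(** Orthants form a pi-system generating the Borel sets, and their indicators are limits of products
    of smooth steps; both facts feed the Dynkin arguments. *)
Definition orthant (b : 'rV[R]_d) : set 'rV[R]_d := [set x | forall i, x ord0 i < b ord0 i].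

Definition orthants : set (set 'rV[R]_d) := [set orthant b | b in setT].

Lemma measurable_orthant b : measurable (orthant b).
Proof.
rewrite (_ : orthant b = \bigcap_(i in [set: 'I_d]) ((fun x : 'rV[R]_d => x ord0 i) @^-1` `]-oo, (b ord0 i)[)).
  apply: fin_bigcap_measurable; first exact: finite_finset.
  move=> i _; rewrite -[X in measurable X]setTI.
  exact: measurable_coord_rV.
apply/seteqP; split=> [x h i _|x h i] /=; first by rewrite in_itv/= h.
by have := h i I; rewrite /= in_itv.
Qed.

Lemma orthantI b c : orthant b `&` orthant c =
  orthant (\row_i Num.min (b ord0 i) (c ord0 i)).
Proof.
apply/seteqP; split=> x /=.
  by move=> [h1 h2] i; rewrite mxE lt_min h1 h2.
by move=> h; split=> i; have := h i; rewrite mxE lt_min => /andP[].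
Qed.

Lemma measurable_orthants : @measurable _ 'rV[R]_d = <<s orthants >>.
Proof.
apply/seteqP; split; last first.
  apply: smallest_sub; first exact: sigma_algebra_measurable.
  by move=> _ [b _ <-]; exact: measurable_orthant.
apply: smallest_sub; first exact: smallest_sigma_algebra.
rewrite -bigcup_seq => A [i _ [B mB <-]].
have mi : measurable_fun setT ((fun x => x ord0 i) : g_sigma_algebraType orthants -> measurableTypeR R).
  apply: (measurability _ (RGenInftyO.measurableE R)) => _ [_ [t ->] <-].
  rewrite setTI.
  (* A half-space is a union of orthants whose remaining bounds tend to infinity. *)
  rewrite (_ : _ @^-1` _ = \bigcup_k orthant (\row_j if j == i then t else k%:R)).
    apply: bigcup_measurable => k _; apply: sub_sigma_algebra.
    by exists (\row_j if j == i then t else k%:R).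
  apply/seteqP; split=> x /=.
    rewrite in_itv/= => xt; have [N hN] : exists N : nat, forall j, x ord0 j < N%:R.
      exists (Num.truncn (\sum_j `|x ord0 j|)).+1 => j.
      apply: le_lt_trans (truncnS_gt _); apply: le_trans (ler_norm _) _.
      by rewrite (bigD1 j)//= lerDl sumr_ge0.
    by exists N => // j; rewrite mxE; case: eqP => [->|_].
  by move=> [k _ h]; have := h i; rewrite mxE eqxx in_itv.
exact: (mi (@measurableT _ (g_sigma_algebraType orthants)) B mB).
Qed.

Lemma orthant_dynkin (P : set_system 'rV[R]_d) :
  P setT -> (forall b, P (orthant b)) ->
  (forall S, measurable S -> P S -> P (~` S)) ->
  (forall F : (set 'rV[R]_d)^nat, (forall n, measurable (F n)) ->
    trivIset [set: nat] F -> (forall n, P (F n)) -> P (\bigcup_k F k)) ->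
  forall S, measurable S -> P S.
Proof.
move=> PT PO PC PU S; rewrite measurable_orthants.
apply: (dynkin_induction measurable_orthants) => //.
- by move=> _ _ [b _ <-] [c _ <-]; rewrite orthantI; eexists.
- by move=> _ [b _ <-].
Qed.

(** For disjoint sets the partial sums stay in [0, 1] and are eventually constant at each point,
    which is what dominated convergence requires. *)
Lemma sum_indic_trivIset (F : (set 'rV[R]_d)^nat) x : trivIset [set: nat] F ->
  (forall n, 0 <= \sum_(k < n) (\1_(F k) x : R) <= 1) /\
  (\sum_(k < n) (\1_(F k) x : R) @[n --> \oo] --> (\1_(\bigcup_k F k) x : R)).
Proof.
move=> tF.
have s0 n : 0 <= \sum_(k < n) (\1_(F k) x : R) by apply: sumr_ge0 => k _; rewrite indicE ler0n.
have [[k0 _ xk]|nx] := pselect ((\bigcup_k F k) x); last first.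
  have E n : \sum_(k < n) (\1_(F k) x : R) = 0.
    apply: big1 => k _; rewrite indicE memNset// => xF; apply: nx; by exists k.
  split=> [n|]; first by rewrite E ler01 lexx.
  rewrite indicE memNset//; under eq_fun do rewrite E.
  exact: cvg_cst.
have other k : k != k0 -> \1_(F k) x = 0 :> R.
  move=> kk0; rewrite indicE memNset// => xF.
  by move: kk0; rewrite (tF k k0 I I (ex_intro _ x (conj xF xk))) eqxx.
have E n : \sum_(k < n) (\1_(F k) x : R) = (k0 < n)%:R.
  case: ltnP => [kn|nk].
    by rewrite (bigD1 (Ordinal kn))//= big1 ?addr0 ?indicE ?mem_set// => k kk0; apply: other.
  by apply: big1 => k _; apply: other; rewrite neq_ltn (leq_trans _ nk).
split=> [n|]; first by rewrite E ler0n lern1; case: (k0 < n)%N.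
rewrite indicE mem_set; last by exists k0.
apply: cvg_near_cst; exists k0.+1 => // n /= kn; by rewrite E kn.
Qed.

End orthants.

Section zero_integrals.
Context dT (T : measurableType dT) {R : realType} (mu : {measure set T -> \bar R}).

Lemma Rintegral_limit0 (f_ : nat -> T -> R) (f g : T -> R) :
  (forall n, measurable_fun setT (f_ n)) ->
  (forall x, f_ n x @[n --> \oo] --> f x) ->
  rintegrable mu g -> (forall n x, `|f_ n x| <= g x) ->
  (forall n, \int[mu]_x f_ n x = 0) -> \int[mu]_x f x = 0.
Proof.
move=> mf cf ig fg I0; have h := Rintegral_dominated mf cf ig fg.
have E : (fun n => \int[mu]_x f_ n x) = (fun=> 0) by apply/funext.
by rewrite E in h; exact/esym/(cvg_unique _ (@cvg_cst _ (0 : R) _ \oo _) h).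
Qed.

Lemma Rintegral0 : \int[mu]_x (0 : R) = 0.
Proof. by rewrite /Rintegral integral0. Qed.

Lemma Rintegral_eq0_ae (f : T -> R) : rintegrable mu f -> (forall x, 0 <= f x) ->
  \int[mu]_x f x = 0 -> {ae mu, forall x, f x = 0}.
Proof.
move=> hf f0 I0; have mf := rintegrable_measurable hf.
have mf' : measurable_fun setT (EFin \o f) by exact/measurable_EFinP.
have := (ae_eq_integral_abs mu measurableT mf').1.
under eq_integral do rewrite /= ger0_norm//.
rewrite (rintegrable_EFin hf) I0 => /(_ erefl); apply: filterS => x /(_ I) h.
by have := congr1 fine h.
Qed.

End zero_integrals.

(** * Test functions: they separate functions and are dense in L2 *)

Section real_tests.
Context {R : realType}.
Local Notation lam := (@lebesgue_rV R).
Variable d : nat.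
Variable chi : 'rV[R]_d -> R.
Hypotheses (chi_smooth : smooth_real chi)
  (chi1 : forall x, norm2_rV x <= 1 -> chi x = 1)
  (chi0 : forall x, 3 / 2 <= norm2_rV x -> chi x = 0).
Implicit Types (u theta D F G : 'rV[R]_d -> R) (x b : 'rV[R]_d).

Definition rtest u := smooth_real u /\ exists r : R, forall x, r < norm2_rV x -> u x = 0.

Lemma rtestM v u : smooth_real v -> rtest u -> rtest (fun x => v x * u x).
Proof.
move=> sv [su [r hr]]; split; first exact: (smoothM sv su).1.
by exists r => x /hr->; rewrite mulr0.
Qed.

Lemma rtestD u v : rtest u -> rtest v -> rtest (fun x => u x + v x).
Proof.
move=> [su [r hr]] [sv [s hs]]; split; first exact: (smoothD su sv).1.
exists (Num.max r s) => x; rewrite gt_max => /andP[/hr-> /hs->]; exact: addr0.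
Qed.

Lemma rtestZ c u : rtest u -> rtest (fun x => c * u x).
Proof.
move=> [su [r hr]]; split; first exact: (smoothZ c su).1.
by exists r => x /hr->; rewrite mulr0.
Qed.

Definition cutoff_sqr (N : nat) x : R := sqr_cutoff chi (harmonic N *: x).

Lemma rtest_cutoff_sqr N : rtest (cutoff_sqr N).
Proof.
have sN := (smooth_dilate chi_smooth (harmonic N)).1.
split; first exact: (smoothM sN sN).1.
have h0 : 0 < harmonic N :> R by exact: harmonic_gt0.
exists (3 / 2 / harmonic N) => x hx; rewrite /cutoff_sqr /sqr_cutoff chi0 ?mul0r//.
by rewrite norm2Z gtr0_norm// -ler_pdivrMl// mulrC ltW.
Qed.

Lemma cutoff_sqr_ge0 N x : 0 <= cutoff_sqr N x.
Proof. exact: sqr_cutoff_ge0. Qed.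

Lemma cutoff_sqr_bounded : exists2 K, 0 <= K & forall N x, cutoff_sqr N x <= K.
Proof.
have [K K0 hK] := rschwartz_le (rschwartz_sqr_cutoff chi_smooth chi0); exists K => // N x.
exact: le_trans (ler_norm _) (hK _).
Qed.

Lemma cutoff_sqr1 x : exists N, forall M, (N <= M)%N -> cutoff_sqr M x = 1.
Proof.
exists (Num.truncn (norm2_rV x)) => M NM; rewrite /cutoff_sqr /sqr_cutoff chi1 ?mul1r//.
rewrite norm2Z gtr0_norm ?harmonic_gt0// /harmonic mulrC ler_pdivrMr ?ltr0n// mul1r.
apply: ltW; apply: lt_le_trans (truncnS_gt _) _.
by rewrite ler_nat.
Qed.

Lemma cvg_cutoff_sqr x : cutoff_sqr N x @[N --> \oo] --> (1 : R).
Proof. by have [N hN] := cutoff_sqr1 x; apply: cvg_near_cst; exists N. Qed.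

(** The shift by 3/2 places the transition inside the orthant: a factor vanishes for x_i >= b_i and
    equals 1 once j (b_i - x_i) exceeds 3/2. Hence the convergence holds at every point, the
    boundary included. *)
Definition orthant_step (b : 'rV[R]_d) (j : nat) (s : seq 'I_d) x : R :=
  \prod_(i <- s) step chi i (j%:R *: (b - x) - const_mx (3 / 2)).

Lemma smooth_orthant_step b j s : smooth_real (orthant_step b j s).
Proof.
elim: s => [|i s IH].
  rewrite (_ : orthant_step b j [::] = fun=> 1); first exact: (smooth_cst d 1).1.
  by apply/funext => x; rewrite /orthant_step big_nil.
rewrite (_ : orthant_step b j (i :: s) = fun x =>
  step chi i (j%:R *: (b - x) - const_mx (3 / 2)) * orthant_step b j s x); last first.
  by apply/funext => x; rewrite /orthant_step big_cons.
apply: (smoothM _ IH).1.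
pose L (x : 'rV[R]_d) := j%:R *: (b - x) - const_mx (3 / 2).
have hL (x : 'rV[R]_d) h k : L (h *: 'e_k + x) = (h * (- j%:R)) *: 'e_k + L x.
  by apply/rowP => l; rewrite /L !mxE; ring.
have cL : continuous L.
  apply: continuous_rV => k; under eq_fun do rewrite !mxE.
  apply: continuous_add; last exact: cst_continuous.
  apply: continuous_mul; first exact: cst_continuous.
  apply: continuous_add; first exact: cst_continuous.
  by apply: continuous_opp; exact: coord_continuous.
exact: (smooth_comp_monomial (sg := id) hL cL (smooth_step chi_smooth chi1 i)).1.
Qed.

Lemma orthant_step_bounded : exists2 K, 0 <= K & forall b j x,
  `|orthant_step b j (enum 'I_d) x| <= K.
Proof.
have [K hK] := step_bounded chi_smooth chi0.
have [d0|/existsP[i0 _]] := boolP [forall i : 'I_d, false].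
  exists 1 => // b j x; rewrite /orthant_step big1_seq ?normr1// => i _.
  by move/forallP: d0 => /(_ i).
have K0 : 0 <= K by apply: le_trans (hK i0 0).
exists (K ^+ d); first exact: exprn_ge0.
move=> b j x; rewrite /orthant_step normr_prod.
rewrite -[leRHS](_ : \prod_(i <- enum 'I_d) K = _); last first.
  by rewrite big_enum prodr_const card_ord.
apply: ler_prod => i _; rewrite normr_ge0/=; exact: hK.
Qed.

Lemma cvg_orthant_step b x :
  orthant_step b j (enum 'I_d) x @[j --> \oo] --> (\1_(orthant b) x : R).
Proof.
have [bx|nbx] := pselect (orthant b x); last first.
  have [i hi] : exists i, b ord0 i <= x ord0 i.
    apply: contrapT => /forallNP h; apply: nbx => i; rewrite ltNge; apply/negP; exact: h.
  rewrite indicE memNset//; apply: cvg_near_cst; apply: nearW => j.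
  rewrite /orthant_step (bigD1_seq i) ?mem_enum ?enum_uniq//= step0 ?mul0r//.
  by rewrite !mxE gerDr mulr_ge0_le0// subr_le0.
rewrite indicE mem_set//; apply: cvg_near_cst.
have [N hN] : exists N : nat, forall i, 3 / 2 < N%:R * (b ord0 i - x ord0 i).
  exists (Num.truncn (\sum_i (3 / 2) / (b ord0 i - x ord0 i))).+1 => i.
  have p0 k : 0 < b ord0 k - x ord0 k by rewrite subr_gt0.
  rewrite -ltr_pdivrMr//; apply: le_lt_trans (truncnS_gt _).
  by rewrite (bigD1 i)//= lerDl sumr_ge0// => k _; rewrite divr_ge0// ltW.
exists N => // j /= Nj; rewrite /orthant_step big1_seq// => i _; rewrite step1//.
rewrite !mxE subr_gt0; apply: lt_le_trans (hN i) _.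
by rewrite ler_wpM2r ?ler_nat// ltW// subr_gt0.
Qed.

Lemma rtest_measurable u : rtest u -> measurable_fun setT u.
Proof. by move=> [su _]; exact: smooth_measurable. Qed.

Lemma rtest_orthant_step theta c (j : nat) : rtest theta ->
  rtest (fun x => orthant_step c j (enum 'I_d) x * theta x).
Proof. by move=> ht; apply: rtestM => //; exact: smooth_orthant_step. Qed.

(** For a fixed test function theta, the sets over which theta D has integral 0 form a Dynkin class
    containing the orthants. The sets {D > 0} and {D < 0}, with growing cutoffs for theta, then give
    the claim. *)
Lemma fundamental_lemma D : measurable_fun setT D ->
  (forall theta, rtest theta -> rintegrable (lam d) (fun x => theta x * D x)) ->
  (forall theta, rtest theta -> \int[lam d]_x (theta x * D x) = 0) ->
  {ae lam d, forall x, D x = 0}.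
Proof.
move=> mD iD D0.
have meas1 A : measurable A -> measurable_fun setT (fun x => \1_A x : R).
  by move=> mA; exact: measurable_indic.
have i1 A theta : measurable A -> rtest theta ->
    rintegrable (lam d) (fun x => \1_A x * (theta x * D x)).
  move=> mA ht; apply: (rintegrableM (C := 1) (iD _ ht) (meas1 A mA)) => x.
  by rewrite indicE; case: (_ \in _); rewrite ?normr1 ?normr0.
have key theta : rtest theta -> forall A, measurable A ->
    \int[lam d]_x (\1_A x * (theta x * D x)) = 0.
  move=> ht; apply: orthant_dynkin.
  - by under eq_Rintegral do rewrite indicT mul1r; exact: D0.
  - move=> c; have [K K0 hK] := orthant_step_bounded.
    apply: (@Rintegral_limit0 _ _ R (lam d)
      (fun j x => orthant_step c j (enum 'I_d) x * (theta x * D x))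
      (fun x => \1_(orthant c) x * (theta x * D x)) (fun x => K * `|theta x * D x|)).
    + move=> j; apply: measurable_funM; first exact: (smooth_measurable (smooth_orthant_step _ _ _)).
      exact: (rintegrable_measurable (iD _ ht)).
    + by move=> x; apply: cvgMr_tmp; exact: cvg_orthant_step.
    + by apply: rintegrableZ; apply: rintegrable_abs; exact: iD.
    + by move=> j x; rewrite normrM ler_wpM2r.
    + move=> j; under eq_Rintegral do rewrite mulrA; apply: D0; exact: rtest_orthant_step.
  - move=> A mA IA; have := D0 _ ht.
    have -> : \int[lam d]_x (theta x * D x) =
        \int[lam d]_x (\1_A x * (theta x * D x) + \1_(~` A) x * (theta x * D x)).
      apply: eq_Rintegral => x _; rewrite !indicE in_setC.
      by case: (x \in A); rewrite ?mul1r ?mul0r ?addr0 ?add0r.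
    rewrite Rintegral_add; [|exact: i1|by apply: i1 => //; exact: measurableC].
    by rewrite IA add0r.
  - move=> F mF tF hF.
    apply: (@Rintegral_limit0 _ _ R (lam d)
      (fun n x => (\sum_(k < n) \1_(F k) x) * (theta x * D x))
      (fun x => \1_(\bigcup_k F k) x * (theta x * D x)) (fun x => `|theta x * D x|)).
    + move=> n; apply: measurable_funM; last exact: (rintegrable_measurable (iD _ ht)).
      by apply: measurable_sum => k; exact: meas1.
    + move=> x; apply: cvgMr_tmp; exact: (sum_indic_trivIset x tF).2.
    + by apply: rintegrable_abs; exact: iD.
    + move=> n x; rewrite normrM ler_piMl//.
      by have [/(_ n)/andP[s0 s1] _] := sum_indic_trivIset (R := R) x tF; rewrite ger0_norm.
    + move=> n; under eq_Rintegral do rewrite mulr_suml.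
      rewrite Rintegral_sum; last by move=> k; exact: i1.
      by apply: big1 => k _; exact: hF.
have mpos : measurable [set x | 0 < D x].
  rewrite (_ : mkset _ = D @^-1` `]0, +oo[); last first.
    by apply/seteqP; split=> x /=; rewrite in_itv/= andbT.
  by rewrite -[X in measurable X]setTI; exact: mD.
have mneg : measurable [set x | D x < 0].
  rewrite (_ : mkset _ = D @^-1` `]-oo, 0[); last first.
    by apply/seteqP; split=> x /=; rewrite in_itv.
  by rewrite -[X in measurable X]setTI; exact: mD.
have ht N := rtest_cutoff_sqr N.
have h1 N : {ae lam d, forall x, \1_[set x | 0 < D x] x * (cutoff_sqr N x * D x) = 0}.
  apply: Rintegral_eq0_ae; [exact: i1|move=> x|exact: key].
  rewrite indicE; have [xp|xn] := boolP (x \in _); last by rewrite mul0r.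
  by rewrite mul1r mulr_ge0 ?cutoff_sqr_ge0// ltW//; move: xp; rewrite inE.
have h2 N : {ae lam d, forall x, - (\1_[set x | D x < 0] x * (cutoff_sqr N x * D x)) = 0}.
  apply: Rintegral_eq0_ae; [by apply: rintegrableN; exact: i1|move=> x|].
    rewrite indicE; have [xp|xn] := boolP (x \in _); last by rewrite mul0r oppr0.
    rewrite mul1r oppr_ge0 mulr_ge0_le0 ?cutoff_sqr_ge0// ltW//; by move: xp; rewrite inE.
  under eq_Rintegral do rewrite -mulN1r.
  by rewrite RintegralZl// ?key ?mulr0//; exact: i1.
apply: filterS2 (ae_foralln h1) (ae_foralln h2) => x p1 p2.
have [N hN] := cutoff_sqr1 x; have c1 := hN N (leqnn N).
case: (ltgtP (D x) 0) => // hx.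
  by have := p2 N; rewrite indicE mem_set// c1 !mul1r => /eqP; rewrite oppr_eq0 => /eqP.
by have := p1 N; rewrite indicE mem_set// c1 !mul1r.
Qed.

(** Dilation by [q] brings the support into radius 3/2, where [rschwartz_cutoff] applies; the bounds
    are scaled back. *)
Lemma rtest_rschwartz u : rtest u -> rschwartz u.
Proof.
move=> [su [r hr]]; pose q : R := 2 * (1 + `|r|).
have q2 : 2 <= q by rewrite /q; have := normr_ge0 r; lra.
have q0 : 0 < q by lra.
have [sv pv] := smooth_dilate su q.
have v0 x : 3 / 2 <= norm2_rV x -> u (q *: x) = 0.
  move=> hx; apply: hr; rewrite norm2Z gtr0_norm//.
  by have := ler_norm r; have := normr_ge0 r; rewrite /q; nra.
have [_ hv] := rschwartz_cutoff sv v0.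
split=> // M; have [K hK] := hv M; exists (q ^+ M * (q ^+ M * K)) => s x sM.
have K0 := sbound_ge0 hK.
have E : partial s u x = q^-1 ^+ size s * partial s (fun x => u (q *: x)) (q^-1 *: x).
  by rewrite pv scalerA divff ?gt_eqF// scale1r mulrA -exprMn mulVf ?gt_eqF// expr1n mul1r.
rewrite E normrM.
have qs : `|q^-1 ^+ size s| <= 1.
  by rewrite normrX ger0_norm ?invr_ge0 ?(ltW q0)// exprn_ile1// ?invr_ge0 ?(ltW q0)// invf_le1//; lra.
have hw : (1 + norm2_rV x) ^+ M <= q ^+ M * (1 + norm2_rV (q^-1 *: x)) ^+ M.
  rewrite -exprMn; apply: lerXn2r; rewrite ?nnegrE ?mulr_ge0 ?addr_ge0 ?norm2_ge0 ?(ltW q0)//.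
  by rewrite norm2Z ger0_norm ?invr_ge0 ?(ltW q0)// mulrDr mulr1 mulrA divff ?gt_eqF// mul1r; lra.
apply: (@le_trans _ _ (q ^+ M * (1 + norm2_rV (q^-1 *: x)) ^+ M *
    `|partial s (fun x => u (q *: x)) (q^-1 *: x)|)).
  apply: ler_pM => //; first exact: weight_ge0.
  by rewrite ler_piMl.
rewrite -mulrA ler_wpM2l ?exprn_ge0 ?(ltW q0)//.
apply: le_trans (hK s (q^-1 *: x) sM) _; rewrite ler_peMl// exprn_ege1//; lra.
Qed.

Definition square_integrable F := measurable_fun setT F /\ rintegrable (lam d) (fun x => F x ^+ 2).

Lemma square_integrable_le (F G : 'rV[R]_d -> R) : measurable_fun setT F ->
  square_integrable G -> (forall x, `|F x| <= `|G x|) -> square_integrable F.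
Proof.
move=> mF [mG iG] FG; split=> //; apply: rintegrable_le iG _; first exact: measurable_sqr.
move=> x; rewrite ger0_norm ?sqr_ge0// -(real_normK (num_real (F x))) -(real_normK (num_real (G x))).
by apply: lerXn2r; rewrite ?nnegrE.
Qed.

Lemma square_integrableZ c F : square_integrable F -> square_integrable (fun x => c * F x).
Proof.
move=> [mF iF]; split; first exact: measurable_funM.
by under eq_fun do rewrite exprMn; exact: rintegrableZ.
Qed.

Lemma sqrD_le (a b : R) : (a + b) ^+ 2 <= 2 * a ^+ 2 + 2 * b ^+ 2.
Proof. by have := sqr_ge0 (a - b); nra. Qed.

Lemma square_integrableD F G : square_integrable F -> square_integrable G ->
  square_integrable (fun x => F x + G x).
Proof.
move=> [mF iF] [mG iG]; split; first exact: measurable_funD.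
apply: (rintegrable_le (g := fun x => 2 * F x ^+ 2 + 2 * G x ^+ 2)).
- by apply: measurable_sqr; exact: measurable_funD.
- by apply: rintegrableD; exact: rintegrableZ.
- by move=> x; rewrite ger0_norm ?sqr_ge0// sqrD_le.
Qed.

Lemma square_integrableB F G : square_integrable F -> square_integrable G ->
  square_integrable (fun x => F x - G x).
Proof.
move=> hF hG; have := square_integrableD hF (square_integrableZ (-1) hG).
by under eq_fun do rewrite mulN1r.
Qed.

Lemma square_integral_le F G : square_integrable F -> square_integrable G ->
  \int[lam d]_x (F x + G x) ^+ 2 <= 2 * \int[lam d]_x F x ^+ 2 + 2 * \int[lam d]_x G x ^+ 2.
Proof.
move=> hF hG.
have E H : square_integrable H -> 2 * \int[lam d]_x H x ^+ 2 = \int[lam d]_x (2 * H x ^+ 2).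
  by move=> hH; rewrite RintegralZl//; exact: hH.2.
rewrite (E F hF) (E G hG).
rewrite -Rintegral_add; [|exact: rintegrableZ hF.2|exact: rintegrableZ hG.2].
apply: le_Rintegral => //.
- exact: (square_integrableD hF hG).2.
- by apply: rintegrableD; apply: rintegrableZ; [exact: hF.2|exact: hG.2].
- by move=> x _; exact: sqrD_le.
Qed.

Lemma rtest_square_integrable u : rtest u -> square_integrable u.
Proof.
move=> /rtest_rschwartz hu; split; first exact: smooth_measurable hu.1.
by apply: rschwartz_integrable; apply: rschwartzM => //; exact: rschwartz_tame.
Qed.

(** This class is closed under L2 limits and linear combinations, so membership passes from test
    functions to indicators, simple functions and finally all of L2. *)
Definition test_approx F := square_integrable F /\ forall e, 0 < e ->
  exists2 theta, rtest theta & \int[lam d]_x (F x - theta x) ^+ 2 <= e.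

Lemma test_approx_limit F : square_integrable F ->
  (forall e, 0 < e -> exists2 G, test_approx G & \int[lam d]_x (F x - G x) ^+ 2 <= e) ->
  test_approx F.
Proof.
move=> hF h; split=> // e e0; have e4 : 0 < e / 4 by rewrite divr_gt0.
have [G [hG aG] FG] := h _ e4; have [theta ht Gt] := aG _ e4.
exists theta => //.
have -> : \int[lam d]_x (F x - theta x) ^+ 2 = \int[lam d]_x ((F x - G x) + (G x - theta x)) ^+ 2.
  by apply: eq_Rintegral => x _; rewrite addrA subrK.
apply: le_trans (square_integral_le (square_integrableB hF hG)
  (square_integrableB hG (rtest_square_integrable ht))) _.
lra.
Qed.

Lemma test_approx_rtest u : rtest u -> test_approx u.
Proof.
move=> hu; split; first exact: rtest_square_integrable.
move=> e e0; exists u => //; under eq_Rintegral do rewrite subrr expr0n/=.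
by rewrite Rintegral0 ltW.
Qed.

Lemma test_approxD F G : test_approx F -> test_approx G -> test_approx (fun x => F x + G x).
Proof.
move=> [hF aF] [hG aG]; split; first exact: square_integrableD.
move=> e e0; have e4 : 0 < e / 4 by rewrite divr_gt0.
have [t ht Ft] := aF _ e4; have [u hu Gu] := aG _ e4.
exists (fun x => t x + u x); first exact: rtestD.
have -> : \int[lam d]_x (F x + G x - (t x + u x)) ^+ 2 =
    \int[lam d]_x ((F x - t x) + (G x - u x)) ^+ 2.
  by apply: eq_Rintegral => x _; rewrite opprD addrACA.
apply: le_trans (square_integral_le (square_integrableB hF (rtest_square_integrable ht))
  (square_integrableB hG (rtest_square_integrable hu))) _; lra.
Qed.

Lemma test_approxZ c F : test_approx F -> test_approx (fun x => c * F x).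
Proof.
move=> [hF aF]; split; first exact: square_integrableZ.
move=> e e0; have c0 : 0 < c ^+ 2 + 1 by rewrite ltr_wpDl ?sqr_ge0.
have [t ht Ft] := aF (e / (c ^+ 2 + 1)) (divr_gt0 e0 c0).
exists (fun x => c * t x); first exact: rtestZ.
under eq_Rintegral do rewrite -mulrBr exprMn.
rewrite RintegralZl//; last exact: (square_integrableB hF (rtest_square_integrable ht)).2.
have I0 : 0 <= \int[lam d]_x (F x - t x) ^+ 2 by apply: Rintegral_ge0 => x _; exact: sqr_ge0.
move: Ft; rewrite ler_pdivlMr//; nra.
Qed.

Lemma test_approx_dominated (F_ : nat -> 'rV[R]_d -> R) F (H : 'rV[R]_d -> R) :
  (forall n, test_approx (F_ n)) -> measurable_fun setT F ->
  (forall x, F_ n x @[n --> \oo] --> F x) ->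
  square_integrable H -> (forall n x, `|F_ n x| <= `|H x|) -> test_approx F.
Proof.
move=> aF mF cF hH FH.
have FHx x : `|F x| <= `|H x|.
  have h : `|F_ n x| @[n --> \oo] --> `|F x| by apply: cvg_norm; exact: cF.
  rewrite -(cvg_lim _ h)//; apply: limr_le; last by apply: nearW => n; exact: FH.
  by apply/cvg_ex; eexists; exact: h.
have hF := square_integrable_le mF hH FHx.
apply: test_approx_limit => // e e0.
have c0 : \int[lam d]_x (F x - F_ n x) ^+ 2 @[n --> \oo] --> \int[lam d]_x ((0 : R) ^+ 2).
  apply: (Rintegral_dominated (f_ := fun n x => (F x - F_ n x) ^+ 2) (f := fun=> 0 ^+ 2)
    (g := fun x => 4 * H x ^+ 2)).
  - by move=> n; apply: measurable_sqr; apply: measurable_funB => //; exact: (aF n).1.1.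
  - move=> x; have h : F x - F_ n x @[n --> \oo] --> (0 : R).
      by rewrite -(subrr (F x)); apply: cvgB; [exact: cvg_cst|exact: cF].
    exact: (cvg_comp _ _ h (@exprn_continuous R 2 0)).
  - exact: rintegrableZ hH.2.
  - move=> n x; rewrite ger0_norm ?sqr_ge0// -(real_normK (num_real (F x - F_ n x))).
    rewrite -(real_normK (num_real (H x))).
    have -> : 4 * `|H x| ^+ 2 = (`|H x| + `|H x|) ^+ 2 by ring.
    apply: lerXn2r; rewrite ?nnegrE ?addr_ge0//; apply: le_trans (ler_normB _ _) _.
    by apply: lerD.
have Z : \int[lam d]_x ((0 : R) ^+ 2) = 0 by rewrite expr0n Rintegral0.
rewrite Z in c0; have [n _ hn] := cvgr_le 0 c0 _ e0.
by exists (F_ n) => //; apply: hn => /=.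
Qed.

Lemma test_approx_indic u A : rtest u -> measurable A ->
  test_approx (fun x => \1_A x * u x).
Proof.
move=> hu; have hu2 := rtest_square_integrable hu; have mu := rtest_measurable hu.
have meas1 B : measurable B -> measurable_fun setT (fun x => \1_B x * u x : R).
  by move=> mB; apply: measurable_funM => //; exact: measurable_indic.
move: A; apply: orthant_dynkin.
- by under eq_fun do rewrite indicT mul1r; exact: test_approx_rtest.
- move=> c; have [K K0 hK] := orthant_step_bounded.
  apply: (test_approx_dominated (F_ := fun j x => orthant_step c j (enum 'I_d) x * u x)
    (H := fun x => K * u x)).
  + by move=> j; apply: test_approx_rtest; exact: rtest_orthant_step.
  + by apply: meas1; exact: measurable_orthant.
  + by move=> x; apply: cvgMr_tmp; exact: cvg_orthant_step.
  + exact: square_integrableZ.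
  + by move=> j x; rewrite !normrM (ger0_norm K0) ler_wpM2r.
- move=> A mA hA; have := test_approxD (test_approx_rtest hu) (test_approxZ (-1) hA).
  rewrite (_ : (fun x => _) = (fun x => \1_(~` A) x * u x))//.
  apply/funext => x; rewrite !indicE in_setC.
  by case: (x \in A); rewrite /= ?mulr1n ?mulr0n; ring.
- move=> F mF tF hF.
  apply: (test_approx_dominated (F_ := fun n x => (\sum_(k < n) \1_(F k) x) * u x) (H := u)).
  + elim=> [|n IH].
      have := test_approxZ 0 (test_approx_rtest hu).
      by under [X in _ -> test_approx X]eq_fun do rewrite big_ord0 mul0r;
        under eq_fun do rewrite mul0r.
    under eq_fun do rewrite big_ord_recr/= mulrDl.
    exact: test_approxD.
  + by apply: meas1; apply: bigcup_measurable => k _.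
  + by move=> x; apply: cvgMr_tmp; exact: (sum_indic_trivIset x tF).2.
  + exact: hu2.
  + move=> n x; rewrite normrM ler_piMl//.
    by have [/(_ n)/andP[s0 s1] _] := sum_indic_trivIset (R := R) x tF; rewrite ger0_norm.
Qed.

Import HBNNSimple.

Lemma test_approx_nnsfun u (f : {nnsfun 'rV[R]_d >-> R}) : rtest u ->
  test_approx (fun x => f x * u x).
Proof.
move=> hu.
have E : (fun x => f x * u x) =
    (fun x => \sum_(y <- finmap.enum_fset (fset_set (range f))) (y * (\1_(f @^-1` [set y]) x * u x))).
  apply/funext => x; rewrite fimfunE fsbig_finite//= mulr_suml.
  by apply: eq_bigr => y _; rewrite mulrA.
rewrite E; elim: (finmap.enum_fset (fset_set (range f))) => [|y l IH].
  have := test_approxZ 0 (test_approx_rtest hu); under eq_fun do rewrite mul0r.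
  by under [X in _ -> test_approx X]eq_fun do rewrite big_nil.
under eq_fun do rewrite big_cons.
by apply: test_approxD => //; apply: test_approxZ; apply: test_approx_indic.
Qed.

Lemma test_approx_square_integrable F : square_integrable F -> test_approx F.
Proof.
move=> hF; have [mF iF] := hF.
have pos G : square_integrable G -> (forall x, 0 <= G x) -> test_approx G.
  move=> hG G0; have mG : measurable_fun setT (EFin \o G) by apply/measurable_EFinP; exact: hG.1.
  have G0' x : setT x -> (0 <= (EFin \o G) x)%E by move=> _ /=; rewrite lee_fin.
  have [K K0 hK] := cutoff_sqr_bounded.
  pose s := nnsfun_approx measurableT mG.
  have sG n x : s n x <= G x.
    by rewrite -lee_fin /s nnsfun_approxE; exact: (le_approx n G0' I).
  (* The growing cutoff supplies the compactly supported smooth factor that [test_approx_nnsfun]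
     asks for. *)
  apply: (test_approx_dominated (F_ := fun n x => s n x * cutoff_sqr n x) (H := fun x => K * G x)).
  - by move=> n; apply: test_approx_nnsfun; exact: rtest_cutoff_sqr.
  - exact: hG.1.
  - move=> x; have h : s n x @[n --> \oo] --> G x.
      have := cvg_nnsfun_approx measurableT mG G0' (I : setT x) => /fine_cvgP[_].
      exact.
    by rewrite -[X in _ --> X]mulr1; apply: cvgM => //; exact: cvg_cutoff_sqr.
  - exact: square_integrableZ.
  - move=> n x; have c0 : 0 <= cutoff_sqr n x by exact: cutoff_sqr_ge0.
    have s0 : 0 <= s n x by [].
    rewrite (ger0_norm (mulr_ge0 s0 c0)) (ger0_norm (mulr_ge0 K0 (G0 x))) mulrC.
    exact: ler_pM.
have hp : square_integrable (fun x => Num.max (F x) 0).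
  apply: (square_integrable_le (G := F)) => //; first exact: measurable_maxr.
  by move=> x; rewrite /Num.max; case: ltP => h; rewrite ?normr0.
have hn : square_integrable (fun x => Num.max (- F x) 0).
  apply: (square_integrable_le (G := F)) => //.
    by apply: measurable_maxr => //; exact: measurable_funN.
  by move=> x; rewrite /Num.max; case: ltP => h; rewrite ?normr0 ?normrN.
have := test_approxD (pos _ hp (fun x => ltac:(rewrite le_max lexx orbT//)))
  (test_approxZ (-1) (pos _ hn (fun x => ltac:(rewrite le_max lexx orbT//)))).
rewrite (_ : (fun x => _) = F)//; apply/funext => x.
by rewrite mulN1r !maxEle oppr_le0; case: lerP => h1; case: lerP => h2; lra.
Qed.

End real_tests.

(** * Summable series and dyadic decompositions *)

Section summable.
Context dT (T : measurableType dT) {R : realType} (mu : {measure set T -> \bar R}).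

(** [a'] replaces the terms by 0 on the null set where the weighted series diverges. The partial
    sums then converge everywhere below one majorant [G], and dominated convergence applies without
    exceptional sets. *)
Lemma ae_summable (a : nat -> T -> R) (W : T -> R) (b : nat -> R) (B : R) :
  (forall k, measurable_fun setT (a k)) -> measurable_fun setT W -> (forall x, 0 < W x) ->
  (forall k, \int[mu]_x (`|a k x| * W x)%:E <= (b k)%:E)%E ->
  (forall N, \sum_(0 <= k < N) b k <= B) ->
  exists (a' : nat -> T -> R) (s G : T -> R),
    [/\ forall k, measurable_fun setT (a' k), forall k, {ae mu, forall x, a' k x = a k x},
        forall x, \sum_(0 <= k < N) a' k x @[N --> \oo] --> s x,
        forall N x, `|\sum_(0 <= k < N) a' k x| <= G x &
        rintegrable mu (fun x => G x * W x)].
Proof.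
move=> ma mW W0 hb hB.
pose S : T -> \bar R := fun x => (\sum_(0 <= k <oo) (`|a k x| * W x)%:E)%E.
have t0 k x : (0 <= (`|a k x| * W x)%:E)%E by rewrite lee_fin mulr_ge0// ltW.
have cS x : (\sum_(0 <= k < N) (`|a k x| * W x)%:E)%E @[N --> \oo] --> S x.
  by apply: is_cvg_nneseries => n _ _; exact: t0.
have mt k : measurable_fun setT (fun x => (`|a k x| * W x)%:E).
  by apply/measurable_EFinP; apply: measurable_funM => //; exact: measurableT_comp.
have mp N : measurable_fun setT (fun x => (\sum_(0 <= k < N) (`|a k x| * W x)%:E)%E).
  by apply: emeasurable_sum.
have mS : measurable_fun setT S by apply: (emeasurable_fun_cvg _ _ mp) => x _; exact: cS.
have S0 x : (0 <= S x)%E by apply: nneseries_ge0 => k _ _; exact: t0.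
have iS : (\int[mu]_x S x <= B%:E)%E.
  apply: (fatou_le mp _ cS) => [N x|N]; first by apply: sume_ge0 => k _; exact: t0.
  rewrite ge0_integral_sum//; apply: (@le_trans _ _ (\sum_(0 <= k < N) (b k)%:E)%E).
    by apply: lee_sum => k _; exact: hb.
  by rewrite sumEFin lee_fin.
have intS : mu.-integrable setT S.
  apply/integrableP; split=> //; under eq_integral do rewrite gee0_abs//.
  exact: le_lt_trans iS (ltry _).
pose E x := (S x < +oo)%E.
have mE : measurable_fun setT E by exact: measurable_fun_lte.
pose G x := fine (S x) / W x.
have G0 x : 0 <= G x by rewrite divr_ge0 ?fine_ge0// ltW.
have partG N x : E x -> \sum_(0 <= k < N) `|a k x| <= G x.
  move=> Ex; rewrite ler_pdivlMr// -lee_fin fineK ?ge0_fin_numE// mulr_suml -sumEFin.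
  by apply: nneseries_lim_ge => k _ _; exact: t0.
pose a' k x := if E x then a k x else 0.
have a'1 x : E x -> a' ^~ x = a ^~ x by move=> Ex; apply/funext => k; rewrite /a' Ex.
have a'0 x : ~~ E x -> a' ^~ x = fun=> 0.
  by move=> /negbTE Ex; apply/funext => k; rewrite /a' Ex.
have a'D N x : \sum_(0 <= k < N) a' k x = series (a' ^~ x) N by [].
have ps N x : `|\sum_(0 <= k < N) a' k x| <= G x.
  rewrite a'D; case: (boolP (E x)) => Ex.
    by rewrite (a'1 _ Ex); apply: le_trans (ler_norm_sum _ _ _) (partG N x Ex).
  by rewrite (a'0 _ Ex) /series/= big1// normr0.
exists a', (fun x => limn (fun N => \sum_(0 <= k < N) a' k x)), G; split => //.
- by move=> k; apply: measurable_fun_ifT.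
- move=> k; have := integrable_ae measurableT intS; apply: filterS => x /(_ I) h.
  by rewrite /a' /E ltey_eq h.
- move=> x; change (cvgn (series (a' ^~ x))); case: (boolP (E x)) => Ex.
    rewrite (a'1 _ Ex); apply: normed_cvg; apply: nondecreasing_is_cvgn.
      by apply: nondecreasing_series => k _ _; exact: normr_ge0.
    by exists (G x) => _ [N _ <-]; exact: partG.
  rewrite (a'0 _ Ex) (_ : series _ = fun=> 0); first exact: is_cvg_cst.
  by apply/funext => N; rewrite /series/= big1.
- rewrite /G (_ : (fun x => _) = fun x => fine (S x)).
    apply: rintegral_lty; [exact: measurableT_comp|by move=> x; rewrite fine_ge0|].
    apply: le_lt_trans (ltry B); apply: le_trans iS.
    apply: ge0_le_integral => //; first by move=> x _; rewrite lee_fin fine_ge0.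
      by apply/measurable_EFinP; exact: measurableT_comp.
    move=> x _; have := S0 x; case: (S x) => [r| |]//= _; exact: leey.
  by apply/funext => x; rewrite mulfVK// gt_eqF.
Qed.

End summable.

Section fourier_linear.
Context {R : realType}.
Local Notation lam d := (@lebesgue_rV R d).
Local Notation Re := (@complex.Re R).
Local Notation Im := (@complex.Im R).
Variable d : nat.
Implicit Types (f g psi : 'rV[R]_d -> R[i]).

Lemma cintegral_linear (a : R[i]) f g : cintegrable f -> cintegrable g ->
  cintegral (fun x => a * f x + g x) = a * cintegral f + cintegral g.
Proof.
move=> [f1 f2] [g1 g2].
have Z c F : rintegrable (lam d) F -> \int[lam d]_x (c * F x) = c * \int[lam d]_x F x.
  by move=> hF; rewrite RintegralZl.
apply: complex_eq; rewrite ?cReD ?cImD ?cReM ?cImM /=.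
  rewrite (_ : (fun x => _) = fun x => (Re a * Re (f x) + (- Im a) * Im (f x)) + Re (g x)).
    rewrite !Rintegral_add ?Z//; try exact: rintegrableZ; first by rewrite mulNr.
    by apply: rintegrableD; exact: rintegrableZ.
  by apply/funext => x; rewrite cReD cReM mulNr.
rewrite (_ : (fun x => _) = fun x => (Re a * Im (f x) + Im a * Re (f x)) + Im (g x)).
  rewrite !Rintegral_add ?Z//; try exact: rintegrableZ.
  by apply: rintegrableD; exact: rintegrableZ.
by apply/funext => x; rewrite cImD cImM.
Qed.

Lemma fourier_linear (a : R[i]) f g : cintegrable f -> cintegrable g ->
  fourier (fun x => a * f x + g x) = fun xi => a * fourier f xi + fourier g xi.
Proof.
move=> hf hg; apply/funext => xi; rewrite /fourier -cintegral_linear.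
- by congr cintegral; apply/funext => x; rewrite mulrDl mulrA.
- by apply: cintegrable_cexp => //; apply: measurable_funN; apply: measurable_phase.
- by apply: cintegrable_cexp => //; apply: measurable_funN; apply: measurable_phase.
Qed.

Lemma tempered_fourier (u : @Defs.distribution R d) : tempered u -> tempered (distr_fourier u).
Proof.
move=> hu; split.
  move=> a psi phi hp hq; rewrite /distr_fourier fourier_linear; try exact: schwartz_cintegrable.
  by apply: hu.1; exact: schwartz_fourier.
have [C [N [C0 hC]]] := tempered_bound hu; have [M [K hK]] := @fourier_sbound R d N.
exists (C * (K * (1 + 1) * (1 + 1))), M => psi hp.
have [-> s1 s2] := schwartz_seminormE M hp; have [t1 t2] := hK _ _ _ hp s1 s2.
rewrite -EFinM lee_fin; apply: le_trans (hC _ _ _ (schwartz_fourier hp) t1 t2) _.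
by rewrite le_eqVlt; apply/orP; left; apply/eqP; ring.
Qed.

Lemma complex_parts_mul (z w : R[i]) : z * w = 'i%C * ((Im z)%:C%C * w) + (Re z)%:C%C * w.
Proof. by case: z => a b; case: w => c e; apply: complex_eq => /=; ring. Qed.

End fourier_linear.

(** * Dyadic resolution of tempered distributions *)

Section dyadic_decomposition.
Context {R : realType}.
Local Notation lam d := (@lebesgue_rV R d).
Local Notation Re := (@complex.Re R).
Local Notation Im := (@complex.Im R).
Variables (d : nat) (phi0 : 'rV[R]_d -> R[i]).
Hypotheses (phi0_smooth : smooth phi0)
  (phi0_1 : forall xi, norm2_rV xi <= 1 -> phi0 xi = 1)
  (phi0_0 : forall xi, 3 / 2 <= norm2_rV xi -> phi0 xi = 0).
Implicit Types (psi : 'rV[R]_d -> R[i]) (U : @Defs.distribution R d).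

Let chi x := Re (phi0 x).
(* Another real cutoff, so that the imaginary part of [phi0] is a difference of cutoffs. *)
Let chi' x := Re (phi0 x) + Im (phi0 x).

Lemma re_cutoff : [/\ smooth_real chi, forall x, norm2_rV x <= 1 -> chi x = 1 &
  forall x, 3 / 2 <= norm2_rV x -> chi x = 0].
Proof.
by split; [exact: phi0_smooth.1|move=> x /phi0_1 h|move=> x /phi0_0 h]; rewrite /chi h.
Qed.

Let re_im_cutoff : [/\ smooth_real chi', forall x, norm2_rV x <= 1 -> chi' x = 1 &
  forall x, 3 / 2 <= norm2_rV x -> chi' x = 0].
Proof.
split; [exact: (smoothD phi0_smooth.1 phi0_smooth.2).1|move=> x /phi0_1 h|move=> x /phi0_0 h];
  by rewrite /chi' h/= addr0.
Qed.

Let chi_smooth := let: And3 h _ _ := re_cutoff in h.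
Let chi1 := let: And3 _ h _ := re_cutoff in h.
Let chi0 := let: And3 _ _ h := re_cutoff in h.
Let chi'_smooth := let: And3 h _ _ := re_im_cutoff in h.
Let chi'1 := let: And3 _ h _ := re_im_cutoff in h.
Let chi'0 := let: And3 _ _ h := re_im_cutoff in h.

(** The expression i (G - F) + F is arranged to match the linearity clause of [tempered], stated for
    a * psi + phi. *)
Let combination (F G : 'rV[R]_d -> R[i]) x := 'i%C * ((-1) * F x + G x) + F x.

Let schwartz_combination F G : schwartz F -> schwartz G -> schwartz (combination F G).
Proof.
move=> hF hG; exact: (schwartzD (schwartzZ 'i%C (schwartzD (schwartzZ (-1) hF) hG)) hF).
Qed.

Let tempered_combination U F G : tempered U -> schwartz F -> schwartz G ->
  U (combination F G) = 'i%C * ((-1) * U F + U G) + U F.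
Proof.
move=> hU hF hG; have h := schwartzD (schwartzZ (-1) hF) hG.
by rewrite /combination (hU.1 'i%C _ _ h hF) (hU.1 (-1) _ _ hF hG).
Qed.

Let dilate_split psi r : (fun x => phi0 (r *: x) * psi x) = combination
  (fun x => (chi (r *: x))%:C%C * psi x) (fun x => (chi' (r *: x))%:C%C * psi x).
Proof.
apply/funext => x; rewrite /combination /chi /chi' complex_parts_mul; congr (_ + _); congr (_ * _).
by rewrite mulN1r -mulNr -mulrDl -rmorphN -rmorphD/= addrA addNr add0r.
Qed.

Lemma schwartz_dilate psi r : 0 <= r <= 1 -> schwartz psi ->
  schwartz (fun x => phi0 (r *: x) * psi x).
Proof.
move=> hr hp; rewrite dilate_split; apply: schwartz_combination.
  exact: schwartz_realM (tame_cutoff chi_smooth chi0 hr) hp.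
exact: schwartz_realM (tame_cutoff chi'_smooth chi'0 hr) hp.
Qed.

Lemma tempered_dilate U psi : tempered U -> schwartz psi -> exists C, forall r : R, 0 < r <= 1 ->
  normc (U (fun x => phi0 (r *: x) * psi x) - U psi) <= C * r.
Proof.
move=> hU hp.
have [C1 h1] := tempered_cutoff chi_smooth chi1 chi0 hU hp.
have [C2 h2] := tempered_cutoff chi'_smooth chi'1 chi'0 hU hp.
exists (C1 + C2 + C1) => r hr.
have hr' : 0 <= r <= 1 by case/andP: hr => h ->; rewrite ltW.
rewrite dilate_split.
have s1 := schwartz_realM (tame_cutoff chi_smooth chi0 hr') hp.
have s2 := schwartz_realM (tame_cutoff chi'_smooth chi'0 hr') hp.
rewrite (tempered_combination hU s1 s2); move: (h1 r hr) (h2 r hr).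
set X := U (fun x => (chi _)%:C%C * _); set Y := U (fun x => (chi' _)%:C%C * _).
set Z := U psi => e1 e2.
have -> : 'i%C * (-1 * X + Y) + X - Z = 'i%C * ((Y - Z) - (X - Z)) + (X - Z) by ring.
apply: le_trans (le_normcD _ _) _; rewrite normcM.
have -> : normc ('i%C : R[i]) = 1 by rewrite /normc/= expr0n/= add0r expr1n sqrtr1.
rewrite mul1r !mulrDl lerD//; apply: le_trans (le_normcD _ _) _.
by rewrite addrC lerD// normcN.
Qed.

Lemma dyadicS k x : dyadic phi0 k.+1 x = phi0 (2 ^- k.+1 *: x) - phi0 (2 ^- k *: x).
Proof.
rewrite /dyadic; congr (_ - phi0 (_ *: x)).
by rewrite exprS invfM mulrA mulfV ?mul1r// pnatr_eq0.
Qed.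

Let pow01 k : 0 <= (2 ^- k : R) <= 1.
Proof. by rewrite invr_ge0 exprn_ge0//= invf_le1 ?exprn_gt0// exprn_ege1// ler1n. Qed.

Lemma schwartz_dyadic k psi : schwartz psi -> schwartz (fun x => dyadic phi0 k x * psi x).
Proof.
move=> hp; case: k => [|k].
  have := @schwartz_dilate psi 1; under eq_fun do rewrite scale1r.
  by apply; rewrite ?ler01 ?lexx.
rewrite (_ : (fun x => _) = fun x => phi0 (2 ^- k.+1 *: x) * psi x +
    (-1) * (phi0 (2 ^- k *: x) * psi x)).
  by apply: schwartzD; [|apply: schwartzZ]; apply: schwartz_dilate => //; exact: pow01.
by apply/funext => x; rewrite dyadicS; ring.
Qed.

Lemma sum_dyadic U psi N : tempered U -> schwartz psi ->
  \sum_(0 <= k < N.+1) U (fun x => dyadic phi0 k x * psi x) =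
  U (fun x => phi0 (2 ^- N *: x) * psi x).
Proof.
move=> hU hp; elim: N => [|N IH].
  by rewrite big_nat1 /=; under [in RHS]eq_fun do rewrite expr0 invr1 scale1r.
rewrite big_nat_recr//= IH.
rewrite -(temperedD hU (schwartz_dilate (pow01 N) hp) (schwartz_dyadic N.+1 hp)).
by congr (U _); apply/funext => x; rewrite dyadicS; ring.
Qed.

(** The first N + 1 terms telescope to the dilate by [2 ^- N], so the error is of order [2 ^- N]; it
    is weakened to [harmonic N] to fit [cvg_harmonic_bound]. *)
Lemma cvg_dyadic U psi : tempered U -> schwartz psi ->
  (Re (\sum_(0 <= k < N) U (fun x => dyadic phi0 k x * psi x)) @[N --> \oo] --> Re (U psi)) /\
  (Im (\sum_(0 <= k < N) U (fun x => dyadic phi0 k x * psi x)) @[N --> \oo] --> Im (U psi)).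
Proof.
move=> hU hp; have [C hC] := tempered_dilate hU hp.
have C0 : 0 <= C by have := hC 1; rewrite mulr1 ltr01 lexx => /(_ isT); apply: le_trans; exact: normc_ge0.
have b N : normc (\sum_(0 <= k < N.+1) U (fun x => dyadic phi0 k x * psi x) - U psi) <=
    C * harmonic N.
  rewrite sum_dyadic//; apply: le_trans (hC _ _) _.
    by rewrite invr_gt0 exprn_gt0//=; have /andP[_ ->] := pow01 N.
  by rewrite ler_wpM2l// /harmonic/= lef_pV2 ?posrE ?exprn_gt0 ?ltr0n// -natrX ler_nat ltn_expl.
split; rewrite -cvg_shiftS; apply: (cvg_harmonic_bound (C := C)) => N; apply: le_trans (b N).
  by rewrite -cReN -cReD; exact: normc_Re.
by rewrite -cImN -cImD; exact: normc_Im.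
Qed.

End dyadic_decomposition.

Section summable_pairing.
Context dT (T : measurableType dT) {R : realType} (mu : {measure set T -> \bar R}).

Lemma Rintegral_ae_eq (f g : T -> R) : measurable_fun setT f -> measurable_fun setT g ->
  {ae mu, forall x, f x = g x} -> \int[mu]_x f x = \int[mu]_x g x.
Proof.
move=> mf mg fg; rewrite /Rintegral; congr fine; apply: ae_eq_integral => //.
- exact/measurable_EFinP.
- exact/measurable_EFinP.
- by apply: filterS fg => x ->.
Qed.

(** The series is summed weakly, against all functions dominated by the weight. Schwartz functions
    are among them, and such pairings do not see the modification on null sets. *)
Lemma summable_pairing (a : nat -> T -> R) (W : T -> R) (b : nat -> R) (B : R) :
  (forall k, measurable_fun setT (a k)) -> measurable_fun setT W -> (forall x, 0 < W x) ->
  (forall k, \int[mu]_x (`|a k x| * W x)%:E <= (b k)%:E)%E ->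
  (forall N, \sum_(0 <= k < N) b k <= B) ->
  exists s G : T -> R, [/\ measurable_fun setT s, forall x, `|s x| <= G x,
    rintegrable mu (fun x => G x * W x) &
    forall (q : T -> R) (K : R), measurable_fun setT q -> (forall x, `|q x| <= K * W x) ->
      \sum_(0 <= k < N) \int[mu]_x (a k x * q x) @[N --> \oo] --> \int[mu]_x (s x * q x)].
Proof.
move=> ma mW W0 hb hB; have [a' [s [G [ma' aa' cs hG iG]]]] := ae_summable ma mW W0 hb hB.
have ms : measurable_fun setT s.
  apply: (measurable_fun_cvg (h := fun N x => \sum_(0 <= k < N) a' k x)) => [N|x _]; last exact: cs.
  exact: measurable_sum.
exists s, G; split=> // [x|q K mq hq].
  have c : `|\sum_(0 <= k < N) a' k x| @[N --> \oo] --> `|s x| by exact: cvg_norm (cs x).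
  rewrite -(cvg_lim (@Rhausdorff R) c); apply: limr_le.
    by apply/cvg_ex; exists `|s x|; exact: c.
  by apply: nearW => N; exact: hG.
have i0 k : rintegrable mu (fun x => a' k x * q x).
  apply: (rintegrable_le (g := fun x => (2 * K) * (G x * W x))); first exact: measurable_funM.
    exact: rintegrableZ.
  move=> x; rewrite normrM (_ : 2 * K * (G x * W x) = (G x + G x) * (K * W x)); last by ring.
  apply: ler_pM => //.
  have -> : a' k x = \sum_(0 <= i < k.+1) a' i x - \sum_(0 <= i < k) a' i x.
    by rewrite big_nat_recr//= addrAC subrr add0r.
  by apply: le_trans (ler_normB _ _) _; rewrite lerD.
rewrite (_ : (fun N => _) = fun N => \int[mu]_x ((\sum_(0 <= k < N) a' k x) * q x)).
  apply: (Rintegral_dominated (g := fun x => K * (G x * W x))).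
  - by move=> N; apply: measurable_funM => //; exact: measurable_sum.
  - by move=> x; apply: cvgM; [exact: cs|exact: cvg_cst].
  - exact: rintegrableZ.
  - by move=> N x; rewrite normrM mulrCA; apply: ler_pM.
apply/funext => N; under [RHS]eq_Rintegral do rewrite mulr_suml.
rewrite Rintegral_sum//; apply: eq_bigr => k _; apply: Rintegral_ae_eq.
- exact: measurable_funM.
- exact: measurable_funM.
- by apply: filterS (aa' k) => x ->.
Qed.

End summable_pairing.

(** * Summation of the dyadic pieces to [m] *)

Section multiplier_series.
Context {R : realType}.
Local Notation lam d := (@lebesgue_rV R d).
Local Notation Re := (@complex.Re R).
Local Notation Im := (@complex.Im R).
Variables (d : nat) (phi0 : 'rV[R]_d -> R[i]).
Hypotheses (phi0_smooth : smooth phi0)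
  (phi0_1 : forall xi, norm2_rV xi <= 1 -> phi0 xi = 1)
  (phi0_0 : forall xi, 3 / 2 <= norm2_rV xi -> phi0 xi = 0).

Let chi x := Re (phi0 x).
Let chi_smooth : smooth_real chi. Proof. by have [] := re_cutoff phi0_smooth phi0_1 phi0_0. Qed.
Let chi1 x : norm2_rV x <= 1 -> chi x = 1.
Proof. by have [_ h _] := re_cutoff phi0_smooth phi0_1 phi0_0; exact: h. Qed.
Let chi0 x : 3 / 2 <= norm2_rV x -> chi x = 0.
Proof. by have [_ _ h] := re_cutoff phi0_smooth phi0_1 phi0_0; exact: h. Qed.

Lemma test_integrable m (b theta : 'rV[R]_d -> R) : locally_integrable_rV m ->
  measurable_fun setT b -> (forall x, `|b x| <= normc (m x)) -> rtest theta ->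
  rintegrable (lam d) (fun x => theta x * b x).
Proof.
move=> [mm lm] mb hb ht; have rt := rtest_rschwartz ht.
have mt : measurable_fun setT theta by exact: smooth_measurable ht.1.
have [K K0 hK] := rschwartz_le rt; have [_ [r hr]] := ht.
pose D := [set x : 'rV[R]_d | norm2_rV x <= r].
have mD : measurable D.
  rewrite (_ : D = (@norm2_rV R d) @^-1` `]-oo, r]); last first.
    by apply/seteqP; split=> x /=; rewrite in_itv/=.
  rewrite -[X in measurable X]setTI; apply: (continuous_measurable_rV (@continuous_norm2 R d)) => //.
have mn : measurable_fun setT (fun x => normc (m x)) by exact: measurable_normc.
have iD : rintegrable (lam d) (fun x => \1_D x * normc (m x)).
  apply: rintegral_lty.
  - by apply: measurable_funM => //; exact: measurable_indic.
  - by move=> x; rewrite mulr_ge0// normc_ge0.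
  - have := lm _ (@compact_norm2_le R d r); rewrite -/D [X in (X < _)%E -> _]integral_mkcond.
    apply: le_lt_trans; rewrite le_eqVlt; apply/orP; left; apply/eqP; apply: eq_integral => x _.
    by rewrite patchE indicE; case: ifP => _; rewrite ?mul1r ?mul0r.
apply: (rintegrable_le (g := fun x => K * (\1_D x * normc (m x)))); first exact: measurable_funM.
  exact: rintegrableZ.
move=> x; rewrite normrM; have [xr|xr] := leP (norm2_rV x) r.
  by rewrite indicE mem_set//= mul1r; apply: ler_pM.
by rewrite hr// normr0 mul0r !mulr_ge0// normc_ge0.
Qed.

Lemma test_complex theta : rtest theta ->
  test_function (fun x : 'rV[R]_d => (theta x)%:C%C : R[i]) /\
  schwartz (fun x : 'rV[R]_d => (theta x)%:C%C : R[i]).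
Proof.
move=> ht; have rt := rtest_rschwartz ht; split.
  split; first by split; [exact: ht.1|exact: (@smooth_cst R d 0).1].
  by have [_ [r hr]] := ht; exists r => x /hr ->.
apply: partsP_schwartz; first exact: rt.
by have := rschwartzZ 0 rt; under eq_fun do rewrite mul0r.
Qed.

Lemma cRe_sum (I : Type) (l : seq I) (F : I -> R[i]) : Re (\sum_(i <- l) F i) = \sum_(i <- l) Re (F i).
Proof. by apply: (big_morph Re cReD). Qed.

Lemma cIm_sum (I : Type) (l : seq I) (F : I -> R[i]) : Im (\sum_(i <- l) F i) = \sum_(i <- l) Im (F i).
Proof. by apply: (big_morph Im cImD). Qed.

Variables (m : 'rV[R]_d -> R[i]) (h : nat -> 'rV[R]_d -> R[i])
  (u v : nat -> @Defs.distribution R d) (M : nat) (b : nat -> R) (B : R).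
Hypotheses (hu : forall k, distr_of_fun (u k) m) (hv : forall k, distr_of_fun (v k) (h k))
  (huv : forall k, eq_distribution (distr_fourier (v k))
     (distr_mul (dyadic phi0 k) (distr_fourier (u k))))
  (hb : forall k, (\int[lam d]_p (normc (h k p) * ((1 + norm2_rV p) ^+ M)^-1)%:E <= (b k)%:E)%E)
  (hB : forall N, \sum_(0 <= k < N) b k <= B).

Let W (p : 'rV[R]_d) := ((1 + norm2_rV p) ^+ M)^-1.
Let mW : measurable_fun setT W.
Proof. exact: (continuous_measurable_rV (@continuous_weightV R d M)). Qed.
Let W0 x : 0 < W x.
Proof. by rewrite invr_gt0 exprn_gt0// ltr_pwDl// norm2_ge0. Qed.

Let mh k : cmeasurable (h k). Proof. by have [_ []] := hv k. Qed.
Let mm : cmeasurable m. Proof. by have [_ []] := hu 0. Qed.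
Let lm : locally_integrable_rV m. Proof. by have [] := hu 0. Qed.

Let part_bound (a : nat -> 'rV[R]_d -> R) : (forall k, measurable_fun setT (a k)) ->
  (forall k x, `|a k x| <= normc (h k x)) ->
  forall k, (\int[lam d]_x (`|a k x| * W x)%:E <= (b k)%:E)%E.
Proof.
move=> ma ha k; apply: le_trans (hb k); apply: ge0_le_integral_EFin.
- by apply: measurable_funM => //; exact: measurableT_comp.
- by apply: measurable_funM => //; exact: measurable_normc.
- by move=> x; rewrite mulr_ge0//= ?ler_wpM2r// ltW.
Qed.

Let schwartz_weighted q : rschwartz q -> measurable_fun setT q /\ exists K, forall x, `|q x| <= K * W x.
Proof.
move=> hq; split; first exact: smooth_measurable hq.1.
have [K hK] := hq.2 M; exists K => x; rewrite ler_pdivlMr ?exprn_gt0 ?ltr_pwDl ?norm2_ge0// mulrC.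
exact: (hK [::] x).
Qed.

(** The same partial sums have two limits on test functions: the pairing with [s], by absolute
    convergence, and the pairing with [F], by the dyadic resolution. [fundamental_lemma] turns this
    into equality almost everywhere. *)
Let identify (a : nat -> 'rV[R]_d -> R) (s G F : 'rV[R]_d -> R) :
  measurable_fun setT s -> (forall x, `|s x| <= G x) -> rintegrable (lam d) (fun x => G x * W x) ->
  (forall (q : 'rV[R]_d -> R) (K : R), measurable_fun setT q -> (forall x, `|q x| <= K * W x) ->
      \sum_(0 <= k < N) \int[lam d]_x (a k x * q x) @[N --> \oo] --> \int[lam d]_x (s x * q x)) ->
  measurable_fun setT F -> (forall x, `|F x| <= normc (m x)) ->
  (forall theta, rtest theta ->
    \sum_(0 <= k < N) \int[lam d]_x (a k x * theta x) @[N --> \oo] --> \int[lam d]_x (F x * theta x)) ->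
  {ae lam d, forall x, F x = s x}.
Proof.
move=> ms sG iG ps mF Fm hF.
have iFt theta : rtest theta -> rintegrable (lam d) (fun x => theta x * F x).
  by move=> ht; exact: (test_integrable lm).
have ist theta : rtest theta -> rintegrable (lam d) (fun x => theta x * s x).
  move=> ht; have [mt [K hK]] := schwartz_weighted (rtest_rschwartz ht).
  apply: (rintegrable_le (g := fun x => K * (G x * W x))); first exact: measurable_funM.
    exact: rintegrableZ.
  by move=> x; rewrite normrM mulrCA mulrC; apply: ler_pM.
have := @fundamental_lemma R d chi chi_smooth chi1 chi0 (fun x => F x - s x).
case.
- exact: measurable_funB.
- by move=> theta ht; under eq_fun do rewrite mulrBr; apply: rintegrableB; [exact: iFt|exact: ist].
- move=> theta ht; under eq_Rintegral do rewrite mulrBr.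
  rewrite RintegralB//; [|exact: iFt|exact: ist].
  have [mt [K hK]] := schwartz_weighted (rtest_rschwartz ht).
  have c1 := ps _ _ mt hK; have c2 := hF _ ht.
  under [X in X - _]eq_Rintegral do rewrite mulrC; under [X in _ - X]eq_Rintegral do rewrite mulrC.
  by rewrite (cvg_unique _ c1 c2) ?subrr.
- move=> N hN; exists N; have [h1 h2 h3] := hN; split=> // x hx; apply: h3 => /= e; apply: hx.
  by apply/eqP; rewrite -subr_eq0 e.
Qed.

(** With [theta] written as the transform of [psi], the pairing of [h k] with [theta] is the k-th
    dyadic term, at [psi], of the Fourier transform of the distribution of [m]. *)
Let pieces_cvg theta : rtest theta ->
  (\sum_(0 <= k < N) \int[lam d]_x (Re (h k x) * theta x) @[N --> \oo] -->
     \int[lam d]_x (Re (m x) * theta x)) /\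
  (\sum_(0 <= k < N) \int[lam d]_x (Im (h k x) * theta x) @[N --> \oo] -->
     \int[lam d]_x (Im (m x) * theta x)).
Proof.
move=> ht; have [tt st] := test_complex ht.
have [psi hp E] := fourier_surj (rschwartz_cutoff chi_smooth chi0) (chi_at0 chi1) st.
pose U := distr_fourier (u 0).
have tU : tempered U by apply: tempered_fourier; have [] := hu 0.
have vE k : U (fun x => dyadic phi0 k x * psi x) = cintegral (fun x => h k x * (theta x)%:C%C).
  rewrite /U /distr_fourier (distr_of_fun_unique chi_smooth chi1 chi0 (hu 0) (hu k)); last first.
    by apply: schwartz_fourier; apply: schwartz_dyadic.
  have := huv k hp; rewrite /distr_fourier /distr_mul => <-; rewrite E.
  by have [_ _ ->] := hv k.
have UE : U psi = cintegral (fun x => m x * (theta x)%:C%C).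
  by rewrite /U /distr_fourier E; have [_ _ ->] := hu 0.
have [c1 c2] := cvg_dyadic phi0_smooth phi0_1 phi0_0 tU hp.
have R1 f : Re (cintegral (fun x => f x * (theta x)%:C%C)) = \int[lam d]_x (Re (f x) * theta x).
  by rewrite /cintegral/=; apply: eq_Rintegral => x _; rewrite cReM/= mulr0 subr0.
have I1 f : Im (cintegral (fun x => f x * (theta x)%:C%C)) = \int[lam d]_x (Im (f x) * theta x).
  by rewrite /cintegral/=; apply: eq_Rintegral => x _; rewrite cImM/= mulr0 add0r.
split.
  rewrite -R1 -UE; rewrite (_ : (fun N => _) = fun N =>
    Re (\sum_(0 <= k < N) U (fun x => dyadic phi0 k x * psi x))) //.
  by apply/funext => N; rewrite cRe_sum; apply: eq_bigr => k _; rewrite vE R1.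
rewrite -I1 -UE; rewrite (_ : (fun N => _) = fun N =>
  Im (\sum_(0 <= k < N) U (fun x => dyadic phi0 k x * psi x))) //.
by apply/funext => N; rewrite cIm_sum; apply: eq_bigr => k _; rewrite vE I1.
Qed.

(** Equality of [m] with the sum also transfers the weighted integrability of the majorant to [m];
    this is how [m] becomes [slow]. *)
Lemma multiplier_series : slow m /\ forall psi, schwartz psi ->
  (Re (\sum_(0 <= k < N) cintegral (fun x => h k x * psi x)) @[N --> \oo] -->
     Re (cintegral (fun x => m x * psi x))) /\
  (Im (\sum_(0 <= k < N) cintegral (fun x => h k x * psi x)) @[N --> \oo] -->
     Im (cintegral (fun x => m x * psi x))).
Proof.
have nW0 (f : 'rV[R]_d -> R[i]) x : 0 <= normc (f x) * W x.
  exact: mulr_ge0 (normc_ge0 _) (ltW (W0 x)).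
have nR k x : `|Re (h k x)| <= normc (h k x) by exact: normc_Re.
have nI k x : `|Im (h k x)| <= normc (h k x) by exact: normc_Im.
have mR k : measurable_fun setT (fun x => Re (h k x)) by exact: (mh k).1.
have mI k : measurable_fun setT (fun x => Im (h k x)) by exact: (mh k).2.
have [s1 [G1 [ms1 sG1 iG1 ps1]]] := summable_pairing mR mW W0 (part_bound mR nR) hB.
have [s2 [G2 [ms2 sG2 iG2 ps2]]] := summable_pairing mI mW W0 (part_bound mI nI) hB.
have e1 : {ae lam d, forall x, Re (m x) = s1 x}.
  apply: (identify ms1 sG1 iG1 ps1) => [|x|theta ht]; [exact: mm.1|exact: normc_Re|].
  by have [] := pieces_cvg ht.
have e2 : {ae lam d, forall x, Im (m x) = s2 x}.
  apply: (identify ms2 sG2 iG2 ps2) => [|x|theta ht]; [exact: mm.2|exact: normc_Im|].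
  by have [] := pieces_cvg ht.
have sm : slow m.
  split=> //; exists M.
  have mn := measurable_normc mm.
  have iG : rintegrable (lam d) (fun x => G1 x * W x + G2 x * W x) by exact: rintegrableD.
  have G0 x : 0 <= G1 x * W x + G2 x * W x.
    by apply: addr_ge0; apply: mulr_ge0; [exact: le_trans (normr_ge0 _) (sG1 x)|exact: ltW
      |exact: le_trans (normr_ge0 _) (sG2 x)|exact: ltW].
  apply: rintegral_lty; first exact: measurable_funM.
    by move=> x; exact: nW0.
  apply: (@le_lt_trans _ _ (\int[lam d]_x (G1 x * W x + G2 x * W x)%:E)%E); last first.
    by rewrite (rintegrable_EFin iG) ltry.
  apply: ae_ge0_le_integral => //.
  - by move=> x _; rewrite lee_fin; exact: nW0.
  - by apply/measurable_EFinP; exact: measurable_funM.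
  - by move=> x _; rewrite lee_fin; exact: G0.
  - by apply/measurable_EFinP; exact: rintegrable_measurable iG.
  - apply: filterS2 e1 e2 => x h1 h2 _; rewrite lee_fin -mulrDl.
    apply: (ler_wpM2r (ltW (W0 x))); apply: le_trans (normc_le _) _.
    by rewrite h1 h2; apply: lerD; [exact: sG1|exact: sG2].
split=> // psi hp; have [p1 p2] := schwartz_parts hp.
have [mp1 [K1 hK1]] := schwartz_weighted p1; have [mp2 [K2 hK2]] := schwartz_weighted p2.
have sh k : slow (h k).
  split=> //; exists M; apply: rintegral_lty.
  - by apply: measurable_funM => //; exact: measurable_normc.
  - by move=> x; exact: nW0.
  - exact: le_lt_trans (hb k) (ltry _).
have RE f : slow f -> Re (cintegral (fun x => f x * psi x)) =
    \int[lam d]_x (Re (f x) * Re (psi x)) - \int[lam d]_x (Im (f x) * Im (psi x)).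
  move=> sf; have [[f1 f2] _] := sf.
  rewrite -RintegralB//.
  - by rewrite /cintegral/=; apply: eq_Rintegral => x _; rewrite cReM.
  - by apply: (slow_integrable sf) => // x; exact: normc_Re.
  - by apply: (slow_integrable sf) => // x; exact: normc_Im.
have IE f : slow f -> Im (cintegral (fun x => f x * psi x)) =
    \int[lam d]_x (Re (f x) * Im (psi x)) + \int[lam d]_x (Im (f x) * Re (psi x)).
  move=> sf; have [[f1 f2] _] := sf.
  rewrite -Rintegral_add//.
  - by rewrite /cintegral/=; apply: eq_Rintegral => x _; rewrite cImM.
  - by apply: (slow_integrable sf) => // x; exact: normc_Re.
  - by apply: (slow_integrable sf) => // x; exact: normc_Im.
have E1 q : measurable_fun setT q ->
    \int[lam d]_x (Re (m x) * q x) = \int[lam d]_x (s1 x * q x).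
  move=> mq; apply: Rintegral_ae_eq; [exact: measurable_funM mm.1 mq|exact: measurable_funM|].
  by apply: filterS e1 => x ->.
have E2 q : measurable_fun setT q ->
    \int[lam d]_x (Im (m x) * q x) = \int[lam d]_x (s2 x * q x).
  move=> mq; apply: Rintegral_ae_eq; [exact: measurable_funM mm.2 mq|exact: measurable_funM|].
  by apply: filterS e2 => x ->.
split.
  rewrite (RE _ sm) (E1 _ mp1) (E2 _ mp2).
  rewrite (_ : (fun N => _) = fun N => \sum_(0 <= k < N) \int[lam d]_x (Re (h k x) * Re (psi x)) -
    \sum_(0 <= k < N) \int[lam d]_x (Im (h k x) * Im (psi x))).
    by apply: cvgB; [exact: ps1 hK1|exact: ps2 hK2].
  by apply/funext => N; rewrite cRe_sum -sumrB; apply: eq_bigr => k _; rewrite (RE _ (sh k)).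
rewrite (IE _ sm) (E1 _ mp2) (E2 _ mp1).
rewrite (_ : (fun N => _) = fun N => \sum_(0 <= k < N) \int[lam d]_x (Re (h k x) * Im (psi x)) +
  \sum_(0 <= k < N) \int[lam d]_x (Im (h k x) * Re (psi x))).
  by apply: cvgD; [exact: ps1 hK2|exact: ps2 hK1].
by apply/funext => N; rewrite cIm_sum -big_split; apply: eq_bigr => k _; rewrite (IE _ (sh k)).
Qed.

End multiplier_series.

(** * The multiplier operator on Schwartz functions *)

Section besov_pieces.
Context {R : realType}.
Local Notation lam d := (@lebesgue_rV R d).
Local Notation Re := (@complex.Re R).
Local Notation Im := (@complex.Im R).
Local Opaque bilinear_multiplier.

Lemma lorentz4_norm_ge0 d (h : 'rV[R]_d -> R[i]) : (0 <= lorentz4_norm h)%E.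
Proof.
apply: (@le_trans _ _ (1%:E * (lam d [set x | (1 < normc (h x))%R]) `^ 4^-1)%E).
  by rewrite mul1e poweR_ge0.
by apply: ereal_sup_ubound; exists 1 => //=.
Qed.

Lemma sum_geometric_half N : \sum_(0 <= k < N) 2 ^- k.+1 <= 1 :> R.
Proof.
suff -> : \sum_(0 <= k < N) 2 ^- k.+1 = 1 - 2 ^- N :> R.
  by rewrite gerBl invr_ge0 exprn_ge0.
elim: N => [|N IH]; first by rewrite big_nil expr0 invr1 subrr.
by rewrite big_nat_recr//= IH exprS invfM; lra.
Qed.

(** The k-th symbol vanishes from radius 3/2 * 2^k on; the cost of that radius in [piece_bound] is
    exactly the Besov weight, up to a constant. *)
Lemma sqrt_dyadic_radius n k :
  Num.sqrt ((3 / 2 * 2 ^+ k) ^+ n) = Num.sqrt ((3 / 2) ^+ n) * 2 `^ (n%:R * k%:R / 2) :> R.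
Proof.
rewrite exprMn sqrtrM; last by rewrite exprn_ge0// divr_ge0.
congr (_ * _); rewrite powRrM -natrM powR_mulrn// powR12_sqrt ?exprn_ge0//.
by rewrite -exprM mulnC.
Qed.

Lemma cvg_normc (z : nat -> R[i]) w : Re (z N) @[N --> \oo] --> Re w ->
  Im (z N) @[N --> \oo] --> Im w -> normc (z N) @[N --> \oo] --> normc w.
Proof.
move=> h1 h2.
have E c : normc c = Num.sqrt (Re c * Re c + Im c * Im c) by case: c => a b; rewrite /normc/= !expr2.
rewrite E (_ : (fun N => _) = fun N => Num.sqrt (Re (z N) * Re (z N) + Im (z N) * Im (z N))).
  apply: (@cvg_comp _ _ _ _ (@Num.sqrt R)); last exact: sqrt_continuous.
  by apply: cvgD; apply: cvgM.
by apply/funext => N; exact: E.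
Qed.

Lemma le_normc_sum (I : Type) (l : seq I) (F : I -> R[i]) :
  normc (\sum_(i <- l) F i) <= \sum_(i <- l) normc (F i).
Proof.
elim: l => [|i l IH]; first by rewrite !big_nil normc0.
by rewrite !big_cons; apply: le_trans (le_normcD _ _) _; rewrite lerD2l.
Qed.

Variable n : nat.
Variable phi0 : 'rV[R]_(n + n) -> R[i].

Lemma besov_decomposition m (e : R) : besov phi0 m -> 0 < e ->
  exists (kappa : nat -> R) h (u v : nat -> @Defs.distribution R (n + n)),
  [/\ forall k, 0 < kappa k,
      forall k, [/\ distr_of_fun (u k) m, distr_of_fun (v k) (h k) &
        eq_distribution (distr_fourier (v k)) (distr_mul (dyadic phi0 k) (distr_fourier (u k)))],
      forall k, (lorentz4_norm (h k) <= (kappa k)%:E)%E &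
      forall N, \sum_(0 <= k < N) 2 `^ (n%:R * k%:R / 2) * kappa k <= fine (besov_norm phi0 m) + e].
Proof.
move=> [_ bm] e0.
pose w k : R := 2 `^ (n%:R * k%:R / 2); have w0 k : 0 < w k by exact: powR_gt0.
pose L k := lorentz4_norm_multiplier (dyadic phi0 k) m.
have L0 k : (0 <= L k)%E by apply: le_ereal_inf_tmp => _ [h _ <-]; exact: lorentz4_norm_ge0.
have t0 k : (0 <= (w k)%:E * L k)%E by rewrite mule_ge0// lee_fin ltW.
have part N : (\sum_(0 <= k < N) (w k)%:E * L k <= besov_norm phi0 m)%E.
  by apply: nneseries_lim_ge => k _ _; exact: t0.
have b0 : (0 <= besov_norm phi0 m)%E by apply: nneseries_ge0 => k _ _; exact: t0.
have bf : besov_norm phi0 m \is a fin_num by rewrite ge0_fin_numE.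
have Lf k : L k \is a fin_num.
  rewrite ge0_fin_numE//; rewrite ltNge leye_eq; apply/negP => /eqP Lk.
  have := part k.+1; rewrite big_nat_recr//= Lk mulry gtr0_sg// mul1e addey.
    by rewrite leye_eq => /eqP h; rewrite h ltxx in bm.
  by rewrite gt_eqF// (@lt_le_trans _ _ 0%E)//; apply: sume_ge0.
(* The slack at index k is e 2^-(k+1) divided by the Besov weight, so the weighted sum exceeds the
   norm by at most [e]; it also makes [kappa k] positive and the infimum approachable. *)
pose kappa k := fine (L k) + e * 2 ^- k.+1 / w k.
have d0 k : 0 < e * 2 ^- k.+1 / w k by rewrite divr_gt0// mulr_gt0// invr_gt0 exprn_gt0.
have ex k : exists p : ('rV[R]_(n + n) -> R[i]) * (@Defs.distribution R (n + n)) * (@Defs.distribution R (n + n)),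
    [/\ distr_of_fun p.1.2 m, distr_of_fun p.2 p.1.1 &
        eq_distribution (distr_fourier p.2) (distr_mul (dyadic phi0 k) (distr_fourier p.1.2))] /\
    (lorentz4_norm p.1.1 <= (kappa k)%:E)%E.
  have [_ [h [u [v [hu hv huv]]] <-] hl] := lb_ereal_inf_adherent (d0 k) (Lf k).
  exists (h, u, v); split=> //; apply: ltW; apply: lt_le_trans hl _.
  by rewrite /kappa EFinD (fineK (Lf k)).
have [F hF] := choice ex.
exists kappa, (fun k => (F k).1.1), (fun k => (F k).1.2), (fun k => (F k).2); split.
- by move=> k; rewrite /kappa ltr_wpDl// fine_ge0.
- by move=> k; have [] := hF k.
- by move=> k; have [] := hF k.
- move=> N; rewrite (_ : \sum_(0 <= k < N) _ =
    \sum_(0 <= k < N) w k * fine (L k) + e * \sum_(0 <= k < N) 2 ^- k.+1).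
    apply: lerD; last first.
      by rewrite -[leRHS]mulr1; apply: (ler_wpM2l (ltW e0)); exact: sum_geometric_half.
    rewrite -lee_fin fineK// -sumEFin; apply: le_trans (part N).
    by apply: lee_sum => k _; rewrite EFinM fineK.
  rewrite mulr_sumr -big_split; apply: eq_bigr => k _ /=; rewrite /kappa -/(w k).
  by rewrite mulrDr; congr (_ + _); rewrite mulrCA mulfV ?mulr1// gt_eqF.
Qed.

Hypotheses (n_gt0 : (0 < n)%N) (phi0_smooth : smooth phi0)
  (phi0_1 : forall xi, norm2_rV xi <= 1 -> phi0 xi = 1)
  (phi0_0 : forall xi, 3 / 2 <= norm2_rV xi -> phi0 xi = 0).

(** Restricting [phi0] to the first half of the variables yields a cutoff on R^n, so no new choice
    enters the constant. *)
Definition half_cutoff (x : 'rV[R]_n) : R := Re (phi0 (row_mx x 0)).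

Let norm2_half (x : 'rV[R]_n) : norm2_rV (row_mx x (0 : 'rV[R]_n)) = norm2_rV x.
Proof.
rewrite /norm2_rV dot_row_mx (_ : dot_rV (0 : 'rV[R]_n) 0 = 0) ?addr0//.
by rewrite /dot_rV big1// => i _; rewrite mxE mul0r.
Qed.

Lemma smooth_half_cutoff : smooth_real half_cutoff.
Proof.
apply: (smooth_comp_monomial (L := fun x : 'rV[R]_n => row_mx x 0) (c := fun=> 1)
  (sg := @lshift n n) _ _ phi0_smooth.1).1.
- move=> x h i; rewrite mulr1; apply/rowP => j; rewrite !mxE.
  case: splitP => k jk; rewrite !mxE ?eqxx/=.
    by rewrite -!val_eqE /= jk.
  rewrite addr0 (_ : (j == lshift n i) = false) ?mulr0//.
  by rewrite -val_eqE /= jk; apply/eqP; have := ltn_ord i; lia.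
- apply: continuous_rV => j; case: (split_ordP j) => k ->.
    by under eq_fun do rewrite row_mxEl; exact: coord_continuous.
  rewrite (_ : (fun _ => _) = fun=> 0); first exact: cst_continuous.
  by apply/funext => y; rewrite row_mxEr mxE.
Qed.

Lemma half_cutoff1 x : norm2_rV x <= 1 -> half_cutoff x = 1.
Proof. by move=> hx; rewrite /half_cutoff phi0_1// norm2_half. Qed.

Lemma half_cutoff0 x : 3 / 2 <= norm2_rV x -> half_cutoff x = 0.
Proof. by move=> hx; rewrite /half_cutoff phi0_0// norm2_half. Qed.

Lemma dyadic_eq0 k xi : 3 / 2 * 2 ^+ k <= norm2_rV xi -> dyadic phi0 k xi = 0.
Proof.
have p0 j : 0 < 2 ^+ j :> R by exact: exprn_gt0.
case: k => [|k]; first by rewrite expr0 mulr1; exact: phi0_0.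
move=> hx; rewrite dyadicS !phi0_0 ?subrr//; rewrite norm2Z ger0_norm ?invr_ge0 ?(ltW (p0 _))// ler_pdivlMl//; apply: le_trans hx; rewrite ?exprS; have := p0 k; nra.
Qed.

Definition besov_const : R := piece_const half_cutoff * Num.sqrt ((3 / 2) ^+ n).

Lemma besov_const_ge0 : 0 <= besov_const.
Proof. by rewrite mulr_ge0 ?sqrtr_ge0//; exact: piece_const_ge0. Qed.

Lemma besov_multiplier_bound m : besov phi0 m -> slow m /\
  forall f g (t : R), schwartz f -> schwartz g -> 0 < t ->
  (\int[lam n]_x (normc (bilinear_multiplier m f g x))%:E <=
   (besov_const * fine (besov_norm phi0 m) * (t * \int[lam n]_x (normc (f x) ^+ 2) +
      (\int[lam n]_x (normc (g x) ^+ 2)) / t))%:E)%E.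
Proof.
move=> bm; have [M [C [C0 hC]]] := @lorentz_weighted R n.
have [Dsmooth D1 D0] := re_cutoff phi0_smooth phi0_1 phi0_0.
have w1 k : 1 <= 2 `^ (n%:R * k%:R / 2) :> R.
  by rewrite -[leLHS](powRr0 2); apply: ler_powR; rewrite ?ler1n// divr_ge0// mulr_ge0.
(* The pieces depend on [e], hence the bound with the norm enlarged by [e]; the operator of [m] does
   not, and [e] tends to 0 at the end. *)
have key e : 0 < e -> slow m /\ forall f g (t : R), schwartz f -> schwartz g -> 0 < t ->
  (\int[lam n]_x (normc (bilinear_multiplier m f g x))%:E <=
   (besov_const * (fine (besov_norm phi0 m) + e) * (t * \int[lam n]_x (normc (f x) ^+ 2) +
      (\int[lam n]_x (normc (g x) ^+ 2)) / t))%:E)%E.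
  move=> e0; have [kappa [h [u [v [kappa0 huv hk hS]]]]] := besov_decomposition bm e0.
  have hu k : distr_of_fun (u k) m by have [] := huv k.
  have hv k : distr_of_fun (v k) (h k) by have [] := huv k.
  have hq k : eq_distribution (distr_fourier (v k)) (distr_mul (dyadic phi0 k) (distr_fourier (u k))).
    by have [] := huv k.
  have mh k : cmeasurable (h k) by have [_ []] := hv k.
  have sh k : slow (h k) by exact: lorentz_slow (mh k) (kappa0 k) (hk k).
  have [] := @multiplier_series R (n + n) phi0 phi0_smooth phi0_1 phi0_0 m h u v M
    (fun k => C * kappa k) (C * (fine (besov_norm phi0 m) + e)) hu hv hq.
  - by move=> k; exact: hC.
  - move=> N; rewrite -mulr_sumr ler_wpM2l//; apply: le_trans (hS N).
    by apply: ler_sum => k _; rewrite ler_peMl// ltW.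
  move=> sm hcvg; split=> // f g t hf hg t0.
  pose A : R := t * \int[lam n]_x (normc (f x) ^+ 2) + (\int[lam n]_x (normc (g x) ^+ 2)) / t.
  have A0 : 0 <= A.
    apply: addr_ge0; [apply: mulr_ge0; first exact: ltW|apply: divr_ge0; last exact: ltW];
      by apply: Rintegral_ge0 => x _; rewrite exprn_ge0// normc_ge0.
  pose S N x := \sum_(0 <= k < N) bilinear_multiplier (h k) f g x.
  have cS x : normc (S N x) @[N --> \oo] --> normc (bilinear_multiplier m f g x).
    have hF := schwartz_fourier (schwartz_tensor_at x hf hg).
    have E N : S N x = \sum_(0 <= k < N) cintegral (fun p => h k p * fourier (tensor_at f g x) p).
      by apply: eq_bigr => k _; exact: bilinear_multiplierE x (sh k) hf hg.
    have [c1 c2] := hcvg _ hF.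
    rewrite (bilinear_multiplierE x sm hf hg) (_ : (fun N => _) = fun N =>
      normc (\sum_(0 <= k < N) cintegral (fun p => h k p * fourier (tensor_at f g x) p))).
      exact: cvg_normc c1 c2.
    by apply/funext => N; rewrite E.
  have mT k : measurable_fun setT (fun x => normc (bilinear_multiplier (h k) f g x)).
    by apply: measurable_normc; exact: cmeasurable_multiplier.
  have bT k : (\int[lam n]_x (normc (bilinear_multiplier (h k) f g x))%:E <=
      (besov_const * (2 `^ (n%:R * k%:R / 2) * kappa k) * A)%:E)%E.
    have r1 : 1 <= 3 / 2 * 2 ^+ k :> R.
      by have : 1 <= 2 ^+ k :> R by [rewrite exprn_ege1// ler1n]; nra.
    have := piece_bound n_gt0 smooth_half_cutoff half_cutoff1 half_cutoff0 Dsmooth D1 D0 r1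
      (@dyadic_eq0 k) (hv k) (hq k) (kappa0 k) (hk k) hf hg t0.
    rewrite sqrt_dyadic_radius; move=> /le_trans; apply; rewrite lee_fin -/A ler_wpM2r//.
    by rewrite le_eqVlt; apply/orP; left; apply/eqP; rewrite /besov_const; ring.
  have mS N : measurable_fun setT (fun x => normc (S N x)).
    apply: measurable_normc; rewrite /S; elim: N => [|N IH].
      by under eq_fun do rewrite big_nil; exact: cmeasurable_cst.
    under eq_fun do rewrite big_nat_recr//=.
    by apply: cmeasurableD => //; exact: cmeasurable_multiplier.
  apply: (fatou_le (f_ := fun N x => (normc (S N x))%:E)).
  - by move=> N; exact/measurable_EFinP.
  - by move=> N x; rewrite lee_fin normc_ge0.
  - by move=> x; apply/cvg_EFin; [exact: nearW|exact: cS].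
  move=> N; apply: (@le_trans _ _ (\int[lam n]_x \sum_(0 <= k < N)
      (normc (bilinear_multiplier (h k) f g x))%:E)%E).
    apply: ge0_le_integral => //.
    - by move=> x _; rewrite lee_fin normc_ge0.
    - exact/measurable_EFinP.
    - by apply: emeasurable_sum => k; exact/measurable_EFinP.
    - by move=> x _; rewrite sumEFin lee_fin; exact: le_normc_sum.
  rewrite ge0_integral_sum//; last 2 first.
  - by move=> k; exact/measurable_EFinP.
  - by move=> k x _; rewrite lee_fin normc_ge0.
  apply: (@le_trans _ _ (\sum_(0 <= k < N)
      (besov_const * (2 `^ (n%:R * k%:R / 2) * kappa k) * A)%:E)%E).
    by apply: lee_sum => k _; exact: bT.
  rewrite sumEFin lee_fin -mulr_suml -mulr_sumr; apply: (ler_wpM2r A0).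
  by apply: (ler_wpM2l besov_const_ge0); exact: hS.
have [sm _] := key 1 ltr01; split=> // f g t hf hg t0.
apply/lee_addgt0Pr => e e0.
pose A : R := t * \int[lam n]_x (normc (f x) ^+ 2) + (\int[lam n]_x (normc (g x) ^+ 2)) / t.
have A0 : 0 <= A.
  apply: addr_ge0; [apply: mulr_ge0; first exact: ltW|apply: divr_ge0; last exact: ltW];
    by apply: Rintegral_ge0 => x _; rewrite exprn_ge0// normc_ge0.
have c0 : 0 <= besov_const * A by rewrite mulr_ge0// besov_const_ge0.
have c1 : 0 < besov_const * A + 1 by rewrite ltr_wpDl.
have [_ h] := key (e / (besov_const * A + 1)) (divr_gt0 e0 c1).
apply: le_trans (h f g t hf hg t0) _; rewrite -EFinD lee_fin -/A.
rewrite (_ : besov_const * (_ + _) * A = besov_const * fine (besov_norm phi0 m) * A +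
  besov_const * A * (e / (besov_const * A + 1))).
  rewrite lerD2l mulrCA ler_piMr ?(ltW e0)//.
  by rewrite ler_pdivrMr// mul1r lerDl.
by move: (e / _) => e'; ring.
Qed.

End besov_pieces.

(** * Extension by density *)

Section l1_complete.
Context dT (T : measurableType dT) {R : realType} (mu : {measure set T -> \bar R}).

(** Completeness of L1 for absolutely convergent series, with the tail of [b] as error. The tail is
    expressed by a bound [c] on its finite sums. *)
Lemma l1_complete (a : nat -> T -> R) (b : nat -> R) (B : R) :
  (forall k, measurable_fun setT (a k)) ->
  (forall k, \int[mu]_x (`|a k x|)%:E <= (b k)%:E)%E ->
  (forall N, \sum_(0 <= k < N) b k <= B) ->
  exists2 s : T -> R, measurable_fun setT s & forall (N : nat) (c : R),
    (forall M, (N <= M)%N -> \sum_(N <= k < M) b k <= c) ->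
    (\int[mu]_x (`|s x - \sum_(0 <= k < N) a k x|)%:E <= c%:E)%E.
Proof.
move=> ma hb hB.
have hb1 k : (\int[mu]_x (`|a k x| * 1)%:E <= (b k)%:E)%E by under eq_integral do rewrite mulr1.
have [a' [s [_ [ma' aa' cs _ _]]]] := ae_summable ma (@measurable_cst _ _ T R setT 1) (fun=> ltr01) hb1 hB.
have ms : measurable_fun setT s.
  apply: (measurable_fun_cvg (h := fun N x => \sum_(0 <= k < N) a' k x)) => [N|x _]; last exact: cs.
  exact: measurable_sum.
exists s => // N c hc.
have ab k : (\int[mu]_x (`|a' k x|)%:E <= (b k)%:E)%E.
  apply: le_trans (hb k); rewrite le_eqVlt; apply/orP; left; apply/eqP; apply: ae_eq_integral => //.
  - by apply/measurable_EFinP; exact: measurableT_comp.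
  - by apply/measurable_EFinP; exact: measurableT_comp.
  - by apply: filterS (aa' k) => x ->.
have mD M : measurable_fun setT (fun x => \sum_(0 <= k < M) a' k x - \sum_(0 <= k < N) a' k x).
  by apply: measurable_funB; exact: measurable_sum.
have h' : (\int[mu]_x (`|s x - \sum_(0 <= k < N) a' k x|)%:E <= c%:E)%E.
  apply: (fatou_le (f_ := fun M x => (`|\sum_(0 <= k < M + N) a' k x - \sum_(0 <= k < N) a' k x|)%:E)).
  - by move=> M; apply/measurable_EFinP; apply: measurableT_comp => //; exact: mD.
  - by move=> M x; rewrite lee_fin.
  - move=> x; apply/cvg_EFin; first exact: nearW.
    apply: cvg_norm; apply: cvgB; last exact: cvg_cst.
    have := cs x; rewrite -(cvg_shiftn N); exact.
  move=> M; apply: (@le_trans _ _ (\int[mu]_x \sum_(N <= k < M + N) (`|a' k x|)%:E)%E).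
    apply: ge0_le_integral => //.
    - by apply/measurable_EFinP; apply: measurableT_comp => //; exact: mD.
    - by apply: emeasurable_sum => k; apply/measurable_EFinP; exact: measurableT_comp.
    - move=> x _; rewrite sumEFin lee_fin (big_cat_nat (n := N))/= ?leq_addl//.
      by rewrite addrAC subrr add0r; exact: ler_norm_sum.
  rewrite ge0_integral_sum//; last first.
    by move=> k; apply/measurable_EFinP; exact: measurableT_comp.
  apply: (@le_trans _ _ (\sum_(N <= k < M + N) (b k)%:E)%E); first by apply: lee_sum => k _; exact: ab.
  by rewrite sumEFin lee_fin; apply: hc; rewrite leq_addl.
apply: le_trans h'; rewrite le_eqVlt; apply/orP; left; apply/eqP; apply: ae_eq_integral => //.
- apply/measurable_EFinP; apply: measurableT_comp => //; apply: measurable_funB => //; exact: measurable_sum.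
- apply/measurable_EFinP; apply: measurableT_comp => //; apply: measurable_funB => //; exact: measurable_sum.
- have aN : {ae mu, forall x, forall k, a' k x = a k x} by apply/ae_foralln.
  by apply: filterS aN => x h _; congr (`|_ - _|%:E); apply: eq_bigr => k _; rewrite h.
Qed.

End l1_complete.

Section complex_integrals.
Context {R : realType}.
Local Notation lam d := (@lebesgue_rV R d).
Local Notation Re := (@complex.Re R).
Local Notation Im := (@complex.Im R).
Variable d : nat.
Implicit Types f g h : 'rV[R]_d -> R[i].

Definition int1 f : \bar R := (\int[lam d]_x (normc (f x))%:E)%E.

Definition int2 f : \bar R := (\int[lam d]_x (normc (f x) ^+ 2)%:E)%E.

Lemma measurable_normc_sqr f : cmeasurable f -> measurable_fun setT (fun x => normc (f x) ^+ 2).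
Proof. by move=> mf; apply: measurable_sqr; exact: measurable_normc. Qed.

Lemma cmeasurableZ (c : R[i]) f : cmeasurable f -> cmeasurable (fun x => c * f x).
Proof. by move=> mf; apply: cmeasurableM => //; exact: cmeasurable_cst. Qed.

Lemma cmeasurableB f g : cmeasurable f -> cmeasurable g -> cmeasurable (fun x => f x - g x).
Proof. by move=> mf mg; apply: cmeasurableD => //; exact: cmeasurableN. Qed.

Lemma int1D_le f g (a b : R) : cmeasurable f -> cmeasurable g ->
  (int1 f <= a%:E)%E -> (int1 g <= b%:E)%E -> (int1 (fun x => (f x + g x)%R) <= (a + b)%:E)%E.
Proof.
move=> mf mg hf hg; have m1 := measurable_normc mf; have m2 := measurable_normc mg.
rewrite EFinD; apply: le_trans (leeD hf hg); rewrite /int1 -ge0_integralD_EFin//;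
  try by move=> x; exact: normc_ge0.
apply: ge0_le_integral_EFin.
- by apply: measurable_normc; exact: cmeasurableD.
- exact: measurable_funD.
- by move=> x; rewrite normc_ge0 le_normcD.
Qed.

Lemma int1Z_le (c : R[i]) f (a : R) : cmeasurable f -> (int1 f <= a%:E)%E ->
  (int1 (fun x => (c * f x)%R) <= (normc c * a)%:E)%E.
Proof.
move=> mf hf; rewrite EFinM; apply: le_trans (lee_wpmul2l _ hf); last by rewrite lee_fin normc_ge0.
rewrite le_eqVlt; apply/orP; left; apply/eqP.
rewrite /int1 -ge0_integralZl_real ?normc_ge0//; last 2 first.
- exact: measurable_normc.
- by move=> x; exact: normc_ge0.
by apply: eq_integral => x _; rewrite normcM.
Qed.

Lemma int2D_le f g (a b : R) : cmeasurable f -> cmeasurable g ->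
  (int2 f <= a%:E)%E -> (int2 g <= b%:E)%E ->
  (int2 (fun x => (f x + g x)%R) <= (2 * a + 2 * b)%:E)%E.
Proof.
move=> mf mg hf hg.
have m1 := measurable_normc_sqr mf; have m2 := measurable_normc_sqr mg.
have p1 x : 0 <= normc (f x) ^+ 2 by rewrite exprn_ge0// normc_ge0.
have p2 x : 0 <= normc (g x) ^+ 2 by rewrite exprn_ge0// normc_ge0.
apply: (@le_trans _ _ (2%:E * int2 f + 2%:E * int2 g)%E); last first.
  by rewrite (EFinD (2 * a) (2 * b)) (EFinM 2 a) (EFinM 2 b); apply: leeD; apply: lee_wpmul2l; rewrite ?lee_fin.
rewrite /int2 -!ge0_integralZl_real// -ge0_integralD_EFin; last 4 first.
- exact: measurable_funM.
- exact: measurable_funM.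
- by move=> x; rewrite mulr_ge0.
- by move=> x; rewrite mulr_ge0.
apply: ge0_le_integral_EFin.
- by apply: measurable_normc_sqr; exact: cmeasurableD.
- by apply: measurable_funD; exact: measurable_funM.
move=> x; rewrite exprn_ge0 ?normc_ge0//=.
apply: le_trans (sqrD_le _ _).
by apply: lerXn2r (le_normcD _ _); rewrite nnegrE ?addr_ge0 ?normc_ge0.
Qed.

Lemma int2Z_le (c : R[i]) f (a : R) : cmeasurable f -> (int2 f <= a%:E)%E ->
  (int2 (fun x => (c * f x)%R) <= (normc c ^+ 2 * a)%:E)%E.
Proof.
move=> mf hf; have c0 : 0 <= normc c ^+ 2 by rewrite exprn_ge0// normc_ge0.
rewrite EFinM; apply: le_trans (lee_wpmul2l _ hf); last by rewrite lee_fin.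
rewrite le_eqVlt; apply/orP; left; apply/eqP.
rewrite /int2 -ge0_integralZl_real//; last 2 first.
- exact: measurable_normc_sqr.
- by move=> x; rewrite exprn_ge0// normc_ge0.
by apply: eq_integral => x _; rewrite normcM exprMn.
Qed.

Lemma int2N f : int2 (fun x => - f x) = int2 f.
Proof. by rewrite /int2; under eq_integral do rewrite normcN. Qed.

Lemma int2_ae f g : cmeasurable f -> cmeasurable g -> ae_eq_rV f g -> int2 f = int2 g.
Proof.
move=> mf mg fg; apply: ae_eq_integral => //.
- by apply/measurable_EFinP; exact: measurable_normc_sqr.
- by apply/measurable_EFinP; exact: measurable_normc_sqr.
- by apply: filterS fg => x ->.
Qed.

Lemma int1_eq0 f : cmeasurable f -> (int1 f <= 0)%E -> {ae lam d, forall x, f x = 0}.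
Proof.
move=> mf hf; have mn := measurable_normc mf.
have mn' : measurable_fun setT (fun x => (normc (f x))%:E) by exact/measurable_EFinP.
have [h _] := ae_eq_integral_abs (lam d) measurableT mn'.
have : {ae lam d, forall x, setT x -> (normc (f x))%:E = cst 0%E x}.
  apply: h; apply/eqP; rewrite eq_le; apply/andP; split; last exact: integral_ge0.
  apply: le_trans hf; rewrite le_eqVlt; apply/orP; left; apply/eqP.
  by apply: eq_integral => x _; rewrite gee0_abs// lee_fin normc_ge0.
apply: filterS => x /(_ I) /= [e]; exact: eq0_normc.
Qed.

Lemma sum_half_pow N M : (N <= M)%N -> \sum_(N <= k < M) 2 ^- k <= 2 * 2 ^- N :> R.
Proof.
move=> NM; apply: (@le_trans _ _ (2 * 2 ^- N - 2 * 2 ^- M)); last first.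
  by rewrite gerBl mulr_ge0// invr_ge0 exprn_ge0.
elim: M NM => [|M IH]; first by rewrite leqn0 => /eqP ->; rewrite big_geq// subrr.
rewrite leq_eqVlt => /predU1P[->|]; first by rewrite big_geq// subrr.
rewrite ltnS => NM; rewrite big_nat_recr//= exprS invfM; have := IH NM; lra.
Qed.

(** The constant 4 is 2 from the geometric tail times 2 for the real and imaginary parts. *)
Lemma cl1_complete (F : nat -> 'rV[R]_d -> R[i]) (c : R) : 0 <= c ->
  (forall j, cmeasurable (F j)) ->
  (forall j, int1 (fun x => (F j.+1 x - F j x)%R) <= (c * 2 ^- j)%:E)%E ->
  exists2 h, cmeasurable h & forall N, (int1 (fun x => (h x - F N x)%R) <= (4 * c * 2 ^- N)%:E)%E.
Proof.
move=> c0 mF hF.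
have sum_b N M : (N <= M)%N -> \sum_(N <= k < M) c * 2 ^- k <= 2 * c * 2 ^- N.
  by move=> NM; rewrite -mulr_sumr -mulrA mulrCA ler_wpM2l// sum_half_pow.
have part (p : R[i] -> R) : (forall j, measurable_fun setT (fun x => p (F j x))) ->
  (forall z, `|p z| <= normc z) -> (forall z w, p (z - w) = p z - p w) ->
  exists2 s : 'rV[R]_d -> R, measurable_fun setT s &
    forall N, (\int[lam d]_x (`|s x - p (F N x)|)%:E <= (2 * c * 2 ^- N)%:E)%E.
  move=> mp np pB.
  have [] := @l1_complete _ _ R (lam d) (fun k x => p (F k.+1 x) - p (F k x)) (fun k => c * 2 ^- k) (2 * c).
  - by move=> k; exact: measurable_funB.
  - move=> k; apply: le_trans (hF k); apply: ge0_le_integral_EFin.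
    + by apply: measurableT_comp => //; exact: measurable_funB.
    + by apply: measurable_normc; exact: cmeasurableB.
    + by move=> x; rewrite normr_ge0 -pB np.
  - by move=> N; have := sum_b 0 N isT; rewrite expr0 invr1 mulr1.
  move=> s ms hs; exists (fun x => p (F 0 x) + s x); first exact: measurable_funD.
  move=> N; have := hs N _ (sum_b N).
  rewrite (_ : (fun x => _) = fun x => (`|p (F 0 x) + s x - p (F N x)|)%:E)//.
  apply/funext => x; rewrite telescope_sumr//; congr (`|_|%:E); ring.
have [s1 m1 h1] := part Re (fun j => (mF j).1) (@normc_Re R) (fun z w => ltac:(by rewrite cReD cReN)).
have [s2 m2 h2] := part Im (fun j => (mF j).2) (@normc_Im R) (fun z w => ltac:(by rewrite cImD cImN)).
exists (fun x => (s1 x +i* s2 x)%C); first by split.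
move=> N; rewrite (_ : 4 * c * 2 ^- N = 2 * c * 2 ^- N + 2 * c * 2 ^- N); last by ring.
rewrite EFinD; apply: le_trans (leeD (h1 N) (h2 N)).
have mm1 : measurable_fun setT (fun x => `|s1 x - Re (F N x)|).
  by apply: measurableT_comp => //; apply: measurable_funB => //; exact: (mF N).1.
have mm2 : measurable_fun setT (fun x => `|s2 x - Im (F N x)|).
  by apply: measurableT_comp => //; apply: measurable_funB => //; exact: (mF N).2.
rewrite -ge0_integralD_EFin//; apply: ge0_le_integral_EFin.
- by apply: measurable_normc; apply: cmeasurableB.
- exact: measurable_funD.
- by move=> x; rewrite normc_ge0/=; apply: le_trans (normc_le _) _; rewrite cReD cImD cReN cImN.
Qed.

End complex_integrals.

(** * Extension of a bilinear operator from Schwartz functions to L2 *)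

Section l2_extension.
Context {R : realType}.
Local Notation lam d := (@lebesgue_rV R d).
Local Notation Re := (@complex.Re R).
Local Notation Im := (@complex.Im R).

Lemma le_affine_limit (X : \bar R) (a C : R) : 0 <= C ->
  (forall s : R, 0 < s <= 1 -> (X <= (a + C * s)%:E)%E) -> (X <= a%:E)%E.
Proof.
move=> C0 h; apply/lee_addgt0Pr => e e0.
have c1 : 0 < C + 1 by rewrite ltr_wpDl.
pose s := Num.min 1 (e / (C + 1)).
have s0 : 0 < s by rewrite lt_min ltr01 divr_gt0.
apply: le_trans (h s _) _; first by rewrite s0 ge_min lexx.
rewrite -EFinD lee_fin lerD2l; apply: (@le_trans _ _ (C * (e / (C + 1)))).
  by rewrite ler_wpM2l// ge_min lexx orbT.
by rewrite mulrCA ler_piMr ?(ltW e0)// ler_pdivrMr// mul1r lerDl.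
Qed.

(** The optimal parameter is the ratio of the roots of [b] and [a]. Adding [s] to both roots keeps
    it defined and positive when one of them vanishes, and [s] then tends to 0. *)
Lemma le_geometric_mean (X : \bar R) (K a b : R) : 0 <= K -> 0 <= a -> 0 <= b ->
  (forall t, 0 < t -> (X <= (K * (t * a + b / t))%:E)%E) ->
  (X <= (K * (2 * Num.sqrt a * Num.sqrt b))%:E)%E.
Proof.
move=> K0 a0 b0 h; set p := Num.sqrt a; set q := Num.sqrt b.
have p0 : 0 <= p by exact: sqrtr_ge0.
have q0 : 0 <= q by exact: sqrtr_ge0.
have pa : a = p * p by rewrite -expr2 sqr_sqrtr.
have qb : b = q * q by rewrite -expr2 sqr_sqrtr.
apply: (@le_affine_limit _ _ (K * (p + q))); first by rewrite mulr_ge0// addr_ge0.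
move=> s /andP[s0 _].
have ps : 0 < p + s by rewrite ltr_wpDl.
have qs : 0 < q + s by rewrite ltr_wpDl.
apply: le_trans (h ((q + s) / (p + s)) (divr_gt0 qs ps)) _.
rewrite lee_fin -(mulrA K) -(mulrDr K); apply: (ler_wpM2l K0).
have e1 : (q + s) / (p + s) * a <= (q + s) * p.
  by rewrite mulrAC ler_pdivrMr// pa -!mulrA ler_wpM2l ?(ltW qs)// ler_wpM2l// lerDl ltW.
have e2 : b / ((q + s) / (p + s)) <= q * (p + s).
  by rewrite invf_div mulrA ler_pdivrMr// qb mulrAC ler_wpM2l ?mulr_ge0 ?(ltW ps)// lerDl ltW.
by apply: le_trans (lerD e1 e2) _; rewrite le_eqVlt; apply/orP; left; apply/eqP; ring.
Qed.

Lemma cLnorm1E d (f : 'rV[R]_d -> R[i]) : cLnorm 1%:E f = int1 f.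
Proof. by rewrite /cLnorm Lnorm1; apply: eq_integral => x _; rewrite gee0_abs// lee_fin normc_ge0. Qed.

Lemma cLnorm2E d (f : 'rV[R]_d -> R[i]) : cLnorm 2%:E f = (int2 f `^ 2^-1)%E.
Proof.
rewrite /cLnorm unlock; congr (_ `^ _)%E; apply: eq_integral => x _.
by rewrite gee0_abs ?lee_fin ?normc_ge0// poweR_EFin powR_mulrn// normc_ge0.
Qed.

Lemma int2_ge0 d (f : 'rV[R]_d -> R[i]) : (0 <= int2 f)%E.
Proof. by apply: integral_ge0 => x _; rewrite lee_fin exprn_ge0// normc_ge0. Qed.

Lemma Lp2P d (f : 'rV[R]_d -> R[i]) : Lp 2%:E f -> cmeasurable f /\
  exists2 a : R, 0 <= a & int2 f = a%:E /\ cLnorm 2%:E f = (Num.sqrt a)%:E.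
Proof.
move=> [mf]; rewrite cLnorm2E => hf; split=> //.
have fi : int2 f \is a fin_num.
  rewrite ge0_fin_numE ?int2_ge0// ltey; apply/eqP => e; move: hf.
  by rewrite e poweRyr ?invr_neq0 ?pnatr_eq0// ltxx.
exists (fine (int2 f)); first by rewrite fine_ge0// int2_ge0.
by rewrite fineK//; split=> //; rewrite -{1}(fineK fi) poweR_EFin powR12_sqrt// fine_ge0// int2_ge0.
Qed.

Lemma Lp2_of_int2 d (f : 'rV[R]_d -> R[i]) (a : R) : cmeasurable f -> (int2 f <= a%:E)%E -> Lp 2%:E f.
Proof.
move=> mf hf; split=> //; rewrite cLnorm2E.
have fi : int2 f \is a fin_num by rewrite ge0_fin_numE ?int2_ge0// (le_lt_trans hf)// ltry.
by rewrite -(fineK fi) poweR_EFin ltry.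
Qed.

Lemma Lp2_linear d (c : R[i]) (f g : 'rV[R]_d -> R[i]) : Lp 2%:E f -> Lp 2%:E g ->
  Lp 2%:E (fun x => c * f x + g x).
Proof.
move=> /Lp2P[mf [a a0 [ha _]]] /Lp2P[mg [b b0 [hb _]]].
apply: (@Lp2_of_int2 _ _ (2 * (normc c ^+ 2 * a) + 2 * b)).
  by apply: cmeasurableD => //; exact: cmeasurableZ.
apply: int2D_le => //; [exact: cmeasurableZ| |by rewrite hb].
by apply: int2Z_le => //; rewrite ha.
Qed.

Variable n : nat.
Implicit Types f g h phi psi : 'rV[R]_n -> R[i].

Lemma schwartz_Lp2 f : schwartz f -> Lp 2%:E f.
Proof.
move=> hf; apply: (@Lp2_of_int2 _ _ (\int[lam n]_x normc (f x) ^+ 2)).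
  exact: schwartz_cmeasurable.
by rewrite /int2 (rintegrable_EFin (schwartz_sqr hf)).
Qed.

Lemma schwartzB f g : schwartz f -> schwartz g -> schwartz (fun x => f x - g x).
Proof.
move=> hf hg; have := schwartzD hf (schwartzZ (-1) hg).
by under eq_fun do rewrite mulN1r.
Qed.

Lemma schwartz_dense (chi : 'rV[R]_n -> R) f (s : R) : smooth_real chi ->
  (forall x, norm2_rV x <= 1 -> chi x = 1) -> (forall x, 3 / 2 <= norm2_rV x -> chi x = 0) ->
  Lp 2%:E f -> 0 < s ->
  exists2 phi, schwartz phi & (int2 (fun x => (f x - phi x)%R) <= (s ^+ 2)%:E)%E.
Proof.
move=> chi_smooth chi1 chi0 /Lp2P[mf [a a0 [ha _]]] s0.
have i2 : rintegrable (lam n) (fun x => normc (f x) ^+ 2).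
  apply: rintegral_lty; first exact: measurable_normc_sqr.
    by move=> x; rewrite exprn_ge0// normc_ge0.
  by rewrite -/(int2 f) ha ltry.
have part (p : R[i] -> R) : measurable_fun setT (fun x => p (f x)) -> (forall z, `|p z| <= normc z) ->
  exists theta, [/\ rtest theta, rintegrable (lam n) (fun x => (p (f x) - theta x) ^+ 2) &
    \int[lam n]_x (p (f x) - theta x) ^+ 2 <= s ^+ 2 / 2].
  move=> mp np.
  have sp : square_integrable (fun x => p (f x)).
    split=> //; apply: (rintegrable_le _ i2); first exact: measurable_sqr.
    move=> x; rewrite ger0_norm ?sqr_ge0// -real_normK ?num_real//.
    by apply: lerXn2r (np _); rewrite nnegrE ?normc_ge0.
  have [_ /(_ (s ^+ 2 / 2))[|theta ht hi]] := test_approx_square_integrable chi_smooth chi1 chi0 sp.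
    by rewrite divr_gt0// exprn_gt0.
  exists theta; split=> //; have := square_integrableB sp (rtest_square_integrable ht).
  by case.
have [t1 [h1 i1 e1]] := part Re mf.1 (@normc_Re R).
have [t2 [h2 i2' e2]] := part Im mf.2 (@normc_Im R).
exists (fun x => (t1 x +i* t2 x)%C).
  by apply: partsP_schwartz; exact: rtest_rschwartz.
rewrite /int2 (eq_integral (fun x => ((Re (f x) - t1 x) ^+ 2 + (Im (f x) - t2 x) ^+ 2)%:E)); last first.
  by move=> x _; rewrite normc_sqr cReD cImD cReN cImN.
rewrite (rintegrable_EFin (rintegrableD i1 i2')) lee_fin Rintegral_add//.
by apply: le_trans (lerD e1 e2) _; rewrite -splitr.
Qed.

Variables (K : R) (T0 : ('rV[R]_n -> R[i]) -> ('rV[R]_n -> R[i]) -> 'rV[R]_n -> R[i]).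
Hypotheses (K0 : 0 <= K)
  (T0_cmeasurable : forall f g, schwartz f -> schwartz g -> cmeasurable (T0 f g))
  (T0_bound : forall f g (a b t : R), schwartz f -> schwartz g -> 0 < t ->
    (int2 f <= a%:E)%E -> (int2 g <= b%:E)%E -> (int1 (T0 f g) <= (K * (t * a + b / t))%:E)%E)
  (T0_linearl : forall (c : R[i]) f f' g x, schwartz f -> schwartz f' -> schwartz g ->
    T0 (fun y => c * f y + f' y) g x = c * T0 f g x + T0 f' g x)
  (T0_linearr : forall (c : R[i]) f g g' x, schwartz f -> schwartz g -> schwartz g' ->
    T0 f (fun y => c * g y + g' y) x = c * T0 f g x + T0 f g' x)
  (dense : forall f (s : R), Lp 2%:E f -> 0 < s ->
    exists2 phi, schwartz phi & (int2 (fun x => (f x - phi x)%R) <= (s ^+ 2)%:E)%E).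

(** Only one argument changes at a time. The square [s ^+ 2] of the difference is balanced against
    [P] by the parameter 1/s in the first term and s in the second, which makes the modulus linear
    in [s]. *)
Lemma extension_continuity phi phi' psi psi' (P s : R) : schwartz phi -> schwartz phi' ->
  schwartz psi -> schwartz psi' -> 0 < s -> (int2 psi <= P%:E)%E -> (int2 phi' <= P%:E)%E ->
  (int2 (fun x => (phi x - phi' x)%R) <= (s ^+ 2)%:E)%E ->
  (int2 (fun x => (psi x - psi' x)%R) <= (s ^+ 2)%:E)%E ->
  (int1 (fun x => (T0 phi psi x - T0 phi' psi' x)%R) <= (2 * K * (1 + P) * s)%:E)%E.
Proof.
move=> h1 h2 h3 h4 s0 hP hP' d1 d2.
have b1 := schwartzB h1 h2; have b2 := schwartzB h3 h4.
have E1 x : T0 phi psi x = T0 (fun y => phi y - phi' y) psi x + T0 phi' psi x.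
  rewrite -[X in _ = X + _]mul1r -T0_linearl//; congr (T0 _ _ _).
  by apply/funext => y; rewrite mul1r subrK.
have E2 x : T0 phi' psi x = T0 phi' (fun y => psi y - psi' y) x + T0 phi' psi' x.
  rewrite -[X in _ = X + _]mul1r -T0_linearr//; congr (T0 _ _ _).
  by apply/funext => y; rewrite mul1r subrK.
rewrite (_ : (fun x => _) = fun x => T0 (fun y => phi y - phi' y) psi x +
    T0 phi' (fun y => psi y - psi' y) x); last first.
  by apply/funext => x; rewrite E1 E2; ring.
rewrite (_ : 2 * K * (1 + P) * s = K * (s^-1 * s ^+ 2 + P / s^-1) + K * (s * P + s ^+ 2 / s)).
  apply: int1D_le; try exact: T0_cmeasurable.
    by apply: T0_bound; rewrite ?invr_gt0.
  exact: T0_bound.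
by rewrite invrK; field; rewrite gt_eqF.
Qed.

(* This linear modulus of approximation determines [h] almost everywhere, so that
   the bilinearity of the extension follows from uniqueness. *)
Definition extends f g h := cmeasurable h /\ exists2 C, 0 <= C & forall (s : R) phi psi,
  0 < s <= 1 -> schwartz phi -> schwartz psi ->
  (int2 (fun x => (f x - phi x)%R) <= (s ^+ 2)%:E)%E ->
  (int2 (fun x => (g x - psi x)%R) <= (s ^+ 2)%:E)%E ->
  (int1 (fun x => (h x - T0 phi psi x)%R) <= (C * s)%:E)%E.

Let int2_near f phi (a s : R) : cmeasurable f -> cmeasurable phi -> (int2 f <= a%:E)%E ->
  (int2 (fun x => (f x - phi x)%R) <= (s ^+ 2)%:E)%E ->
  (int2 phi <= (2 * a + 2 * s ^+ 2)%:E)%E.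
Proof.
move=> mf mp ha hs; have := int2D_le mf (cmeasurableN (cmeasurableB mf mp)) ha.
rewrite int2N => /(_ _ hs); rewrite (_ : (fun x => f x + _) = phi)//.
by apply/funext => x; rewrite opprB addrC subrK.
Qed.

Let int2_between f phi phi' (a s : R) : cmeasurable f -> cmeasurable phi -> cmeasurable phi' ->
  (int2 (fun x => (f x - phi x)%R) <= a%:E)%E ->
  (int2 (fun x => (f x - phi' x)%R) <= s%:E)%E ->
  (int2 (fun x => (phi x - phi' x)%R) <= (2 * s + 2 * a)%:E)%E.
Proof.
move=> mf mp mp' ha hs.
have := int2D_le (cmeasurableB mf mp') (cmeasurableN (cmeasurableB mf mp)) hs.
rewrite int2N => /(_ _ ha); rewrite (_ : (fun x => f x - phi' x + _) = fun x => phi x - phi' x)//.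
by apply/funext => x; ring.
Qed.

(** Approximants at distance 2^-j yield L1 differences of geometric size. An arbitrary approximant
    at distance [s] is compared with one whose index N satisfies 2^-N <= s. *)
Lemma extension_exists f g : Lp 2%:E f -> Lp 2%:E g -> exists h, extends f g h.
Proof.
move=> lf lg; have [mf [a a0 [ha _]]] := Lp2P lf; have [mg [b b0 [hb _]]] := Lp2P lg.
have q0 j : 0 < 2 ^- j :> R by rewrite invr_gt0 exprn_gt0.
have q1 j : 2 ^- j <= 1 :> R by rewrite invf_le1 ?exprn_gt0// exprn_ege1// ler1n.
have [F hF] := choice (fun j => proj1 (exists2P _ _) (dense lf (q0 j))).
have [G hG] := choice (fun j => proj1 (exists2P _ _) (dense lg (q0 j))).
have mF j := schwartz_cmeasurable (hF j).1; have mG j := schwartz_cmeasurable (hG j).1.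
pose P : R := 2 * (a + b) + 2.
have sqr1 (s : R) : 0 < s -> s <= 1 -> s ^+ 2 <= 1 by move=> s0 s1; rewrite expr_le1// ltW.
have bF phi (s : R) : 0 < s -> s <= 1 -> schwartz phi ->
    (int2 (fun x => (f x - phi x)%R) <= (s ^+ 2)%:E)%E -> (int2 phi <= P%:E)%E.
  move=> s0 s1 hp hs; have mp := schwartz_cmeasurable hp.
  have ha' : (int2 f <= a%:E)%E by rewrite ha.
  apply: le_trans (int2_near mf mp ha' hs) _.
  by rewrite lee_fin /P; have := sqr1 s s0 s1; lra.
have bG psi (s : R) : 0 < s -> s <= 1 -> schwartz psi ->
    (int2 (fun x => (g x - psi x)%R) <= (s ^+ 2)%:E)%E -> (int2 psi <= P%:E)%E.
  move=> s0 s1 hp hs; have mp := schwartz_cmeasurable hp.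
  have hb' : (int2 g <= b%:E)%E by rewrite hb.
  apply: le_trans (int2_near mg mp hb' hs) _.
  by rewrite lee_fin /P; have := sqr1 s s0 s1; lra.
have P0 : 0 <= P by rewrite /P; lra.
pose c := 2 * K * (1 + P) * 2.
have c0 : 0 <= c by rewrite /c; apply: mulr_ge0 => //; apply: mulr_ge0; [apply: mulr_ge0|lra].
have step j : (int1 (fun x => (T0 (F j.+1) (G j.+1) x - T0 (F j) (G j) x)%R) <= (c * 2 ^- j)%:E)%E.
  rewrite /c -mulrA.
  have e : 2 * (2 ^- j) ^+ 2 + 2 * (2 ^- j.+1) ^+ 2 <= (2 * 2 ^- j) ^+ 2 :> R.
    by rewrite (exprS 2 j) invfM; have := q0 j; nra.
  apply: extension_continuity; try exact: (hF _).1; try exact: (hG _).1.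
  - by rewrite mulr_gt0.
  - exact: bG (q0 j.+1) (q1 j.+1) (hG _).1 (hG _).2.
  - exact: bF (q0 j) (q1 j) (hF _).1 (hF _).2.
  - apply: le_trans (int2_between mf (mF j.+1) (mF j) (hF _).2 (hF _).2) _.
    by rewrite lee_fin.
  - apply: le_trans (int2_between mg (mG j.+1) (mG j) (hG _).2 (hG _).2) _.
    by rewrite lee_fin.
have mT j : cmeasurable (T0 (F j) (G j)) by exact: T0_cmeasurable (hF j).1 (hG j).1.
have [h mh hh] := cl1_complete c0 mT step.
exists h; split=> //; exists (4 * c + c); first by rewrite addr_ge0// mulr_ge0.
move=> s phi psi /andP[s0 s1] hp hq dp dq.
have [N hN] : exists N, 2 ^- N <= s :> R.
  exists (Num.bound s^-1); rewrite -[leRHS]invrK lef_pV2 ?posrE ?invr_gt0 ?exprn_gt0//.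
  apply: le_trans (ltW (archi_boundP _)) _; first by rewrite invr_ge0 ltW.
  by rewrite -natrX ler_nat ltnW// ltn_expl.
have e : 2 * s ^+ 2 + 2 * (2 ^- N) ^+ 2 <= (2 * s) ^+ 2 by have := q0 N; nra.
rewrite (_ : (fun x => _) = fun x => (h x - T0 (F N) (G N) x) +
  (T0 (F N) (G N) x - T0 phi psi x)); last by apply/funext => x; rewrite addrA subrK.
rewrite (mulrDl (4 * c)); apply: int1D_le.
- exact: cmeasurableB.
- by apply: cmeasurableB => //; exact: T0_cmeasurable.
- by apply: le_trans (hh N) _; rewrite lee_fin ler_wpM2l// mulr_ge0.
rewrite /c -mulrA; apply: extension_continuity => //; try exact: (hF _).1; try exact: (hG _).1.
- by rewrite mulr_gt0.
- exact: bG (q0 N) (q1 N) (hG _).1 (hG _).2.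
- exact: bF s0 s1 hp dp.
- apply: le_trans (int2_between mf (mF N) (schwartz_cmeasurable hp) (hF _).2 dp) _.
  by rewrite lee_fin.
- apply: le_trans (int2_between mg (mG N) (schwartz_cmeasurable hq) (hG _).2 dq) _.
  by rewrite lee_fin.
Qed.

Lemma extends_ae f g f' g' h : Lp 2%:E f -> Lp 2%:E f' -> Lp 2%:E g -> Lp 2%:E g' ->
  ae_eq_rV f f' -> ae_eq_rV g g' -> extends f g h -> extends f' g' h.
Proof.
move=> [mf _] [mf' _] [mg _] [mg' _] ff' gg' [mh [C C0 hC]]; split=> //; exists C => //.
move=> s phi psi s01 hp hq dp dq.
have mp := schwartz_cmeasurable hp; have mq := schwartz_cmeasurable hq.
apply: hC => //.
  rewrite (@int2_ae _ _ _ (fun x => f' x - phi x)) //; try exact: cmeasurableB.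
  by apply: filterS ff' => x ->.
rewrite (@int2_ae _ _ _ (fun x => g' x - psi x)) //; try exact: cmeasurableB.
by apply: filterS gg' => x ->.
Qed.

Lemma ae_eq_of_int1 h h' (C : R) : cmeasurable h -> cmeasurable h' -> 0 <= C ->
  (forall s, 0 < s <= 1 -> (int1 (fun x => (h x - h' x)%R) <= (C * s)%:E)%E) -> ae_eq_rV h h'.
Proof.
move=> mh mh' C0 hC; have mB := cmeasurableB mh mh'.
have : (int1 (fun x => (h x - h' x)%R) <= 0%:E)%E.
  by apply: (le_affine_limit C0) => s hs; rewrite add0r; exact: hC.
by move=> /(int1_eq0 mB); apply: filterS => x /eqP; rewrite subr_eq0 => /eqP.
Qed.

Lemma extends_unique f g h h' : Lp 2%:E f -> Lp 2%:E g -> extends f g h -> extends f g h' ->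
  ae_eq_rV h h'.
Proof.
move=> lf lg [mh [C C0 hC]] [mh' [C' C'0 hC']].
apply: (ae_eq_of_int1 (C := C + normc (-1 : R[i]) * C')) => //.
  by rewrite addr_ge0// mulr_ge0// normc_ge0.
move=> s s01; have s0 : 0 < s by case/andP: s01.
have [phi hp dp] := dense lf s0; have [psi hq dq] := dense lg s0.
have mT := T0_cmeasurable hp hq.
rewrite (_ : (fun x => _) = fun x => (h x - T0 phi psi x) + (-1) * (h' x - T0 phi psi x)); last first.
  by apply/funext => x; ring.
rewrite mulrDl -mulrA; apply: int1D_le.
- exact: cmeasurableB.
- by apply: cmeasurableZ; exact: cmeasurableB.
- exact: hC.
- by apply: int1Z_le; [exact: cmeasurableB|exact: hC'].
Qed.

Lemma extends_linearl (c : R[i]) f f' g h h' H : Lp 2%:E f -> Lp 2%:E f' -> Lp 2%:E g ->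
  extends f g h -> extends f' g h' -> extends (fun x => c * f x + f' x) g H ->
  ae_eq_rV H (fun x => c * h x + h' x).
Proof.
move=> lf lf' lg [mh [C C0 hC]] [mh' [C' C'0 hC']] [mH [D D0 hD]].
have c0 : 0 <= normc c := normc_ge0 c.
have mf := lf.1; have mf' := lf'.1; have mg := lg.1.
apply: (ae_eq_of_int1 (C := D + (normc (- c) * C + normc (-1 : R[i]) * C'))) => //.
- by apply: cmeasurableD => //; exact: cmeasurableZ.
- by rewrite !addr_ge0// mulr_ge0// normc_ge0.
move=> s s01; have /andP[s0 s1] := s01.
(* If both functions are approximated within [r], the combination c f + f' is approximated within
   [s]. *)
pose r := s / (2 * (1 + normc c)).
have d0 : 0 < 2 * (1 + normc c) by rewrite mulr_gt0// ltr_pwDl.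
have r0 : 0 < r by rewrite divr_gt0.
have rs : r * (2 * (1 + normc c)) = s by rewrite /r divfK// gt_eqF.
have r_le_s : r <= s by nra.
have rs2 : ((r ^+ 2)%:E <= (s ^+ 2)%:E)%E by rewrite lee_fin; nra.
have [phi hp dp] := dense lf r0; have [phi' hp' dp'] := dense lf' r0.
have [psi hq dq] := dense lg s0.
have mp := schwartz_cmeasurable hp; have mp' := schwartz_cmeasurable hp'.
have mT := T0_cmeasurable hp hq; have mT' := T0_cmeasurable hp' hq.
have hpp := schwartzD (schwartzZ c hp) hp'.
have dd : (int2 (fun x => (c * f x + f' x - (c * phi x + phi' x))%R) <= (s ^+ 2)%:E)%E.
  rewrite (_ : (fun x => _) = fun x => c * (f x - phi x) + (f' x - phi' x)); last first.
    by apply/funext => x; ring.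
  have m1 := cmeasurableB mf mp; have m2 := cmeasurableB mf' mp'.
  apply: le_trans (int2D_le (cmeasurableZ c m1) m2 (int2Z_le c m1 dp) dp') _.
  by rewrite lee_fin -rs; nra.
rewrite (_ : (fun x => _) = fun x => (H x - T0 (fun y => c * phi y + phi' y) psi x) +
  ((- c) * (h x - T0 phi psi x) + (-1) * (h' x - T0 phi' psi x))); last first.
  by apply/funext => x; rewrite T0_linearl//; ring.
rewrite !mulrDl -!mulrA; apply: int1D_le.
- by apply: cmeasurableB => //; exact: T0_cmeasurable.
- by apply: cmeasurableD; apply: cmeasurableZ; exact: cmeasurableB.
- exact: hD.
apply: int1D_le; try by apply: cmeasurableZ; exact: cmeasurableB.
- by apply: int1Z_le; [exact: cmeasurableB|apply: hC => //; exact: le_trans dp rs2].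
- by apply: int1Z_le; [exact: cmeasurableB|apply: hC' => //; exact: le_trans dp' rs2].
Qed.

(** The factor 2 reflects the estimate |phi|^2 <= 2 |f|^2 + 2 |f - phi|^2 for the approximants. *)
Lemma extends_bound f g h (a b t : R) : Lp 2%:E f -> Lp 2%:E g -> 0 < t ->
  (int2 f <= a%:E)%E -> (int2 g <= b%:E)%E -> extends f g h ->
  (int1 h <= (2 * K * (t * a + b / t))%:E)%E.
Proof.
move=> lf lg t0 ha hb [mh [C C0 hC]].
apply: (@le_affine_limit _ _ (C + 2 * K * (t + t^-1))).
  by rewrite addr_ge0// mulr_ge0 ?mulr_ge0// addr_ge0 ?invr_ge0// ltW.
move=> s s01; have /andP[s0 s1] := s01.
have [phi hp dp] := dense lf s0; have [psi hq dq] := dense lg s0.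
have mT := T0_cmeasurable hp hq.
have np := int2_near lf.1 (schwartz_cmeasurable hp) ha dp.
have nq := int2_near lg.1 (schwartz_cmeasurable hq) hb dq.
have mhT := cmeasurableB mh mT.
have := int1D_le mhT mT (hC s phi psi s01 hp hq dp dq) (T0_bound hp hq t0 np nq).
rewrite (_ : (fun x => h x - _ + _) = h); last by apply/funext => x; rewrite subrK.
move=> /le_trans; apply; rewrite lee_fin.
have s2 : s ^+ 2 <= s by rewrite expr2 ler_piMl// ltW.
have ti0 : 0 < t^-1 by rewrite invr_gt0.
have k1 : 0 <= K * (t + t^-1) * (s - s ^+ 2).
  by apply: mulr_ge0; [apply: mulr_ge0 => //; rewrite addr_ge0// ltW|rewrite subr_ge0].
have E : 2 * K * (t * a + b / t) + (C + 2 * K * (t + t^-1)) * s -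
  (C * s + K * (t * (2 * a + 2 * s ^+ 2) + (2 * b + 2 * s ^+ 2) / t)) =
  2 * (K * (t + t^-1) * (s - s ^+ 2)) by ring.
by rewrite -subr_ge0 E mulr_ge0.
Qed.

End l2_extension.

Section l2_extension_right.
Context {R : realType}.
Variable n : nat.
Implicit Types f g h phi psi : 'rV[R]_n -> R[i].
Variables (K : R) (T0 : ('rV[R]_n -> R[i]) -> ('rV[R]_n -> R[i]) -> 'rV[R]_n -> R[i]).
Hypotheses (K0 : 0 <= K)
  (T0_cmeasurable : forall f g, schwartz f -> schwartz g -> cmeasurable (T0 f g))
  (T0_bound : forall f g (a b t : R), schwartz f -> schwartz g -> 0 < t ->
    (int2 f <= a%:E)%E -> (int2 g <= b%:E)%E -> (int1 (T0 f g) <= (K * (t * a + b / t))%:E)%E)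
  (T0_linearl : forall (c : R[i]) f f' g x, schwartz f -> schwartz f' -> schwartz g ->
    T0 (fun y => c * f y + f' y) g x = c * T0 f g x + T0 f' g x)
  (T0_linearr : forall (c : R[i]) f g g' x, schwartz f -> schwartz g -> schwartz g' ->
    T0 f (fun y => c * g y + g' y) x = c * T0 f g x + T0 f g' x)
  (dense : forall f (s : R), Lp 2%:E f -> 0 < s ->
    exists2 phi, schwartz phi & (int2 (fun x => (f x - phi x)%R) <= (s ^+ 2)%:E)%E).

(** Reduces linearity in the second argument to linearity in the first. *)
Lemma extends_swap f g h : extends T0 f g h -> extends (fun f g => T0 g f) g f h.
Proof. by move=> [mh [C C0 hC]]; split=> //; exists C => // s phi psi s01 hp hq dp dq; exact: hC. Qed.

Lemma extends_linearr (c : R[i]) f g g' h h' H : Lp 2%:E f -> Lp 2%:E g -> Lp 2%:E g' ->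
  extends T0 f g h -> extends T0 f g' h' -> extends T0 f (fun x => c * g x + g' x) H ->
  ae_eq_rV H (fun x => c * h x + h' x).
Proof.
move=> lf lg lg' /extends_swap e /extends_swap e' /extends_swap eH.
apply: (extends_linearl (T0 := fun f g => T0 g f) _ _ dense lg lg' lf e e' eH).
- by move=> f1 g1 h1 h2; exact: T0_cmeasurable.
- by move=> c1 f1 f2 g1 x h1 h2 h3; exact: T0_linearr.
Qed.

Lemma extends_schwartz f g : schwartz f -> schwartz g -> extends T0 f g (T0 f g).
Proof.
move=> hf hg; have mf := schwartz_cmeasurable hf; have mg := schwartz_cmeasurable hg.
have [_ [a a0 [ha _]]] := Lp2P (schwartz_Lp2 hf); have [_ [b b0 [hb _]]] := Lp2P (schwartz_Lp2 hg).
split; first exact: T0_cmeasurable.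
pose P := 2 * (a + b) + 2; exists (2 * K * (1 + P)).
  by apply: mulr_ge0; [apply: mulr_ge0|rewrite /P; lra].
move=> s phi psi /andP[s0 s1] hp hq dp dq.
have s2 : s ^+ 2 <= 1 by rewrite expr_le1// ltW.
apply: (extension_continuity T0_cmeasurable T0_bound T0_linearl T0_linearr) => //.
  by rewrite hb lee_fin /P; lra.
have ha' : (int2 f <= a%:E)%E by rewrite ha.
have mp := schwartz_cmeasurable hp.
have := int2D_le mf (cmeasurableN (cmeasurableB mf mp)) ha'.
rewrite int2N => /(_ _ dp); rewrite (_ : (fun x => f x + _) = phi); last first.
  by apply/funext => x; rewrite opprB addrC subrK.
by move=> /le_trans; apply; rewrite lee_fin /P; lra.
Qed.

End l2_extension_right.

Section extension_theorem.
Context {R : realType}.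
Local Notation lam d := (@lebesgue_rV R d).
Variable n : nat.
Implicit Types f g h phi psi : 'rV[R]_n -> R[i].
Variables (K : R) (T0 : ('rV[R]_n -> R[i]) -> ('rV[R]_n -> R[i]) -> 'rV[R]_n -> R[i]).
Hypotheses (K0 : 0 <= K)
  (T0_cmeasurable : forall f g, schwartz f -> schwartz g -> cmeasurable (T0 f g))
  (T0_bound : forall f g (a b t : R), schwartz f -> schwartz g -> 0 < t ->
    (int2 f <= a%:E)%E -> (int2 g <= b%:E)%E -> (int1 (T0 f g) <= (K * (t * a + b / t))%:E)%E)
  (T0_linearl : forall (c : R[i]) f f' g x, schwartz f -> schwartz f' -> schwartz g ->
    T0 (fun y => c * f y + f' y) g x = c * T0 f g x + T0 f' g x)
  (T0_linearr : forall (c : R[i]) f g g' x, schwartz f -> schwartz g -> schwartz g' ->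
    T0 f (fun y => c * g y + g' y) x = c * T0 f g x + T0 f g' x)
  (dense : forall f (s : R), Lp 2%:E f -> 0 < s ->
    exists2 phi, schwartz phi & (int2 (fun x => (f x - phi x)%R) <= (s ^+ 2)%:E)%E).

(** The constant [4 * K] is the factor 2 of [extends_bound] times the 2 of [le_geometric_mean],
    applied after optimising over the parameter. *)
Lemma bilinear_extension : exists T : ('rV[R]_n -> R[i]) -> ('rV[R]_n -> R[i]) -> 'rV[R]_n -> R[i],
  [/\ bilinear_L2_L1 T,
      forall f g, schwartz f -> schwartz g -> ae_eq_rV (T f g) (T0 f g) &
      forall f g, Lp 2%:E f -> Lp 2%:E g ->
        (cLnorm 1%:E (T f g) <= (4 * K)%:E * cLnorm 2%:E f * cLnorm 2%:E g)%E].
Proof.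
(* One representative is chosen for each pair of functions; its values are constrained only for
   pairs in L2. *)
have ex (p : ('rV[R]_n -> R[i]) * ('rV[R]_n -> R[i])) : exists h, Lp 2%:E p.1 -> Lp 2%:E p.2 ->
    extends T0 p.1 p.2 h.
  have [lf|lf] := pselect (Lp 2%:E p.1); last by exists (fun=> 0).
  have [lg|lg] := pselect (Lp 2%:E p.2); last by exists (fun=> 0).
  have [h hh] := extension_exists K0 T0_cmeasurable T0_bound T0_linearl T0_linearr dense lf lg.
  by exists h.
have [F hF] := choice ex; pose T f g := F (f, g).
have hT f g : Lp 2%:E f -> Lp 2%:E g -> extends T0 f g (T f g) by exact: (hF (f, g)).
have bT f g : Lp 2%:E f -> Lp 2%:E g ->
    (cLnorm 1%:E (T f g) <= (4 * K)%:E * cLnorm 2%:E f * cLnorm 2%:E g)%E.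
  move=> lf lg; have [_ [a a0 [ha ->]]] := Lp2P lf; have [_ [b b0 [hb ->]]] := Lp2P lg.
  rewrite cLnorm1E -!EFinM.
  rewrite (_ : 4 * K * Num.sqrt a * Num.sqrt b = 2 * K * (2 * Num.sqrt a * Num.sqrt b)); last by ring.
  apply: le_geometric_mean => //; first by rewrite mulr_ge0.
  move=> t t0; apply: (extends_bound K0 T0_cmeasurable T0_bound dense lf lg t0 _ _ (hT f g lf lg)).
    by rewrite ha.
  by rewrite hb.
exists T; split=> //.
- split.
  + move=> f g lf lg; have [mh _] := hT f g lf lg; split=> //.
    apply: le_lt_trans (bT f g lf lg) _.
    have [_ [a a0 [ha ->]]] := Lp2P lf; have [_ [b b0 [hb ->]]] := Lp2P lg.
    by rewrite -!EFinM ltry.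
  + move=> f f' g g' lf lf' lg lg' ff' gg'.
    apply: (extends_unique T0_cmeasurable dense lf' lg' _ (hT f' g' lf' lg')).
    exact: extends_ae lf lf' lg lg' ff' gg' (hT f g lf lg).
  + move=> c f f' g lf lf' lg; have lff := Lp2_linear c lf lf'.
    exact: (extends_linearl T0_cmeasurable T0_linearl dense lf lf' lg (hT f g lf lg)
      (hT f' g lf' lg) (hT _ g lff lg)).
  + move=> c f g g' lf lg lg'; have lgg := Lp2_linear c lg lg'.
    exact: (extends_linearr T0_cmeasurable T0_linearr dense lf lg lg' (hT f g lf lg)
      (hT f g' lf lg') (hT f _ lf lgg)).
- move=> f g hf hg; have lf := schwartz_Lp2 hf; have lg := schwartz_Lp2 hg.
  apply: (extends_unique T0_cmeasurable dense lf lg (hT f g lf lg)).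
  exact: (extends_schwartz K0 T0_cmeasurable T0_bound T0_linearl T0_linearr hf hg).
Qed.

End extension_theorem.

(** * Bilinearity of the multiplier on Schwartz functions *)

Section multiplier_bilinear.
Context {R : realType}.
Variable n : nat.
Implicit Types f g : 'rV[R]_n -> R[i].
Local Opaque bilinear_multiplier.

Lemma multiplier_linearl (m : 'rV[R]_(n + n) -> R[i]) (c : R[i]) f f' g x : slow m ->
  schwartz f -> schwartz f' -> schwartz g ->
  bilinear_multiplier m (fun y => c * f y + f' y) g x =
  c * bilinear_multiplier m f g x + bilinear_multiplier m f' g x.
Proof.
move=> sm hf hf' hg; have hff := schwartzD (schwartzZ c hf) hf'.
rewrite (bilinear_multiplierE x sm hff hg) (bilinear_multiplierE x sm hf hg)
  (bilinear_multiplierE x sm hf' hg).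
have h := schwartz_tensor_at x hf hg; have h' := schwartz_tensor_at x hf' hg.
rewrite -cintegral_linear; last 2 first.
- by apply: slow_cintegrable => //; exact: schwartz_fourier.
- by apply: slow_cintegrable => //; exact: schwartz_fourier.
congr cintegral; apply/funext => p.
rewrite (_ : tensor_at _ g x = fun q => c * tensor_at f g x q + tensor_at f' g x q); last first.
  by apply/funext => q; rewrite /tensor_at mulrDl mulrA.
by rewrite fourier_linear; [ring|exact: schwartz_cintegrable|exact: schwartz_cintegrable].
Qed.

Lemma multiplier_linearr (m : 'rV[R]_(n + n) -> R[i]) (c : R[i]) f g g' x : slow m ->
  schwartz f -> schwartz g -> schwartz g' ->
  bilinear_multiplier m f (fun y => c * g y + g' y) x =
  c * bilinear_multiplier m f g x + bilinear_multiplier m f g' x.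
Proof.
move=> sm hf hg hg'; have hgg := schwartzD (schwartzZ c hg) hg'.
rewrite (bilinear_multiplierE x sm hf hgg) (bilinear_multiplierE x sm hf hg)
  (bilinear_multiplierE x sm hf hg').
have h := schwartz_tensor_at x hf hg; have h' := schwartz_tensor_at x hf hg'.
rewrite -cintegral_linear; last 2 first.
- by apply: slow_cintegrable => //; exact: schwartz_fourier.
- by apply: slow_cintegrable => //; exact: schwartz_fourier.
congr cintegral; apply/funext => p.
rewrite (_ : tensor_at f _ x = fun q => c * tensor_at f g x q + tensor_at f g' x q); last first.
  by apply/funext => q; rewrite /tensor_at mulrDr mulrCA.
by rewrite fourier_linear; [ring|exact: schwartz_cintegrable|exact: schwartz_cintegrable].
Qed.

End multiplier_bilinear.

Theorem theorem3p1 (R : realType) (n : nat) (n_gt0 : (0 < n)%N)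
    (phi0 : 'rV[R]_(n + n) -> R[i])
    (phi0_smooth : smooth phi0)
    (phi0_1 : forall xi, norm2_rV xi <= 1 -> phi0 xi = 1)
    (phi0_0 : forall xi, 3 / 2 <= norm2_rV xi -> phi0 xi = 0) :
  exists C : R, forall m : 'rV[R]_(n + n) -> R[i], besov phi0 m ->
    exists T : ('rV[R]_n -> R[i]) -> ('rV[R]_n -> R[i]) -> 'rV[R]_n -> R[i],
      [/\ bilinear_L2_L1 T,
          forall f g, schwartz f -> schwartz g ->
            ae_eq_rV (T f g) (bilinear_multiplier m f g) &
          forall f g, Lp 2%:E f -> Lp 2%:E g ->
            (cLnorm 1%:E (T f g) <=
               C%:E * besov_norm phi0 m * cLnorm 2%:E f * cLnorm 2%:E g)%E].
Proof.
(* The factor 4 is that of [bilinear_extension]; the constant is fixed before [m] is introduced. *)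
exists (4 * besov_const phi0) => m bm.
have [sm hm] := besov_multiplier_bound n_gt0 phi0_smooth phi0_1 phi0_0 bm.
have c0 : 0 <= besov_const phi0 by exact: besov_const_ge0.
have b0 : (0 <= besov_norm phi0 m)%E.
  apply: nneseries_ge0 => k _ _; apply: mule_ge0; first by rewrite lee_fin powR_ge0.
  by apply: le_ereal_inf_tmp => _ [h _ <-]; exact: lorentz4_norm_ge0.
have bE : besov_norm phi0 m = (fine (besov_norm phi0 m))%:E.
  by rewrite fineK// ge0_fin_numE//; exact: bm.2.
have k0 : 0 <= besov_const phi0 * fine (besov_norm phi0 m) by rewrite mulr_ge0// fine_ge0.
have [] := @bilinear_extension R n _ (bilinear_multiplier m) k0.
- by move=> f g hf hg; exact: cmeasurable_multiplier.
- move=> f g a b t hf hg t0 ha hb; apply: le_trans (hm f g t hf hg t0) _.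
  rewrite lee_fin; apply: (ler_wpM2l k0); apply: lerD.
    by apply: (ler_wpM2l (ltW t0)); rewrite -lee_fin -(rintegrable_EFin (schwartz_sqr hf)).
  apply: ler_wpM2r; first by rewrite invr_ge0 ltW.
  by rewrite -lee_fin -(rintegrable_EFin (schwartz_sqr hg)).
- by move=> c f f' g x hf hf' hg; exact: multiplier_linearl.
- by move=> c f g g' x hf hg hg'; exact: multiplier_linearr.
- move=> f s lf s0; apply: schwartz_dense lf s0; [exact: smooth_half_cutoff phi0_smooth
    |exact: half_cutoff1 phi0_1|exact: half_cutoff0 phi0_0].
move=> T [h1 h2 h3]; exists T; split=> // f g lf lg.
apply: le_trans (h3 f g lf lg) _; rewrite bE -EFinM.
by rewrite (_ : 4 * (besov_const phi0 * _) = 4 * besov_const phi0 * fine (besov_norm phi0 m)) ?mulrA.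
Qed.
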